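(* Let $X=\mathbb{R}\times S^3$ with the product metric, and let $E=X\times SU(2)$ be the product principal $SU(2)$-bundle over $X$. The minimum of $\|F_A\|_{\mathrm{op}}$ over all non-flat anti-self-dual (ASD) connections $A$ on $E$ is equal to $1/\sqrt{2}$. (That is, the minimum exists, i.e. it is attained by some non-flat ASD connection on $E$, and its value is $1/\sqrt{2}$.)
   Context: $S^3=\{x_1^2+x_2^2+x_3^2+x_4^2=1\}\subset\mathbb{R}^4$ is the unit $3$-sphere with the Riemannian metric induced by the Euclidean metric on $\mathbb{R}^4$; $\mathbb{R}$ has its standard metric; $X=\mathbb{R}\times S^3$ has the product metric and is oriented by $dt\wedge \mathrm{vol}_{S^3}$, where $t$ is the coordinate on $\mathbb{R}$ and $S^3$ has its standard orientation. Let $\mathbb{H}$ be the quaternions and $SU(2)=\{x\in\mathbb{H} : |x|=1\}$, with Lie algebra $su(2)=T_1SU(2)=\mathrm{Im}\,\mathbb{H}=\mathbb{R}i+\mathbb{R}j+\mathbb{R}k$, bracket $[a,b]=ab-ba$ (quaternion multiplication), and norm $|\cdot|$ the Euclidean one, so that $i,j,k$ are orthonormal of length $1$. A connection $A$ on the product bundle $E$ is a smooth $su(2)$-valued $1$-form on $X$. Its curvature $F_A$ is the $su(2)$-valued $2$-form given in local coordinates, with $A=\sum_{i=1}^4 A_i\,dx_i$, by $F(A)_{ij}=F_A(\partial/\partial x_i,\partial/\partial x_j)=\partial_iA_j-\partial_jA_i+[A_i,A_j]$. $A$ is flat if $F_A\equiv 0$, and ASD if $*F_A=-F_A$, where $*$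 is the Hodge star of $X$. For $p\in X$, the curvature at $p$ is regarded as a linear map $F_{A,p}:\Lambda^2(T_pX)\to su(2)$, and $|F_{A,p}|_{\mathrm{op}}$ is its operator norm, where $\Lambda^2(T_pX)$ has the Euclidean norm for which $e_i\wedge e_j$ $(1\le i<j\le 4)$ are orthonormal whenever $e_1,\dots,e_4$ is an orthonormal basis of $T_pX$. Explicitly, in normal coordinates $x_1,\dots,x_4$ centered at $p$ (with $\partial/\partial x_i$ orthonormal at $p$), $$|F_{A,p}|_{\mathrm{op}}=\sup\Big\{\Big|\sum_{1\le i<j\le 4}a_{ij}F(A)_{ij,p}\Big| \;:\; a_{ij}\in\mathbb{R},\ \sum_{1\le i<j\le4}a_{ij}^2=1\Big\}.$$ Finally $\|F_A\|_{\mathrm{op}}=\sup_{p\in X}|F_{A,p}|_{\mathrm{op}}\in[0,+\infty]$. *)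

(* Defs.v *)
From HB Require Import structures.
From mathcomp Require Import all_boot all_order all_algebra.
From mathcomp Require Import all_classical all_reals all_analysis.

Set Implicit Arguments.
Unset Strict Implicit.
Unset Printing Implicit Defensive.
Import Order.TTheory GRing.Theory Num.Theory.
Import numFieldNormedType.Exports.
Local Open Scope classical_set_scope.
Local Open Scope ring_scope.

Section Quaternions.
Variable R : realType.

(* (a_0, a_1, a_2, a_3) stands for a_0 + a_1 i + a_2 j + a_3 k. *)
Definition quat := 'rV[R]_4.

Definition qcoef (a : quat) (n : nat) : R := a 0 (inord n).

Definition qmul (a b : quat) : quat :=
  let a0 := qcoef a 0 in let a1 := qcoef a 1 in
  let a2 := qcoef a 2 in let a3 := qcoef a 3 in
  let b0 := qcoef b 0 in let b1 := qcoef b 1 in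
  let b2 := qcoef b 2 in let b3 := qcoef b 3 in
  \row_(i < 4) nth 0
    [:: a0 * b0 - a1 * b1 - a2 * b2 - a3 * b3;
        a0 * b1 + a1 * b0 + a2 * b3 - a3 * b2;
        a0 * b2 - a1 * b3 + a2 * b0 + a3 * b1;
        a0 * b3 + a1 * b2 - a2 * b1 + a3 * b0] i.

Definition su2 : set quat := [set a : quat | a 0 0 = 0].

Definition bracket (a b : quat) : quat := qmul a b - qmul b a.

(* The norm `|a| that the library puts on row vectors is the sup norm. *)
Definition enorm (a : quat) : R := Num.sqrt (\sum_(i < 4) a 0 i ^+ 2).

End Quaternions.

(* C^oo on an open set U: all iterated directional derivatives exist and are
   Frechet differentiable (hence continuous) on U. *)
Definition iter_derive (R : realType) (V W : normedModType R)
    (vs : seq V) (f : V -> W) : V -> W :=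
  foldr (fun v g => 'D_v g) f vs.

Definition smooth_on (R : realType) (V W : normedModType R)
    (U : set V) (f : V -> W) : Prop :=
  forall (vs : seq V) (x : V), U x -> differentiable (iter_derive vs f) x.

Section Cylinder.
Variable R : realType.

Definition S3 : set 'rV[R]_4 := [set q : 'rV[R]_4 | \sum_(i < 4) q 0 i ^+ 2 = 1].

Local Notation ambient := (R * 'rV[R]_4)%type.

Definition cyl : set ambient := [set p : ambient | S3 p.2].

Definition inner (u v : ambient) : R :=
  u.1 * v.1 + \sum_(i < 4) u.2 0 i * v.2 0 i.

Definition tangent (p : ambient) : set ambient :=
  [set v : ambient | \sum_(i < 4) p.2 0 i * v.2 0 i = 0].

(* S^3 is oriented as the boundary of the unit ball (outward normal first). *)
Definition vol_S3 (q : 'rV[R]_4) (u : 'I_3 -> 'rV[R]_4) : R :=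
  \det (col_mx q (\matrix_(k < 3) u k) : 'M[R]_4).

(* The 4-form dt /\ vol_{S^3} at p. *)
Definition vol_cyl (p : ambient) (v : 'I_4 -> ambient) : R :=
  \sum_(i < 4) (-1) ^+ i * (v i).1
               * vol_S3 p.2 (fun k : 'I_3 => (v (lift i k)).2).

(* A local coordinate system x_1, ..., x_4 of X, given by its inverse
   phi : U -> X. *)
Definition local_coords (U : set 'rV[R]_4) (phi : 'rV[R]_4 -> ambient) : Prop :=
  [/\ open U,
      smooth_on U phi,
      (forall x, U x -> cyl (phi x)),
      (forall x y, U x -> U y -> phi x = phi y -> x = y) &
      (forall x, U x -> injective ('d phi x : 'rV[R]_4 -> ambient))].

Definition basis_vec (i : 'I_4) : 'rV[R]_4 := delta_mx 0 i.

(* The vector d/dx_i at the point of coordinates x. *)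
Definition coord_vec (phi : 'rV[R]_4 -> ambient) (x : 'rV[R]_4) (i : 'I_4) :
  ambient := 'D_(basis_vec i) phi x.

Definition orthonormal_at (phi : 'rV[R]_4 -> ambient) (x : 'rV[R]_4) : Prop :=
  forall i j, inner (coord_vec phi x i) (coord_vec phi x j) = (i == j)%:R.

Definition oriented_at (phi : 'rV[R]_4 -> ambient) (x : 'rV[R]_4) : Prop :=
  0 < vol_cyl (phi x) (coord_vec phi x).

(* A p v is the value at v in T_pX of an su(2)-valued 1-form on X; the values
   of A at other arguments are irrelevant. *)
Definition su2_form := ambient -> ambient -> quat R.

Definition coord_form (A : su2_form) (phi : 'rV[R]_4 -> ambient) (i : 'I_4) :
  'rV[R]_4 -> quat R := fun x => A (phi x) (coord_vec phi x i).

Definition is_connection (A : su2_form) : Prop :=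
  [/\ (forall p v, cyl p -> tangent p v -> su2 (A p v)),
      (forall p (c : R) u v, cyl p -> tangent p u -> tangent p v ->
         A p (c *: u + v) = c *: A p u + A p v) &
      (forall U phi, local_coords U phi ->
         forall i, smooth_on U (coord_form A phi i))].

Definition curvature (A : su2_form) (phi : 'rV[R]_4 -> ambient) (x : 'rV[R]_4)
    (i j : 'I_4) : quat R :=
  'D_(basis_vec i) (coord_form A phi j) x
  - 'D_(basis_vec j) (coord_form A phi i) x
  + bracket (coord_form A phi i x) (coord_form A phi j x).

Definition flat (A : su2_form) : Prop :=
  forall U phi x, local_coords U phi -> U x ->
  forall i j, curvature A phi x i j = 0.

(* Levi-Civita symbol. *)
Definition levi_civita (i j k l : 'I_4) : R :=
  \det (\matrix_(a < 4) basis_vec (tnth [tuple i; j; k; l] a)).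

(* Components of the Hodge star of a 2-form in an oriented orthonormal frame. *)
Definition hodge (F : 'I_4 -> 'I_4 -> quat R) (i j : 'I_4) : quat R :=
  2^-1 *: \sum_(k < 4) \sum_(l < 4) levi_civita i j k l *: F k l.

(* *F_A = -F_A, tested at each point in all coordinates for which the d/dx_i
   form an oriented orthonormal basis there. *)
Definition asd (A : su2_form) : Prop :=
  forall U phi x, local_coords U phi -> U x ->
  orthonormal_at phi x -> oriented_at phi x ->
  forall i j, hodge (curvature A phi x) i j = - curvature A phi x i j.

Definition op_norm (F : 'I_4 -> 'I_4 -> quat R) : \bar R :=
  ereal_sup
    [set (enorm (\sum_(i < 4) \sum_(j < 4 | (i < j)%N) a i j *: F i j))%:E
       | a in [set a : 'M[R]_4 |
                \sum_(i < 4) \sum_(j < 4 | (i < j)%N) a i j ^+ 2 = 1]].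

(* |F_{A,p}|_op: all coordinates that are orthonormal at p give the same value
   of op_norm, so the outer supremum only removes the choice. *)
Definition curvature_norm_at (A : su2_form) (p : ambient) : \bar R :=
  ereal_sup
    [set N | exists U phi x,
       [/\ local_coords U phi, U x, phi x = p, orthonormal_at phi x
         & N = op_norm (curvature A phi x)]].

Definition curvature_norm (A : su2_form) : \bar R :=
  ereal_sup [set curvature_norm_at A p | p in cyl].

End Cylinder.

(* Main.v *)
Require Import Defs.
From HB Require Import structures.
From mathcomp Require Import all_boot all_order all_algebra.
From mathcomp Require Import all_classical all_reals all_analysis.
From mathcomp Require Import ring lra.
Set Implicit Arguments.
Unset Strict Implicit.
Unset Printing Implicit Defensive.
Import Order.TTheory GRing.Theory Num.Theory.
Import numFieldNormedType.Exports.
Local Open Scope classical_set_scope.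
Local Open Scope ring_scope.

(** The conformal map (t, q) |-> e^t q turns a connection on X into a 1-form a on
    R^4 minus the origin, and ||F||_op < 1/sqrt 2 becomes r^2 |F(u, v)| <= b |u /\ v|
    at distance r from the origin, with b < 1/2, for anti-self-dual F.

    On each sphere of radius r, transport along the meridians from the two poles
    gives two gauges.  Their transition function K is constant along meridians and
    moves on the equator with speed at most 2b < 1, so over a half great circle
    its angular variation is less than pi.  Hence K stays in a half space around the
    midpoint of two opposite values and the gauges can be interpolated by a
    nonvanishing quaternion-valued psi.  Relative to psi the connection form is
    O(d / r) tangentially whenever r^2 |F| <= d |u /\ v| at radius r, and the Chern-Simons
    current J, whose divergence is -2 times the energy density, has radial part O(d^2 / r^3).  Integrating
    div J against a cutoff bounds the energy by O(d^2), where d only has to bound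
    r^2 |F| near 0 and infinity.  Thus the energy is finite; the Weitzenboeck formula
    and a mean value inequality then give r^2 |F| -> 0 at both ends, so d is
    arbitrarily small and F = 0.

    The value 1/sqrt 2 is attained by the standard instanton
    Im(conj(x) dx) / (1 + |x|^2), whose curvature on X is
    2 e^(2t) / (1 + e^(2t))^2 times Im(conj(dx) /\ dx) in an orthonormal frame. *)

(** * Derivatives along coordinate directions *)

(** The two constants are linked by decomposable 2-vectors: half of the squared length of u /\ v
    lies in its anti-self-dual part, so that |F(u, v)| is at most |F|_op / sqrt 2 times |u /\ v|. On
    the equator each polar gauge has covariant derivative at most b / r, whence the speed 2b of K;
    at 2b = 1 the values at opposite points could be antipodal and their midpoint could vanish. That
    the covariant derivative of psi is O(d) has another reason: where the gauges are interpolated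
    they differ by O(d), and this small difference is what the derivative of the weight multiplies.
    A lower bound for |psi| takes the place of unit length, because the current is built from (d_A
    psi) psi^-1. All estimates are invariant under dilations, and a radial part O(d^2 / r^3) has
    flux O(d^2) through spheres of every radius; hence a bound at the two ends alone controls all
    the energy between them. Integrals over R^4 are iterated primitives over cubes: the tools are
    the vanishing of integrals of derivatives that are zero on the faces, and differentiation under
    the integral sign. *)

Section OneDim.
Variable R : realType.
Implicit Types (f g F G df dg : R -> R) (a b s x y : R).
Local Notation isD f x d := (is_derive (x : R) (1 : R) f d).

Lemma is_derive_continuous f x l : isD f x l -> {for x, continuous f}.
Proof.
by case=> dfx _; apply: differentiable_continuous; apply/derivable1_diffP.
Qed.

Lemma mvt f df a b : a <= b ->
  (forall x, a <= x <= b -> isD f x (df x)) ->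
  exists2 c, a <= c <= b & f b - f a = df c * (b - a).
Proof.
move=> ab dfx.
have cf : {within `[a, b], continuous f}.
  apply: continuous_in_subspaceT => x; rewrite inE /= in_itv /= => xab.
  exact: is_derive_continuous (dfx x xab).
have [|c cab ->] := @MVT_segment R f df a b ab _ cf; last first.
- by exists c => //; move: cab; rewrite in_itv.
- by move=> x; rewrite in_itv /= => /andP[/ltW ax /ltW xb]; apply: dfx; rewrite ax.
Qed.

Lemma ler_derive f df g dg a b : a <= b ->
  (forall x, a <= x <= b -> isD f x (df x)) ->
  (forall x, a <= x <= b -> isD g x (dg x)) ->
  (forall x, a <= x <= b -> df x <= dg x) -> f b - f a <= g b - g a.
Proof.
move=> ab fd gd le.
have [|c cab] := @mvt (g - f) (dg - df) a b ab.
  by move=> x xab; apply: is_deriveB; [exact: gd | exact: fd].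
rewrite !fctE => E; have : 0 <= (dg c - df c) * (b - a).
  by rewrite mulr_ge0 ?subr_ge0 // le.
by rewrite -E; lra.
Qed.

Lemma ler_norm_derive f df g dg a b : a <= b ->
  (forall x, a <= x <= b -> isD f x (df x)) ->
  (forall x, a <= x <= b -> isD g x (dg x)) ->
  (forall x, a <= x <= b -> `|df x| <= dg x) -> `|f b - f a| <= g b - g a.
Proof.
move=> ab fd gd le; rewrite ler_norml; apply/andP; split; last first.
  by apply: ler_derive fd gd _ => // x /le; apply: le_trans; exact: ler_norm.
have := @ler_derive (- f) (- df) g dg a b ab _ gd _; rewrite !fctE => H.
suff : - f b - - f a <= g b - g a by lra.
apply: H => [x xab|x xab]; first by apply: is_deriveN; exact: fd.
by apply: le_trans (le x xab); rewrite -normrN; exact: ler_norm.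
Qed.

(* The two signs of [s] are treated at once, [g] being typically odd. *)
Lemma ler_norm_derive0 f df g dg (S s : R) : `|s| <= S ->
  (forall x, `|x| <= S -> isD f x (df x)) ->
  (forall x, `|x| <= S -> isD g x (dg x)) ->
  (forall x, `|x| <= S -> `|df x| <= dg x) ->
  f 0 = 0 -> g 0 = 0 -> `|f s| <= `|g s|.
Proof.
move=> sS fd gd le f0 g0.
have in_S x : (0 <= x <= s) || (s <= x <= 0) -> `|x| <= S.
  move=> xs; apply: le_trans sS; move: xs.
  by case/orP => /andP[x0 xs]; [rewrite !ger0_norm | rewrite !ler0_norm]; lra.
have [s0|s0] := leP 0 s.
  have := @ler_norm_derive f df g dg 0 s s0; rewrite f0 g0 !subr0 => H.
  apply: le_trans (ler_norm _); apply: H => x xs; [apply: fd|apply: gd|apply: le];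
  by apply: in_S; rewrite xs.
have := @ler_norm_derive f df g dg s 0 (ltW s0).
rewrite f0 g0 !sub0r normrN => H.
rewrite -(normrN (g s)); apply: le_trans (ler_norm _); apply: H => x xs;
  [apply: fd|apply: gd|apply: le]; by apply: in_S; rewrite xs orbT.
Qed.

Lemma derive0_cst f : (forall x : R, isD f x 0) -> forall x y, f x = f y.
Proof. by move=> H x y; exact: is_derive_0_is_cst. Qed.

Lemma ex_antiderivative f : continuous f ->
  exists F, F 0 = 0 /\ forall s : R, isD F s (f s).
Proof.
move=> cf.
pose I a b : R := \int[lebesgue_measure]_(t in `[a, b]) f t.
have int a b : lebesgue_measure.-integrable `[a, b] (EFin \o f).
  apply: continuous_compact_integrable; first exact: segment_compact.
  exact: continuous_subspaceT.
have shift a b : a <= b -> b <= 0 -> forall s, b <= s -> I a s - I a 0 = I b s - I b 0.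
  move=> ab b0 s bs.
  have H c : b <= c -> I a c - I a b = I b c.
    move=> bc; rewrite /I; have := @Rintegral_itvB R f (BLeft a) (BRight c) b (int a c).
    rewrite !bnd_simp => /(_ ab bc) ->.
    by rewrite Rintegral_itv_obnd_cbnd //; apply: integrableS (int b c) => //; exact: subset_itv_oc_cc.
  by rewrite -(H s bs) -(H 0 b0) opprB addrA subrK.
(* An integral over [[a, s]] with s < a vanishes instead of changing sign, so the left endpoint is
   taken below both 0 and s; [shift] makes the value independent of it. *)
pose F s := I (- (`|s| + 1)) s - I (- (`|s| + 1)) 0.
have FE a : a <= 0 -> forall s, a <= s -> F s = I a s - I a 0.
  move=> a0 s as_; rewrite /F; have := normr_ge0 s; have := ler_norm s.
  have := ler_norm (- s); rewrite normrN => h1 h2 h3.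
  have [h|h] := leP a (- (`|s| + 1)).
    by rewrite -(shift a) //; lra.
  by rewrite (shift _ a) //; lra.
exists F; split; first by rewrite /F subrr.
move=> s; pose a := - (`|s| + 1).
have as_ : a < s by rewrite /a; have := ler_norm (- s); rewrite normrN; lra.
have a0 : a <= 0 by rewrite /a; have := normr_ge0 s; lra.
have [|dI Is] := @continuous_FTC1_closed R f a s (s + 1) _ (int _ _) as_ (cf s).
  by rewrite ltrDl.
have nearF : \forall y \near s, I a y - I a 0 = F y.
  near=> y; rewrite (FE a) //; apply: ltW; near: y; exact: lt_nbhsr.
have dG : derivable (I a) s 1 := dI.
have Gs : (I a)^`()%classic s = f s := Is.
move: (I a) dG Gs nearF => G dG Gs nearF.
apply: near_eq_is_derive nearF _; apply: is_derive_eq (subr0 (f s)).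
by apply: is_deriveB; split; [exact: dG | rewrite -derive1E].
Unshelve. all: by end_near. Qed.
End OneDim.

(** * Partial derivatives and Frechet differentiability *)

Section Partial.
Variable R : realType.
Local Notation isD f x d := (is_derive (x : R) (1 : R) f d).

Lemma nearP_norm (V : normedModType R) (x : V) (P : V -> Prop) :
  (\near x, P x) <-> exists2 e : R, 0 < e & forall y, `|y - x| < e -> P y.
Proof.
split=> [/nbhs_normP[e /= e0 H]|[e e0 H]].
  by exists e => // y yx; apply: H; rewrite /= distrC.
by apply/nbhs_normP; exists e => // y /=; rewrite distrC; exact: H.
Qed.

Lemma near_forall (V : normedModType R) (x : V) n (P : 'I_n -> V -> Prop) :
  (forall i, \forall y \near x, P i y) -> \forall y \near x, forall i, P i y.
Proof.
exact: filter_forall.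
Qed.

Lemma cvg_sumr T (F : set_system T) (FF : Filter F) I (r : seq I) (f : I -> T -> R) l :
  (forall i, f i x @[x --> F] --> (l i : R)) ->
  \sum_(i <- r) f i x @[x --> F] --> \sum_(i <- r) l i.
Proof.
move=> H; elim: r => [|i r IH].
  by rewrite big_nil (_ : (fun _ => _) = cst 0); [exact: cvg_cst|apply/funext => x; rewrite big_nil].
rewrite big_cons (_ : (fun _ => _) = (fun x => f i x + \sum_(i <- r) f i x)).
  exact: cvgD.
by apply/funext => x; rewrite big_cons.
Qed.

Lemma continuousP_norm (V W : normedModType R) (f : V -> W) (x : V) :
  {for x, continuous f} <->
  forall e : R, 0 < e -> exists2 d : R, 0 < d & forall y, `|y - x| < d -> `|f y - f x| < e.
Proof.
split=> [/cvgrPdist_lt H e /H /nearP_norm[d d0 {}H]|H].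
  by exists d => // y /H; rewrite distrC.
apply/cvgrPdist_lt => e /H[d d0 {}H]; apply/nearP_norm; exists d => // y /H.
by rewrite distrC.
Qed.

Lemma ler_coord n (v : 'rV[R]_n) j : `|v 0 j| <= `|v|.
Proof. by rewrite [leRHS]/Num.norm /= mx_normrE; apply: (le_bigmax _ _ (0, j)). Qed.

Lemma ler_norm_coord n (v : 'rV[R]_n) c : 0 <= c ->
  (forall j, `|v 0 j| <= c) -> `|v| <= c.
Proof.
move=> c0 H; rewrite [leLHS]/Num.norm /= mx_normrE; apply: bigmax_le => // -[i j] _ /=.
by rewrite ord1.
Qed.

Lemma continuous_coordP (V : normedModType R) n (f : V -> 'rV[R]_n) (x : V) :
  (forall j, {for x, continuous (fun y => f y 0 j)}) -> {for x, continuous f}.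
Proof.
move=> H; apply/continuousP_norm => e e0.
have e2 : 0 < e / 2 by lra.
have : \forall y \near x, forall j, `|f y 0 j - f x 0 j| < e / 2.
  apply: near_forall => j; apply/nearP_norm.
  by have /continuousP_norm/(_ _ e2) := H j.
move=> /nearP_norm[d d0 dP]; exists d => // y /dP {}dP.
have : `|f y - f x| <= e / 2; last by lra.
apply: ler_norm_coord => [|j]; first by lra.
by rewrite !mxE; exact: ltW.
Qed.

Lemma is_derive_line (V W : normedModType R) (f : V -> W) (y v : V) (t : R) :
  derivable f (y + t *: v) v ->
  is_derive (t : R) (1 : R) (fun t : R => f (y + t *: v)) ('D_v f (y + t *: v)).
Proof.
have E : (fun h : R => h^-1 *: (((fun t : R => f (y + t *: v)) \o shift t) (h *: 1) - f (y + t *: v))) =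
    (fun h : R => h^-1 *: ((f \o shift (y + t *: v)) (h *: v) - f (y + t *: v))).
  apply/funext => h /=; congr (_ *: (f _ - _)).
  by rewrite [h *: 1]mulr1 scalerDl addrCA.
by move=> df; split; rewrite /derivable /derive E.
Qed.

Definition ev n (i : 'I_n) : 'rV[R]_n := delta_mx 0 i.
Definition pd n (i : 'I_n) (f : 'rV[R]_n -> R) : 'rV[R]_n -> R := 'D_(ev i) f.

Lemma evE n (i j : 'I_n) : ev i 0 j = (i == j)%:R.
Proof. by rewrite mxE eqxx eq_sym. Qed.

Lemma rowE n (v : 'rV[R]_n) : v = \sum_j v 0 j *: ev j.
Proof. exact: row_sum_delta. Qed.

Lemma mvt_pd n (i : 'I_n) (f : 'rV[R]_n -> R) (y : 'rV[R]_n) (t : R) :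
  (forall s : R, `|s| <= `|t| -> derivable f (y + s *: ev i) (ev i)) ->
  exists2 s : R, `|s| <= `|t| & f (y + t *: ev i) - f y = t * pd i f (y + s *: ev i).
Proof.
move=> df.
have D s : `|s| <= `|t| ->
    isD (fun s => f (y + s *: ev i)) s (pd i f (y + s *: ev i)).
  by move=> st; apply: is_derive_line; apply: df.
have E (a b : R) : (0 <= a <= b) || (b <= a <= 0) -> `|a| <= `|b|.
  by case/orP => /andP[ha hb]; [rewrite !ger0_norm|rewrite !ler0_norm]; lra.
have [t0|t0] := leP 0 t.
  have [|s st] := @mvt R (fun s => f (y + s *: ev i)) (fun s => pd i f (y + s *: ev i)) 0 t t0.
    by move=> s st; apply: D; apply: E; rewrite st.
  rewrite scale0r addr0 subr0 => ->; exists s; last by rewrite mulrC.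
  by apply: E; rewrite st.
have [|s st] := @mvt R (fun s => f (y + s *: ev i)) (fun s => pd i f (y + s *: ev i)) t 0 (ltW t0).
  by move=> s st; apply: D; apply: E; rewrite st orbT.
rewrite scale0r addr0 => H; exists s; last by rewrite -opprB H; ring.
by apply: E; rewrite st orbT.
Qed.

Section Differentiable.
Variables (n : nat) (f : 'rV[R]_n -> R) (x : 'rV[R]_n).

Let L (c : 'I_n -> R) (h : 'rV[R]_n) : R := \sum_j h 0 j * c j.

Let L_linear c : linear (L c).
Proof.
move=> a u v; rewrite /L scaler_sumr -big_split /=; apply: eq_bigr => j _.
by rewrite !mxE mulrDl -mulrA.
Qed.

Lemma differentiable_estimate (c : 'I_n -> R) :
  (forall e : R, 0 < e -> exists2 d : R, 0 < d & forall h : 'rV[R]_n, `|h| < d ->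
     `|f (x + h) - f x - \sum_j h 0 j * c j| <= e * `|h|) ->
  differentiable f x /\ forall v, 'D_v f x = \sum_j v 0 j * c j.
Proof.
move=> H.
pose LL : {linear 'rV[R]_n -> R} := HB.pack (L c) (GRing.isLinear.Build _ _ _ _ _ (L_linear c)).
have LC : continuous LL.
  move=> v /=; apply: (@cvg_sumr _ (nbhs v)) => j.
  by apply: cvgMl; exact: coord_continuous.
have E : f \o shift x = cst (f x) + LL +o_ (0 : 'rV[R]_n) id.
  have N e : 0 < e -> \forall h \near (0 : 'rV[R]_n),
      `|(f \o shift x - (cst (f x) + LL)) h| <= e * `|h|.
    move=> e0; apply/nearP_norm; have [d d0 dP] := H _ e0; exists d => // h.
    by rewrite subr0 => /dP; rewrite !fctE /= /L (addrC h) opprD addrA.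
  by apply/eqaddoP => e e0; exact: N.
have D := diff_unique LC E.
have df : differentiable f x by apply/diff_locallyP; rewrite D.
by split=> // v; rewrite deriveE // D.
Qed.

(** The increment h is decomposed into steps along the axes; the mean value theorem on each step and
    the continuity of the partial derivatives at x bound the total error by e |h|. *)
Lemma differentiable_pd (U : set 'rV[R]_n) : open U -> U x ->
  (forall y i, U y -> derivable f y (ev i)) ->
  (forall i, {for x, continuous (pd i f)}) ->
  differentiable f x /\ forall v, 'D_v f x = \sum_j v 0 j * pd j f x.
Proof.
move=> oU Ux df cf; apply: (differentiable_estimate (c := fun j => pd j f x)) => e e0.
pose e' := e / n.+1%:R.
have e'0 : 0 < e' by rewrite divr_gt0.
have /nearP_norm[d1 d10 d1P] : \near x, U x by apply: open_nbhs_nbhs.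
have : \forall y \near x, forall i, `|pd i f y - pd i f x| < e'.
  apply: near_forall => i; apply/nearP_norm.
  by have /continuousP_norm/(_ _ e'0) := cf i.
move=> /nearP_norm[d2 d20 d2P]; exists (Num.min d1 d2); first by rewrite lt_min d10.
move=> h; rewrite lt_min => /andP[hd1 hd2].
(* [p j] has the first j coordinates of x + h and the remaining ones of x, so consecutive points
   differ in one coordinate only. *)
pose p (j : nat) := x + \sum_(k < n | (k < j)%N) h 0 k *: ev k.
have pE j i : (p j - x) 0 i = if (i < j)%N then h 0 i else 0.
  rewrite /p addrC addKr summxE.
  under eq_bigr do rewrite mxE evE.
  case: ifP => ij.
    rewrite (bigD1 i) //= eqxx mulr1 big1 ?addr0 // => k /andP[_ /negbTE ->].
    by rewrite mulr0.
  apply: big1 => k kj; case: eqP => [E|]; last by rewrite mulr0.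
  by move: kj; rewrite E ij.
have pS (i : 'I_n) : p i.+1 = p i + h 0 i *: ev i.
  apply/rowP => k; have := pE i.+1 k; have := pE i k; rewrite !mxE eqxx /= eq_sym.
  rewrite (ltnS k i) [(k <= i)%N]leq_eqVlt; case: (ltngtP k i) => ki.
  - have -> : (i == k) = false by apply: contraTF ki => /eqP ->; rewrite ltnn.
    by rewrite /= mulr0 => H1 H2; lra.
  - have -> : (i == k) = false by apply: contraTF ki => /eqP ->; rewrite ltnn.
    by rewrite /= mulr0 => H1 H2; lra.
  - have -> : i = k by apply: val_inj.
    by rewrite eqxx /= mulr1 => H1 H2; lra.
have p0 : p 0 = x by rewrite /p big1 ?addr0 // => k; rewrite ltn0.
have pn : p n = x + h.
  by rewrite /p [in RHS](rowE h); congr (_ + _); apply: eq_bigl => k; rewrite ltn_ord.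
have near_p (i : 'I_n) s : `|s| <= `|h 0 i| -> `|p i + s *: ev i - x| <= `|h|.
  move=> sh; apply: ler_norm_coord => // k; rewrite addrAC mxE pE [X in _ + X]mxE evE.
  case: ltngtP => ki.
  - have -> : (i == k) = false by apply: contraTF ki => /eqP ->; rewrite ltnn.
    by rewrite mulr0 addr0; exact: ler_coord.
  - have -> : (i == k) = false by apply: contraTF ki => /eqP ->; rewrite ltnn.
    by rewrite mulr0 addr0 normr0.
  - rewrite add0r; case: (i == k); rewrite ?mulr0 ?normr0 // mulr1.
    by apply: le_trans sh _; exact: ler_coord.
have step (i : 'I_n) : `|f (p i.+1) - f (p i) - h 0 i * pd i f x| <= e' * `|h|.
  rewrite pS; have [s sh|s sh ->] := @mvt_pd n i f (p i) (h 0 i).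
    by apply: df; apply: d1P; apply: le_lt_trans (near_p _ _ sh) hd1.
  rewrite -mulrBr normrM mulrC; apply: ler_pM => //; last exact: ler_coord.
  by apply/ltW/d2P; apply: le_lt_trans (near_p _ _ sh) hd2.
have -> : f (x + h) - f x - \sum_j h 0 j * pd j f x =
    \sum_(j < n) (f (p j.+1) - f (p j) - h 0 j * pd j f x).
  rewrite sumrB; congr (_ - _).
  by rewrite -(big_mkord predT (fun j => f (p j.+1) - f (p j))) telescope_sumr // pn p0.
apply: le_trans (ler_norm_sum _ _ _) _.
apply: le_trans (ler_sum _ (fun j _ => step j)) _.
rewrite sumr_const card_ord -mulr_natl /e' mulrA ler_wpM2r //.
by rewrite mulrCA ger_pMr // ler_pdivrMr // mul1r ler_nat.
Qed.
End Differentiable.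
End Partial.

(** * Functions of class C^m depending on a parameter *)
Section Cn.
Variable R : realType.
Local Notation isD f x d := (is_derive (x : R) (1 : R) f d).

Section Defs.
Variable n : nat.
Implicit Types (U : set 'rV[R]_n) (k h : R -> 'rV[R]_n -> R).

(** Joint continuity in time and space is what makes estimates uniform over compact time intervals
    ([tube]). *)
Definition jcont U k := forall s x, U x ->
  {for (s, x), continuous (fun p : R * 'rV[R]_n => k p.1 p.2)}.

(* Only the derivatives in the space variable [x] count; the time [s] is a
   parameter on which they depend continuously. *)
Fixpoint Cn (m : nat) U k : Prop :=
  jcont U k /\
  match m with
  | 0 => True
  | m'.+1 => forall i, (forall s x, U x -> derivable (k s) x (ev R i)) /\
                       Cn m' U (fun s => pd i (k s))
  end.

Lemma Cn_jcont m U k : Cn m U k -> jcont U k.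
Proof. by case: m => [|m] []. Qed.

Lemma Cn_pd m U k i : Cn m.+1 U k -> Cn m U (fun s => pd i (k s)).
Proof. by case=> _ /(_ i)[]. Qed.

Lemma Cn_derivable m U k i s x : Cn m.+1 U k -> U x -> derivable (k s) x (ev R i).
Proof. by case=> _ /(_ i)[H _]; exact: H. Qed.

Lemma Cn_le m m' U k : (m' <= m)%N -> Cn m U k -> Cn m' U k.
Proof.
elim: m' m k => [|m' IH] [|m] k //.
  by move=> _ /Cn_jcont.
rewrite ltnS => le [jc H]; split=> // i; have [H1 H2] := H i; split=> //.
exact: IH H2.
Qed.

Lemma Cn_sub m U U' k : U' `<=` U -> Cn m U k -> Cn m U' k.
Proof.
move=> UU; elim: m k => [|m IH] k [jc H]; split=> //; try by move=> s x /UU /jc.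
by move=> i; have [H1 /IH H2] := H i; split=> // s x /UU; exact: H1.
Qed.

Lemma Cn_setU m U U' k : Cn m U k -> Cn m U' k -> Cn m (U `|` U') k.
Proof.
elim: m k => [|m IH] k [jc H] [jc' H']; split=> //; try by move=> s x [/jc|/jc'].
move=> i; have [[H1 H2] [H1' H2']] := (H i, H' i); split; last exact: IH.
by move=> s x [/H1|/H1'].
Qed.

Lemma open_near U x : open U -> U x -> \near x, U x.
Proof. by move=> oU Ux; apply: open_nbhs_nbhs. Qed.

Lemma pd_eq U (f g : 'rV[R]_n -> R) i x : open U -> U x ->
  (forall y, U y -> f y = g y) -> pd i f x = pd i g x.
Proof.
move=> oU Ux fg; apply: near_eq_derive.
by apply: filterS (open_near oU Ux) => y /fg.
Qed.

Lemma derivable_eq U (f g : 'rV[R]_n -> R) v x : open U -> U x ->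
  (forall y, U y -> f y = g y) -> derivable f x v -> derivable g x v.
Proof.
move=> oU Ux fg; apply: near_eq_derivable.
by apply: filterS (open_near oU Ux) => y /fg.
Qed.

Lemma Cn_eq m U k h : open U -> (forall s x, U x -> k s x = h s x) ->
  Cn m U k -> Cn m U h.
Proof.
move=> oU; have jcE k' h' : (forall s x, U x -> k' s x = h' s x) -> jcont U k' -> jcont U h'.
  move=> kh jc s x Ux; have := jc s x Ux.
  have E : \forall p \near (s, x), k' p.1 p.2 = h' p.1 p.2.
    have : \forall p \near (s, x), U p.2.
      by apply: cvg_snd; exact: open_near.
    by apply: filterS => -[s' x'] /= /kh.
  move=> H'; rewrite /prop_for /continuous_at /= -(kh s x Ux).
  by apply: cvg_trans H'; apply: near_eq_cvg.
elim: m k h => [|m IH] k h kh [jc H]; (split; first exact: jcE jc) => //.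
move=> i; have [H1 H2] := H i; split.
  by move=> s x Ux; apply: (derivable_eq oU Ux (kh s)); exact: H1.
by apply: IH H2 => s x Ux; apply: (pd_eq _ oU) => // y /kh.
Qed.

Lemma jcont_x U (f : 'rV[R]_n -> R) : (forall x, U x -> {for x, continuous f}) ->
  jcont U (fun _ => f).
Proof.
by move=> cf s x Ux; apply: (@continuous_comp _ _ _ snd); [exact: cvg_snd|exact: cf].
Qed.

Lemma jcont_s U (f : R -> R) : continuous f -> jcont U (fun s _ => f s).
Proof.
by move=> cf s x Ux; apply: (@continuous_comp _ _ _ fst); [exact: cvg_fst|exact: cf].
Qed.

Lemma Cn_zero m U : Cn m U (fun _ _ => 0).
Proof.
elim: m => [|m IH]; (split=> [s x Ux|]; first exact: cst_continuous) => // i; split.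
  by move=> s x _; exact: derivable_cst.
suff -> : (fun s : R => pd i (fun _ : 'rV[R]_n => 0 : R)) = (fun _ _ => 0) by [].
by apply/funext => s; apply/funext => x; exact: derive_cst.
Qed.

Lemma Cn_time m U (f : R -> R) : continuous f -> Cn m U (fun s _ => f s).
Proof.
case: m => [|m] cf; (split; first exact: jcont_s) => // i; split.
  by move=> s x _; exact: derivable_cst.
rewrite (_ : (fun s : R => _) = (fun _ _ => 0)); first exact: Cn_zero.
by apply/funext => s; apply/funext => x; exact: derive_cst.
Qed.

Lemma Cn_cst m U c : Cn m U (fun _ _ => c).
Proof. by apply: (@Cn_time m U (fun=> c)) => x; exact: cst_continuous. Qed.

Lemma is_derive_coord (x v : 'rV[R]_n) j :
  is_derive x v (fun y : 'rV[R]_n => y 0 j) (v 0 j).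
Proof.
have E : (fun h : R => h^-1 *: (((fun y : 'rV[R]_n => y 0 j) \o shift x) (h *: v) - x 0 j))
    @ 0^' --> v 0 j.
  apply/cvgrPdist_le => e e0; near=> h; rewrite /= !mxE addrK scalerA.
  rewrite mulVf ?scale1r ?subrr ?normr0 ?ltW //.
  by near: h; exact: nbhs_dnbhs_neq.
by split; [apply/cvg_ex; exists (v 0 j) | exact/cvg_lim].
Unshelve. all: by end_near. Qed.

Lemma pd_coord i j (x : 'rV[R]_n) : pd i (fun y => y 0 j) x = (i == j)%:R.
Proof. by rewrite /pd; have [_ ->] := is_derive_coord x (ev R i) j; rewrite evE. Qed.

Lemma Cn_coord m U j : Cn m U (fun _ x => x 0 j).
Proof.
case: m => [|m]; (split; first by apply: jcont_x => x _; exact: coord_continuous) => //.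
move=> i; split; first by move=> s x _; have [] := is_derive_coord x (ev R i) j.
rewrite (_ : (fun s : R => _) = (fun _ _ => (i == j)%:R)); first exact: Cn_cst.
by apply/funext => s; apply/funext => x; exact: pd_coord.
Qed.

Lemma pdD i (f g : 'rV[R]_n -> R) x : derivable f x (ev R i) -> derivable g x (ev R i) ->
  pd i (fun y => f y + g y) x = pd i f x + pd i g x.
Proof. by move=> df dg; rewrite /pd -deriveD. Qed.

Lemma pdM i (f g : 'rV[R]_n -> R) x : derivable f x (ev R i) -> derivable g x (ev R i) ->
  pd i (fun y => f y * g y) x = pd i f x * g x + f x * pd i g x.
Proof.
move=> df dg; apply: etrans (deriveM df dg) _.
by rewrite addrC [g x *: _]mulrC.
Qed.

Lemma jcontD U k h : jcont U k -> jcont U h -> jcont U (fun s x => k s x + h s x).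
Proof. by move=> ck ch s x Ux; apply: continuousD; [exact: ck|exact: ch]. Qed.

Lemma jcontM U k h : jcont U k -> jcont U h -> jcont U (fun s x => k s x * h s x).
Proof. by move=> ck ch s x Ux; apply: continuousM; [exact: ck|exact: ch]. Qed.

Lemma Cn_add m U k h : open U -> Cn m U k -> Cn m U h ->
  Cn m U (fun s x => k s x + h s x).
Proof.
move=> oU; elim: m k h => [|m IH] k h [jk Hk] [jh Hh]; (split; first exact: jcontD) => //.
move=> i; have [[k1 k2] [h1 h2]] := (Hk i, Hh i); split.
  by move=> s x Ux; apply: derivableD; [exact: k1|exact: h1].
apply: Cn_eq (IH _ _ k2 h2) => // s x Ux.
by rewrite pdD //; [exact: k1|exact: h1].
Qed.

Lemma Cn_mul m U k h : open U -> Cn m U k -> Cn m U h ->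
  Cn m U (fun s x => k s x * h s x).
Proof.
move=> oU; elim: m k h => [|m IH] k h Ck Ch;
  (split; first exact: jcontM (Cn_jcont Ck) (Cn_jcont Ch)) => //.
move=> i; split.
  by move=> s x Ux; apply: derivableM; [exact: Cn_derivable Ck Ux|exact: Cn_derivable Ch Ux].
have Ck' := Cn_le (leqnSn m) Ck; have Ch' := Cn_le (leqnSn m) Ch.
apply: Cn_eq (Cn_add oU (IH _ _ (Cn_pd i Ck) Ch') (IH _ _ Ck' (Cn_pd i Ch))) => // s x Ux.
by rewrite pdM //; [exact: Cn_derivable Ck Ux|exact: Cn_derivable Ch Ux].
Qed.

Lemma Cn_opp m U k : open U -> Cn m U k -> Cn m U (fun s x => - k s x).
Proof.
move=> oU Ck; apply: Cn_eq (Cn_mul oU (Cn_cst m U (-1)) Ck) => // s x _.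
by rewrite mulN1r.
Qed.

Lemma Cn_sub2 m U k h : open U -> Cn m U k -> Cn m U h ->
  Cn m U (fun s x => k s x - h s x).
Proof. by move=> oU Ck Ch; apply: Cn_add => //; exact: Cn_opp. Qed.

Lemma Cn_sum m U I (r : seq I) (k : I -> R -> 'rV[R]_n -> R) : open U ->
  (forall j, Cn m U (k j)) -> Cn m U (fun s x => \sum_(j <- r) k j s x).
Proof.
move=> oU H; elim: r => [|j r IH].
  by apply: Cn_eq (Cn_zero m U) => // s x _; rewrite big_nil.
by apply: Cn_eq (Cn_add oU (H j) IH) => // s x _; rewrite big_cons.
Qed.

(* One step of the chain rule: iterating it needs the derivatives of the outer
   function only. *)
Lemma Cn_comp1 m U (O : set R) (f df : R -> R) k : open U ->
  (forall s x, U x -> O (k s x)) -> (forall y, O y -> isD f y (df y)) ->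
  Cn m.+1 U k -> Cn m U (fun s x => df (k s x)) -> Cn m.+1 U (fun s x => f (k s x)).
Proof.
move=> oU kO fd Ck Cdf.
have jc : jcont U (fun s x => f (k s x)).
  move=> s x Ux; apply: (@continuous_comp _ _ _ (fun p : R * 'rV[R]_n => k p.1 p.2) f).
    exact: Cn_jcont Ck s x Ux.
  exact: is_derive_continuous (fd _ (kO s x Ux)).
have D i s x : U x -> is_derive x (ev R i) (fun y => f (k s y)) (df (k s x) * pd i (k s) x).
  move=> Ux; have dk := @Cn_derivable m U k i s x Ck Ux.
  pose g t := k s (x + t *: ev R i).
  have x0 : x = x + (0 : R) *: ev R i by rewrite scale0r addr0.
  have gd : isD g 0 (pd i (k s) x).
    by rewrite [X in pd i (k s) X]x0; apply: is_derive_line; rewrite -x0.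
  have fgd : isD (f \o g) 0 (df (k s x) * pd i (k s) x).
    by apply: is_derive1_comp => //; rewrite /g -x0; apply: fd; exact: kO.
  have E : (fun h : R => h^-1 *: (((f \o g) \o shift 0) (h *: 1) - (f \o g) 0)) =
     (fun h : R => h^-1 *: (((fun y => f (k s y)) \o shift x) (h *: ev R i) - f (k s x))).
    apply/funext => t; rewrite /g /= [t *: 1]mulr1 addr0 -x0.
    by rewrite (addrC x).
  by case: fgd; rewrite /derivable /derive E.
split=> // i; split; first by move=> s x Ux; have [] := D i s x Ux.
apply: Cn_eq (Cn_mul oU Cdf (Cn_pd i Ck)) => // s x Ux.
by have [_ <-] := D i s x Ux.
Qed.

Lemma Cn_inv m U k : open U -> (forall s x, U x -> k s x != 0) ->
  Cn m U k -> Cn m U (fun s x => (k s x)^-1).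
Proof.
move=> oU k0; elim: m => [|m IH] Ck.
  split=> // s x Ux; apply: (@continuousV _ _ (fun p : R * 'rV[R]_n => k p.1 p.2)).
    exact: k0.
  exact: Cn_jcont Ck s x Ux.
apply: (@Cn_comp1 m U [set y | y != 0] (fun y => y^-1) (fun y => - y ^- 2)) => //.
  by move=> y y0; apply: is_derive_eq (is_deriveV _ _) _ => //; rewrite [_ *: _]mulr1.
have Ci := IH (Cn_le (leqnSn m) Ck).
by apply: Cn_eq (Cn_opp oU (Cn_mul oU Ci Ci)) => // s x _; rewrite expr2 invfM.
Qed.

Lemma Cn_sqrt m U k : open U -> (forall s x, U x -> 0 < k s x) ->
  Cn m U k -> Cn m U (fun s x => Num.sqrt (k s x)).
Proof.
move=> oU k0; elim: m => [|m IH] Ck.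
  split=> // s x Ux; apply: (@continuous_comp _ _ _ (fun p : R * 'rV[R]_n => k p.1 p.2)).
    exact: Cn_jcont Ck s x Ux.
  exact: sqrt_continuous.
apply: (@Cn_comp1 m U [set y | 0 < y] Num.sqrt (fun y => (2 * Num.sqrt y)^-1)) => //.
have Ci := IH (Cn_le (leqnSn m) Ck).
apply: Cn_inv => // [s x Ux|]; last exact: Cn_mul (Cn_cst _ _ _) Ci.
by rewrite mulf_neq0 // ?sqrtr_eq0 -?ltNge ?k0.
Qed.

Lemma Cn_continuous m U k s x : Cn m U k -> U x -> {for x, continuous (k s)}.
Proof.
move=> Ck Ux; apply: (@continuous_comp _ _ _ (fun y => (s, y)) (fun p : R * 'rV[R]_n => k p.1 p.2)).
  by apply: (@cvg_pair _ _ _ (nbhs x) (nbhs s) (nbhs x) _ _ _ (cst s) id); [exact: cvg_cst | exact: cvg_id].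
exact: Cn_jcont Ck s x Ux.
Qed.

Lemma Cn_differentiable m U k s x : open U -> Cn m.+1 U k -> U x ->
  differentiable (k s) x /\ forall v, 'D_v (k s) x = \sum_j v 0 j * pd j (k s) x.
Proof.
move=> oU Ck Ux; apply: (@differentiable_pd R n (k s) x U oU Ux).
  by move=> y i Uy; exact: Cn_derivable Ck Uy.
by move=> i; exact: Cn_continuous (Cn_pd i Ck) Ux.
Qed.

Lemma pd_shift (f : 'rV[R]_n -> R) (c y : 'rV[R]_n) i :
  (derivable (fun z => f (z + c)) y (ev R i) <-> derivable f (y + c) (ev R i)) /\
  pd i (fun z => f (z + c)) y = pd i f (y + c).
Proof.
have E : (fun h : R => h^-1 *: (((fun z => f (z + c)) \o shift y) (h *: ev R i) - f (y + c))) =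
    (fun h : R => h^-1 *: ((f \o shift (y + c)) (h *: ev R i) - f (y + c))).
  by apply/funext => h /=; rewrite addrA.
by rewrite /pd /derivable /derive E.
Qed.

(** The second difference of f over a square of side h is symmetric in the two directions; two
    applications of the mean value theorem put it within h^2 e of h^2 times either mixed
    derivative. *)
Lemma pd_comm m U k s x i j : open U -> Cn m.+2 U k -> U x ->
  pd i (pd j (k s)) x = pd j (pd i (k s)) x.
Proof.
move=> oU Ck Ux; set f := k s.
have mixed a b (e : R) : 0 < e -> exists2 d : R, 0 < d & forall h : R, 0 < h -> h < d ->
    `|(f (x + h *: ev R a + h *: ev R b) - f (x + h *: ev R a) - (f (x + h *: ev R b) - f x))
      - h * (h * pd b (pd a f) x)| <= h * (h * e).
  move=> e0.
  have /nearP_norm[d1 d10 d1P] := open_near oU Ux.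
  have /continuousP_norm/(_ _ e0)[d2 d20 d2P] := @Cn_continuous m U _ s x (Cn_pd b (Cn_pd a Ck)) Ux.
  exists (Num.min d1 d2 / 2); first by rewrite divr_gt0 // lt_min d10.
  move=> h h0; rewrite ltr_pdivlMr // lt_min => /andP[hd1 hd2].
  have small (s1 s2 : R) : `|s1| <= h -> `|s2| <= h ->
      `|x + s1 *: ev R a + s2 *: ev R b - x| <= h * 2.
    move=> H1 H2; rewrite addrAC (addrC x) addrK; apply: le_trans (ler_normD _ _) _.
    have bd c (t : R) : `|t| <= h -> `|t *: ev R c : 'rV[R]_n| <= h.
      move=> th; apply: ler_norm_coord => [|q]; first exact: ltW.
      rewrite mxE evE; case: (c == q); rewrite ?mulr1 ?mulr0 ?normr0 //.
      exact: ltW.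
    by rewrite mulr_natr mulr2n lerD // bd.
  have inU (s1 s2 : R) : `|s1| <= h -> `|s2| <= h -> U (x + s1 *: ev R a + s2 *: ev R b).
    by move=> H1 H2; apply: d1P; apply: le_lt_trans (small _ _ H1 H2) hd1.
  have inU0 (s1 : R) : `|s1| <= h -> U (x + s1 *: ev R a).
    by move=> H1; have := inU s1 0 H1; rewrite scale0r addr0 normr0; apply; exact: ltW.
  have hh : `|h| = h by rewrite gtr0_norm.
  have dg y : U y -> U (y + h *: ev R b) ->
     is_derive y (ev R a) (fun z => f (z + h *: ev R b) - f z)
       (pd a f (y + h *: ev R b) - pd a f y).
    move=> Uy Uy'; apply: is_deriveB; last first.
      by split=> //; exact: Cn_derivable Ck Uy.
    have [H1 H2] := pd_shift f (h *: ev R b) y a; split; last by rewrite -H2.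
    by apply/H1; exact: Cn_derivable Ck Uy'.
  have [s1 s1h|s1 s1h] := @mvt_pd R n a (fun z => f (z + h *: ev R b) - f z) x h.
    have [] // := dg (x + s1 *: ev R a); rewrite hh in s1h; first exact: inU0.
    by apply: inU => //; rewrite hh.
  rewrite hh in s1h.
  have -> : pd a (fun z => f (z + h *: ev R b) - f z) (x + s1 *: ev R a) =
      pd a f (x + s1 *: ev R a + h *: ev R b) - pd a f (x + s1 *: ev R a).
    by have [] // := dg (x + s1 *: ev R a) (inU0 _ s1h) (inU _ _ s1h _); rewrite hh.
  have [s2 s2h|s2 s2h ->] := @mvt_pd R n b (pd a f) (x + s1 *: ev R a) h.
    by apply: Cn_derivable (Cn_pd a Ck) _; apply: inU => //; rewrite -hh.
  rewrite hh in s2h => ->; rewrite -!mulrBr !normrM hh.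
  rewrite ler_pM2l // ler_pM2l //; apply/ltW/d2P.
  exact: le_lt_trans (small _ _ s1h s2h) hd2.
apply/eqP; rewrite -subr_eq0 -normr_le0; apply/ler_addgt0Pl => e e0; rewrite addr0.
have e2 : 0 < e / 2 by lra.
have [d1 d10 H1] := mixed i j _ e2; have [d2 d20 H2] := mixed j i _ e2.
pose h := Num.min d1 d2 / 2.
have h0 : 0 < h by rewrite divr_gt0 // lt_min d10.
have hm : h < Num.min d1 d2 by rewrite /h; have : 0 < Num.min d1 d2; [rewrite lt_min d10|lra].
move: hm; rewrite lt_min => /andP[/(H1 _ h0) + /(H2 _ h0)].
rewrite (addrAC x (h *: ev R j)).
set a := f _; set b := f _; set c := f _; set d := f _.
have -> : a - c - (b - d) = a - b - (c - d) by ring.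
set D := a - b - _ => A1 A2; clearbody D h.
move: (pd j (pd i f) x) (pd i (pd j f) x) A1 A2 => u v A1 A2.
have : `|h * (h * (u - v))| <= h * (h * e).
  have -> : h * (h * (u - v)) =
     (D - h * (h * v)) - (D - h * (h * u)) by ring.
  apply: le_trans (ler_normB _ _) _; apply: le_trans (lerD A2 A1) _.
  by rewrite [in leRHS](splitr e) !mulrDr.
by rewrite !normrM (gtr0_norm h0) ler_pM2l // ler_pM2l // distrC.
Qed.

End Defs.

Section Chain.
Variables (n' n : nat).

Lemma is_derive_curve (f : 'rV[R]_n -> R) (c : R -> 'rV[R]_n) (dc : 'I_n -> R) (t : R) :
  differentiable f (c t) -> (forall v, 'D_v f (c t) = \sum_j v 0 j * pd j f (c t)) ->
  (forall j, isD (fun t => c t 0 j) t (dc j)) ->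
  isD (fun t => f (c t)) t (\sum_j dc j * pd j f (c t)).
Proof.
move=> df Df dcj.
have cd : derivable c t 1 by apply/derivable_mxP => i j; rewrite ord1; have [] := dcj j.
have cD : 'D_1 c t = \row_j dc j.
  by rewrite derive_mx //; apply/rowP => j; rewrite !mxE; have [_ <-] := dcj j.
have cd' : differentiable c t by exact/derivable1_diffP.
have fc : differentiable (f \o c) t by exact: differentiable_comp.
split; first exact/derivable1_diffP.
rewrite -[LHS]/('D_1 (f \o c) t) deriveE // diff_comp //=.
have -> : 'd c t 1 = \row_j dc j by rewrite -cD deriveE.
rewrite -deriveE // Df; by apply: eq_bigr => j _; rewrite mxE.
Qed.

Lemma Cn_is_derive_curve m (O : set 'rV[R]_n) (f : 'rV[R]_n -> R) (c : R -> 'rV[R]_n)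
    (dc : 'I_n -> R) (t : R) : open O -> Cn m.+1 O (fun _ => f) -> O (c t) ->
  (forall j, isD (fun t => c t 0 j) t (dc j)) ->
  isD (fun t => f (c t)) t (\sum_j dc j * pd j f (c t)).
Proof.
move=> oO Cf Oc; have [H1 H2] := Cn_differentiable 0 oO Cf Oc.
exact: is_derive_curve.
Qed.

Variables (U : set 'rV[R]_n') (O : set 'rV[R]_n) (c : R -> 'rV[R]_n' -> 'rV[R]_n).
Hypotheses (oU : open U) (oO : open O) (cO : forall s x, U x -> O (c s x)).

Lemma pd_comp m (f : 'rV[R]_n -> R) i s x : Cn m.+1 O (fun _ => f) ->
  (forall j, derivable (fun x => c s x 0 j) x (ev R i)) -> U x ->
  is_derive x (ev R i) (fun x => f (c s x)) (\sum_j pd i (fun x => c s x 0 j) x * pd j f (c s x)).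
Proof.
move=> Cf dc Ux.
have x0 : x = x + (0 : R) *: ev R i by rewrite scale0r addr0.
have := @Cn_is_derive_curve m O f (fun t => c s (x + t *: ev R i))
  (fun j => pd i (fun x => c s x 0 j) x) 0 oO Cf.
rewrite -x0 => /(_ (cO s Ux)) H.
have {}H : isD (fun t : R => f (c s (x + t *: ev R i))) 0
   (\sum_j pd i (fun x => c s x 0 j) x * pd j f (c s x)).
  by apply: H => j; rewrite [X in pd i _ X]x0; apply: (@is_derive_line _ _ _ (fun x => c s x 0 j)); rewrite -x0.
have E : (fun h : R => h^-1 *: (((fun t : R => f (c s (x + t *: ev R i))) \o shift 0) (h *: 1)
        - f (c s (x + (0 : R) *: ev R i)))) =
   (fun h : R => h^-1 *: (((fun x => f (c s x)) \o shift x) (h *: ev R i) - f (c s x))).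
  apply/funext => t /=; rewrite [t *: 1]mulr1 addr0 -x0.
  by rewrite (addrC x).
by case: H; rewrite /derivable /derive E.
Qed.

(** Induction on m: by the chain rule a partial derivative of the composite is a combination of
    composites with the partial derivatives of f, to which the induction hypothesis applies. *)
Lemma Cn_comp m (f : 'rV[R]_n -> R) : Cn m O (fun _ => f) ->
  (forall j, Cn m U (fun s x => c s x 0 j)) -> Cn m U (fun s x => f (c s x)).
Proof.
move=> + Cc; elim: m f Cc => [|m IH] f Cc Cf.
  split=> // s x Ux; apply: (@continuous_comp _ _ _ (fun p : R * 'rV[R]_n' => c p.1 p.2) f).
    by apply: continuous_coordP => j; exact: Cn_jcont (Cc j) s x Ux.
  by apply: (@Cn_continuous _ _ O (fun=> f) 0) Cf _; exact: cO.
have Cc' j : Cn m U (fun s x => c s x 0 j) := Cn_le (leqnSn m) (Cc j).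
split.
  move=> s x Ux; apply: (@continuous_comp _ _ _ (fun p : R * 'rV[R]_n' => c p.1 p.2) f).
    by apply: continuous_coordP => j; exact: Cn_jcont (Cc j) s x Ux.
  by apply: (@Cn_continuous _ _ O (fun=> f) 0) Cf _; exact: cO.
have D i s x (Ux : U x) := @pd_comp m f i s x Cf
   (fun j => @Cn_derivable n' m U (fun s x => c s x 0 j) i s x (Cc j) Ux) Ux.
move=> i; split; first by move=> s x /(D i s)[].
have H : Cn m U (fun s x => \sum_j pd i (fun x => c s x 0 j) x * pd j f (c s x)).
  apply: Cn_sum => // j; apply: Cn_mul => //; first exact: Cn_pd i (Cc j).
  exact: (IH (pd j f) Cc' (Cn_pd j Cf)).
by apply: Cn_eq H => // s x /(D i s)[_ <-].
Qed.
End Chain.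
End Cn.

(** * Primitives in time of functions with a space parameter *)

Section Primitive.
Variable R : realType.
Local Notation isD f x d := (is_derive (x : R) (1 : R) f d).

(** A choice operator makes this a total function of f, with an arbitrary value if f has no
    primitive; [prim_spec] and [prim_eq] characterise it for continuous f. *)
Definition prim (f : R -> R) : R -> R :=
  get [set F : R -> R | F 0 = 0 /\ forall s : R, isD F s (f s)].

Lemma prim_spec (f : R -> R) : continuous f ->
  prim f 0 = 0 /\ forall s : R, isD (prim f) s (f s).
Proof.
move=> cf; have [F FP] := ex_antiderivative cf.
exact: (@getPex _ [set F : R -> R | F 0 = 0 /\ forall s : R, isD F s (f s)] (ex_intro _ F FP)).
Qed.

Lemma prim_eq (f F : R -> R) : continuous f -> F 0 = 0 ->
  (forall s : R, isD F s (f s)) -> prim f = F.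
Proof.
move=> cf F0 FD; have [p0 pD] := prim_spec cf; apply/funext => s.
apply/eqP; rewrite -subr_eq0; apply/eqP.
have := @derive0_cst R (prim f - F) _ s 0; rewrite !fctE p0 F0 subrr; apply=> x.
by apply: is_derive_eq (subrr (f x)); apply: is_deriveB.
Qed.

Lemma ler_norm_prim (f g G : R -> R) (S s : R) : continuous f -> `|s| <= S ->
  (forall x, `|x| <= S -> isD G x (g x)) -> G 0 = 0 ->
  (forall x, `|x| <= S -> `|f x| <= g x) -> `|prim f s| <= `|G s|.
Proof.
move=> cf sS GD G0 fg; have [p0 pD] := prim_spec cf.
exact: ler_norm_derive0 sS (fun x _ => pD x) GD fg p0 G0.
Qed.

Lemma continuous_cstM (T : topologicalType) c (f : T -> R) :
  continuous f -> continuous (fun t => c * f t).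
Proof.
by move=> cf t; apply: (@continuousM _ _ (fun=> c)); [exact: cst_continuous|exact: cf].
Qed.

Lemma continuous_sub (T : topologicalType) (f g : T -> R) :
  continuous f -> continuous g -> continuous (fun t => f t - g t).
Proof. by move=> cf cg t; apply: (@continuousB _ _ _ f g); [exact: cf|exact: cg]. Qed.

Lemma is_derive_linear (c x : R) : isD (fun s => c * s) x c.
Proof.
have := is_deriveZ (c : R) (is_derive_id x (1 : R)).
by rewrite [_ *: 1]mulr1.
Qed.

Lemma ler_norm_prim_cst (f : R -> R) (S s c : R) : continuous f -> `|s| <= S ->
  (forall x, `|x| <= S -> `|f x| <= c) -> `|prim f s| <= c * `|s|.
Proof.
move=> cf sS fc.
have c0 : 0 <= c by apply: le_trans (fc 0 _); rewrite // normr0; exact: le_trans sS.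
rewrite -[c * _]/(c * `|s|) -{1}(ger0_norm c0) -normrM.
apply: (@ler_norm_prim f (fun=> c) (fun s => c * s) S s cf sS _ _ fc).
  by move=> x _; exact: is_derive_linear.
exact: mulr0.
Qed.

Lemma primB (f g : R -> R) : continuous f -> continuous g ->
  forall s, prim (fun t => f t - g t) s = prim f s - prim g s.
Proof.
move=> cf cg s; have [f0 fD] := prim_spec cf; have [g0 gD] := prim_spec cg.
rewrite (@prim_eq (fun t => f t - g t) (fun t => prim f t - prim g t)) //.
- exact: continuous_sub.
- by rewrite f0 g0 subrr.
Qed.

Lemma primZ (f : R -> R) c : continuous f ->
  forall s, prim (fun t => c * f t) s = c * prim f s.
Proof.
move=> cf s; have [f0 fD] := prim_spec cf.
rewrite (@prim_eq (fun t => c * f t) (fun t => c * prim f t)) //.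
- exact: continuous_cstM.
- by rewrite f0 mulr0.
Qed.

Section Dependence.
Variable n : nat.
Implicit Types (U : set 'rV[R]_n) (k : R -> 'rV[R]_n -> R).

Lemma jcont_time U k x : jcont U k -> U x -> continuous (fun s => k s x).
Proof.
move=> jk Ux s; apply: (@continuous_comp _ _ _ (fun s => (s, x)) (fun p : R * 'rV[R]_n => k p.1 p.2)).
  by apply: (@cvg_pair _ _ _ (nbhs s) (nbhs s) (nbhs x) _ _ _ id (cst x)); [exact: cvg_id|exact: cvg_cst].
exact: jk.
Qed.

(** Compactness of [[- S, S]] turns continuity at each point (s, x) into a radius d that serves all
    times at once. *)
Lemma tube U k x (S e : R) : jcont U k -> U x -> 0 < e -> exists2 d : R, 0 < d &
  forall s y, `|s| <= S -> `|y - x| < d -> `|k s y - k s x| < e.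
Proof.
move=> jk Ux e0.
have cK : near_covering `[- S, S] by apply/compact_near_coveringP; exact: segment_compact.
have : \forall y \near x, `[- S, S] `<=` [set s | `|k s y - k s x| < e].
  apply: (cK _ (nbhs x) (fun y s => `|k s y - k s x| < e)) => s _.
  have /cvgrPdist_lt/(_ (e / 2)) := jk s x Ux.
  have e2 : 0 < e / 2 by lra.
  move=> /(_ e2) /nearP_norm[d1 d10 H1].
  have /cvgrPdist_lt/(_ _ e2)/nearP_norm[d2 d20 H2] := @jcont_time U k x jk Ux s.
  pose d := Num.min d1 d2; have d0 : 0 < d by rewrite lt_min d10.
  exists ([set s' | `|s' - s| < d], [set y | `|y - x| < d]).
    split; first by have /nearP_norm : exists2 e : R, 0 < e &
      forall s' : R, `|s' - s| < e -> `|s' - s| < d by exists d.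
    by have /nearP_norm : exists2 e : R, 0 < e &
      forall y, `|y - x| < e -> `|y - x| < d by exists d.
  move=> [s' y] [] /=; rewrite !lt_min => /andP[s1 s2] /andP[y1 y2].
  have A : `|k s x - k s' y| < e / 2.
    by apply: (H1 (s', y)); rewrite prod_normE /= gt_max s1 y1.
  have B := H2 _ s2.
  rewrite (_ : k s' y - k s' x = (k s x - k s' x) - (k s x - k s' y)); last by ring.
  by apply: le_lt_trans (ler_normB _ _) _; lra.
move=> /nearP_norm[d d0 dP]; exists d => // s y sS yx.
by apply: (dP y yx s); rewrite /= in_itv /= -ler_norml.
Qed.

Lemma jcont_prim U k : open U -> jcont U k -> jcont U (fun s x => prim (k^~ x) s).
Proof.
move=> oU jk s x Ux.
have cx := jcont_time jk Ux; have [_ pD] := prim_spec cx.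
apply/continuousP_norm => e e0.
pose S := `|s| + 1.
have S0 : 0 < S by rewrite /S; have := normr_ge0 s; lra.
have eS : 0 < e / 2 / S by rewrite !divr_gt0.
have [d1 d10 H1] := @tube U k x S _ jk Ux eS.
have /nearP_norm[d2 d20 H2] := open_near oU Ux.
have e2 : 0 < e / 2 by lra.
have /continuousP_norm/(_ _ e2)[d3 d30 H3] := is_derive_continuous (pD s).
exists (Num.min (Num.min d1 d2) (Num.min d3 1)).
  by rewrite !lt_min d10 d20 d30 ltr01.
move=> [s' y]; rewrite prod_normE /= gt_max !lt_min.
move=> /andP[/andP[_ /andP[ss3 ss1]] /andP[/andP[y1 y2] _]].
have s'S : `|s'| <= S.
  by rewrite /S; have := ler_normD (s' - s) s; rewrite subrK; lra.
have Uy := H2 _ y2; have cy := jcont_time jk Uy.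
rewrite (_ : prim (k^~ y) s' - prim (k^~ x) s =
  prim (fun t => k t y - k t x) s' + (prim (k^~ x) s' - prim (k^~ x) s)); last first.
  by rewrite (primB cy cx); ring.
apply: le_lt_trans (ler_normD _ _) _.
have A : `|prim (fun t => k t y - k t x) s'| <= e / 2 / S * `|s'|.
  apply: (@ler_norm_prim_cst _ S) => //.
    exact: continuous_sub.
  by move=> t tS; apply/ltW/H1.
have B : e / 2 / S * `|s'| <= e / 2.
  by rewrite -mulrA ger_pMr // mulrC ler_pdivrMr // mul1r.
have := H3 s' ss3; lra.
Qed.

(** Differentiation under the integral sign: by the mean value theorem the difference quotient of k
    is a partial derivative at a nearby point, and [tube] makes its distance from the one at x small
    uniformly in time. *)
Lemma is_derive_prim U k x i s : open U -> Cn 1 U k -> U x ->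
  is_derive x (ev R i) (fun x => prim (k^~ x) s) (prim (fun t => pd i (k t) x) s).
Proof.
move=> oU Ck Ux.
have jk := Cn_jcont Ck; have cx := jcont_time jk Ux.
have jp := Cn_jcont (Cn_pd i Ck); have cp := jcont_time jp Ux.
have H : (fun h : R => h^-1 *: (((fun x => prim (k^~ x) s) \o shift x) (h *: ev R i) - prim (k^~ x) s))
   @ 0^' --> prim (fun t => pd i (k t) x) s.
  apply/cvgrPdist_le => e e0.
  have S0 : 0 < `|s| + 1 by have := normr_ge0 s; lra.
  have eS : 0 < e / (`|s| + 1) by rewrite divr_gt0.
  have [d1 d10 H1] := @tube U _ x `|s| _ jp Ux eS.
  have /nearP_norm[d2 d20 H2] := open_near oU Ux.
  near=> h.
  have h0 : h != 0 by near: h; exact: nbhs_dnbhs_neq.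
  have hd : `|h| < Num.min d1 d2.
    by near: h; apply: dnbhs0_lt; rewrite lt_min d10.
  have nev (t : R) : `|t| <= `|h| -> `|x + t *: ev R i - x| < Num.min d1 d2.
    move=> th; apply: le_lt_trans hd; rewrite addrC addKr.
    apply: ler_norm_coord => // q; rewrite mxE evE; apply: le_trans th.
    by case: (i == q); rewrite ?mulr1 // mulr0 normr0.
  have Uh t : `|t| <= `|h| -> U (x + t *: ev R i).
    by move=> /nev; rewrite lt_min => /andP[_ /H2].
  have ch := jcont_time jk (Uh h (lexx _)).
  rewrite /= (addrC _ x).
  rewrite (_ : prim (fun t => pd i (k t) x) s -
     h^-1 *: (prim (k^~ (x + h *: ev R i)) s - prim (k^~ x) s) =
     - (h^-1 * prim (fun t => k t (x + h *: ev R i) - k t x - h * pd i (k t) x) s)); last first.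
    rewrite primB; last 2 first.
    - exact: continuous_sub.
    - exact: continuous_cstM.
    by rewrite (primB ch cx) primZ // [_ *: _]mulrBr mulrBr (mulrA _ h) mulVf // mul1r; ring.
  rewrite normrN normrM normfV ler_pdivrMl ?normr_gt0 //.
  apply: (@le_trans _ _ (`|h| * (e / (`|s| + 1)) * `|s|)).
    apply: (@ler_norm_prim_cst _ `|s|) => //.
      by apply: continuous_sub; [exact: continuous_sub|exact: continuous_cstM].
    move=> t ts; have [r rh|r rh ->] := @mvt_pd R n i (k t) x h.
      exact: Cn_derivable Ck (Uh r rh).
    rewrite -mulrBr normrM ler_wpM2l //; apply/ltW/H1 => //.
    by have := nev r rh; rewrite lt_min => /andP[].
  rewrite -mulrA ler_wpM2l // -mulrA ger_pMr //.
  by rewrite mulrC ler_pdivrMr // mul1r; lra.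
by split; [apply/cvg_ex; eexists; exact: H|exact/cvg_lim].
Unshelve. all: by end_near. Qed.

Lemma Cn_prim m U k : open U -> Cn m U k -> Cn m U (fun s x => prim (k^~ x) s).
Proof.
move=> oU; elim: m k => [|m IH] k Ck; (split; first exact: jcont_prim (Cn_jcont Ck)) => //.
move=> i; have Ck1 : Cn 1 U k by exact: Cn_le Ck.
split; first by move=> s x Ux; have [] := is_derive_prim i s oU Ck1 Ux.
apply: Cn_eq (IH _ (Cn_pd i Ck)) => // s x Ux.
by have [_ <-] := is_derive_prim i s oU Ck1 Ux.
Qed.
End Dependence.

Lemma is_derive_pd n (i : 'I_n) (f : 'rV[R]_n -> R) x l :
  is_derive x (ev R i) f l -> pd i f x = l.
Proof. by case. Qed.

Lemma derivable_pd n (i : 'I_n) (f : 'rV[R]_n -> R) x :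
  derivable f x (ev R i) -> is_derive x (ev R i) f (pd i f x).
Proof. by move=> df; split. Qed.

Lemma jcont_Cn n (U : set 'rV[R]_n) k : jcont U k -> Cn 0 U k.
Proof. by move=> jk; split. Qed.

Lemma Cn_succ n m (U : set 'rV[R]_n) k : jcont U k ->
  (forall i, (forall s x, U x -> derivable (k s) x (ev R i)) /\
     Cn m U (fun s => pd i (k s))) -> Cn m.+1 U k.
Proof. by move=> jk H; split. Qed.
End Primitive.

(* Unification must never unfold a partial derivative into a limit. *)
#[global] Opaque pd Cn prim.

(** * Quaternions *)
Section Quat.
Variable R : realType.
Implicit Types a b c : quat R.

Definition i0 : 'I_4 := @Ordinal 4 0 isT.
Definition i1 : 'I_4 := @Ordinal 4 1 isT.
Definition i2 : 'I_4 := @Ordinal 4 2 isT.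
Definition i3 : 'I_4 := @Ordinal 4 3 isT.

Lemma ord4P (P : 'I_4 -> Prop) : P i0 -> P i1 -> P i2 -> P i3 -> forall i, P i.
Proof.
move=> P0 P1 P2 P3 [[|[|[|[|i]]]] //= H].
- by rewrite (_ : Ordinal H = i0) //; exact: val_inj.
- by rewrite (_ : Ordinal H = i1) //; exact: val_inj.
- by rewrite (_ : Ordinal H = i2) //; exact: val_inj.
- by rewrite (_ : Ordinal H = i3) //; exact: val_inj.
Qed.

Lemma inord4 : (@inord 3 0 = i0) * (@inord 3 1 = i1) * (@inord 3 2 = i2) * (@inord 3 3 = i3).
Proof. by do !split; apply: val_inj; rewrite /= inordK. Qed.

Lemma sum4 (V : nmodType) (F : 'I_4 -> V) : \sum_(i < 4) F i = F i0 + F i1 + F i2 + F i3.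
Proof.
rewrite !big_ord_recl big_ord0 addr0 !addrA.
by congr (F _ + F _ + F _ + F _); exact: val_inj.
Qed.

Lemma quatP a b : a 0 i0 = b 0 i0 -> a 0 i1 = b 0 i1 -> a 0 i2 = b 0 i2 ->
  a 0 i3 = b 0 i3 -> a = b.
Proof. by move=> h0 h1 h2 h3; apply/rowP; exact: ord4P. Qed.

Definition mkq (a0 a1 a2 a3 : R) : quat R := \row_(i < 4) nth 0 [:: a0; a1; a2; a3] i.

Lemma mkqE (a0 a1 a2 a3 : R) : (mkq a0 a1 a2 a3 0 i0 = a0) * (mkq a0 a1 a2 a3 0 i1 = a1) *
  (mkq a0 a1 a2 a3 0 i2 = a2) * (mkq a0 a1 a2 a3 0 i3 = a3).
Proof. by rewrite /mkq !mxE. Qed.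

Lemma qmulE a b :
  (qmul a b 0 i0 = a 0 i0 * b 0 i0 - a 0 i1 * b 0 i1 - a 0 i2 * b 0 i2 - a 0 i3 * b 0 i3) *
  (qmul a b 0 i1 = a 0 i0 * b 0 i1 + a 0 i1 * b 0 i0 + a 0 i2 * b 0 i3 - a 0 i3 * b 0 i2) *
  (qmul a b 0 i2 = a 0 i0 * b 0 i2 - a 0 i1 * b 0 i3 + a 0 i2 * b 0 i0 + a 0 i3 * b 0 i1) *
  (qmul a b 0 i3 = a 0 i0 * b 0 i3 + a 0 i1 * b 0 i2 - a 0 i2 * b 0 i1 + a 0 i3 * b 0 i0).
Proof. by rewrite /qmul /qcoef !inord4 !mxE. Qed.

Definition qconj a : quat R := mkq (a 0 i0) (- a 0 i1) (- a 0 i2) (- a 0 i3).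
Definition qone : quat R := mkq 1 0 0 0.
Definition dot n (a b : 'rV[R]_n) : R := \sum_i a 0 i * b 0 i.

Lemma dot4E a b : dot a b =
  a 0 i0 * b 0 i0 + a 0 i1 * b 0 i1 + a 0 i2 * b 0 i2 + a 0 i3 * b 0 i3.
Proof. exact: sum4. Qed.

Lemma addqE a b i : (a + b) 0 i = a 0 i + b 0 i. Proof. by rewrite mxE. Qed.
Lemma oppqE a i : (- a) 0 i = - a 0 i. Proof. by rewrite mxE. Qed.
Lemma scaleqE (r : R) a i : (r *: a) 0 i = r * a 0 i. Proof. by rewrite mxE. Qed.
Lemma zeroqE i : (0 : quat R) 0 i = 0. Proof. by rewrite mxE. Qed.

Definition qE := (qmulE, mkqE, dot4E, addqE, oppqE, scaleqE, zeroqE).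
End Quat.

Ltac gen_quats := repeat match goal with
  | |- context [@fun_of_matrix ?R ?m ?n ?a ?i ?j] => move: (@fun_of_matrix R m n a i j) => ?
  end.
Ltac qring := try apply: quatP; rewrite /bracket /qconj /qone ?qE; gen_quats; ring.

Section QuatTheory.
Variable R : realType.
Implicit Types a b c : quat R.

Lemma qmulA a b c : qmul a (qmul b c) = qmul (qmul a b) c. Proof. qring. Qed.
Lemma qmul1q a : qmul (qone R) a = a. Proof. qring. Qed.
Lemma qmulq1 a : qmul a (qone R) = a. Proof. qring. Qed.
Lemma qmulDl a b c : qmul (a + b) c = qmul a c + qmul b c. Proof. qring. Qed.
Lemma qmulDr a b c : qmul a (b + c) = qmul a b + qmul a c. Proof. qring. Qed.
Lemma qmulNl a b : qmul (- a) b = - qmul a b. Proof. qring. Qed.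
Lemma qmulNr a b : qmul a (- b) = - qmul a b. Proof. qring. Qed.
Lemma qmulBl a b c : qmul (a - b) c = qmul a c - qmul b c. Proof. qring. Qed.
Lemma qmulBr a b c : qmul a (b - c) = qmul a b - qmul a c. Proof. qring. Qed.
Lemma qmulZl (r : R) a b : qmul (r *: a) b = r *: qmul a b. Proof. qring. Qed.
Lemma qmulZr (r : R) a b : qmul a (r *: b) = r *: qmul a b. Proof. qring. Qed.
Lemma qconjM a b : qconj (qmul a b) = qmul (qconj b) (qconj a). Proof. qring. Qed.
Lemma qmulVq a : qmul (qconj a) a = dot a a *: qone R. Proof. qring. Qed.
Lemma qmulqV a : qmul a (qconj a) = dot a a *: qone R. Proof. qring. Qed.
Lemma dot_qmul a b : dot (qmul a b) (qmul a b) = dot a a * dot b b. Proof. qring. Qed.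
Lemma dot_qconj a : dot (qconj a) (qconj a) = dot a a. Proof. qring. Qed.
Lemma qconj_imag a : a 0 i0 = 0 -> qconj a = - a.
Proof. by move=> a0; apply: quatP; rewrite /qconj ?qE ?a0 ?oppr0. Qed.

Lemma dotC n (a b : 'rV[R]_n) : dot a b = dot b a.
Proof. by apply: eq_bigr => i _; rewrite mulrC. Qed.
Lemma dotDl n (a b c : 'rV[R]_n) : dot (a + b) c = dot a c + dot b c.
Proof. by rewrite -big_split; apply: eq_bigr => i _; rewrite mxE mulrDl. Qed.
Lemma dotDr n (a b c : 'rV[R]_n) : dot a (b + c) = dot a b + dot a c.
Proof. by rewrite dotC dotDl !(dotC a). Qed.
Lemma dotZl n r (a b : 'rV[R]_n) : dot (r *: a) b = r * dot a b.
Proof. by rewrite /dot mulr_sumr; apply: eq_bigr => i _; rewrite mxE mulrA. Qed.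
Lemma dotZr n r (a b : 'rV[R]_n) : dot a (r *: b) = r * dot a b.
Proof. by rewrite dotC dotZl dotC. Qed.
Lemma dotNl n (a b : 'rV[R]_n) : dot (- a) b = - dot a b.
Proof. by rewrite -scaleN1r dotZl mulN1r. Qed.
Lemma dotNr n (a b : 'rV[R]_n) : dot a (- b) = - dot a b.
Proof. by rewrite dotC dotNl dotC. Qed.
Lemma dotBl n (a b c : 'rV[R]_n) : dot (a - b) c = dot a c - dot b c.
Proof. by rewrite dotDl dotNl. Qed.
Lemma dotBr n (a b c : 'rV[R]_n) : dot a (b - c) = dot a b - dot a c.
Proof. by rewrite dotDr dotNr. Qed.
Lemma dot0l n (a : 'rV[R]_n) : dot 0 a = 0.
Proof. by rewrite -(scale0r (0 : 'rV_n)) dotZl mul0r. Qed.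
Lemma dot_ge0 n (a : 'rV[R]_n) : 0 <= dot a a.
Proof. by apply: sumr_ge0 => i _; rewrite -expr2 sqr_ge0. Qed.
Lemma dot_eq0 n (a : 'rV[R]_n) : dot a a = 0 -> a = 0.
Proof.
move=> /eqP; rewrite psumr_eq0 => [/allP H|i _]; last by rewrite -expr2 sqr_ge0.
by apply/rowP => i; have := H i (mem_index_enum _); rewrite mulf_eq0 orbb mxE => /eqP.
Qed.

(** Topology and differentiability refer to the sup norm of row vectors, while the estimates need a
    norm that is multiplicative on quaternions; [eucl_le_norm] and [eucl_coord] compare the two. *)
Definition eucl n (a : 'rV[R]_n) : R := Num.sqrt (dot a a).
Lemma eucl_ge0 n (a : 'rV[R]_n) : 0 <= eucl a. Proof. exact: sqrtr_ge0. Qed.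
Lemma eucl_sqr n (a : 'rV[R]_n) : eucl a ^+ 2 = dot a a.
Proof. by rewrite sqr_sqrtr // dot_ge0. Qed.
Lemma eucl0 n : eucl (0 : 'rV[R]_n) = 0. Proof. by rewrite /eucl dot0l sqrtr0. Qed.
Lemma eucl_eq0 n (a : 'rV[R]_n) : eucl a = 0 -> a = 0.
Proof. by move=> a0; apply: dot_eq0; rewrite -eucl_sqr a0 expr0n. Qed.
Lemma euclZ n (r : R) (a : 'rV[R]_n) : eucl (r *: a) = `|r| * eucl a.
Proof. by rewrite /eucl dotZl dotZr mulrA -expr2 sqrtrM ?sqr_ge0 // sqrtr_sqr. Qed.
Lemma euclN n (a : 'rV[R]_n) : eucl (- a) = eucl a.
Proof. by rewrite /eucl dotNl dotNr opprK. Qed.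

Lemma cauchy_schwarz n (a b : 'rV[R]_n) : dot a b <= eucl a * eucl b.
Proof.
have [a0|a0] := eqVneq (eucl a) 0.
  by rewrite a0 mul0r (eucl_eq0 a0) dot0l.
have [b0|b0] := eqVneq (eucl b) 0.
  by rewrite b0 mulr0 (eucl_eq0 b0) dotC dot0l.
have ap : 0 < eucl a by rewrite lt_def a0 eucl_ge0.
have bp : 0 < eucl b by rewrite lt_def b0 eucl_ge0.
have := dot_ge0 ((eucl b) *: a - (eucl a) *: b).
rewrite dotBl !dotBr !dotZl !dotZr (dotC b) -!eucl_sqr => H.
have {}H : 0 <= (eucl a * eucl b) * (eucl a * eucl b - dot a b).
  by move: (eucl a) (eucl b) (dot a b) H => u v w; nra.
by rewrite -subr_ge0; move: H; rewrite pmulr_rge0 // mulr_gt0.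
Qed.

Lemma cauchy_schwarz_norm n (a b : 'rV[R]_n) : `|dot a b| <= eucl a * eucl b.
Proof.
rewrite ler_norml cauchy_schwarz andbT lerNl -dotNl.
by rewrite -(euclN a); exact: cauchy_schwarz.
Qed.

Lemma eucl_triangle n (a b : 'rV[R]_n) : eucl (a + b) <= eucl a + eucl b.
Proof.
rewrite -ler_sqr ?nnegrE ?addr_ge0 ?eucl_ge0 //.
rewrite eucl_sqr dotDl !dotDr (dotC b) sqrrD !eucl_sqr.
by have := cauchy_schwarz a b; move: (eucl a * eucl b) => u; lra.
Qed.

Lemma eucl_triangleB n (a b : 'rV[R]_n) : eucl (a - b) <= eucl a + eucl b.
Proof. by rewrite -(euclN b); exact: eucl_triangle. Qed.

Lemma eucl_qmul a b : eucl (qmul a b) = eucl a * eucl b.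
Proof. by rewrite /eucl dot_qmul sqrtrM // dot_ge0. Qed.
Lemma eucl_qconj a : eucl (qconj a) = eucl a.
Proof. by rewrite /eucl dot_qconj. Qed.
Lemma eucl_coord n (a : 'rV[R]_n) j : `|a 0 j| <= eucl a.
Proof.
rewrite -sqrtr_sqr; apply: ler_wsqrtr; rewrite /dot (bigD1 j) //= expr2 lerDl.
by apply: sumr_ge0 => i _; rewrite -expr2 sqr_ge0.
Qed.

Lemma eucl_le_norm a : eucl a <= 2 * `|a|.
Proof.
rewrite -ler_sqr ?nnegrE ?eucl_ge0 ?mulr_ge0 // eucl_sqr dot4E exprMn.
have H i : a 0 i * a 0 i <= `|a| ^+ 2.
  by rewrite -expr2 -real_normK ?num_real // lerXn2r ?nnegrE ?ler_coord.
by have := H i0; have := H i1; have := H i2; have := H i3; lra.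
Qed.

Lemma enormE a : enorm a = eucl a.
Proof. by rewrite /enorm /eucl; congr Num.sqrt; apply: eq_bigr => i _; rewrite expr2. Qed.
End QuatTheory.

(** * Vector-valued derivatives *)
Section VectorDerive.
Variable R : realType.
Local Notation isD f x d := (is_derive (x : R) (1 : R) f d).

Section Directional.
Variables (V : normedModType R) (x v : V).

Lemma is_deriveMr (f g : V -> R) df dg : is_derive x v f df -> is_derive x v g dg ->
  is_derive x v (fun y => f y * g y) (df * g x + f x * dg).
Proof.
move=> fd gd; apply: is_derive_eq (is_deriveM fd gd) _.
by rewrite addrC [g x *: _]mulrC.
Qed.

Lemma is_deriveDr (f g : V -> R) df dg : is_derive x v f df -> is_derive x v g dg ->
  is_derive x v (fun y => f y + g y) (df + dg).
Proof. by move=> fd gd; exact: is_deriveD. Qed.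

Lemma is_deriveNr (f : V -> R) df : is_derive x v f df ->
  is_derive x v (fun y => - f y) (- df).
Proof. by move=> fd; exact: is_deriveN. Qed.

(** With the derivative as an argument, the rules of calculus below establish existence and value in
    one go. *)
Definition isDV m (f : V -> 'rV[R]_m) (df : 'rV[R]_m) : Prop :=
  forall j, is_derive x v (fun y => f y 0 j) (df 0 j).

Lemma isDV_eq m (f : V -> 'rV[R]_m) df df' : isDV f df -> df = df' -> isDV f df'.
Proof. by move=> H <-. Qed.

Lemma isDV_cst m (c : 'rV[R]_m) : isDV (fun _ => c) 0.
Proof. by move=> j; rewrite mxE; exact: is_derive_cst. Qed.

Lemma isDV_D m (f g : V -> 'rV[R]_m) df dg : isDV f df -> isDV g dg ->
  isDV (fun y => f y + g y) (df + dg).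
Proof.
move=> fd gd j; rewrite mxE (_ : (fun y => _) = (fun y => f y 0 j + g y 0 j)).
  exact: is_deriveDr.
by apply/funext => y; rewrite mxE.
Qed.

Lemma isDV_scale m (r : V -> R) (f : V -> 'rV[R]_m) dr df :
  is_derive x v r dr -> isDV f df -> isDV (fun y => r y *: f y) (dr *: f x + r x *: df).
Proof.
move=> rd fd j; rewrite !mxE (_ : (fun y => _) = (fun y => r y * f y 0 j)).
  exact: is_deriveMr.
by apply/funext => y; rewrite mxE.
Qed.

Lemma isDV_N m (f : V -> 'rV[R]_m) df : isDV f df -> isDV (fun y => - f y) (- df).
Proof.
move=> fd j; rewrite mxE (_ : (fun y => _) = (fun y => - f y 0 j)).
  exact: is_deriveNr.
by apply/funext => y; rewrite mxE.
Qed.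

Lemma isDV_B m (f g : V -> 'rV[R]_m) df dg : isDV f df -> isDV g dg ->
  isDV (fun y => f y - g y) (df - dg).
Proof. by move=> fd gd; apply: isDV_D => //; exact: isDV_N. Qed.

Lemma is_derive_dot m (f g : V -> 'rV[R]_m) df dg : isDV f df -> isDV g dg ->
  is_derive x v (fun y => dot (f y) (g y)) (dot df (g x) + dot (f x) dg).
Proof.
move=> fd gd; rewrite /dot -big_split /=.
rewrite (_ : (fun y => _) = \sum_(i < m) (fun y => f y 0 i * g y 0 i)).
  by apply: is_derive_sum => i; exact: is_deriveMr.
by apply/funext => y; rewrite fct_sumE.
Qed.

Lemma isDV_qmul (f g : V -> quat R) df dg : isDV f df -> isDV g dg ->
  isDV (fun y => qmul (f y) (g y)) (qmul df (g x) + qmul (f x) dg).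
Proof.
move=> fd gd.
have M i j := is_deriveMr (fd i) (gd j).
apply: ord4P; rewrite !qE.
- rewrite (_ : (fun y => _) = (fun y => f y 0 i0 * g y 0 i0 - f y 0 i1 * g y 0 i1 - f y 0 i2 * g y 0 i2 - f y 0 i3 * g y 0 i3)); last by apply/funext => y; rewrite qE.
  by apply: is_derive_eq (is_deriveDr (is_deriveDr (is_deriveDr (M i0 i0) (is_deriveNr (M i1 i1))) (is_deriveNr (M i2 i2))) (is_deriveNr (M i3 i3))) _; gen_quats; ring.
- rewrite (_ : (fun y => _) = (fun y => f y 0 i0 * g y 0 i1 + f y 0 i1 * g y 0 i0 + f y 0 i2 * g y 0 i3 - f y 0 i3 * g y 0 i2)); last by apply/funext => y; rewrite qE.
  by apply: is_derive_eq (is_deriveDr (is_deriveDr (is_deriveDr (M i0 i1) (M i1 i0)) (M i2 i3)) (is_deriveNr (M i3 i2))) _; gen_quats; ring.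
- rewrite (_ : (fun y => _) = (fun y => f y 0 i0 * g y 0 i2 - f y 0 i1 * g y 0 i3 + f y 0 i2 * g y 0 i0 + f y 0 i3 * g y 0 i1)); last by apply/funext => y; rewrite qE.
  by apply: is_derive_eq (is_deriveDr (is_deriveDr (is_deriveDr (M i0 i2) (is_deriveNr (M i1 i3))) (M i2 i0)) (M i3 i1)) _; gen_quats; ring.
- rewrite (_ : (fun y => _) = (fun y => f y 0 i0 * g y 0 i3 + f y 0 i1 * g y 0 i2 - f y 0 i2 * g y 0 i1 + f y 0 i3 * g y 0 i0)); last by apply/funext => y; rewrite qE.
  by apply: is_derive_eq (is_deriveDr (is_deriveDr (is_deriveDr (M i0 i3) (M i1 i2)) (is_deriveNr (M i2 i1))) (M i3 i0)) _; gen_quats; ring.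
Qed.

Lemma isDV_qconj (f : V -> quat R) df : isDV f df ->
  isDV (fun y => qconj (f y)) (qconj df).
Proof.
move=> fd; apply: ord4P; rewrite /qconj !qE.
- by rewrite (_ : (fun y => _) = (fun y => f y 0 i0)) //; apply/funext => y; rewrite qE.
- rewrite (_ : (fun y => _) = (fun y => - f y 0 i1)); first exact: is_deriveNr.
  by apply/funext => y; rewrite qE.
- rewrite (_ : (fun y => _) = (fun y => - f y 0 i2)); first exact: is_deriveNr.
  by apply/funext => y; rewrite qE.
- rewrite (_ : (fun y => _) = (fun y => - f y 0 i3)); first exact: is_deriveNr.
  by apply/funext => y; rewrite qE.
Qed.

Lemma isDV_bracket (f g : V -> quat R) df dg : isDV f df -> isDV g dg ->
  isDV (fun y => bracket (f y) (g y)) (bracket df (g x) + bracket (f x) dg).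
Proof.
move=> fd gd; apply: isDV_eq (isDV_B (isDV_qmul fd gd) (isDV_qmul gd fd)) _.
by rewrite /bracket opprD (addrC (- qmul dg (f x))) addrACA.
Qed.

End Directional.

(** Pairing f with the constant vector u = f b - f a reduces to real functions; Cauchy-Schwarz gives
    |u|^2 <= |u| (g b - g a). *)
Lemma eucl_mvt m (f : R -> 'rV[R]_m) df (g dg : R -> R) (a b : R) : a <= b ->
  (forall s, a <= s <= b -> isDV s 1 f (df s)) ->
  (forall s, a <= s <= b -> isD g s (dg s)) ->
  (forall s, a <= s <= b -> eucl (df s) <= dg s) ->
  eucl (f b - f a) <= g b - g a.
Proof.
move=> ab fd gd le; set u := f b - f a.
have gab : 0 <= g b - g a.
  have := @ler_derive R (cst 0) (cst 0) g dg a b ab _ gd _; rewrite subrr; apply=> x xab.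
  by apply: le_trans (le x xab); exact: eucl_ge0.
have [u0|u0] := eqVneq (eucl u) 0; first by rewrite u0.
have up : 0 < eucl u by rewrite lt_def u0 eucl_ge0.
have H : dot (f b) u - dot (f a) u <= eucl u * g b - eucl u * g a.
  apply: (@ler_derive R (fun s => dot (f s) u) (fun s => dot (df s) u)
     (fun s => eucl u * g s) (fun s => eucl u * dg s) a b ab) => s sab.
  - apply: is_derive_eq (is_derive_dot (fd s sab) (isDV_cst s 1 u)) _.
    by rewrite (dotC (f s)) dot0l addr0.
  - exact: is_deriveZ (gd s sab).
  - apply: le_trans (cauchy_schwarz _ _) _; rewrite mulrC ler_wpM2l ?eucl_ge0 //.
    exact: le.
move: H; rewrite -dotBl -/u -eucl_sqr -mulrBr expr2 ler_pM2l //.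
Qed.

Section Space.
Variable n : nat.
Implicit Types (U : set 'rV[R]_n).

Definition pdv m (i : 'I_n) (f : 'rV[R]_n -> 'rV[R]_m) (x : 'rV[R]_n) : 'rV[R]_m :=
  \row_j pd i (fun y => f y 0 j) x.

Lemma pdvE m i (f : 'rV[R]_n -> 'rV[R]_m) x j : pdv i f x 0 j = pd i (fun y => f y 0 j) x.
Proof. by rewrite mxE. Qed.

Definition CnV l m U (k : R -> 'rV[R]_n -> 'rV[R]_m) : Prop :=
  forall j, Cn l U (fun s x => k s x 0 j).

Lemma CnV_isDV l m U (k : R -> 'rV[R]_n -> 'rV[R]_m) i s x : CnV l.+1 U k -> U x ->
  isDV x (ev R i) (k s) (pdv i (k s) x).
Proof.
move=> Ck Ux j; rewrite pdvE; apply: derivable_pd.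
exact: (@Cn_derivable R n l U (fun s x => k s x 0 j) i s x (Ck j) Ux).
Qed.

Lemma isDV_pdv m (f : 'rV[R]_n -> 'rV[R]_m) i x df : isDV x (ev R i) f df -> pdv i f x = df.
Proof. by move=> H; apply/rowP => j; rewrite mxE; exact: is_derive_pd (H j). Qed.

Lemma CnV_pdv l m U (k : R -> 'rV[R]_n -> 'rV[R]_m) i : CnV l.+1 U k ->
  CnV l U (fun s => pdv i (k s)).
Proof.
move=> Ck j; have := Cn_pd i (Ck j).
by congr Cn; apply/funext => s; apply/funext => x; rewrite pdvE.
Qed.

Lemma CnV_le l l' m U (k : R -> 'rV[R]_n -> 'rV[R]_m) : (l' <= l)%N -> CnV l U k -> CnV l' U k.
Proof. by move=> le Ck j; exact: Cn_le (Ck j). Qed.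

Lemma CnV_eq l m U (k h : R -> 'rV[R]_n -> 'rV[R]_m) : open U ->
  (forall s x, U x -> k s x = h s x) -> CnV l U k -> CnV l U h.
Proof. by move=> oU kh Ck j; apply: Cn_eq (Ck j) => // s x Ux; rewrite kh. Qed.

Lemma CnV_D l m U (k h : R -> 'rV[R]_n -> 'rV[R]_m) : open U -> CnV l U k -> CnV l U h ->
  CnV l U (fun s x => k s x + h s x).
Proof.
move=> oU Ck Ch j; apply: Cn_eq (Cn_add oU (Ck j) (Ch j)) => // s x _.
by rewrite mxE.
Qed.

Lemma CnV_N l m U (k : R -> 'rV[R]_n -> 'rV[R]_m) : open U -> CnV l U k ->
  CnV l U (fun s x => - k s x).
Proof.
by move=> oU Ck j; apply: Cn_eq (Cn_opp oU (Ck j)) => // s x _; rewrite mxE.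
Qed.

Lemma CnV_B l m U (k h : R -> 'rV[R]_n -> 'rV[R]_m) : open U -> CnV l U k -> CnV l U h ->
  CnV l U (fun s x => k s x - h s x).
Proof. by move=> oU Ck Ch; apply: CnV_D => //; exact: CnV_N. Qed.

Lemma CnV_scale l m U r (k : R -> 'rV[R]_n -> 'rV[R]_m) : open U -> Cn l U r -> CnV l U k ->
  CnV l U (fun s x => r s x *: k s x).
Proof.
move=> oU Cr Ck j; apply: Cn_eq (Cn_mul oU Cr (Ck j)) => // s x _.
by rewrite mxE.
Qed.

Lemma CnV_sum l m p U (k : 'I_p -> R -> 'rV[R]_n -> 'rV[R]_m) : open U ->
  (forall q, CnV l U (k q)) -> CnV l U (fun s x => \sum_q k q s x).
Proof.
move=> oU Ck j; have := @Cn_sum R n l U _ (index_enum _) (fun q s x => k q s x 0 j) oU (fun q => Ck q j).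
by apply: Cn_eq => // s x _; rewrite summxE.
Qed.

Lemma Cn_dot l m U (k h : R -> 'rV[R]_n -> 'rV[R]_m) : open U -> CnV l U k -> CnV l U h ->
  Cn l U (fun s x => dot (k s x) (h s x)).
Proof. by move=> oU Ck Ch; apply: Cn_sum => // j; exact: Cn_mul. Qed.

Lemma CnV_qmul l U (k h : R -> 'rV[R]_n -> quat R) : open U -> CnV l U k -> CnV l U h ->
  CnV l U (fun s x => qmul (k s x) (h s x)).
Proof.
move=> oU Ck Ch; have M i j := Cn_mul oU (Ck i) (Ch j).
apply: ord4P.
- by apply: (Cn_eq oU _ (Cn_sub2 oU (Cn_sub2 oU (Cn_sub2 oU (M i0 i0) (M i1 i1)) (M i2 i2)) (M i3 i3))) => s x _; rewrite qE.
- by apply: (Cn_eq oU _ (Cn_sub2 oU (Cn_add oU (Cn_add oU (M i0 i1) (M i1 i0)) (M i2 i3)) (M i3 i2))) => s x _; rewrite qE.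
- by apply: (Cn_eq oU _ (Cn_add oU (Cn_add oU (Cn_sub2 oU (M i0 i2) (M i1 i3)) (M i2 i0)) (M i3 i1))) => s x _; rewrite qE.
- by apply: (Cn_eq oU _ (Cn_add oU (Cn_sub2 oU (Cn_add oU (M i0 i3) (M i1 i2)) (M i2 i1)) (M i3 i0))) => s x _; rewrite qE.
Qed.

Lemma CnV_bracket l U (k h : R -> 'rV[R]_n -> quat R) : open U -> CnV l U k -> CnV l U h ->
  CnV l U (fun s x => bracket (k s x) (h s x)).
Proof. by move=> oU Ck Ch; apply: CnV_B => //; exact: CnV_qmul. Qed.

Lemma CnV_qconj l U (k : R -> 'rV[R]_n -> quat R) : open U -> CnV l U k ->
  CnV l U (fun s x => qconj (k s x)).
Proof.
move=> oU Ck; apply: ord4P.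
- by apply: (Cn_eq oU _ (Ck i0)) => s x _; rewrite /qconj qE.
- by apply: (Cn_eq oU _ (Cn_opp oU (Ck i1))) => s x _; rewrite /qconj qE.
- by apply: (Cn_eq oU _ (Cn_opp oU (Ck i2))) => s x _; rewrite /qconj qE.
- by apply: (Cn_eq oU _ (Cn_opp oU (Ck i3))) => s x _; rewrite /qconj qE.
Qed.

Lemma pdv_comm l m U (k : R -> 'rV[R]_n -> 'rV[R]_m) s x i j : open U -> CnV l.+2 U k -> U x ->
  pdv i (pdv j (k s)) x = pdv j (pdv i (k s)) x.
Proof.
move=> oU Ck Ux; apply/rowP => q.
have E p : (fun y => pdv p (k s) y 0 q) = pd p (fun y => k s y 0 q).
  by apply/funext => y; rewrite pdvE.
apply: etrans (pdvE _ _ _ _) _; apply: etrans _ (esym (pdvE _ _ _ _)).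
apply: etrans (congr1 (fun f => pd i f x) (E j)) _.
apply: etrans _ (esym (congr1 (fun f => pd j f x) (E i))).
exact: (@pd_comm R n l U (fun s x => k s x 0 q) s x i j oU (Ck q) Ux).
Qed.
End Space.
End VectorDerive.

(** * Linear differential equations *)
Section Geometric.
Variable R : realType.
Implicit Types (u : nat -> R) (c e l : R).

Lemma ex_pow2_lt c e : 0 < e -> exists n : nat, c / 2 ^+ n < e.
Proof.
move=> e0; exists (Num.bound `|c / e|); set n := Num.bound _.
have n2 : n%:R < 2 ^+ n :> R by rewrite -natrX ltr_nat ltn_expl.
have H : `|c / e| < n%:R by rewrite /n archi_boundP.
rewrite ltr_pdivrMr ?exprn_gt0 // mulrC -ltr_pdivrMr //.
by apply: le_lt_trans (ler_norm _) _; exact: lt_trans n2.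
Qed.

Lemma geometric_dist u c n m : (forall n, `|u n.+1 - u n| <= c / 2 ^+ n.+1) ->
  (n <= m)%N -> `|u n - u m| <= c / 2 ^+ n - c / 2 ^+ m.
Proof.
move=> H; elim: m => [|m IH]; first by rewrite leqn0 => /eqP ->; rewrite !subrr normr0.
rewrite leq_eqVlt => /predU1P[->|]; first by rewrite !subrr normr0.
rewrite ltnS => /IH {}IH.
have -> : u n - u m.+1 = (u n - u m) - (u m.+1 - u m) by ring.
apply: le_trans (ler_normB _ _) _; apply: le_trans (lerD IH (H m)) _.
have -> : c / 2 ^+ m = c / 2 ^+ m.+1 + c / 2 ^+ m.+1.
  by rewrite exprS invfM mulrCA mulrA -mulrDl; congr (_ * _); field.
by lra.
Qed.

(** The intervals of radius c / 2^n around u n all intersect, so the supremum of their left ends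
    lies in each of them. *)
Lemma geometric_lim u c : (forall n, `|u n.+1 - u n| <= c / 2 ^+ n.+1) ->
  exists l, forall n, `|u n - l| <= c / 2 ^+ n.
Proof.
move=> H.
have c0 : 0 <= c by have := le_trans (normr_ge0 _) (H 0); rewrite ler_pdivlMr ?mul0r // exprn_gt0.
have D n m : u n - c / 2 ^+ n <= u m + c / 2 ^+ m.
  have pos k : 0 <= c / 2 ^+ k by rewrite divr_ge0 // exprn_ge0.
  have := pos n; have := pos m.
  by case: (leqP n m) => [|/ltnW] /(geometric_dist H); rewrite ler_norml => /andP[]; lra.
pose A := [set u n - c / 2 ^+ n | n in [set: nat]].
have A0 : A !=set0 by exists (u 0 - c / 2 ^+ 0); exists 0.
have ubA m : ubound A (u m + c / 2 ^+ m) by move=> _ [n _ <-].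
exists (sup A) => n; rewrite ler_distl; apply/andP; split.
  have : sup A <= u n + c / 2 ^+ n by exact: ge_sup.
  by lra.
have : u n - c / 2 ^+ n <= sup A.
  by apply: ub_le_sup; [exists (u 0 + c / 2 ^+ 0); exact: ubA | exists n].
by lra.
Qed.

(** The rate of convergence to a given limit is governed by the steps alone. The limit can thus be
    chosen point by point, with a poor constant, and a uniform constant recovered afterwards. *)
Lemma geometric_lim_rate u c c' l : (forall n, `|u n - l| <= c / 2 ^+ n) ->
  (forall n, `|u n.+1 - u n| <= c' / 2 ^+ n.+1) -> forall n, `|u n - l| <= c' / 2 ^+ n.
Proof.
move=> H H' n; apply/ler_addgt0Pl => e e0.
have [m0 m0e] := ex_pow2_lt c e0.
pose m := maxn n m0.
have c0 : 0 <= c by have := le_trans (normr_ge0 _) (H 0); rewrite ler_pdivlMr ?mul0r // exprn_gt0.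
have c'0 : 0 <= c' by have := le_trans (normr_ge0 _) (H' 0); rewrite ler_pdivlMr ?mul0r // exprn_gt0.
have me : c / 2 ^+ m < e.
  apply: le_lt_trans m0e; rewrite ler_wpM2l // lef_pV2 ?posrE ?exprn_gt0 //.
  by rewrite ler_weXn2l ?ler1n // leq_maxr.
have -> : u n - l = (u n - u m) + (u m - l) by ring.
apply: le_trans (ler_normD _ _) _.
have := geometric_dist H' (leq_maxl n m0); rewrite -/m.
have := H m; have : 0 <= c' / 2 ^+ m by rewrite divr_ge0 // exprn_ge0.
by lra.
Qed.
End Geometric.

Section LinearODE.
Variable R : realType.
Local Notation isD f x d := (is_derive (x : R) (1 : R) f d).

Definition contq m (f : R -> 'rV[R]_m) := forall j, continuous (fun s => f s 0 j).

Lemma contq_CnV m (f : R -> 'rV[R]_m) : contq f ->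
  CnV 0 [set: 'rV[R]_1] (fun s _ => f s).
Proof. by move=> cf j; exact: (@Cn_time R 1 0 setT (fun s => f s 0 j) (cf j)). Qed.

Lemma CnV_contq l n m U (k : R -> 'rV[R]_n -> 'rV[R]_m) x : CnV l U k -> U x ->
  contq (fun s => k s x).
Proof.
by move=> Ck Ux j; exact: (@jcont_time R n U (fun s x => k s x 0 j) x (Cn_jcont (Ck j)) Ux).
Qed.

Lemma contq_qmul (f g : R -> quat R) : contq f -> contq g -> contq (fun s => qmul (f s) (g s)).
Proof.
move=> cf cg.
have H := CnV_qmul openT (contq_CnV cf) (contq_CnV cg).
exact: (@CnV_contq 0 1 4 setT (fun s _ => qmul (f s) (g s)) 0 H I).
Qed.

Lemma contq_dot m (f g : R -> 'rV[R]_m) : contq f -> contq g -> continuous (fun s => dot (f s) (g s)).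
Proof.
move=> cf cg.
have /Cn_jcont H := Cn_dot openT (contq_CnV cf) (contq_CnV cg).
exact: (@jcont_time R 1 setT (fun s _ => dot (f s) (g s)) 0 H I).
Qed.

Lemma isDV_contq m (f df : R -> 'rV[R]_m) : (forall s, isDV (s : R) (1 : R) f (df s)) -> contq f.
Proof. by move=> fd j s; exact: is_derive_continuous (fd s j). Qed.

Definition primq m (f : R -> 'rV[R]_m) (s : R) : 'rV[R]_m :=
  \row_j prim (fun t => f t 0 j) s.

Lemma primqE m (f : R -> 'rV[R]_m) s j : primq f s 0 j = prim (fun t => f t 0 j) s.
Proof. by rewrite mxE. Qed.

Lemma primq_spec m (f : R -> 'rV[R]_m) : contq f ->
  primq f 0 = 0 /\ forall s, isDV (s : R) (1 : R) (primq f) (f s).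
Proof.
move=> cf; split.
  by apply/rowP => j; rewrite primqE mxE; have [] := prim_spec (cf j).
move=> s j; rewrite (_ : (fun y => _) = prim (fun t => f t 0 j)).
  by have [_] := prim_spec (cf j); exact.
by apply/funext => t; rewrite primqE.
Qed.

Lemma eucl_derive0 m (f df : R -> 'rV[R]_m) (g dg : R -> R) (S s : R) : `|s| <= S ->
  (forall x, `|x| <= S -> isDV (x : R) (1 : R) f (df x)) -> (forall x, `|x| <= S -> isD g x (dg x)) ->
  (forall x, `|x| <= S -> eucl (df x) <= dg x) -> f 0 = 0 -> g 0 = 0 ->
  eucl (f s) <= `|g s|.
Proof.
move=> sS fd gd le f0 g0.
have in_S x : (0 <= x <= s) || (s <= x <= 0) -> `|x| <= S.
  move=> xs; apply: le_trans sS; move: xs.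
  by case/orP => /andP[x0 xs]; [rewrite !ger0_norm | rewrite !ler0_norm]; lra.
have [s0|s0] := leP 0 s.
  have := @eucl_mvt R m f df g dg 0 s s0; rewrite f0 g0 !subr0 => H.
  apply: le_trans (ler_norm _); apply: H => x xs; [apply: fd|apply: gd|apply: le];
  by apply: in_S; rewrite xs.
have := @eucl_mvt R m f df g dg s 0 (ltW s0).
rewrite f0 g0 !sub0r euclN => H.
rewrite -(normrN (g s)); apply: le_trans (ler_norm _); apply: H => x xs;
  [apply: fd|apply: gd|apply: le]; by apply: in_S; rewrite xs orbT.
Qed.

Lemma ex_eucl_bound m (f : R -> 'rV[R]_m) (S : R) : contq f ->
  exists2 M, 0 < M & forall s, `|s| <= S -> eucl (f s) <= M.
Proof.
move=> cf.
have [S0|S0] := leP 0 S; last first.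
  exists 1 => // s sS; have := le_trans (normr_ge0 s) sS; lra.
have [||c _ H] := @EVT_max R (fun s => dot (f s) (f s)) (- S) S.
  - by lra.
  - by apply: continuous_subspaceT; exact: contq_dot.
exists (eucl (f c) + 1); first by have := eucl_ge0 (f c); lra.
move=> s sS; have : eucl (f s) <= eucl (f c).
  by apply: ler_wsqrtr; apply: H; rewrite in_itv /= -ler_norml.
lra.
Qed.

Section Picard.
Variable b : R -> quat R.
Hypothesis cb : contq b.

Fixpoint picard (n : nat) : R -> quat R :=
  match n with
  | 0 => fun _ => qone R
  | n.+1 => fun s => qone R + primq (fun t => qmul (b t) (picard n t)) s
  end.

Lemma picard_spec n : contq (picard n) /\
  forall s, isDV (s : R) (1 : R) (picard n.+1) (qmul (b s) (picard n s)).
Proof.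
have H k : contq (picard k) -> forall s, isDV (s : R) (1 : R) (picard k.+1) (qmul (b s) (picard k s)).
  move=> ck s; have [_ D] := primq_spec (contq_qmul cb ck).
  by apply: isDV_eq (isDV_D (isDV_cst (s : R) (1 : R) (qone R)) (D s)) _; rewrite add0r.
elim: n => [|n [IH1 IH2]]; first by split; [move=> j s; exact: cst_continuous|apply: H => j s; exact: cst_continuous].
by have c := isDV_contq IH2; split => //; exact: H.
Qed.

Lemma picard0 n : picard n 0 = qone R.
Proof.
case: n => //= n; have [cn _] := picard_spec n.
by have [-> _] := primq_spec (contq_qmul cb cn); rewrite addr0.
Qed.

Section Rate.
Variables S M : R.
Hypotheses (M0 : 0 < M) (bM : forall s, `|s| <= S -> eucl (b s) <= M).

(** A weight of Bielecki type. [G] is the odd primitive of [M * mu] and |G| <= mu / 2, so one Picard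
    step with a coefficient of size M halves any bound by [mu]; the sum of two exponentials serves
    both signs of s. *)
Let mu (s : R) := expR (2 * M * s) + expR (- (2 * M) * s).
Let G (s : R) := (expR (2 * M * s) - expR (- (2 * M) * s)) / 2.

Let mu_ge1 s : 1 <= mu s.
Proof.
rewrite /mu; have := expR_ge1Dx (2 * M * s); have := expR_ge1Dx (- (2 * M) * s).
by rewrite mulNr; lra.
Qed.

Let is_derive_exp c x : isD (fun s => expR (c * s)) x (c * expR (c * x)).
Proof.
rewrite mulrC; apply: (@is_derive1_comp R expR (fun s => c * s)).
exact: is_derive_linear.
Qed.

Let is_deriveG x : isD G x (M * mu x).
Proof.
rewrite (_ : M * mu x = (2 * M * expR (2 * M * x) - - (2 * M) * expR (- (2 * M) * x)) * 2^-1
    + (expR (2 * M * x) - expR (- (2 * M) * x)) * 0); last by rewrite /mu; field.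
apply: (@is_deriveMr R R x 1 _ (fun=> 2^-1)).
by apply: is_deriveDr; [exact: is_derive_exp | apply: is_deriveNr; exact: is_derive_exp].
Qed.

Let normG s : `|G s| <= mu s / 2.
Proof.
rewrite /G /mu normrM (ger0_norm (_ : 0 <= 2^-1)) ?invr_ge0 // ler_wpM2r ?invr_ge0 //.
apply: le_trans (ler_normB _ _) _.
by rewrite !ger0_norm ?expR_ge0.
Qed.

Let G0 : G 0 = 0. Proof. by rewrite /G !mulr0 subrr mul0r. Qed.

Lemma picard_rate n s : `|s| <= S ->
  eucl (picard n.+1 s - picard n s) <= (expR (2 * M * s) + expR (- (2 * M) * s)) / 2 ^+ n.+1.
Proof.
rewrite -/(mu s); elim: n s => [|n IH] s sS.
  have [_ D] := picard_spec 0.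
  apply: le_trans (normG s).
  apply: (@eucl_derive0 _ (fun s => picard 1 s - picard 0 s) _ G (fun x => M * mu x) S s sS).
  - by move=> x _; apply: isDV_B; [exact: D|exact: isDV_cst].
  - by move=> x _; exact: is_deriveG.
  - move=> x xS; rewrite /= subr0 qmulq1; apply: le_trans (bM xS) _.
    by rewrite ler_peMr ?mu_ge1 // ltW.
  - by rewrite !picard0 subrr.
  - exact: G0.
have [_ D] := picard_spec n; have [_ D'] := picard_spec n.+1.
have pn : 0 < 2 ^+ n.+1 :> R by rewrite exprn_gt0.
apply: (@le_trans _ _ `|(2 ^+ n.+1)^-1 * G s|); last first.
  rewrite normrM ger0_norm ?invr_ge0 ?(ltW pn) //.
  apply: le_trans (ler_wpM2l _ (normG s)) _; first by rewrite invr_ge0 (ltW pn).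
  by rewrite [2 ^+ n.+2]exprS invfM mulrC mulrA.
apply: (@eucl_derive0 _ (fun s => picard n.+2 s - picard n.+1 s) _
  (fun s => (2 ^+ n.+1)^-1 * G s) (fun x => (2 ^+ n.+1)^-1 * (M * mu x)) S s sS).
- by move=> x _; apply: isDV_B; [exact: D'|exact: D].
- by move=> x _; exact: is_deriveZ (is_deriveG x).
- move=> x xS; cbv beta; rewrite -qmulBr eucl_qmul.
  rewrite mulrCA; apply: ler_pM; rewrite ?eucl_ge0 ?bM // mulrC.
  exact: IH.
- by rewrite !picard0 subrr.
- by rewrite G0 mulr0.
Qed.

Lemma picard_rate_cst n s : `|s| <= S ->
  eucl (picard n.+1 s - picard n s) <= 2 * expR (2 * M * S) / 2 ^+ n.+1.
Proof.
move=> sS; apply: le_trans (picard_rate n sS) _.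
rewrite ler_wpM2r ?invr_ge0 ?exprn_ge0 //.
rewrite (_ : 2 * expR (2 * M * S) = expR (2 * M * S) + expR (2 * M * S)); last by ring.
move: sS; rewrite ler_norml => /andP[s1 s2].
by apply: lerD; rewrite ler_expR ?mulNr -?mulrN ler_pM2l ?mulr_gt0 //; lra.
Qed.
End Rate.

(** One function Q serves all S and M: it is the pointwise limit, and the rate is then improved to
    one that is uniform on [|s| <= S]. Of the factor 4, one 2 is that of [picard_rate_cst], the
    other the loss in [eucl_le_norm]. *)
Lemma ex_picard_lim : exists Q : R -> quat R, forall S M, 0 < M ->
  (forall s, `|s| <= S -> eucl (b s) <= M) -> forall n s, `|s| <= S ->
  eucl (picard n s - Q s) <= 4 * expR (2 * M * S) / 2 ^+ n.
Proof.
have [Q QP] : {Q : R -> quat R | forall s j, exists c, forall n,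
    `|picard n s 0 j - Q s 0 j| <= c / 2 ^+ n}.
  have H s j : {l : R | exists c, forall n, `|picard n s 0 j - l| <= c / 2 ^+ n}.
    apply: cid; have [M M0 bM] := ex_eucl_bound `|s| cb.
    have [|l lP] := @geometric_lim R (fun n => picard n s 0 j) (2 * expR (2 * M * `|s|)).
      move=> n; apply: le_trans (picard_rate_cst M0 bM n (lexx _)).
      by apply: le_trans (eucl_coord _ j); rewrite !mxE.
    by exists l; exists (2 * expR (2 * M * `|s|)).
  exists (fun s => \row_j sval (H s j)) => s j.
  by have [c cP] := svalP (H s j); exists c => n; rewrite mxE.
exists Q => S M M0 bM n s sS.
apply: le_trans (eucl_le_norm _) _.
have -> : 4 * expR (2 * M * S) / 2 ^+ n = 2 * (2 * expR (2 * M * S) / 2 ^+ n).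
  by rewrite !mulrA -natrM.
rewrite ler_wpM2l //; apply: ler_norm_coord.
  by rewrite divr_ge0 ?exprn_ge0 // mulr_ge0 // expR_ge0.
move=> j; have [c cP] := QP s j; rewrite !mxE.
apply: (geometric_lim_rate cP) => k; apply: le_trans (picard_rate_cst M0 bM k sS).
by apply: le_trans (eucl_coord _ j); rewrite !mxE.
Qed.

Lemma ex_linear_ode : exists Q : R -> quat R, Q 0 = qone R /\
  forall s, isDV (s : R) (1 : R) Q (qmul (b s) (Q s)).
Proof.
have [Q QP] := ex_picard_lim.
have cQ : contq Q.
  move=> j s; apply/continuousP_norm => e e0.
  have [M M0 bM] := ex_eucl_bound (`|s| + 1) cb.
  have [|n nP] := @ex_pow2_lt R (4 * expR (2 * M * (`|s| + 1))) (e / 3); first by lra.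
  have [cn _] := picard_spec n.
  have e3 : 0 < e / 3 by lra.
  have /continuousP_norm/(_ _ e3)[d d0 dP] := cn j s.
  exists (Num.min d 1); first by rewrite lt_min d0 ltr01.
  move=> y; rewrite lt_min => /andP[/dP + ys].
  have yS : `|y| <= `|s| + 1 by have := ler_normD (y - s) s; rewrite subrK; lra.
  have sS : `|s| <= `|s| + 1 by lra.
  have A z (zS : `|z| <= `|s| + 1) : `|picard n z 0 j - Q z 0 j| < e / 3.
    apply: le_lt_trans nP; apply: le_trans (QP _ _ M0 bM n z zS).
    by apply: le_trans (eucl_coord _ j); rewrite !mxE.
  have := A _ yS; have := A _ sS.
  rewrite !ltr_norml => /andP[h1 h2] /andP[h3 h4] /andP[h5 h6].
  by apply/andP; split; lra.
have [p0 pD] := primq_spec (contq_qmul cb cQ).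
(* Both sides are compared with the iterate of index n.+1, the left one by the rate of convergence
   and the right one by integrating the error of the iterate n; the sum of the two errors is at most
   C / 2^n. *)
have E s : Q s = qone R + primq (fun t => qmul (b t) (Q t)) s.
  apply/eqP; rewrite -subr_eq0; apply/eqP/eucl_eq0/eqP.
  rewrite eq_le eucl_ge0 andbT; apply/ler_addgt0Pl => e e0; rewrite addr0.
  have [M M0 bM] := ex_eucl_bound `|s| cb.
  set C := 4 * expR (2 * M * `|s|) * (1 + M * `|s|).
  have [n nP] := @ex_pow2_lt R C e e0.
  have [cn Dn] := picard_spec n.
  have B1 := QP _ _ M0 bM n.+1 s (lexx _).
  pose c := M * (4 * expR (2 * M * `|s|) / 2 ^+ n).
  have B2 : eucl (picard n.+1 s - (qone R + primq (fun t => qmul (b t) (Q t)) s))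
      <= `|c * s|.
    apply: (@eucl_derive0 _ (fun s => picard n.+1 s - (qone R + primq (fun t => qmul (b t) (Q t)) s))
       _ (fun s => c * s) (fun=> c) `|s| s (lexx _)).
    - move=> x _; apply: isDV_B; first exact: Dn.
      by apply: isDV_D; [exact: isDV_cst|exact: pD].
    - by move=> x _; exact: is_derive_linear.
    - move=> x xs; rewrite /= add0r -qmulBr eucl_qmul; apply: ler_pM; rewrite ?eucl_ge0 ?bM //.
      exact: QP.
    - by rewrite picard0 p0 addr0 subrr.
    - exact: mulr0.
  apply: le_trans (ltW nP).
  rewrite -(subrKA (picard n.+1 s)) -(opprB (picard n.+1 s)).
  apply: le_trans (eucl_triangle _ _) _; rewrite euclN.
  apply: le_trans (lerD B1 B2) _.
  have K0 : 0 <= 4 * expR (2 * M * `|s|) by rewrite mulr_ge0 // expR_ge0.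
  move: (4 * expR (2 * M * `|s|)) K0 @c @C {B1 B2 nP} => K K0 c C.
  have p2 : 0 < (2 ^+ n)^-1 :> R by rewrite invr_gt0 exprn_gt0.
  rewrite /c !normrM (gtr0_norm M0) (ger0_norm K0) (gtr0_norm p2) exprS invfM /C.
  move: (2 ^+ n)^-1 p2 (normr_ge0 s) => P P0; move: `|s| => a a0.
  have : 0 <= K * P by rewrite mulr_ge0 // ltW.
  by move=> KP; rewrite -subr_ge0 (_ : _ - _ = K * P / 2); [lra|field].
exists Q; split; first by rewrite E p0 addr0.
move=> s j; have : isDV (s : R) (1 : R) (fun s => qone R + primq (fun t => qmul (b t) (Q t)) s) (qmul (b s) (Q s)).
  by apply: isDV_eq (isDV_D (isDV_cst (s : R) (1 : R) (qone R)) (pD s)) _; rewrite add0r.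
move=> /(_ j); congr is_derive.
by apply/funext => t; rewrite -E.
Qed.
End Picard.
End LinearODE.

(** * Solutions of linear equations and their dependence on parameters *)

Section Propagator.
Variable R : realType.
Local Notation isD f x d := (is_derive (x : R) (1 : R) f d).

Definition propagator (b : R -> quat R) : R -> quat R :=
  get [set Q : R -> quat R | Q 0 = qone R /\
    forall s, isDV (s : R) (1 : R) Q (qmul (b s) (Q s))].

Lemma propagator_spec (b : R -> quat R) : contq b -> propagator b 0 = qone R /\
  forall s, isDV (s : R) (1 : R) (propagator b) (qmul (b s) (propagator b s)).
Proof.
move=> cb; have [Q QP] := ex_linear_ode cb.
exact: (@getPex _ [set Q : R -> quat R | Q 0 = qone R /\
  forall s, isDV (s : R) (1 : R) Q (qmul (b s) (Q s))] (ex_intro _ Q QP)).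
Qed.

(** Left multiplication by an imaginary quaternion is skew, so |Q|^2 has derivative 0. *)
Lemma propagator_unit (b : R -> quat R) s : contq b -> (forall t, b t 0 i0 = 0) ->
  dot (propagator b s) (propagator b s) = 1.
Proof.
move=> cb b0; have [P0 PD] := propagator_spec cb.
have -> : dot (propagator b s) (propagator b s) = dot (propagator b 0) (propagator b 0).
  apply: (@derive0_cst R (fun s => dot (propagator b s) (propagator b s))) => x.
  apply: is_derive_eq (is_derive_dot (PD x) (PD x)) _.
  by rewrite !qE b0; gen_quats; ring.
by rewrite P0; qring.
Qed.

Lemma unit_qmulqV a : dot a a = 1 -> qmul a (qconj a) = qone R.
Proof. by rewrite qmulqV => ->; rewrite scale1r. Qed.

Lemma unit_eucl (a : quat R) : dot a a = 1 -> eucl a = 1.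
Proof. by rewrite /eucl => ->; rewrite sqrtr1. Qed.

(** Variation of constants: for an imaginary coefficient the conjugate of the propagator is its
    inverse, and in the derivative of Q_b^-1 Q_c only the difference of the coefficients
    survives. *)
Lemma compare_propagators (b c : R -> quat R) s : contq b -> contq c ->
  (forall t, b t 0 i0 = 0) ->
  isDV (s : R) (1 : R) (fun t => qmul (qconj (propagator b t)) (propagator c t))
    (qmul (qmul (qconj (propagator b s)) (c s - b s)) (propagator c s)).
Proof.
move=> cb cc b0; have [_ PD] := propagator_spec cb; have [_ PD'] := propagator_spec cc.
apply: isDV_eq (isDV_qmul (isDV_qconj (PD s)) (PD' s)) _.
rewrite qconjM (qconj_imag (b0 s)) qmulBr qmulBl -!qmulA qmulNl.
by rewrite addrC qmulNr.
Qed.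

Section Dependence.
Variables (n : nat) (U : set 'rV[R]_n).
Hypothesis oU : open U.

Lemma tubeq l m (k : R -> 'rV[R]_n -> 'rV[R]_m) x (S e : R) : CnV l U k -> U x -> 0 < e ->
  exists2 d : R, 0 < d &
  forall s y, `|s| <= S -> `|y - x| < d -> `|k s y - k s x| <= e.
Proof.
move=> Ck Ux e0.
have : \forall y \near x, forall j, forall s, `|s| <= S -> `|k s y 0 j - k s x 0 j| <= e.
  apply: near_forall => j; apply/nearP_norm.
  have [d d0 H] := @tube R n U (fun s x => k s x 0 j) x S e (Cn_jcont (Ck j)) Ux e0.
  by exists d => // y yx s sS; apply/ltW/H.
move=> /nearP_norm[d d0 H]; exists d => // s y sS /H{}H.
by apply: ler_norm_coord => [|j]; [exact: ltW|rewrite !mxE; exact: H].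
Qed.

Variable k : R -> 'rV[R]_n -> quat R.
Hypothesis k_imag : forall s x, U x -> k s x 0 i0 = 0.
Let Q s x := propagator (fun t => k t x) s.
Let ck l x : CnV l U k -> U x -> contq (fun t => k t x).
Proof. by move=> Ck Ux; exact: CnV_contq Ck Ux. Qed.

Let Q1 l s x : CnV l U k -> U x -> dot (Q s x) (Q s x) = 1.
Proof. by move=> Ck Ux; apply: propagator_unit => [|t]; [exact: ck Ck Ux|exact: k_imag]. Qed.

Let Q0 l x : CnV l U k -> U x -> Q 0 x = qone R.
Proof. by move=> Ck Ux; have [] := propagator_spec (ck Ck Ux). Qed.

Let Qdist l s x y (S e : R) : CnV l U k -> U x -> U y -> `|s| <= S ->
  (forall t, `|t| <= S -> eucl (k t y - k t x) <= e) -> eucl (Q s y - Q s x) <= e * `|s|.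
Proof.
move=> Ck Ux Uy sS H.
have cx := ck Ck Ux; have cy := ck Ck Uy.
have kx0 t : k t x 0 i0 = 0 by exact: k_imag.
pose r t := qmul (qconj (Q t x)) (Q t y).
have e0 : 0 <= e by apply: le_trans (H 0 _); rewrite ?eucl_ge0 // normr0; exact: le_trans sS.
have -> : Q s y - Q s x = qmul (Q s x) (r s - r 0).
  rewrite qmulBr /r qmulA (unit_qmulqV (Q1 s Ck Ux)) qmul1q.
  by rewrite (Q0 Ck Ux) (Q0 Ck Uy); congr (_ - _); qring.
rewrite eucl_qmul (unit_eucl (Q1 s Ck Ux)) mul1r.
rewrite -[leRHS]ger0_norm ?mulr_ge0 // normrM normr_id -normrM.
apply: (@eucl_derive0 R 4 (fun t => r t - r 0) _ (fun t => e * t) (fun=> e) S s sS).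
- move=> t _; apply: isDV_B; last exact: isDV_cst.
  exact: (@compare_propagators (fun t => k t x) (fun t => k t y) t cx cy kx0).
- by move=> t _; exact: is_derive_linear.
- move=> t tS; cbv beta; rewrite subr0 !eucl_qmul eucl_qconj.
  rewrite (unit_eucl (Q1 t Ck Ux)) (unit_eucl (Q1 t Ck Uy)) mul1r mulr1; exact: H.
- by rewrite subrr.
- exact: mulr0.
Qed.

Let jcontQ l : CnV l U k -> CnV 0 U Q.
Proof.
move=> Ck j; apply: jcont_Cn => s x Ux; apply/continuousP_norm => e e0.
have [_ PD] := propagator_spec (ck Ck Ux).
have e2 : 0 < e / 2 by lra.
have S0 : 0 < `|s| + 1 by have := normr_ge0 s; lra.
have e4 : 0 < e / 8 / (`|s| + 1) by rewrite !divr_gt0.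
have [d1 d10 H1] := tubeq (`|s| + 1) Ck Ux e4.
have /nearP_norm[d2 d20 H2] := open_near oU Ux.
have /continuousP_norm/(_ _ e2)[d3 d30 H3] := is_derive_continuous (PD s j).
exists (Num.min (Num.min d1 d2) (Num.min d3 1)).
  by rewrite !lt_min d10 d20 d30 ltr01.
move=> [s' y]; rewrite prod_normE /= gt_max !lt_min.
move=> /andP[/andP[_ /andP[ss3 ss1]] /andP[/andP[y1 y2] _]].
have s'S : `|s'| <= `|s| + 1 by have := ler_normD (s' - s) s; rewrite subrK; lra.
have A : eucl (Q s' y - Q s' x) <= 2 * (e / 8 / (`|s| + 1)) * `|s'|.
  apply: (Qdist Ck Ux (H2 _ y2) s'S) => t tS.
  apply: le_trans (eucl_le_norm _) _; rewrite ler_wpM2l //; exact: H1.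
have B : 2 * (e / 8 / (`|s| + 1)) * `|s'| <= e / 4.
  have -> : 2 * (e / 8 / (`|s| + 1)) * `|s'| = e / 4 * (`|s'| / (`|s| + 1)).
    by field; rewrite gt_eqF.
  rewrite ger_pMr ?divr_gt0 // ler_pdivrMr // mul1r //.
have C : `|Q s' y 0 j - Q s' x 0 j| <= e / 4.
  by apply: le_trans (le_trans A B); apply: le_trans (eucl_coord _ j); rewrite !mxE.
have := H3 s' ss3.
have -> : Q s' y 0 j - Q s x 0 j = (Q s' y 0 j - Q s' x 0 j) + (Q s' x 0 j - Q s x 0 j) by ring.
move=> D; apply: le_lt_trans (ler_normD _ _) _.
by move: D; rewrite -/(Q s' x) -/(Q s x); lra.
Qed.

(** Duhamel's integral for Q^-1 times the derivative of Q in the direction i, as [isDV_propagator]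
    shows. *)
Definition propagatorD (i : 'I_n) s x : quat R :=
  primq (fun t => qmul (qmul (qconj (Q t x)) (pdv i (k t) x)) (Q t x)) s.

Lemma isDV_propagator i s x : CnV 1 U k -> U x ->
  isDV x (ev R i) (Q s) (qmul (Q s x) (propagatorD i s x)).
Proof.
move=> Ck Ux j.
have Ck0 := CnV_le (leq0n 1) Ck.
have Cdk := CnV_pdv i Ck.
have CQ := jcontQ Ck.
have cdk : contq (fun t => pdv i (k t) x) by exact: CnV_contq Cdk Ux.
have cQ : contq (fun t => Q t x) by exact: CnV_contq CQ Ux.
have cX : contq (fun t => qmul (qmul (qconj (Q t x)) (pdv i (k t) x)) (Q t x)).
  apply: contq_qmul => //; apply: contq_qmul => //.
  exact: CnV_contq (CnV_qconj oU CQ) Ux.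
have [X0 XD] := primq_spec cX.
have H : (fun h : R => h^-1 *: (((fun y => Q s y 0 j) \o shift x) (h *: ev R i) - Q s x 0 j))
   @ 0^' --> qmul (Q s x) (propagatorD i s x) 0 j.
  apply/cvgrPdist_le => e e0.
  have S0 : 0 < `|s| + 1 by have := normr_ge0 s; lra.
  have [M M0 dkM] := ex_eucl_bound `|s| cdk.
  (* [e1] bounds the error of the difference quotient of k and [e2] the variation of k, hence that
     of Q; each is scaled to contribute e / (2 (|s| + 1)) to the integrand. *)
  pose e1 := e / (`|s| + 1) / 4.
  have e10 : 0 < e1 by rewrite !divr_gt0.
  pose e2 := e / (`|s| + 1) / 4 / (M * (`|s| + 1)).
  have e20 : 0 < e2 by rewrite !divr_gt0 ?mulr_gt0.
  have [d1 d10 H1] := tubeq `|s| Cdk Ux e10.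
  have [d2 d20 H2] := tubeq `|s| Ck Ux e20.
  have /nearP_norm[d3 d30 H3] := open_near oU Ux.
  near=> h.
  have h0 : h != 0 by near: h; exact: nbhs_dnbhs_neq.
  have hd : `|h| < Num.min (Num.min d1 d2) d3.
    by near: h; apply: dnbhs0_lt; rewrite !lt_min d10 d20.
  have nev (t : R) : `|t| <= `|h| -> `|x + t *: ev R i - x| < Num.min (Num.min d1 d2) d3.
    move=> th; apply: le_lt_trans hd; rewrite addrC addKr.
    apply: ler_norm_coord => // q; rewrite mxE evE; apply: le_trans th.
    by case: (i == q); rewrite ?mulr1 // mulr0 normr0.
  have Uh t : `|t| <= `|h| -> U (x + t *: ev R i).
    by move=> /nev; rewrite lt_min => /andP[_ /H3].
  set y := x + h *: ev R i.
  have Uy : U y by exact: Uh.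
  have [yd1 yd2] : `|y - x| < d1 /\ `|y - x| < d2.
    by have := nev h (lexx _); rewrite !lt_min -/y => /andP[/andP[]].
  have cx := ck Ck Ux; have cy := ck Ck Uy.
  pose r t := qmul (qconj (Q t x)) (Q t y).
  have QE : Q s y - Q s x = qmul (Q s x) (r s - r 0).
    rewrite qmulBr /r qmulA (unit_qmulqV (Q1 s Ck Ux)) qmul1q.
    by rewrite (Q0 Ck Ux) (Q0 Ck Uy); congr (_ - _); qring.
  have rX : eucl (h^-1 *: (r s - r 0) - propagatorD i s x) <= `|(e / (`|s| + 1)) * s|.
    apply: (@eucl_derive0 R 4 (fun t => h^-1 *: (r t - r 0) - propagatorD i t x)
      (fun t => 0 *: (r t - r 0) + h^-1 *: (qmul (qmul (qconj (Q t x)) (k t y - k t x)) (Q t y) - 0)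
        - qmul (qmul (qconj (Q t x)) (pdv i (k t) x)) (Q t x))
      (fun t => (e / (`|s| + 1)) * t) (fun=> e / (`|s| + 1)) `|s| s (lexx _)).
    - move=> t _; apply: isDV_B; last exact: XD.
      apply: (@isDV_scale R R t 1 4 (fun=> h^-1)).
      apply: isDV_B; last exact: isDV_cst.
      by apply: (@compare_propagators (fun t => k t x) (fun t => k t y) t cx cy) => u; exact: k_imag.
    - by move=> t _; exact: is_derive_linear.
    - move=> t ts; cbv beta; rewrite scale0r add0r subr0.
      have -> : h^-1 *: qmul (qmul (qconj (Q t x)) (k t y - k t x)) (Q t y) -
           qmul (qmul (qconj (Q t x)) (pdv i (k t) x)) (Q t x) =
         qmul (qmul (qconj (Q t x)) (h^-1 *: (k t y - k t x) - pdv i (k t) x)) (Q t y) +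
         qmul (qmul (qconj (Q t x)) (pdv i (k t) x)) (Q t y - Q t x).
        by move: (k t y - k t x) (pdv i (k t) x) (qconj (Q t x)) (Q t y) (Q t x) (h^-1) => D P C Y X hi; qring.
      apply: le_trans (eucl_triangle _ _) _; rewrite !eucl_qmul !eucl_qconj.
      rewrite (unit_eucl (Q1 t Ck Ux)) (unit_eucl (Q1 t Ck Uy)) !mul1r mulr1.
      have A : eucl (h^-1 *: (k t y - k t x) - pdv i (k t) x) <= 2 * e1.
        apply: le_trans (eucl_le_norm _) _; rewrite ler_wpM2l //.
        apply: ler_norm_coord => [|q]; first exact: ltW.
        have [u uh|u uh] := @mvt_pd R n i (fun z => k t z 0 q) x h.
          exact: (@Cn_derivable R n 0 U (fun s z => k s z 0 q) i t _ (Ck q) (Uh u uh)).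
        rewrite -/y !mxE => ->; rewrite mulrA mulVf // mul1r.
        have := H1 t (x + u *: ev R i) ts.
        have := nev u uh; rewrite !lt_min => /andP[/andP[ud _] _] /(_ ud).
        by apply: le_trans; apply: le_trans (ler_coord _ q); rewrite !mxE.
      have B : eucl (Q t y - Q t x) <= 2 * e2 * `|t|.
        apply: (Qdist Ck Ux Uy ts) => u us.
        apply: le_trans (eucl_le_norm _) _; rewrite ler_wpM2l //; exact: H2.
      have B' : eucl (pdv i (k t) x) * eucl (Q t y - Q t x) <= M * (2 * e2 * (`|s| + 1)).
        apply: ler_pM; rewrite ?eucl_ge0 ?dkM //; apply: le_trans B _.
        apply: ler_wpM2l; first by rewrite mulr_ge0 // ltW.
        by apply: (le_trans ts); rewrite lerDl.
      apply: le_trans (lerD A B') _; rewrite /e1 /e2 le_eqVlt; apply/orP; left; apply/eqP.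
      by field; rewrite !gt_eqF.
    - by rewrite subrr scaler0 /propagatorD X0 subrr.
    - exact: mulr0.
  rewrite /= (addrC _ x) -/y.
  have -> : qmul (Q s x) (propagatorD i s x) 0 j - h^-1 *: (Q s y 0 j - Q s x 0 j) =
     - (qmul (Q s x) (h^-1 *: (r s - r 0) - propagatorD i s x)) 0 j.
    rewrite qmulBr qmulZr -QE; move: (propagatorD i s x) (Q s y) (Q s x) => W X Y; move: (qmul Y W) => Z {rX QE}.
    by rewrite !mxE (_ : h^-1 *: (X 0 j - Y 0 j) = h^-1 * (X 0 j - Y 0 j)) //; ring.
  rewrite normrN; apply: le_trans (eucl_coord _ j) _.
  rewrite eucl_qmul (unit_eucl (Q1 s Ck Ux)) mul1r; apply: le_trans rX _.
  have E0 : 0 <= e / (`|s| + 1) by rewrite divr_ge0 // ltW.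
  rewrite normrM (ger0_norm E0).
  by rewrite -mulrA ger_pMr // mulrC ler_pdivrMr // mul1r; lra.
by split; [apply/cvg_ex; eexists; exact: H|exact/cvg_lim].
Unshelve. all: by end_near. Qed.

Lemma CnV_primq l m (f : R -> 'rV[R]_n -> 'rV[R]_m) : CnV l U f ->
  CnV l U (fun s x => primq (fun t => f t x) s).
Proof.
move=> Cf j; have := @Cn_prim R n l U (fun s x => f s x 0 j) oU (Cf j).
by apply: Cn_eq => // s x Ux; rewrite primqE.
Qed.

(** Bootstrapping: the derivative [Q * propagatorD] contains Q itself and first derivatives of k, so
    regularity of order l for Q gives order l + 1. *)
Lemma CnV_propagator l : CnV l U k -> CnV l U Q.
Proof.
elim: l => [|l IH] Ck; first exact: jcontQ Ck.
have Ckl : CnV l U k := CnV_le (leqnSn l) Ck.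
have CQ := IH Ckl; have Ck1 : CnV 1 U k by exact: CnV_le Ck.
move=> j; have CQ0 := jcontQ Ck.
have CX i : CnV l U (propagatorD i).
  by apply: CnV_primq; apply: CnV_qmul => //; apply: CnV_qmul => //; [exact: CnV_qconj|exact: CnV_pdv].
have CQX i := CnV_qmul oU CQ (CX i).
apply: Cn_succ (Cn_jcont (CQ j)) _ => i; split.
  by move=> s x Ux; have [] := isDV_propagator i s Ck1 Ux j.
apply: Cn_eq (CQX i j) => // s x Ux.
by rewrite (is_derive_pd (isDV_propagator i s Ck1 Ux j)).
Qed.
End Dependence.
End Propagator.

(** * Integrals over boxes *)
Section BoxIntegral.
Variables (R : realType) (n : nat).
Local Notation isD f x d := (is_derive (x : R) (1 : R) f d).
Implicit Types (O : set 'rV[R]_n) (f g : 'rV[R]_n -> R) (x y : 'rV[R]_n) (i j : 'I_n).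

Definition upd i x (s : R) : 'rV[R]_n := x + (s - x 0 i) *: ev R i.

Lemma updE i x s j : upd i x s 0 j = if i == j then s else x 0 j.
Proof.
rewrite mxE [X in _ + X]mxE evE; case: (eqVneq i j) => [->|ij].
  by rewrite mulr1 addrC subrK.
by rewrite mulr0 addr0.
Qed.

Lemma upd_id i x : upd i x (x 0 i) = x.
Proof. by rewrite /upd subrr scale0r addr0. Qed.

Definition stable i O := forall x s, O x -> O (upd i x s).

Lemma stableT i : stable i [set: 'rV[R]_n]. Proof. by []. Qed.

Lemma Cn_freeze m O (k : R -> 'rV[R]_n -> R) s : open O -> Cn m O k -> Cn m O (fun _ => k s).
Proof.
move=> oO; elim: m k => [|m IH] k Ck.
  by apply: jcont_Cn; apply: jcont_x => x Ox; exact: Cn_continuous Ck Ox.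
apply: Cn_succ; first by apply: jcont_x => x Ox; exact: Cn_continuous Ck Ox.
move=> i; split; first by move=> _ x Ox; exact: Cn_derivable Ck Ox.
exact: IH (Cn_pd i Ck).
Qed.

(** The integral over [[- L, L]] in the coordinate i, kept as a function of the whole point although
    it ignores that coordinate; such integrals can be iterated and still be differentiated in the
    other coordinates. *)
Definition BI i (L : R) f x : R :=
  prim (fun s => f (upd i x s)) L - prim (fun s => f (upd i x s)) (- L).

Lemma BI_cst i L c x : BI i L (fun=> c) x = 2 * L * c.
Proof.
rewrite /BI; have -> : prim (fun=> c) = (fun s => c * s); last by ring.
apply: prim_eq; first by move=> s; exact: cst_continuous.
  exact: mulr0.
by move=> s; exact: is_derive_linear.
Qed.

Section OneVariable.
Variables (i : 'I_n) (O : set 'rV[R]_n).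
Hypotheses (oO : open O) (sO : stable i O).

Lemma Cn_upd_coord m j : Cn m O (fun s x => upd i x s 0 j).
Proof.
case: (eqVneq i j) => [->|ij].
  have Ct : Cn m O (fun s _ => s) by apply: (@Cn_time R n m O id) => t; exact: cvg_id.
  apply: Cn_eq Ct => // s x _.
  by rewrite updE eqxx.
apply: (Cn_eq oO _ (@Cn_coord R n m O j)) => s x _.
by rewrite updE (negbTE ij).
Qed.

Lemma Cn_upd m f : Cn m O (fun _ => f) -> Cn m O (fun s x => f (upd i x s)).
Proof.
move=> Cf; apply: (@Cn_comp R n n O O (fun s x => upd i x s) oO oO _ m f Cf).
  by move=> s x; exact: sO.
exact: Cn_upd_coord.
Qed.

Lemma continuous_upd f x : Cn 0 O (fun _ => f) -> O x -> continuous (fun s => f (upd i x s)).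
Proof.
move=> Cf Ox.
exact: (@jcont_time R n O (fun s x => f (upd i x s)) x (Cn_jcont (Cn_upd Cf)) Ox).
Qed.

Lemma Cn_BI m L f : Cn m O (fun _ => f) -> Cn m O (fun _ => BI i L f).
Proof.
move=> Cf; have H := Cn_prim oO (Cn_upd Cf).
exact: Cn_sub2 oO (Cn_freeze L oO H) (Cn_freeze (- L) oO H).
Qed.

Lemma pd_upd j f s x : Cn 1 O (fun _ => f) -> O x -> j != i ->
  pd j (fun x => f (upd i x s)) x = pd j f (upd i x s).
Proof.
move=> Cf Ox ji.
have Cc q := @Cn_upd_coord 1 q.
have D := @pd_comp R n n O O (fun s x => upd i x s) oO (fun s x => @sO x s) 0 f j s x Cf
  (fun q => @Cn_derivable R n 0 O (fun s x => upd i x s 0 q) j s x (Cc q) Ox) Ox.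
rewrite (is_derive_pd D) (bigD1 j) //= big1 ?addr0; last first.
  move=> q qj; case: (eqVneq i q) => [<-|iq].
    rewrite (@pd_eq R n O _ (fun=> s) j x oO Ox) => [|y _]; last by rewrite updE eqxx.
    by rewrite (is_derive_pd (is_derive_cst s x (ev R j))) mul0r.
  rewrite (@pd_eq R n O _ (fun y => y 0 q) j x oO Ox) => [|y _]; last by rewrite updE (negbTE iq).
  by rewrite pd_coord eq_sym (negbTE qj) mul0r.
rewrite (@pd_eq R n O _ (fun y => y 0 j) j x oO Ox) => [|y _].
  by rewrite pd_coord eqxx mul1r.
by rewrite updE eq_sym (negbTE ji).
Qed.

Lemma pd_BI j L f x : Cn 1 O (fun _ => f) -> O x -> j != i ->
  pd j (BI i L f) x = BI i L (pd j f) x.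
Proof.
move=> Cf Ox ji; have CU := Cn_upd Cf.
have D s := is_derive_prim j s oO CU Ox.
have E s : prim (fun t => pd j ((fun s x => f (upd i x s)) t) x) s =
   prim (fun t => pd j f (upd i x t)) s.
  by congr (prim _ s); apply/funext => t; rewrite pd_upd.
have D1 := D L; have D2 := D (- L).
rewrite E in D1; rewrite E in D2.
exact: is_derive_pd (is_deriveB D1 D2).
Qed.

Lemma BI_pd L f x : Cn 1 O (fun _ => f) -> O x ->
  BI i L (pd i f) x = f (upd i x L) - f (upd i x (- L)).
Proof.
move=> Cf Ox; rewrite /BI.
have -> : prim (fun s => pd i f (upd i x s)) = (fun s => f (upd i x s) - f (upd i x 0)).
  apply: prim_eq; first by apply: (continuous_upd (f := pd i f)) => //; exact: Cn_pd i Cf.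
    by rewrite subrr.
  move=> s; apply: is_derive_eq (subr0 _); apply: is_deriveB.
  have E t : upd i x t = (x - x 0 i *: ev R i) + t *: ev R i.
    by rewrite /upd scalerBl addrA addrAC.
  rewrite (_ : (fun s => _) = (fun t => f ((x - x 0 i *: ev R i) + t *: ev R i))); last first.
    by apply/funext => t; rewrite E.
  rewrite E; apply: is_derive_line; rewrite -E.
  exact: (@Cn_derivable R n 0 O (fun=> f) i 0 _ Cf (sO s Ox)).
by rewrite opprB addrA subrK.
Qed.

Lemma BI_derive_bounds L f g x : 0 <= L -> Cn 0 O (fun _ => f) -> Cn 0 O (fun _ => g) -> O x ->
  (forall s, `|s| <= L -> f (upd i x s) <= g (upd i x s)) -> BI i L f x <= BI i L g x.
Proof.
move=> L0 Cf Cg Ox fg.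
have [_ fD] := prim_spec (continuous_upd Cf Ox).
have [_ gD] := prim_spec (continuous_upd Cg Ox).
apply: (@ler_derive R _ _ _ _ (- L) L _ (fun s _ => fD s) (fun s _ => gD s)); first by lra.
by move=> s sL; apply: fg; rewrite ler_norml.
Qed.

Lemma BI_le L f g x : 0 <= L -> Cn 0 O (fun _ => f) -> Cn 0 O (fun _ => g) -> O x ->
  (forall y, O y -> f y <= g y) -> BI i L f x <= BI i L g x.
Proof. by move=> L0 Cf Cg Ox fg; apply: BI_derive_bounds => // s _; apply: fg; exact: sO. Qed.

Lemma BIB L f g x : Cn 0 O (fun _ => f) -> Cn 0 O (fun _ => g) -> O x ->
  BI i L (fun y => f y - g y) x = BI i L f x - BI i L g x.
Proof.
move=> Cf Cg Ox; rewrite /BI !primB; try exact: continuous_upd.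
by move: (prim _ L) (prim _ (- L)) (prim _ L) (prim _ (- L)) => a b c d; ring.
Qed.

Lemma BIZ L f c x : Cn 0 O (fun _ => f) -> O x -> BI i L (fun y => c * f y) x = c * BI i L f x.
Proof. by move=> Cf Ox; rewrite /BI !primZ ?mulrBr //; exact: continuous_upd. Qed.

Lemma BI_eq L f g x : O x -> (forall y, O y -> f y = g y) -> BI i L f x = BI i L g x.
Proof.
move=> Ox fg; rewrite /BI.
suff -> : (fun s => f (upd i x s)) = (fun s => g (upd i x s)) by [].
by apply/funext => s; apply: fg; exact: sO.
Qed.

Lemma BI_shrink l L f x : 0 <= l -> l <= L -> Cn 0 O (fun _ => f) -> O x ->
  (forall s, l <= `|s| -> f (upd i x s) = 0) -> BI i L f x = BI i l f x.
Proof.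
move=> l0 lL Cf Ox f0; have [_ fD] := prim_spec (continuous_upd Cf Ox).
have Z a b : a <= b -> (forall s, a <= s <= b -> l <= `|s|) ->
    prim (fun s => f (upd i x s)) b = prim (fun s => f (upd i x s)) a.
  move=> ab H; have [s sab E] := @mvt R _ _ a b ab (fun s _ => fD s).
  by apply/eqP; rewrite -subr_eq0 E f0 ?mul0r // H.
rewrite /BI (Z l L) // => [|s /andP[s1 _]]; last by rewrite ger0_norm //; lra.
rewrite -(Z (- L) (- l)) // => [|s /andP[_ s1]]; first by lra.
by rewrite ler0_norm; lra.
Qed.

Lemma BI_affine L f (p y : 'rV[R]_n) (c : R) : 0 < c -> 0 <= L -> `|p 0 i| + c <= L ->
  Cn 0 O (fun _ => f) -> (forall z, O z -> 0 <= f z) -> O (p + c *: y) ->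
  BI i 1 (fun z => f (p + c *: z)) y <= c^-1 * BI i L f (p + c *: y).
Proof.
move=> c0 L0 pL Cf f0 Oy.
have cf := continuous_upd Cf Oy; have [F0 FD] := prim_spec cf.
set F := prim _ in F0 FD.
have E s : p + c *: upd i y s = upd i (p + c *: y) (p 0 i + c * s).
  by apply/rowP => j; rewrite updE mxE [X in _ + X]mxE updE !mxE; case: eqP => [<-|].
have D0 s : isD (fun s => p 0 i + c * s) s c.
  by apply: is_derive_eq (add0r c); apply: is_deriveD; exact: is_derive_linear.
have -> : BI i 1 (fun z => f (p + c *: z)) y = c^-1 * (F (p 0 i + c) - F (p 0 i - c)).
  rewrite /BI; have -> : prim (fun s => f (p + c *: upd i y s)) =
      (fun s => c^-1 * (F (p 0 i + c * s) - F (p 0 i))).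
    have D s : isD (fun s => c^-1 * (F (p 0 i + c * s) - F (p 0 i))) s (f (p + c *: upd i y s)).
      rewrite E.
      have D1 : isD (fun s => F (p 0 i + c * s)) s (f (upd i (p + c *: y) (p 0 i + c * s)) * c).
        exact: (@is_derive1_comp R F (fun s => p 0 i + c * s) s _ c (FD _) (D0 s)).
      have D2 : isD (fun s => c^-1 *: (F (p 0 i + c * s) - F (p 0 i))) s
          (c^-1 *: (f (upd i (p + c *: y) (p 0 i + c * s)) * c - 0)).
        exact: is_deriveZ.
      apply: is_derive_eq D2 _; rewrite subr0; move: (f _) => u.
      by rewrite [_ *: _](_ : _ = c^-1 * (u * c)) //; field; rewrite gt_eqF.
    apply: prim_eq => //; last by rewrite mulr0 addr0 subrr mulr0.
    rewrite (_ : (fun s => _) = (fun s => f (upd i (p + c *: y) s)) \o (fun s => p 0 i + c * s)).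
      by move=> s; apply: continuous_comp; [exact: is_derive_continuous (D0 s)|exact: cf].
    by apply/funext => s; rewrite /= E.
  by rewrite mulr1 mulrN mulr1; ring.
rewrite ler_pM2l ?invr_gt0 // /BI -/F.
have mono a b : a <= b -> F a <= F b.
  move=> ab; rewrite -subr_ge0; have [s _ ->] := @mvt R _ _ a b ab (fun s _ => FD s).
  by rewrite mulr_ge0 ?subr_ge0 // f0 //; exact: sO.
have := ler_norm (p 0 i); have := ler_norm (- p 0 i); rewrite normrN => h1 h2.
by apply: lerD; [apply: mono; lra|rewrite lerN2; apply: mono; lra].
Qed.

(** The primitive is nondecreasing, and it would increase strictly just to the right of x_i if f x
    were positive. *)
Lemma BI_eq0 L f x : Cn 0 O (fun _ => f) -> O x -> (forall y, O y -> 0 <= f y) ->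
  `|x 0 i| < L -> BI i L f x <= 0 -> f x = 0.
Proof.
move=> Cf Ox f0 xL B0; have cf := continuous_upd Cf Ox; have [_ FD] := prim_spec cf.
move: xL; rewrite ltr_norml => /andP[x1 x2].
apply/eqP; rewrite eq_le f0 // andbT leNgt; apply/negP => fx.
have /continuousP_norm/(_ _ fx)[d d0 H] := cf (x 0 i).
rewrite upd_id in H.
pose a := x 0 i; pose b := Num.min (a + d / 2) L.
have ab : a < b by rewrite lt_min; apply/andP; split; rewrite /a; lra.
have bL : b <= L by rewrite ge_min lexx orbT.
set F := prim _ in FD.
have mono u v : u <= v -> F u <= F v.
  move=> uv; rewrite -subr_ge0; have [s _ ->] := @mvt R _ _ u v uv (fun s _ => FD s).
  by rewrite mulr_ge0 ?subr_ge0 // f0 //; exact: sO.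
have : 0 < F b - F a.
  have [s /andP[s1 s2] ->] := @mvt R _ _ a b (ltW ab) (fun s _ => FD s).
  rewrite mulr_gt0 ?subr_gt0 //.
  have : b <= a + d / 2 by rewrite ge_min lexx.
  move=> bd; have := H s; rewrite ger0_norm; last by rewrite /a in s1; lra.
  have -> : s - x 0 i < d by rewrite -/a; lra.
  by move=> /(_ isT); rewrite ltr_norml => /andP[]; lra.
have := mono _ _ bL; have : F (- L) <= F a by apply: mono; rewrite /a; lra.
by move: B0; rewrite /BI -/F; lra.
Qed.
End OneVariable.

Section ManyVariables.
Variable O : set 'rV[R]_n.
Hypothesis oO : open O.
Implicit Type r : seq 'I_n.

Definition boxI r (L : R) f : 'rV[R]_n -> R := foldr (fun i g => BI i L g) f r.
Definition stables r := forall i, i \in r -> stable i O.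

Lemma stables_cons i r : stables (i :: r) -> stable i O /\ stables r.
Proof. by move=> H; split=> [|j jr]; apply: H; rewrite inE ?eqxx ?jr ?orbT. Qed.

Lemma Cn_boxI m r L f : stables r -> Cn m O (fun _ => f) -> Cn m O (fun _ => boxI r L f).
Proof.
elim: r => //= i r IH /stables_cons[si sr] Cf.
by apply: Cn_BI => //; exact: IH.
Qed.

Lemma boxI_le r L f g x : stables r -> 0 <= L -> Cn 0 O (fun _ => f) -> Cn 0 O (fun _ => g) -> O x ->
  (forall y, O y -> f y <= g y) -> boxI r L f x <= boxI r L g x.
Proof.
move=> + L0 Cf Cg + fg; elim: r x => [|i r IH] x /=; first by move=> _; exact: fg.
move=> /stables_cons[si sr] Ox.
by apply: (BI_le oO si) => //; [exact: Cn_boxI|exact: Cn_boxI|move=> y Oy; exact: IH].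
Qed.

Lemma boxI_cst r L c x : boxI r L (fun=> c) x = (2 * L) ^+ size r * c.
Proof.
elim: r x => [|i r IH] x /=; first by rewrite expr0 mul1r.
rewrite exprS -[RHS]mulrA -(BI_cst i L _ x); congr (BI i L _ x).
by apply/funext => y; exact: IH.
Qed.

Lemma boxIB r L f g x : stables r -> Cn 0 O (fun _ => f) -> Cn 0 O (fun _ => g) -> O x ->
  boxI r L (fun y => f y - g y) x = boxI r L f x - boxI r L g x.
Proof.
move=> + Cf Cg; elim: r x => [|i r IH] x //= /stables_cons[si sr] Ox.
rewrite -(BIB oO si) //; try exact: Cn_boxI.
by apply: (BI_eq si _ Ox) => y Oy; exact: IH.
Qed.

Lemma boxIZ r L f c x : stables r -> Cn 0 O (fun _ => f) -> O x ->
  boxI r L (fun y => c * f y) x = c * boxI r L f x.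
Proof.
move=> + Cf; elim: r x => [|i r IH] x //= /stables_cons[si sr] Ox.
rewrite -(BIZ oO si) //; last exact: Cn_boxI.
by apply: (BI_eq si _ Ox) => y Oy; exact: IH.
Qed.

Lemma boxI_ge0 r L f x : stables r -> 0 <= L -> Cn 0 O (fun _ => f) -> O x ->
  (forall y, O y -> 0 <= f y) -> 0 <= boxI r L f x.
Proof.
move=> sr L0 Cf Ox f0; have := boxI_cst r L 0 x; rewrite mulr0 => <-.
by apply: boxI_le => //; exact: Cn_cst.
Qed.

Lemma boxI_le_cst r L f c x : stables r -> 0 <= L -> Cn 0 O (fun _ => f) -> O x ->
  (forall y, O y -> f y <= c) -> boxI r L f x <= (2 * L) ^+ size r * c.
Proof.
by move=> sr L0 Cf Ox fc; rewrite -(boxI_cst r L c x); apply: boxI_le => //; exact: Cn_cst.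
Qed.

Lemma pd_boxI r j L f x : stables r -> j \notin r -> Cn 1 O (fun _ => f) -> O x ->
  pd j (boxI r L f) x = boxI r L (pd j f) x.
Proof.
move=> + + Cf; elim: r x => [|i r IH] x //= /stables_cons[si sr].
rewrite inE negb_or => /andP[ji jr] Ox.
rewrite (pd_BI oO si) //; last exact: Cn_boxI.
by apply: (BI_eq si _ Ox) => y Oy; exact: IH.
Qed.

Lemma boxI_slice0 r j c L f x : stables r -> j \notin r ->
  (forall y, O y -> y 0 j = c -> f y = 0) -> O x -> x 0 j = c -> boxI r L f x = 0.
Proof.
move=> + + f0; elim: r x => [|i r IH] x /=; first by move=> _ _; exact: f0.
move=> /stables_cons[si sr]; rewrite inE negb_or => /andP[ji jr] Ox xj.
have := BI_cst i L 0 x; rewrite mulr0 => <-; rewrite /BI.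
suff -> : (fun s => boxI r L f (upd i x s)) = (fun=> 0) by [].
by apply/funext => s; apply: IH; rewrite ?updE 1?eq_sym ?(negbTE ji) //; exact: si.
Qed.

(** The derivative in direction j passes through the integrations preceding the one over x_j, which
    turns it into a difference of values on two faces. *)
Lemma boxI_pd r j L f x : stables r -> uniq r -> j \in r -> Cn 1 O (fun _ => f) -> O x ->
  (forall y, O y -> `|y 0 j| = `|L| -> f y = 0) -> boxI r L (pd j f) x = 0.
Proof.
move=> + + + Cf + f0; elim: r x => [|i r IH] x //= /stables_cons[si sr] /andP[ir ur].
rewrite inE => /predU1P[ji|jr] Ox; last first.
  have := BI_cst i L 0 x; rewrite mulr0 => <-.
  by apply: (BI_eq si _ Ox) => y Oy; exact: IH.
rewrite ji -(BI_eq (f := pd i (boxI r L f)) si _ Ox) => [|y Oy]; last exact: pd_boxI.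
rewrite (BI_pd oO si) //; last exact: Cn_boxI.
have Z s : `|s| = `|L| -> boxI r L f (upd i x s) = 0.
  move=> sL; apply: (@boxI_slice0 r i s) => //; [|exact: si|by rewrite updE eqxx].
  by move=> y Oy yi; apply: f0; rewrite // ji yi.
by rewrite !Z ?subr0 ?normrN.
Qed.

Lemma boxI_shrink r l L f x : stables r -> 0 <= l -> l <= L -> Cn 0 O (fun _ => f) -> O x ->
  (forall y j, O y -> l <= `|y 0 j| -> f y = 0) -> uniq r -> boxI r L f x = boxI r l f x.
Proof.
move=> + l0 lL Cf + f0; elim: r x => [|i r IH] x //= /stables_cons[si sr] Ox /andP[ir ur].
rewrite (BI_eq (g := boxI r l f) si _ Ox) => [|y Oy]; last exact: IH.
apply: (BI_shrink oO si) => //; first exact: Cn_boxI.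
move=> s sl; apply: (@boxI_slice0 r i s) => //; [|exact: si|by rewrite updE eqxx].
by move=> y Oy yi; apply: (f0 y i) => //; rewrite yi.
Qed.

Lemma boxI_eq0 r L f x : stables r -> 0 <= L -> Cn 0 O (fun _ => f) -> O x ->
  (forall y, O y -> 0 <= f y) -> (forall i, i \in r -> `|x 0 i| < L) ->
  boxI r L f x <= 0 -> f x = 0.
Proof.
move=> + L0 Cf Ox f0; elim: r => [|i r IH] /=; first by move=> _ _ H; apply/eqP; rewrite eq_le H f0.
move=> /stables_cons[si sr] xL B; apply: IH => // [j jr|]; first by apply: xL; rewrite inE jr orbT.
rewrite (BI_eq0 oO si (f := boxI r L f) (L := L)) //; first exact: Cn_boxI.
  by move=> y Oy; exact: boxI_ge0.
by apply: xL; rewrite inE eqxx.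
Qed.
End ManyVariables.

Lemma stablesT r : stables [set: 'rV[R]_n] r. Proof. by []. Qed.

Lemma boxI_affine (r : seq 'I_n) L f (p y : 'rV[R]_n) (c : R) : 0 < c -> 0 <= L ->
  (forall i, i \in r -> `|p 0 i| + c <= L) -> Cn 0 setT (fun _ => f) -> (forall z, 0 <= f z) ->
  boxI r 1 (fun z => f (p + c *: z)) y <= c ^- size r * boxI r L f (p + c *: y).
Proof.
move=> c0 L0 + Cf f0.
have CA g : Cn 0 setT (fun _ => g) -> Cn 0 setT (fun _ z => g (p + c *: z)).
  move=> Cg; apply: (@Cn_comp R n n setT setT (fun _ z => p + c *: z) openT openT _ 0 g Cg) => [//|j].
  apply: (Cn_eq openT _ (Cn_add openT (Cn_cst _ _ (p 0 j)) (Cn_mul openT (Cn_cst _ _ c) (Cn_coord _ _ j)))).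
  by move=> s x _; rewrite !mxE.
elim: r y => [|i r IH] y pL /=; first by rewrite expr0 invr1 mul1r.
have pLr j : j \in r -> `|p 0 j| + c <= L by move=> jr; apply: pL; rewrite inE jr orbT.
have CB := Cn_boxI openT L (@stablesT r) Cf.
apply: (@le_trans _ _ (BI i 1 (fun z => c ^- size r * boxI r L f (p + c *: z)) y)).
  apply: (BI_le openT (@stableT i)) => //; try by move=> z _; exact: IH.
    by apply: Cn_boxI => //; [exact: openT|exact: CA].
  by apply: Cn_mul; [exact: openT|exact: Cn_cst|exact: CA].
rewrite (BIZ openT (@stableT i)) //; last exact: CA.
rewrite exprS invfM -mulrA mulrCA ler_wpM2l ?invr_ge0 ?exprn_ge0 ?(ltW c0) //.
apply: (BI_affine openT (@stableT i)) => //; first by apply: pL; rewrite inE eqxx.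
by move=> z _; apply: (boxI_ge0 openT).
Qed.
End BoxIntegral.

(** * Parallel transport and curvature *)
Section Transport.
Variable R : realType.
Local Notation isD f x d := (is_derive (x : R) (1 : R) f d).

(** The time and space derivatives commute: k is written as its value at time 0 plus the primitive
    of k', and the primitive is differentiated under the integral sign. *)
Lemma is_derive_time_pd n (U : set 'rV[R]_n) (k k' : R -> 'rV[R]_n -> R) i s x :
  open U -> Cn 1 U k -> Cn 1 U k' ->
  (forall s x, U x -> isD (fun s => k s x) s (k' s x)) -> U x ->
  isD (fun s => pd i (k s) x) s (pd i (k' s) x).
Proof.
move=> oU Ck Ck' kD Ux.
have E t y : U y -> k t y = k 0 y + prim (k'^~ y) t.
  move=> Uy; have [P0 PD] := prim_spec (jcont_time (Cn_jcont Ck') Uy).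
  have D u : isD (fun t => k t y - prim (k'^~ y) t) u 0.
    by apply: is_derive_eq (subrr (k' u y)); apply: is_deriveB; exact: kD.
  by have := derive0_cst D t 0; rewrite P0 subr0 => /eqP; rewrite subr_eq => /eqP.
have E2 : (fun t => pd i (k t) x) = (fun t => pd i (k 0) x + prim (fun t => pd i (k' t) x) t).
  apply/funext => t; rewrite (pd_eq i oU Ux (E t)); apply: is_derive_pd; apply: is_deriveDr.
    by apply: derivable_pd; exact: Cn_derivable Ck Ux.
  exact: (is_derive_prim i t oU Ck' Ux).
rewrite E2; have [_ PD] := prim_spec (jcont_time (Cn_jcont (Cn_pd i Ck')) Ux).
by apply: is_derive_eq (add0r _); apply: is_deriveD; exact: PD.
Qed.

Lemma bracketDl (a b c : quat R) : bracket (a + b) c = bracket a c + bracket b c.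
Proof. by qring. Qed.
Lemma bracketDr (a b c : quat R) : bracket c (a + b) = bracket c a + bracket c b.
Proof. by qring. Qed.
Lemma bracketZl r (a b : quat R) : bracket (r *: a) b = r *: bracket a b.
Proof. by qring. Qed.
Lemma bracketZr r (a b : quat R) : bracket a (r *: b) = r *: bracket a b.
Proof. by qring. Qed.
Lemma bracketC (a b : quat R) : bracket a b = - bracket b a.
Proof. by qring. Qed.

Lemma bracket_suml I (r : seq I) (f : I -> quat R) b :
  bracket (\sum_(i <- r) f i) b = \sum_(i <- r) bracket (f i) b.
Proof.
elim: r => [|i r IH]; first by rewrite !big_nil; qring.
by rewrite !big_cons bracketDl IH.
Qed.

Lemma bracket_sumr I (r : seq I) (f : I -> quat R) b :
  bracket b (\sum_(i <- r) f i) = \sum_(i <- r) bracket b (f i).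
Proof.
elim: r => [|i r IH]; first by rewrite !big_nil; qring.
by rewrite !big_cons bracketDr IH.
Qed.

Lemma qmul_suml I (r : seq I) (f : I -> quat R) b :
  qmul (\sum_(i <- r) f i) b = \sum_(i <- r) qmul (f i) b.
Proof.
elim: r => [|i r IH]; first by rewrite !big_nil; qring.
by rewrite !big_cons qmulDl IH.
Qed.

Lemma qmul_sumr I (r : seq I) (f : I -> quat R) b :
  qmul b (\sum_(i <- r) f i) = \sum_(i <- r) qmul b (f i).
Proof.
elim: r => [|i r IH]; first by rewrite !big_nil; qring.
by rewrite !big_cons qmulDr IH.
Qed.

Lemma isDV_sum (V : normedModType R) (x v : V) m I (r : seq I) (f : I -> V -> 'rV[R]_m) df :
  (forall i, isDV x v (f i) (df i)) ->
  isDV x v (fun y => \sum_(i <- r) f i y) (\sum_(i <- r) df i).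
Proof.
move=> fD; elim: r => [|i r IH].
  have -> : (fun y => \sum_(i <- [::]) f i y) = (fun=> 0) by apply/funext => y; rewrite big_nil.
  by rewrite big_nil; exact: isDV_cst.
have -> : (fun y => \sum_(i <- i :: r) f i y) = (fun y => f i y + \sum_(i <- r) f i y).
  by apply/funext => y; rewrite big_cons.
by rewrite big_cons; exact: isDV_D.
Qed.

Section Forms.
Variable n : nat.
Implicit Types (a : 'I_n -> 'rV[R]_n -> quat R) (x u v : 'rV[R]_n).

Definition form a x v : quat R := \sum_i v 0 i *: a i x.

Definition curv a i j x : quat R := pdv i (a j) x - pdv j (a i) x + bracket (a i x) (a j x).

Definition curv2 a x u v : quat R := \sum_i \sum_j (u 0 i * v 0 j) *: curv a i j x.

Lemma curv2E a x u v : curv2 a x u v =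
  \sum_j v 0 j *: (\sum_i u 0 i *: pdv i (a j) x) - \sum_j u 0 j *: (\sum_i v 0 i *: pdv i (a j) x)
  + bracket (form a x u) (form a x v).
Proof.
rewrite /form bracket_suml.
under [X in _ + X]eq_bigr => i _.
  rewrite bracketZl bracket_sumr.
  over.
rewrite (eq_bigr (fun j => \sum_i (u 0 i * v 0 j) *: pdv i (a j) x)); last first.
  by move=> j _; rewrite scaler_sumr; apply: eq_bigr => i _; rewrite scalerA mulrC.
rewrite exchange_big /= -sumrB -big_split /=; apply: eq_bigr => i _.
rewrite !scaler_sumr -sumrB -big_split /=; apply: eq_bigr => j _.
rewrite bracketZr !scalerA /curv.
by rewrite scalerDr scalerBr.
Qed.
End Forms.

Section Along.
Variables (p n : nat) (U : set 'rV[R]_p) (V : set 'rV[R]_n).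
Hypotheses (oU : open U) (oV : open V).
Variables (c cs : R -> 'rV[R]_p -> 'rV[R]_n) (a : 'I_n -> 'rV[R]_n -> quat R).
Hypothesis cV : forall s x, U x -> V (c s x).
Hypotheses (Cc : CnV 2 U c) (Ccs : CnV 2 U cs).
Hypothesis c_time : forall s x, U x -> isDV (s : R) (1 : R) (fun s => c s x) (cs s x).
Hypothesis Ca : forall i, CnV 2 V (fun _ => a i).
Hypothesis a_imag : forall i x, V x -> a i x 0 i0 = 0.

(** The coefficient of the equation Q' + a(c') Q = 0 of parallel transport along the curve s |-> c s
    x. *)
Definition along s x : quat R := - form a (c s x) (cs s x).
Definition transport x : quat R := propagator (along^~ x) 1.

Definition dirpd m (f : 'rV[R]_p -> 'rV[R]_m) x (v : 'rV[R]_p) : 'rV[R]_m :=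
  \sum_i v 0 i *: pdv i f x.

Lemma form_imag x v : V x -> form a x v 0 i0 = 0.
Proof.
move=> Vx; rewrite /form summxE big1 // => i _.
by rewrite mxE a_imag ?mulr0.
Qed.

Lemma Ca_along i : CnV 2 U (fun s x => a i (c s x)).
Proof. by move=> j; exact: (@Cn_comp R p n U V c oU oV cV 2 _ (@Ca i j) Cc). Qed.

Lemma C_along : CnV 2 U along.
Proof.
apply: CnV_N => //; apply: CnV_sum => // i.
by apply: CnV_scale => //; exact: Ca_along.
Qed.

Lemma along_imag s x : U x -> along s x 0 i0 = 0.
Proof. by move=> Ux; rewrite /along mxE form_imag ?oppr0 //; exact: cV. Qed.

Lemma C_propagator : CnV 2 U (fun s x => propagator (along^~ x) s).
Proof. by have H := CnV_propagator oU along_imag C_along; exact: H. Qed.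

Lemma C_transport : CnV 2 U (fun _ => transport).
Proof. by move=> j; exact: (Cn_freeze 1 oU (C_propagator j)). Qed.

Lemma contq_propagatorD i x : U x ->
  contq (fun t => qmul (qmul (qconj (propagator (along^~ x) t)) (pdv i (along t) x))
    (propagator (along^~ x) t)).
Proof.
move=> Ux; have CQ : CnV 1 U (fun t y => propagator (along^~ y) t).
  exact: CnV_le (isT : (1 <= 2)%N) C_propagator.
apply: (@CnV_contq R 1 p 4 U (fun t y => qmul (qmul (qconj (propagator (along^~ y) t))
  (pdv i (along t) y)) (propagator (along^~ y) t)) x _ Ux).
exact: (CnV_qmul oU (CnV_qmul oU (CnV_qconj oU CQ) (CnV_pdv i C_along)) CQ).
Qed.

Lemma transport_unit x : U x -> dot (transport x) (transport x) = 1.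
Proof.
move=> Ux; apply: propagator_unit; first exact: CnV_contq C_along Ux.
by move=> t; exact: along_imag.
Qed.

Lemma dirpd_a_along i s x v : U x -> dirpd (fun y => a i (c s y)) x v =
  \sum_k dirpd (c s) x v 0 k *: pdv k (a i) (c s x).
Proof.
move=> Ux; apply/rowP => l; rewrite /dirpd !summxE.
under eq_bigr => q _.
  rewrite mxE pdvE (is_derive_pd (@pd_comp R p n U V c oV cV 1 (fun y => a i y 0 l) q s x (@Ca i l)
    (fun j => @Cn_derivable R p 1 U (fun s y => c s y 0 j) q s x (Cc j) Ux) Ux)) mulr_sumr.
  over.
rewrite exchange_big /=; apply: eq_bigr => k _.
rewrite mxE summxE pdvE mulr_suml; apply: eq_bigr => q _.
by rewrite [in RHS]mxE pdvE mulrA.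
Qed.

Lemma dirpd_along s x v : U x -> dirpd (along s) x v =
  - (\sum_j (dirpd (cs s) x v 0 j *: a j (c s x)
     + cs s x 0 j *: \sum_k dirpd (c s) x v 0 k *: pdv k (a j) (c s x))).
Proof.
move=> Ux.
have D i : isDV x (ev R i) (along s)
    (- (\sum_j (pd i (fun y => cs s y 0 j) x *: a j (c s x)
        + cs s x 0 j *: pdv i (fun y => a j (c s y)) x))).
  apply: isDV_N; apply: isDV_sum => j; apply: isDV_scale.
    by apply: derivable_pd; exact: Cn_derivable (Ccs j) Ux.
  exact: CnV_isDV (@Ca_along j) Ux.
rewrite /dirpd; under eq_bigr => i _.
  rewrite (isDV_pdv (D i)) scalerN scaler_sumr.
  over.
rewrite sumrN exchange_big /=; congr (- _); apply: eq_bigr => j _.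
rewrite -dirpd_a_along // /dirpd summxE scaler_suml scaler_sumr -big_split /=.
apply: eq_bigr => i _.
by rewrite [in RHS]mxE pdvE scalerDr !scalerA [v 0 i * cs s x 0 j]mulrC.
Qed.

Lemma isDV_form_along s x v : U x -> isDV (s : R) (1 : R)
  (fun s => form a (c s x) (dirpd (c s) x v))
  (\sum_j (dirpd (cs s) x v 0 j *: a j (c s x)
     + dirpd (c s) x v 0 j *: \sum_k cs s x 0 k *: pdv k (a j) (c s x))).
Proof.
move=> Ux; apply: isDV_sum => j; apply: isDV_scale; last first.
  move=> l; rewrite summxE.
  have := @Cn_is_derive_curve R n 1 V (fun y => a j y 0 l) (fun t => c t x) (fun k => cs s x 0 k) s
    oV (@Ca j l) (@cV s x Ux) (fun k => c_time s Ux k).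
  move=> D; apply: is_derive_eq D _; apply: eq_bigr => k _.
  by rewrite [in RHS]mxE pdvE.
(* Real numbers are packed into rows with a single entry so that the vector rules [isDV_sum] and
   [isDV_scale] apply to them. *)
rewrite /dirpd; have -> : (fun y => (\sum_i v 0 i *: pdv i (c y) x) 0 j) =
    (fun y => (\sum_i v 0 i *: row j (\matrix_(_ < n, _ < 1) pd i (fun z => c y z 0 j) x)) 0 0).
  by apply/funext => y; rewrite !summxE; apply: eq_bigr => i _; rewrite !mxE.
rewrite summxE.
have -> : \sum_i (v 0 i *: pdv i (cs s) x) 0 j =
    (\sum_i (0 *: row j (\matrix_(_ < n, _ < 1) pd i (fun z => c s z 0 j) x)
      + v 0 i *: row j (\matrix_(_ < n, _ < 1) pd i (fun z => cs s z 0 j) x))) 0 0.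
  by rewrite summxE; apply: eq_bigr => i _; rewrite !mxE mul0r add0r.
apply: isDV_sum => i; apply: isDV_scale.
move=> q; rewrite !mxE.
have -> : (fun y => row j (\matrix_(_ < n, _ < 1) pd i (fun z => c y z 0 j) x) 0 q) =
  (fun y => pd i (fun z => c y z 0 j) x) by apply/funext => y; rewrite !mxE.
apply: (@is_derive_time_pd p U (fun s z => c s z 0 j) (fun s z => cs s z 0 j) i s x oU) => //.
- exact: Cn_le (Cc j).
- exact: Cn_le (Ccs j).
- by move=> t y Uy; exact: c_time.
Qed.

(** The covariant derivative of a parallel frame with respect to the parameter is the curvature of
    the swept surface, integrated along the curve; there is no boundary term because the initial
    point does not move in the direction v. *)
Lemma transport_le x v (h H : R -> R) : U x -> dirpd (c 0) x v = 0 ->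
  (forall s, 0 <= s <= 1 -> isD H s (h s)) ->
  (forall s, 0 <= s <= 1 -> eucl (curv2 a (c s x) (cs s x) (dirpd (c s) x v)) <= h s) ->
  eucl (dirpd transport x v + qmul (form a (c 1 x) (dirpd (c 1) x v)) (transport x)) <= H 1 - H 0.
Proof.
move=> Ux v0 HD Fh.
have Ck := CnV_contq C_along Ux.
have [Q0 QD] := propagator_spec Ck.
have Qu t : dot (propagator (along^~ x) t) (propagator (along^~ x) t) = 1.
  by apply: propagator_unit => // s; exact: along_imag.
set Q := propagator _ in Q0 QD Qu.
(* [W] is Q^-1 times the covariant derivative of Q in the direction v. Its time derivative is the
   curvature on the two tangent vectors of the surface, conjugated by the unit quaternion Q, which
   does not change its norm. *)
pose W s := (\sum_i v 0 i *: propagatorD along i s x)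
  + qmul (qmul (qconj (Q s)) (form a (c s x) (dirpd (c s) x v))) (Q s).
have WD s : isDV (s : R) (1 : R) W
    (qmul (qmul (qconj (Q s)) (curv2 a (c s x) (cs s x) (dirpd (c s) x v))) (Q s)).
  have D1 : isDV (s : R) (1 : R) (fun s => \sum_i v 0 i *: propagatorD along i s x)
      (\sum_i (0 *: propagatorD along i s x
        + v 0 i *: qmul (qmul (qconj (Q s)) (pdv i (along s) x)) (Q s))).
    apply: isDV_sum => i; apply: isDV_scale.
    by have [_ P] := primq_spec (@contq_propagatorD i x Ux); exact: (P s).
  have D2 := isDV_form_along s v Ux.
  have D3 := isDV_qmul (isDV_qmul (isDV_qconj (QD s)) D2) (QD s).
  apply: isDV_eq (isDV_D D1 D3) _.
  rewrite (eq_bigr (fun i => qmul (qmul (qconj (Q s)) (v 0 i *: pdv i (along s) x)) (Q s))); last first.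
    by move=> i _; rewrite scale0r add0r qmulZr qmulZl.
  rewrite -qmul_suml -qmul_sumr -/(dirpd (along s) x v) dirpd_along // curv2E.
  have ai : along s x 0 i0 = 0 by exact: along_imag.
  rewrite qconjM (qconj_imag ai) /along.
  rewrite !big_split /=.
  move: (form _ _ _) (form _ _ _) (\sum_j dirpd (cs s) x v 0 j *: a j (c s x))
    (\sum_j cs s x 0 j *: _) (\sum_j dirpd (c s) x v 0 j *: _) (Q s) => P1 P2 S1 S2 S3 q.
  rewrite !qmulA -!qmulDl; congr (qmul _ q); rewrite -!qmulA -!qmulDr; congr (qmul _ _).
  by qring.
have W1 : eucl (W 1 - W 0) <= H 1 - H 0.
  apply: (eucl_mvt ler01 (fun s _ => WD s) HD) => s s01.
  rewrite !eucl_qmul eucl_qconj (unit_eucl (Qu s)) mul1r mulr1; exact: Fh.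
have W00 : W 0 = 0.
  rewrite /W v0 big1 ?add0r => [|i _].
    rewrite [form _ _ _]big1 => [|j _]; last by rewrite mxE scale0r.
    by qring.
  have -> : propagatorD along i 0 x = 0; last by rewrite scaler0.
  apply/rowP => j; rewrite primqE mxE.
  exact: (prim_spec (@contq_propagatorD i x Ux j)).1.
move: W1; rewrite W00 subr0; congr (_ <= _).
rewrite -[LHS]mul1r -[X in X * _](unit_eucl (Qu 1)) -eucl_qmul; congr eucl.
rewrite /W qmulDr -/(transport x) !qmulA (unit_qmulqV (Qu 1)) qmul1q; congr (_ + _).
rewrite /dirpd qmul_sumr; apply: eq_bigr => i _.
by rewrite qmulZr (isDV_pdv (isDV_propagator oU along_imag i 1 (CnV_le (isT : (1 <= 2)%N) C_along) Ux)).
Qed.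
End Along.
End Transport.

(** * Meridian arcs *)
Ltac Cn_step := match goal with
  | H : Cn _ _ _ |- Cn _ _ _ => exact: H
  | |- Cn _ _ (fun s x => @?f s x + @?g s x) => simple refine (@Cn_add _ _ _ _ f g _ _ _)
  | |- Cn _ _ (fun s x => @?f s x * @?g s x) => simple refine (@Cn_mul _ _ _ _ f g _ _ _)
  | |- Cn _ _ (fun s x => - @?f s x) => simple refine (@Cn_opp _ _ _ _ f _ _)
  | |- Cn _ _ (fun _ _ => ?c) => simple refine (@Cn_cst _ _ _ _ c)
  | |- Cn _ _ (fun _ x => @fun_of_matrix _ _ _ x _ ?i) => simple refine (@Cn_coord _ _ _ _ i)
  | |- Cn _ _ (fun s x => (@?f s x)^-1) => simple refine (@Cn_inv _ _ _ _ f _ _ _)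
  | |- Cn _ _ (fun s _ => s) => simple refine (@Cn_time _ _ _ _ idfun _)
  | |- Cn _ _ (fun s x => if _ then _ else _) => fail
  | |- open _ => assumption
  | |- continuous (@idfun _) => by move=> ?; exact: cvg_id
  end.
Ltac Cn_auto := repeat Cn_step.

Section Radial.
Variable R : realType.
Local Notation isD f x d := (is_derive (x : R) (1 : R) f d).

Lemma isD_cst (V : normedModType R) (c : R) (x v : V) : is_derive x v (fun _ : V => c) 0.
Proof. exact: is_derive_cst. Qed.

Lemma isD_id (s : R) : isD (fun s => s) s 1.
Proof. exact: is_derive_id. Qed.

Lemma is_derive_invr (V : normedModType R) (x v : V) (f : V -> R) df : f x != 0 ->
  is_derive x v f df -> is_derive x v (fun y => (f y)^-1) (- df / f x ^+ 2).
Proof.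
move=> f0 fD; have dv : derivable (fun y => (f y)^-1) x v.
  by apply: derivableV => //; case: fD.
have D : is_derive x v (fun y => (f y)^-1) ('D_v (fun y => (f y)^-1) x) by apply: DeriveDef.
apply: is_derive_eq D _; case: fD => fd <-; rewrite deriveV //;
  rewrite [_ *: _](_ : _ = - (f x) ^- 2 * 'D_v f x) //.
by rewrite mulNr [in RHS]mulNr mulrC.
Qed.

Lemma open_nonzero n : open [set x : 'rV[R]_n | x != 0].
Proof.
have -> : [set x : 'rV[R]_n | x != 0] = ~` [set 0].
  by apply/seteqP; split=> x /= /eqP.
by apply: closed_openC; exact: accessible_closed_set1 (hausdorff_accessible (@norm_hausdorff _ _)) _.
Qed.

Lemma dot_gt0 n (x : 'rV[R]_n) : x != 0 -> 0 < dot x x.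
Proof. by move=> x0; rewrite lt_def dot_ge0 andbT; apply: contra x0 => /eqP/dot_eq0 ->. Qed.

Lemma eucl_gt0 n (x : 'rV[R]_n) : x != 0 -> 0 < eucl x.
Proof. by move=> x0; rewrite sqrtr_gt0 dot_gt0. Qed.

Lemma Cn_dotxx n m (U : set 'rV[R]_n) : open U -> Cn m U (fun _ x => dot x x).
Proof. by move=> oU; apply: Cn_dot => // j; exact: Cn_coord. Qed.

Lemma Cn_eucl n m (U : set 'rV[R]_n) : open U -> (forall x, U x -> x != 0) ->
  Cn m U (fun _ x => eucl x).
Proof. by move=> oU U0; apply: Cn_sqrt => // [_ x /U0/dot_gt0//|]; exact: Cn_dotxx. Qed.

Lemma isDV_id (V := 'rV[R]_4) (x v : V) : isDV x v id v.
Proof. by move=> j; exact: is_derive_coord. Qed.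

Lemma is_derive_eucl n (x v : 'rV[R]_n) : x != 0 ->
  is_derive x v (fun y => eucl y) (dot x v / eucl x).
Proof.
move=> x0; have [d _] := @Cn_differentiable R n 0 _ (fun _ y => eucl y) 0 x
  (@open_nonzero n) (Cn_eucl 1 (@open_nonzero n) (fun _ h => h)) x0.
have D : is_derive x v (fun y => eucl y) ('D_v (fun y => eucl y) x).
  by apply: DeriveDef => //; exact: diff_derivable.
move: D; move: ('D_v _ x) => l D; suff <- : l = dot x v / eucl x by [].
have D1 := is_deriveMr D D.
have iV : isDV x v id v by move=> j; exact: is_derive_coord.
have D2 : is_derive x v (fun y : 'rV[R]_n => dot y y) (dot v x + dot x v).
  by have := is_derive_dot iV iV.
have := @derive_val _ _ _ _ _ _ _ D1; have := @derive_val _ _ _ _ _ _ _ D2.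
have -> : (fun y : 'rV[R]_n => dot y y) = (fun y => eucl y * eucl y).
  by apply/funext => y; rewrite -eucl_sqr expr2.
have r0 : eucl x != 0 by rewrite gt_eqF // eucl_gt0.
move=> ->; rewrite (dotC v); move: (dot x v) (eucl x) r0 => p r r0 E.
by apply: (mulIf r0); rewrite divfK //; lra.
Qed.

Lemma dirpd_eq p m (U : set 'rV[R]_p) (f : 'rV[R]_p -> 'rV[R]_m) x v df : open U ->
  CnV 1 U (fun _ => f) -> U x -> isDV x v f df -> dirpd f x v = df.
Proof.
move=> oU Cf Ux fD; apply/rowP => j; rewrite /dirpd summxE.
have [_ E] := @Cn_differentiable R p 0 U (fun _ y => f y 0 j) 0 x oU (Cf j) Ux.
rewrite -(@derive_val _ _ _ _ _ _ _ (fD j)) E; apply: eq_bigr => i _.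
by rewrite mxE pdvE.
Qed.

Definition wedge n (u v : 'rV[R]_n) : R := Num.sqrt (dot u u * dot v v - dot u v ^+ 2).

Lemma wedge_le n (u v : 'rV[R]_n) : wedge u v <= eucl u * eucl v.
Proof.
rewrite /eucl -sqrtrM ?dot_ge0 // ler_sqrt; last by rewrite mulr_ge0 ?dot_ge0.
by rewrite gerBl sqr_ge0.
Qed.
End Radial.

(** * Explicit arcs from a pole and their derivatives *)

Section Arc.
Variable R : realType.
Local Notation isD f x d := (is_derive (x : R) (1 : R) f d).
Variable sg : R.
Hypothesis sg2 : sg * sg = 1.
Implicit Types x v : quat R.

(* [arc s x] multiplies by s the stereographic coordinate of x, projected from the
   pole opposite to sg; it runs from the pole (s = 0) to x (s = 1) on the sphere
   through x, and [arcs], [arcv] are its derivatives in s and in x. *)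
Definition polw x : R := eucl x + sg * x 0 i0.
Definition polu x : R := eucl x - sg * x 0 i0.
Definition polar_set : set (quat R) := [set x | 0 < polw x].
Definition arcd (s : R) x : R := polw x + s ^+ 2 * polu x.

Definition arc (s : R) x : quat R :=
  let g := 2 * eucl x / arcd s x in
  mkq (sg * (g * polw x - eucl x)) (g * s * x 0 i1) (g * s * x 0 i2) (g * s * x 0 i3).

Definition arcs (s : R) x : quat R :=
  let g := 2 * eucl x / arcd s x ^+ 2 in
  let h := g * (polw x - s ^+ 2 * polu x) in
  mkq (sg * (- 2 * s * g * polu x * polw x)) (h * x 0 i1) (h * x 0 i2) (h * x 0 i3).

Lemma polar_nz x : polar_set x -> x != 0.
Proof.
by apply: contraTneq => ->; rewrite /polar_set /= /polw eucl0 mxE mulr0 addr0 ltxx.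
Qed.

Lemma polu_ge0 x : 0 <= polu x.
Proof.
have := eucl_coord x i0; rewrite /polu; move: (x 0 i0) (eucl x) => a r.
have [->|->] : sg = 1 \/ sg = -1.
  have : (sg - 1) * (sg + 1) = 0 by move: sg2; lra.
  by move=> /eqP; rewrite mulf_eq0 => /orP[] /eqP; [left|right]; lra.
  by rewrite ler_norml => /andP[]; lra.
by rewrite ler_norml => /andP[]; lra.
Qed.

Lemma eucl4 x : eucl x ^+ 2 = x 0 i0 ^+ 2 + x 0 i1 ^+ 2 + x 0 i2 ^+ 2 + x 0 i3 ^+ 2.
Proof. by rewrite eucl_sqr dot4E !expr2. Qed.

(** If theta is the angle of x from the pole sg, then [polw] = r (1 + cos theta) and [polu] = r (1 -
    cos theta); the product is (r sin theta)^2. *)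
Lemma poluw x : polw x * polu x = x 0 i1 ^+ 2 + x 0 i2 ^+ 2 + x 0 i3 ^+ 2.
Proof.
rewrite /polw /polu; have := eucl4 x; have := sg2; gen_quats; move: (eucl x) sg.
move=> r t t2 E; have -> (a : R) : (r + t * a) * (r - t * a) = r ^+ 2 - t * t * a ^+ 2 by ring.
by rewrite t2; lra.
Qed.

Lemma arcd_gt0 s x : polar_set x -> 0 < arcd s x.
Proof. by move=> w0; rewrite ltr_wpDr // mulr_ge0 ?sqr_ge0 ?polu_ge0. Qed.

Lemma arcd1 x : arcd 1 x = 2 * eucl x.
Proof. by rewrite /arcd /polw /polu; ring. Qed.

Lemma Cn_polw m U : open U -> (forall x, U x -> x != 0) -> Cn m U (fun _ x => polw x).
Proof. by move=> oU U0; have H := Cn_eucl m oU U0; rewrite /polw; Cn_auto. Qed.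

Lemma Cn_polu m U : open U -> (forall x, U x -> x != 0) -> Cn m U (fun _ x => polu x).
Proof. by move=> oU U0; have H := Cn_eucl m oU U0; rewrite /polu; Cn_auto. Qed.

Lemma open_polar : open polar_set.
Proof.
rewrite openE => x Ux.
have C := @Cn_continuous R 4 0 _ (fun _ x => polw x) 0 x (Cn_polw 0 (@open_nonzero R 4) (fun _ h => h)) (polar_nz Ux).
have N : nbhs (polw x) [set y : R | 0 < y].
  by apply: open_nbhs_nbhs; split; [exact: open_gt|exact: Ux].
exact: (C _ N).
Qed.

Lemma Cn_arcd m : Cn m polar_set arcd.
Proof.
have oU := open_polar; have W := Cn_polw m oU polar_nz; have H := Cn_polu m oU polar_nz.
by rewrite /arcd; apply: (@Cn_eq R 4 m polar_set (fun s x => polw x + s * s * polu x)) => //; Cn_auto.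
Qed.

Lemma CnV_mkq n m (U : set 'rV[R]_n) (f0 f1 f2 f3 : R -> 'rV[R]_n -> R) : open U ->
  Cn m U f0 -> Cn m U f1 -> Cn m U f2 -> Cn m U f3 ->
  CnV m U (fun s (x : 'rV[R]_n) => mkq (f0 s x) (f1 s x) (f2 s x) (f3 s x)).
Proof.
move=> oU h0 h1 h2 h3; apply: ord4P.
- by apply: Cn_eq h0 => // s x _; rewrite mkqE.
- by apply: Cn_eq h1 => // s x _; rewrite mkqE.
- by apply: Cn_eq h2 => // s x _; rewrite mkqE.
- by apply: Cn_eq h3 => // s x _; rewrite mkqE.
Qed.

Lemma isDV_mkq (V : normedModType R) (x v : V) (f0 f1 f2 f3 : V -> R) d0 d1 d2 d3 :
  is_derive x v f0 d0 -> is_derive x v f1 d1 -> is_derive x v f2 d2 -> is_derive x v f3 d3 ->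
  isDV x v (fun x : V => mkq (f0 x) (f1 x) (f2 x) (f3 x)) (mkq d0 d1 d2 d3).
Proof.
have E (g0 g1 g2 g3 : V -> R) : ((fun x : V => mkq (g0 x) (g1 x) (g2 x) (g3 x) 0 i0) = g0) *
  ((fun x : V => mkq (g0 x) (g1 x) (g2 x) (g3 x) 0 i1) = g1) *
  ((fun x : V => mkq (g0 x) (g1 x) (g2 x) (g3 x) 0 i2) = g2) *
  ((fun x : V => mkq (g0 x) (g1 x) (g2 x) (g3 x) 0 i3) = g3).
  by do !split; apply/funext => y; rewrite mkqE.
by move=> h0 h1 h2 h3; apply: ord4P; rewrite E mkqE.
Qed.

Lemma arcd_neq0 s x : polar_set x -> arcd s x != 0.
Proof. by move=> /(arcd_gt0 s)/gt_eqF ->. Qed.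

Lemma CnV_arc m : CnV m polar_set arc.
Proof.
have oU := open_polar; have W := Cn_polw m oU polar_nz; have H := Cn_eucl m oU polar_nz.
have D := Cn_inv oU arcd_neq0 (Cn_arcd m).
rewrite /arc; cbv zeta; apply: CnV_mkq => //; Cn_auto.
Qed.

Lemma CnV_arcs m : CnV m polar_set arcs.
Proof.
have oU := open_polar; have W := Cn_polw m oU polar_nz; have H := Cn_eucl m oU polar_nz.
have H' := Cn_polu m oU polar_nz; have D := Cn_inv oU arcd_neq0 (Cn_arcd m).
have E : arcs = (fun (s : R) x => let g := 2 * eucl x * ((arcd s x)^-1 * (arcd s x)^-1) in
  let h := g * (polw x - s * s * polu x) in
  mkq (sg * (- 2 * s * g * polu x * polw x)) (h * x 0 i1) (h * x 0 i2) (h * x 0 i3)).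
  by apply/funext => s; apply/funext => x; rewrite /arcs !expr2 invfM.
by rewrite E; cbv zeta; apply: CnV_mkq => //; Cn_auto.
Qed.

Lemma arc_time s x : polar_set x -> isDV (s : R) (1 : R) (fun s => arc s x) (arcs s x).
Proof.
move=> Ux; have d0 := arcd_neq0 s Ux.
have Dd : isD (fun s => arcd s x) s (2 * s * polu x).
  rewrite /arcd; move: (polw x) (polu x) => w u.
  have D := is_deriveMr (is_deriveMr (isD_id s) (isD_id s)) (isD_cst u s 1).
  apply: is_derive_eq (is_deriveDr (isD_cst w s 1) D) _; ring.
have Dg : isD (fun s => 2 * eucl x / arcd s x) s (2 * eucl x * (- (2 * s * polu x) / arcd s x ^+ 2)).
  apply: is_derive_eq (is_deriveMr (isD_cst (2 * eucl x) s 1) (@is_derive_invr R _ s 1 (fun s => arcd s x) _ d0 Dd)) _.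
  by rewrite mul0r add0r.
have E : arcd s x = polw x + s ^+ 2 * polu x by [].
have Di := isD_id s.
have H k : isD (fun s => 2 * eucl x / arcd s x * s * x 0 k) s
    (2 * eucl x / arcd s x ^+ 2 * (polw x - s ^+ 2 * polu x) * x 0 k).
  apply: is_derive_eq (is_deriveMr (is_deriveMr Dg Di) (isD_cst (x 0 k) s 1)) _.
  move: d0; rewrite E; move: (polw x) (polu x) (eucl x) (x 0 k) => w u r y d0.
  by field.
rewrite /arc; cbv zeta; apply: isDV_eq.
  exact: (isDV_mkq (is_deriveMr (isD_cst sg s 1)
    (is_deriveDr (is_deriveMr Dg (isD_cst (polw x) s 1)) (isD_cst (- eucl x) s 1)))
    (H i1) (H i2) (H i3)).
rewrite /arcs; congr (mkq _ _ _ _).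
move: d0; rewrite E; move: (polw x) (polu x) (eucl x) => w u r d0.
by field.
Qed.

Lemma arc1 x : polar_set x -> arc 1 x = x.
Proof.
move=> Ux; have r0 := eucl_gt0 (polar_nz Ux).
rewrite /arc arcd1 divff ?mulf_neq0 ?pnatr_eq0 ?gt_eqF //.
apply: quatP; rewrite mkqE ?mul1r //= /polw addrAC subrr add0r mulrA sg2 mul1r //.
Qed.

Lemma dot_arc s x : polar_set x -> dot (arc s x) (arc s x) = eucl x ^+ 2.
Proof.
move=> Ux; have d0 := arcd_neq0 s Ux; rewrite dot4E !mkqE.
have E := poluw x; have Ed : arcd s x = polw x + s ^+ 2 * polu x by [].
have -> (a b c t g w r : R) : sg * (g * w - r) * (sg * (g * w - r)) +
   g * t * a * (g * t * a) + g * t * b * (g * t * b) + g * t * c * (g * t * c) =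
   sg * sg * (g * w - r) ^+ 2 + g ^+ 2 * t ^+ 2 * (a ^+ 2 + b ^+ 2 + c ^+ 2) by ring.
rewrite sg2 -E; move: d0; rewrite Ed; move: (polw x) (polu x) (eucl x) => w u r d0.
by field.
Qed.

Lemma dot_arcs s x : polar_set x ->
  dot (arcs s x) (arcs s x) = 4 * eucl x ^+ 2 * (polw x * polu x) / arcd s x ^+ 2.
Proof.
move=> Ux; have d0 := arcd_neq0 s Ux; rewrite dot4E !mkqE.
have E := poluw x; have Ed : arcd s x = polw x + s ^+ 2 * polu x by [].
have -> (a b c t g : R) : sg * t * (sg * t) + g * a * (g * a) + g * b * (g * b) + g * c * (g * c) =
   sg * sg * t ^+ 2 + g ^+ 2 * (a ^+ 2 + b ^+ 2 + c ^+ 2) by ring.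
rewrite sg2 -E; move: d0; rewrite Ed; move: (polw x) (polu x) (eucl x) => w u r d0.
by field.
Qed.

Definition arcv (s : R) x v : quat R :=
  let g := 2 * eucl x / arcd s x ^+ 2 in
  let f k := g * s * (v 0 k * arcd s x - x 0 k * (sg * v 0 i0) * (1 - s ^+ 2)) in
  mkq (g * 2 * eucl x * s ^+ 2 * v 0 i0) (f i1) (f i2) (f i3).

Lemma isDV_arc s x v : polar_set x -> dot x v = 0 -> isDV x v (arc s) (arcv s x v).
Proof.
move=> Ux xv; have d0 := arcd_neq0 s Ux.
have Dr : is_derive x v (fun y => eucl y) 0.
  by apply: is_derive_eq (is_derive_eucl v (polar_nz Ux)) _; rewrite xv mul0r.
have Dc k : is_derive x v (fun y => y 0 k) (v 0 k) by exact: is_derive_coord.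
have Ds : is_derive x v (fun y => sg * y 0 i0) (sg * v 0 i0).
  by apply: is_derive_eq (is_deriveMr (isD_cst sg x v) (Dc i0)) _; rewrite mul0r add0r.
have Dw : is_derive x v (fun y => polw y) (sg * v 0 i0).
  by apply: is_derive_eq (is_deriveDr Dr Ds) _; rewrite add0r.
have Du : is_derive x v (fun y => polu y) (- (sg * v 0 i0)).
  by apply: is_derive_eq (is_deriveDr Dr (is_deriveNr Ds)) _; rewrite add0r.
have Dd : is_derive x v (fun y => arcd s y) (sg * v 0 i0 * (1 - s ^+ 2)).
  apply: is_derive_eq (is_deriveDr Dw (is_deriveMr (isD_cst (s ^+ 2) x v) Du)) _.
  by move: (v 0 i0) (polu x) => a u; ring.
have Dg : is_derive x v (fun y => 2 * eucl y / arcd s y)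
    (- (2 * eucl x * (sg * v 0 i0 * (1 - s ^+ 2)) / arcd s x ^+ 2)).
  have D := is_deriveMr (is_deriveMr (isD_cst (2 : R) x v) Dr) (is_derive_invr d0 Dd).
  apply: is_derive_eq D _; move: (v 0 i0) (eucl x) d0; move: (arcd s x) => d a r d0.
  by field.
have H k : is_derive x v (fun y => 2 * eucl y / arcd s y * s * y 0 k)
    (2 * eucl x / arcd s x ^+ 2 * s * (v 0 k * arcd s x - x 0 k * (sg * v 0 i0) * (1 - s ^+ 2))).
  have D := is_deriveMr (is_deriveMr Dg (isD_cst s x v)) (Dc k).
  apply: is_derive_eq D _; move: (v 0 i0) (v 0 k) (x 0 k) (eucl x) d0; move: (arcd s x) => d a b y r d0.
  by field.
rewrite /arc; cbv zeta; apply: isDV_eq.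
  exact: (isDV_mkq (is_deriveMr (isD_cst sg x v) (is_deriveDr (is_deriveMr Dg Dw) (is_deriveNr Dr)))
    (H i1) (H i2) (H i3)).
rewrite /arcv; congr mkq.
have Er : eucl x = (polw x + polu x) / 2 by rewrite /polw /polu; field.
have Ed : arcd s x = polw x + s ^+ 2 * polu x by [].
rewrite mul0r add0r subr0; set rhs := (X in _ = X); rewrite -[rhs]mul1r -[X in X * rhs]sg2 /rhs.
move: d0; rewrite Er Ed; move: (polw x) (polu x) (v 0 i0) => w u a d0.
by field.
Qed.

(** Stereographic projection is conformal and multiplication by s is a similarity of the plane, so
    the tangent vector v is stretched by a factor independent of its direction. *)
Lemma dot_arcv s x v : polar_set x -> dot x v = 0 ->
  dot (arcv s x v) (arcv s x v) = 4 * s ^+ 2 * eucl x ^+ 2 * dot v v / arcd s x ^+ 2.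
Proof.
move=> Ux xv; have d0 := arcd_neq0 s Ux.
have Er : eucl x = (polw x + polu x) / 2 by rewrite /polw /polu; field.
have Ex : sg * x 0 i0 = (polw x - polu x) / 2 by rewrite /polw /polu; field.
have Ed : arcd s x = polw x + s ^+ 2 * polu x by [].
have E := poluw x; rewrite !dot4E !mkqE; rewrite dot4E in xv.
set V0 := sg * v 0 i0.
have V2 : v 0 i0 * v 0 i0 = V0 ^+ 2.
  have -> : V0 ^+ 2 = sg * sg * (v 0 i0 * v 0 i0) by rewrite /V0; ring.
  by rewrite sg2 mul1r.
have xv' : x 0 i1 * v 0 i1 + x 0 i2 * v 0 i2 + x 0 i3 * v 0 i3 = - ((polw x - polu x) / 2 * V0).
  have -> : (polw x - polu x) / 2 * V0 = sg * sg * (x 0 i0 * v 0 i0).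
    by rewrite -Ex /V0; ring.
  by rewrite sg2; lra.
have -> (g r d s2 a b1 b2 b3 c1 c2 c3 : R) : g * 2 * r * s ^+ 2 * a * (g * 2 * r * s ^+ 2 * a)
    + g * s * (b1 * d - c1 * V0 * s2) * (g * s * (b1 * d - c1 * V0 * s2))
    + g * s * (b2 * d - c2 * V0 * s2) * (g * s * (b2 * d - c2 * V0 * s2))
    + g * s * (b3 * d - c3 * V0 * s2) * (g * s * (b3 * d - c3 * V0 * s2)) =
  g ^+ 2 * ((2 * r * s ^+ 2) ^+ 2 * (a * a) + s ^+ 2 * (d ^+ 2 * (b1 * b1 + b2 * b2 + b3 * b3)
    - 2 * d * V0 * s2 * (c1 * b1 + c2 * b2 + c3 * b3)
    + V0 ^+ 2 * s2 ^+ 2 * (c1 ^+ 2 + c2 ^+ 2 + c3 ^+ 2))) by ring.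
rewrite xv' -E V2 -2!(addrA (V0 ^+ 2)); move: (v 0 i1 * _ + _ + _) => N.
move: d0; rewrite Er Ed; move: (polw x) (polu x) V0 {V2 xv'} => w u a d0.
by field.
Qed.

Lemma arcv0 x v : arcv 0 x v = 0.
Proof. by apply: quatP; rewrite !qE ?expr0n /= !(mulr0, mul0r). Qed.

Lemma arcv1 x v : polar_set x -> arcv 1 x v = v.
Proof.
move=> Ux; have r0 : eucl x != 0 by rewrite gt_eqF // eucl_gt0 // polar_nz.
by rewrite /arcv arcd1; apply: quatP; rewrite !qE ?expr1n ?subrr; move: (eucl x) r0 (v 0 _) => r r0 a; field.
Qed.

(** This is [eucl x *: arcs 1 x] cleared of denominators, a tangent vector to the meridian at x. *)
Definition meridian x : quat R :=
  mkq (sg * - (polw x * polu x)) (sg * x 0 i0 * x 0 i1) (sg * x 0 i0 * x 0 i2) (sg * x 0 i0 * x 0 i3).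

Lemma dot_meridian x : dot x (meridian x) = 0.
Proof. by rewrite dot4E !mkqE poluw; gen_quats; ring. Qed.

(** If the end point moves along its own meridian, the arc slides along itself. The curvature is
    then evaluated on parallel vectors, which is why [covd_meridian] holds. *)
Lemma arcv_meridian s x : polar_set x -> arcv s x (meridian x) = (s * eucl x) *: arcs s x.
Proof.
move=> Ux; have d0 := arcd_neq0 s Ux.
have Er : eucl x = (polw x + polu x) / 2 by rewrite /polw /polu; field.
have Ex : sg * x 0 i0 = (polw x - polu x) / 2 by rewrite /polw /polu; field.
have Ed : arcd s x = polw x + s ^+ 2 * polu x by [].
rewrite /arcv /arcs /meridian; have S y : sg * (sg * y) = y by rewrite mulrA sg2 mul1r.
apply: quatP; rewrite !qE ?S ?Ex ?Er; move: d0; rewrite Ed.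
- by move: (polw x) (polu x) => w u d0; field.
- by move: (polw x) (polu x) (x 0 i1) => w u a d0; field.
- by move: (polw x) (polu x) (x 0 i2) => w u a d0; field.
- by move: (polw x) (polu x) (x 0 i3) => w u a d0; field.
Qed.
End Arc.

(** * Polar gauges *)
Section PolarTransport.
Variable R : realType.
Local Notation isD f x d := (is_derive (x : R) (1 : R) f d).
Variable a : 'I_4 -> quat R -> quat R.
Local Notation U0 := [set x : quat R | x != 0].
Hypothesis Ca : forall i, CnV 2 U0 (fun _ => a i).
Hypothesis a_imag : forall i x, U0 x -> a i x 0 i0 = 0.
Implicit Types x v : quat R.

Definition covd (P : quat R -> quat R) x v : quat R := dirpd P x v + qmul (form a x v) (P x).

(** The factor r^2 makes e invariant under dilations; under the conformal map it is a bound for the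
    curvature on the cylinder. *)
Definition curv_le (e r : R) := forall x u v, eucl x = r ->
  r ^+ 2 * eucl (curv2 a x u v) <= e * wedge u v.

Lemma eucl_eq n (z : 'rV[R]_n) k : 0 <= k -> dot z z = k ^+ 2 -> eucl z = k.
Proof. by move=> k0 E; rewrite /eucl E sqrtr_sqr ger0_norm. Qed.

Lemma dirpdZ m (f : quat R -> 'rV[R]_m) x k v : dirpd f x (k *: v) = k *: dirpd f x v.
Proof.
by rewrite /dirpd scaler_sumr; apply: eq_bigr => i _; rewrite mxE scalerA.
Qed.

Lemma formZ x k v : form a x (k *: v) = k *: form a x v.
Proof.
by rewrite /form scaler_sumr; apply: eq_bigr => i _; rewrite mxE scalerA.
Qed.

Lemma covdZ P x k v : covd P x (k *: v) = k *: covd P x v.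
Proof. by rewrite /covd dirpdZ formZ qmulZl scalerDr. Qed.

Lemma curv2_parallel x u k : curv2 a x u (k *: u) = 0.
Proof.
rewrite curv2E formZ bracketZr (_ : bracket _ _ = 0) ?scaler0 ?addr0; last by qring.
apply/eqP; rewrite subr_eq0; apply/eqP; apply: eq_bigr => j _.
rewrite mxE -scalerA [in RHS](eq_bigr (fun i => k *: (u 0 i *: pdv i (a j) x))); last first.
  by move=> i _; rewrite mxE scalerA.
by rewrite -scaler_sumr !scalerA mulrC.
Qed.

Variable sg : R.
Hypothesis sg2 : sg * sg = 1.
Local Notation polar := (polar_set sg).
Definition polT : quat R -> quat R := transport (arc sg) (arcs sg) a.

Let arcU s x : polar x -> U0 (arc sg s x).
Proof.
move=> Ux; apply: contraTneq (eucl_gt0 (polar_nz Ux)) => E.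
have := dot_arc sg2 s Ux; rewrite E dot0l => /esym/eqP.
by rewrite sqrf_eq0 => /eqP ->; rewrite ltxx.
Qed.

Let oP := @open_polar R sg.
Let oU0 := @open_nonzero R 4.

Lemma C_polT : CnV 2 polar (fun _ => polT).
Proof.
exact: (C_transport oP oU0 arcU (CnV_arc sg2 2) (CnV_arcs sg2 2) Ca a_imag).
Qed.

Lemma polT_unit x : polar x -> dot (polT x) (polT x) = 1.
Proof.
exact: (transport_unit oP oU0 arcU (CnV_arc sg2 2) (CnV_arcs sg2 2) Ca a_imag).
Qed.

Lemma dirpd_arc s x v : polar x -> dot x v = 0 -> dirpd (arc sg s) x v = arcv sg s x v.
Proof.
move=> Ux xv; apply: (dirpd_eq oP _ Ux (isDV_arc sg2 s Ux xv)).
by move=> j; exact: (Cn_freeze s oP (CnV_arc sg2 1 j)).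
Qed.

Lemma covd_le x v (h H : R -> R) : polar x -> dot x v = 0 ->
  (forall s, 0 <= s <= 1 -> isD H s (h s)) ->
  (forall s, 0 <= s <= 1 -> eucl (curv2 a (arc sg s x) (arcs sg s x) (arcv sg s x v)) <= h s) ->
  eucl (covd polT x v) <= H 1 - H 0.
Proof.
move=> Ux xv HD Fh.
have E0 : dirpd (arc sg 0) x v = 0 by rewrite dirpd_arc // arcv0.
have E1 : dirpd (arc sg 1) x v = v by rewrite dirpd_arc // arcv1.
have := @transport_le R 4 4 polar U0 oP oU0 (arc sg) (arcs sg) a arcU (CnV_arc sg2 2) (CnV_arcs sg2 2)
  (fun s x => @arc_time R sg sg2 s x) Ca a_imag x v h H Ux E0 HD.
rewrite E1 arc1 //; apply=> s s01; rewrite dirpd_arc //; exact: Fh.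
Qed.

(** With theta the angle from the pole, the square root is r sin theta and [polw] is r (1 + cos
    theta): the bound is r |covd| <= e tan(theta / 2) |v|, which equals e |v| on the equator. *)
Lemma covd_polT_le x v e : polar x -> dot x v = 0 -> 0 <= e -> curv_le e (eucl x) ->
  polw sg x * eucl x * eucl (covd polT x v) <=
  e * Num.sqrt (polw sg x * polu sg x) * eucl v.
Proof.
move=> Ux xv e0 Fe; have r0 := eucl_gt0 (polar_nz Ux); have w0 : 0 < polw sg x := Ux.
have u0 := polu_ge0 sg2 x; have wu0 : 0 <= polw sg x * polu sg x by rewrite mulr_ge0 // ltW.
have := sqr_sqrtr wu0; have := sqrtr_ge0 (polw sg x * polu sg x).
move: (Num.sqrt _) => rho rho0 rho2.
have v0 := eucl_ge0 v.
(* [h] is e / r^2 times the product of the lengths of [arcs] and [arcv], with rho = r sin theta; [H]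
   is its primitive vanishing at 0. *)
pose h s := 4 * e * rho * eucl v * s / arcd sg s x ^+ 2.
pose H s := 2 * e * rho * eucl v / polw sg x * (s * s / arcd sg s x).
suff : eucl (covd polT x v) <= H 1 - H 0.
  rewrite /H mul0r mul0r mulr0 subr0 arcd1 => /(ler_wpM2l (ltW (mulr_gt0 w0 r0))) B.
  apply: le_trans B _; rewrite le_eqVlt; apply/orP; left; apply/eqP.
  have F (r w y : R) : 0 < r -> 0 < w ->
    w * r * (2 * e * rho * y / w * (1 * 1 / (2 * r))) = e * rho * y.
    by move=> r1 w1; field; rewrite !gt_eqF.
  exact: F.
apply: (@covd_le x v h H Ux xv) => s /andP[s0 s1]; have d0 := arcd_gt0 sg2 s Ux.
  rewrite /H /h.
  have Dd : isD (fun s => arcd sg s x) s (2 * s * polu sg x).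
    rewrite /arcd; move: (polw sg x) (polu sg x) => w u.
    have D := is_deriveMr (is_deriveMr (isD_id s) (isD_id s)) (isD_cst u s 1).
    apply: is_derive_eq (is_deriveDr (isD_cst w s 1) D) _; ring.
  have D1 := is_deriveMr (is_deriveMr (isD_id s) (isD_id s))
    (@is_derive_invr R _ s 1 (fun s => arcd sg s x) _ (lt0r_neq0 d0) Dd).
  apply: is_derive_eq (is_deriveMr (isD_cst (2 * e * rho * eucl v / polw sg x) s 1) D1) _.
  have F (w u y : R) : 0 < w -> 0 < w + s ^+ 2 * u ->
      0 * (s * s / (w + s ^+ 2 * u)) + 2 * e * rho * y / w * ((1 * s + s * 1) / (w + s ^+ 2 * u)
        + s * s * (- (2 * s * u) / (w + s ^+ 2 * u) ^+ 2)) =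
      4 * e * rho * y * s / (w + s ^+ 2 * u) ^+ 2.
    by move=> w1 d1; field; rewrite !gt_eqF.
  exact: (F _ _ _ w0 d0).
have Ecs : eucl (arcs sg s x) = 2 * eucl x * rho / arcd sg s x.
  apply: eucl_eq; first by rewrite !mulr_ge0 ?invr_ge0 // ltW.
  rewrite dot_arcs // -rho2; move: (arcd _ _ _) (eucl x) d0 => d r d0.
  by field; rewrite gt_eqF.
have Ecv : eucl (arcv sg s x v) = 2 * s * eucl x * eucl v / arcd sg s x.
  apply: eucl_eq; first by rewrite !mulr_ge0 ?invr_ge0 // ltW.
  rewrite dot_arcv // -eucl_sqr; move: (arcd _ _ _) (eucl x) (eucl v) d0 => d r y d0.
  by field; rewrite gt_eqF.
have Er : eucl (arc sg s x) = eucl x.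
  by apply: eucl_eq; [exact: ltW|exact: dot_arc].
have B := Fe _ (arcs sg s x) (arcv sg s x v) Er.
rewrite -(ler_pM2l (exprn_gt0 2 r0)); apply: le_trans B _.
apply: le_trans (ler_wpM2l e0 (wedge_le _ _)) _.
rewrite Ecs Ecv /h le_eqVlt; apply/orP; left; apply/eqP.
have F (d r y : R) : 0 < d -> e * (2 * r * rho / d * (2 * s * r * y / d)) =
  r ^+ 2 * (4 * e * rho * y * s / d ^+ 2) by move=> d1; field; rewrite gt_eqF.
exact: F.
Qed.

Lemma covd_meridian x : polar x -> covd polT x (meridian sg x) = 0.
Proof.
move=> Ux; apply: eucl_eq0; apply/eqP; rewrite eq_le eucl_ge0 andbT.
have -> : (0 : R) = 0 - 0 by rewrite subrr.
apply: (@covd_le x (meridian sg x) (fun=> 0) (fun=> 0)) => //; first exact: dot_meridian.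
by move=> s _; rewrite arcv_meridian // curv2_parallel eucl0.
Qed.
End PolarTransport.

(** * The transition function of the polar gauges *)
Section Comparison.
Variable R : realType.
Local Notation isD f x d := (is_derive (x : R) (1 : R) f d).

Lemma derive_gt0_left (g : R -> R) (t l : R) : isD g t l -> 0 < l ->
  exists2 d : R, 0 < d & forall s, t - d < s < t -> g s < g t.
Proof.
move=> [dg El] l0.
have C : (h^-1 *: (g (h *: 1 + t) - g t)) @[h --> 0^'] --> (l : R) by rewrite -El; exact: dg.
have N : nbhs (l : R) [set y : R | 0 < y] by apply: open_nbhs_nbhs; split; [exact: open_gt|].
have := C _ N; rewrite /= /dnbhs /within /= => /nbhs_ballP[d /= d0 H].
exists d => // s /andP[s1 s2].
have := H (s - t); rewrite /ball /= sub0r normrN; have -> : `|s - t| < d.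
  by rewrite ltr_norml; apply/andP; split; lra.
have st : s - t != 0 by rewrite subr_eq0 lt_eqF.
move=> /(_ isT st); have -> : (s - t) *: 1 + t = s by rewrite [_ *: _]mulr1 subrK.
rewrite [_ *: _](_ : _ = (s - t)^-1 * (g s - g t)) // => P.
have : (s - t) * ((s - t)^-1 * (g s - g t)) < 0 by rewrite nmulr_rlt0 // subr_lt0.
by rewrite mulVKf // subr_lt0.
Qed.

(** At the first time with g <= 0 the value is 0 by continuity; a positive derivative there would
    make g negative just before. *)
Lemma barrier (g dg : R -> R) (T : R) : (forall s, isD g s (dg s)) -> 0 < g 0 ->
  (forall s, 0 <= s <= T -> g s = 0 -> 0 < dg s) -> forall s, 0 <= s <= T -> 0 < g s.
Proof.
move=> gD g0 H t /andP[t0 tT]; rewrite ltNge; apply/negP => gt.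
pose A := [set s : R | 0 <= s <= t /\ g s <= 0].
have At : A t by split=> //; rewrite t0 lexx.
have lbA : has_lbound A by exists 0 => s [/andP[]].
have hA : has_inf A by split; [exists t|].
pose t1 := inf A.
have t1t : t1 <= t by exact: ge_inf.
have t10 : 0 <= t1 by apply: lb_le_inf; [exists t|move=> s [/andP[]]].
have gpos s : 0 <= s < t1 -> 0 < g s.
  move=> /andP[s0 st]; rewrite ltNge; apply/negP => gs.
  have : A s by split=> //; rewrite s0 (le_trans (ltW st)).
  by move=> /(ge_inf lbA); rewrite leNgt st.
have cg s : {for s, continuous g} by exact: is_derive_continuous (gD s).
have g1 : g t1 <= 0.
  rewrite leNgt; apply/negP => p.
  have [d d0 D] := (continuousP_norm _ _).1 (cg t1) _ p.
  have [s As sd] := inf_adherent d0 hA.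
  have ts : t1 <= s by exact: ge_inf.
  have := D s; rewrite ger0_norm ?subr_ge0 // ltrBlDl => /(_ sd).
  by rewrite ltr_norml => /andP[+ _]; case: As => _; lra.
have t1p : 0 < t1 by rewrite lt_def t10 andbT; apply/negP => /eqP E; move: g1; rewrite E leNgt g0.
have g1' : g t1 = 0.
  apply/eqP; rewrite eq_le g1 /= leNgt; apply/negP => p; rewrite -oppr_gt0 in p.
  have [d d0 D] := (continuousP_norm _ _).1 (cg t1) _ p.
  pose s := Num.max 0 (t1 - d / 2).
  have s1 : s < t1 by rewrite gt_max t1p /=; lra.
  have s0 : 0 <= s by rewrite le_max lexx.
  have s2 : t1 - d / 2 <= s by rewrite le_max lexx orbT.
  have := D s; rewrite ler0_norm; last by lra.
  have -> : - (s - t1) < d by lra.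
  have := gpos s; rewrite s0 s1 => /(_ isT) gs /(_ isT).
  by rewrite ltr_norml => /andP[_]; lra.
have t1T : 0 <= t1 <= T by rewrite t10 (le_trans t1t).
have [d d0 D] := derive_gt0_left (gD t1) (H t1 t1T g1').
pose s := Num.max (t1 / 2) (t1 - d / 2).
have s1 : s < t1 by rewrite gt_max; apply/andP; split; lra.
have s0 : t1 / 2 <= s by rewrite le_max lexx.
have s2 : t1 - d / 2 <= s by rewrite le_max lexx orbT.
have := D s; rewrite s1 andbT; have -> : t1 - d < s by lra.
move=> /(_ isT); rewrite g1'; have := gpos s; rewrite s1 andbT.
by have -> : 0 <= s by [lra]; move=> /(_ isT); lra.
Qed.

(** A curve of speed b on the unit sphere stays within the angle b s of its start; b' > b and c > 0
    provide the strictness that [barrier] asks for. Where the product g of k 0 and k s equals the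
    cosine, the part of k 0 orthogonal to k s has length sin(b' s + c), so g decreases at rate at
    most b sin < b' sin. *)
Lemma unit_curve_dot n (k dk : R -> 'rV[R]_n) (b b' c T : R) :
  (forall s, isDV (s : R) (1 : R) k (dk s)) -> (forall s, dot (k s) (k s) = 1) ->
  (forall s, eucl (dk s) <= b) -> 0 <= b -> b < b' -> 0 < c -> b' * T + c < pi ->
  forall s, 0 <= s <= T -> cos (b' * s + c) < dot (k 0) (k s).
Proof.
move=> kD k1 kb b0 bb c0 bT s1 s1T.
have b'0 : 0 <= b' by exact: le_trans b0 (ltW bb).
have T0 : 0 <= T by case/andP: s1T; exact: le_trans.
move: s1 s1T; suff H : forall s, 0 <= s <= T -> 0 < dot (k 0) (k s) - cos (b' * s + c).
  by move=> s sT; rewrite -subr_gt0; exact: H.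
have phiD s : isD (fun s => b' * s + c) s b'.
  by apply: is_derive_eq (is_deriveDr (is_derive_linear b' s) (isD_cst c s 1)) _; rewrite addr0.
have D s : isD (fun s => dot (k 0) (k s) - cos (b' * s + c)) s
    (dot (k 0) (dk s) + b' * sin (b' * s + c)).
  have D1 := is_derive_dot (@isDV_cst R _ s 1 n (k 0)) (kD s).
  have D2 := @is_derive1_comp R cos (fun s => b' * s + c) s _ b' (is_derive_cos _) (phiD s).
  apply: is_derive_eq (is_deriveDr D1 (is_deriveNr D2)) _.
  by rewrite dot0l add0r mulNr opprK [X in _ = _ + X]mulrC.
apply: (barrier D); first rewrite mulr0 add0r k1 subr_gt0.
  rewrite -cos0; rewrite ltr_cos // in_itv /=; apply/andP; split; rewrite ?lexx ?pi_ge0 ?(ltW c0) //.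
  apply/ltW; apply: le_lt_trans bT; by rewrite lerDr mulr_ge0.
move=> s /andP[s0 sT] /eqP; rewrite subr_eq0 => /eqP E.
have sp : 0 < sin (b' * s + c).
  apply: sin_gt0_pi; apply/andP; split.
    by rewrite ltr_wpDl // mulr_ge0.
  by apply: le_lt_trans bT; rewrite lerD2r ler_wpM2l.
have kk : dot (dk s) (k s) = 0.
  have D1 := is_derive_dot (kD s) (kD s).
  have E1 : (fun y => dot (k y) (k y)) = (fun=> 1) by apply/funext => y; exact: k1.
  have := @derive_val _ _ _ _ _ _ _ D1; rewrite E1 derive_cst (dotC (k s)) => /esym; lra.
set g := dot (k 0) (k s) in E.
have Eg : dot (k 0) (dk s) = dot (k 0 - g *: k s) (dk s).
  by rewrite dotBl dotZl (dotC (k s)) kk mulr0 subr0.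
have eg : eucl (k 0 - g *: k s) = sin (b' * s + c).
  apply: eucl_eq; first exact: ltW.
  rewrite sin2cos2 -E dotBl !dotBr !dotZl !dotZr !k1 (dotC (k s)) -/g; ring.
have := cauchy_schwarz_norm (k 0 - g *: k s) (dk s); rewrite eg -Eg ler_norml => /andP[+ _].
have := ler_wpM2l (ltW sp) (kb s); have : sin (b' * s + c) * b < b' * sin (b' * s + c).
  by rewrite mulrC ltr_pM2r.
by lra.
Qed.

Lemma cosD_ge (s d : R) : 0 <= s <= pi / 2 -> `|d| <= s -> 2 * cos s ^+ 2 <= cos (s + d) + cos (s - d).
Proof.
move=> /andP[s0 s1] ds; rewrite cosD cosB.
have pp := @pi_gt0 R.
have c0 : 0 <= cos s by apply: cos_ge0_pihalf; apply/andP; split; lra.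
have : cos s <= cos d.
  rewrite -(cos_norm d) leNgt; apply/negP; rewrite ltr_cos ?in_itv /=; last first.
  - by rewrite normr_ge0 /=; lra.
  - by apply/andP; split; lra.
  by lra.
move=> cd; have := ler_wpM2l c0 cd; rewrite expr2.
by move: (cos s) (cos d) (sin s) (sin d) {c0 cd} => a b u v; lra.
Qed.
End Comparison.

(** * Polar gauges compared along meridians and on the equator *)

Section Comparing.
Variable R : realType.
Local Notation isD f x d := (is_derive (x : R) (1 : R) f d).
Implicit Types x v : quat R.

Lemma isDV_curve p m (O : set 'rV[R]_p) (f : 'rV[R]_p -> 'rV[R]_m) (c : R -> 'rV[R]_p) dc (t : R) :
  open O -> CnV 1 O (fun _ => f) -> O (c t) -> isDV (t : R) (1 : R) c dc ->
  isDV (t : R) (1 : R) (fun t => f (c t)) (dirpd f (c t) dc).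
Proof.
move=> oO Cf Oc cD j.
have D := @Cn_is_derive_curve R p 0 O (fun y => f y 0 j) c (fun i => dc 0 i) t oO (Cf j) Oc cD.
apply: is_derive_eq D _; rewrite /dirpd summxE; apply: eq_bigr => i _.
by rewrite [in RHS]mxE pdvE.
Qed.

Variable a : 'I_4 -> quat R -> quat R.
Local Notation U0 := [set x : quat R | x != 0].
Hypothesis Ca : forall i, CnV 2 U0 (fun _ => a i).
Hypothesis a_imag : forall i x, U0 x -> a i x 0 i0 = 0.

(* The gauges that are parallel along the meridians from the two poles and their
   transition function, which is constant along meridians ([KK_on_path]). *)
Definition PN : quat R -> quat R := polT a 1.
Definition PS : quat R -> quat R := polT a (-1).
Definition KK x : quat R := qmul (qconj (PS x)) (PN x).
Definition offaxis : set (quat R) := polar_set 1 `&` polar_set (-1).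

Let sgN : (1 : R) * 1 = 1. Proof. by rewrite mulr1. Qed.
Let sgS : (-1 : R) * -1 = 1. Proof. by rewrite mulrNN mulr1. Qed.

Lemma open_offaxis : open offaxis.
Proof. by apply: openI; exact: open_polar. Qed.

Lemma offaxis_spatial x : offaxis x <-> 0 < x 0 i1 ^+ 2 + x 0 i2 ^+ 2 + x 0 i3 ^+ 2.
Proof.
have Su : polu 1 x = polw (-1) x by rewrite /polw /polu mulN1r mul1r.
rewrite -(poluw sgN) Su; split; first by case=> h1 h2; exact: mulr_gt0.
have := polu_ge0 sgS x; have := polu_ge0 sgN x; rewrite Su.
have -> : polu (-1) x = polw 1 x by rewrite /polw /polu mulN1r opprK mul1r.
rewrite /offaxis /setI /polar_set /=; move: (polw 1 x) (polw (-1) x) => u w u0 w0 P.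
split; rewrite lt_def; first rewrite w0 andbT; last rewrite u0 andbT.
  by apply: contraTneq P => ->; rewrite mul0r ltxx.
by apply: contraTneq P => ->; rewrite mulr0 ltxx.
Qed.

Lemma C_PN : CnV 2 (polar_set 1) (fun _ => PN).
Proof. exact: C_polT. Qed.
Lemma C_PS : CnV 2 (polar_set (-1)) (fun _ => PS).
Proof. exact: C_polT. Qed.
Lemma PN_unit x : polar_set 1 x -> dot (PN x) (PN x) = 1.
Proof. exact: polT_unit. Qed.
Lemma PS_unit x : polar_set (-1) x -> dot (PS x) (PS x) = 1.
Proof. exact: polT_unit. Qed.

Lemma C_KK : CnV 2 offaxis (fun _ => KK).
Proof.
have H1 : CnV 2 offaxis (fun _ => PN).
  by move=> j; apply: Cn_sub (C_PN j) => x [].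
have H2 : CnV 2 offaxis (fun _ => PS).
  by move=> j; apply: Cn_sub (C_PS j) => x [].
exact: (CnV_qmul open_offaxis (CnV_qconj open_offaxis H2) H1).
Qed.

Lemma KK_unit x : offaxis x -> dot (KK x) (KK x) = 1.
Proof. by case=> h1 h2; rewrite dot_qmul dot_qconj PN_unit // PS_unit // mulr1. Qed.

Lemma qconj_sum I (r : seq I) (f : I -> quat R) : qconj (\sum_(i <- r) f i) = \sum_(i <- r) qconj (f i).
Proof.
elim: r => [|i r IH]; first by rewrite !big_nil; qring.
rewrite !big_cons -IH; move: (f i) (\sum_(_ <- _) _) => u w; qring.
Qed.

(** The connection form is imaginary, so its contributions to the two factors of conj(PS) PN cancel
    and only covariant derivatives remain. *)
Lemma dirpd_KK x v : offaxis x -> dirpd KK x v =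
  qmul (qconj (covd a PS x v)) (PN x) + qmul (qconj (PS x)) (covd a PN x v).
Proof.
move=> [h1 h2].
have E i : pdv i KK x = qmul (qconj (pdv i PS x)) (PN x) + qmul (qconj (PS x)) (pdv i PN x).
  apply: isDV_pdv; apply: isDV_qmul; last exact: (CnV_isDV i 0 C_PN h1).
  by apply: isDV_qconj; exact: (CnV_isDV i 0 C_PS h2).
have -> : dirpd KK x v = qmul (qconj (dirpd PS x v)) (PN x) + qmul (qconj (PS x)) (dirpd PN x v).
  rewrite /dirpd qconj_sum qmul_suml qmul_sumr -big_split /=; apply: eq_bigr => i _.
  rewrite E scalerDr qmulZr; congr (_ + _).
  by move: (pdv i PS x) (PN x) (v 0 i) => u w k; qring.
have U0x : U0 x by exact: polar_nz h1.
have ai := form_imag a_imag v U0x.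
rewrite /covd; move: (form a x v) (dirpd PS x v) (dirpd PN x v) (PS x) (PN x) ai => f u w p q ai.
have -> : qconj (u + qmul f p) = qconj u - qmul (qconj p) f.
  rewrite -[f in RHS]opprK -(qconj_imag ai); qring.
rewrite qmulDr qmulBl qmulA; move: (qmul (qmul (qconj p) f) q) (qmul _ q) (qmul _ w) => r s t.
by rewrite [t + r]addrC addrA subrK.
Qed.

Lemma dirpd_KK_le x v : offaxis x -> eucl (dirpd KK x v) <= eucl (covd a PS x v) + eucl (covd a PN x v).
Proof.
move=> Ox; rewrite dirpd_KK //; case: Ox => h1 h2; apply: le_trans (eucl_triangle _ _) _.
by rewrite !eucl_qmul !eucl_qconj (unit_eucl (PN_unit h1)) (unit_eucl (PS_unit h2)) mulr1 mul1r.
Qed.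

(** The meridian vectors belonging to the two poles are opposite to each other, and each gauge is
    covariantly constant along its own. *)
Lemma dirpd_KK_meridian x : offaxis x -> dirpd KK x (meridian 1 x) = 0.
Proof.
move=> Ox; rewrite dirpd_KK //; case: Ox => h1 h2.
have -> : covd a PN x (meridian 1 x) = 0 by exact: covd_meridian.
have E : meridian 1 x = -1 *: meridian (-1) x.
  rewrite /meridian !(mulrC (polw _ x)) !(mulrC (polu _ x)) !poluw //.
  by apply: quatP; rewrite !qE; ring.
rewrite E covdZ (_ : covd a PS x _ = 0); last exact: covd_meridian.
by move: (PN x) (PS x) => u w; qring.
Qed.

(** On the equator [polw], [polu] and [eucl] coincide for either pole, so [covd_polT_le] gives e for
    each gauge. This factor 2 is the reason for the threshold 1/2. *)
Lemma KK_equator_le x v e : offaxis x -> x 0 i0 = 0 -> dot x v = 0 -> eucl v = eucl x -> 0 <= e ->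
  curv_le a e (eucl x) -> eucl (dirpd KK x v) <= 2 * e.
Proof.
move=> Ox x0 xv vx e0 Fe; apply: le_trans (dirpd_KK_le v Ox) _; case: Ox => h1 h2.
have r0 := eucl_gt0 (polar_nz h1).
have W t : polw t x = eucl x by rewrite /polw x0 mulr0 addr0.
have U t : polu t x = eucl x by rewrite /polu x0 mulr0 subr0.
have H t : (t : R) * t = 1 -> polar_set t x -> eucl (covd a (polT a t) x v) <= e.
  move=> t2 h; have := covd_polT_le Ca a_imag t2 h xv e0 Fe.
  rewrite W U vx -expr2 sqrtr_sqr ger0_norm ?eucl_ge0 // -mulrA -expr2 mulrC.
  by rewrite ler_pM2r // exprn_gt0.
have -> : 2 * e = e + e by ring.
exact: lerD (H (-1) sgS h2) (H 1 sgN h1).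
Qed.

Lemma spatial_mkq (c0 c1 c2 c3 : R) : 0 < c1 ^+ 2 + c2 ^+ 2 + c3 ^+ 2 -> offaxis (mkq c0 c1 c2 c3).
Proof. by move=> h; apply/offaxis_spatial; rewrite !mkqE. Qed.

Lemma spatial_scale (k c1 c2 c3 : R) : 0 < k -> 0 < c1 ^+ 2 + c2 ^+ 2 + c3 ^+ 2 ->
  0 < (k * c1) ^+ 2 + (k * c2) ^+ 2 + (k * c3) ^+ 2.
Proof. by move=> k0 c0; rewrite !exprMn -!mulrDr mulr_gt0 // exprn_gt0. Qed.

Definition equator x : quat R :=
  let k := eucl x / Num.sqrt (x 0 i1 ^+ 2 + x 0 i2 ^+ 2 + x 0 i3 ^+ 2) in
  mkq 0 (k * x 0 i1) (k * x 0 i2) (k * x 0 i3).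

Lemma KK_equator x : offaxis x -> KK x = KK (equator x).
Proof.
move=> Ox; have := Ox => /offaxis_spatial; set q := _ + _ + _ => q0.
have x0 : x != 0 by case: Ox => /polar_nz.
(* The path y multiplies the polar coordinate of x by s and rescales to the radius of x: it runs
   along the meridian from the equator (s = 0) to x (s = 1), and K is constant on it. *)
pose p (s : R) := s * s * x 0 i0 ^+ 2 + q.
have p0 s : 0 < p s by rewrite ltr_wpDl // mulr_ge0 ?sqr_ge0 // -expr2 sqr_ge0.
pose n s := Num.sqrt (p s).
have n0 s : 0 < n s by rewrite sqrtr_gt0.
have n2 s : n s ^+ 2 = p s by rewrite sqr_sqrtr // ltW.
pose k s := eucl x / n s.
pose y s := mkq (k s * (s * x 0 i0)) (k s * x 0 i1) (k s * x 0 i2) (k s * x 0 i3).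
have r0 := eucl_gt0 x0.
have k0 s : 0 < k s by rewrite divr_gt0.
have Oy s : offaxis (y s).
  by apply: spatial_mkq; exact: spatial_scale.
have pD s : isD p s (2 * s * x 0 i0 ^+ 2).
  have D := is_deriveMr (is_deriveMr (isD_id s) (isD_id s)) (isD_cst (x 0 i0 ^+ 2) s 1).
  by apply: is_derive_eq (is_deriveDr D (isD_cst q s 1)) _; move: (x 0 i0) => z; ring.
have nD s : isD n s (s * x 0 i0 ^+ 2 / n s).
  have D := @is_derive1_comp R Num.sqrt p s _ _ (is_derive1_sqrt (p0 s)) (pD s).
  apply: is_derive_eq D _; rewrite -/(n s); move: (n s) (n0 s) (x 0 i0) => w w0 z.
  by field; rewrite gt_eqF.
have kD s : isD k s (- (eucl x * s * x 0 i0 ^+ 2 / n s ^+ 3)).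
  have D := is_deriveMr (isD_cst (eucl x) s 1) (@is_derive_invr R _ s 1 n _ (lt0r_neq0 (n0 s)) (nD s)).
  apply: is_derive_eq D _; move: (n s) (n0 s) (x 0 i0) (eucl x) => w w0 z r.
  by field; rewrite gt_eqF.
have yD s : isDV (s : R) (1 : R) y ((- (x 0 i0 / (eucl x * n s))) *: meridian 1 (y s)).
  have Di i := is_deriveMr (kD s) (isD_cst (x 0 i) s 1).
  have D0 := is_deriveMr (kD s) (is_deriveMr (isD_id s) (isD_cst (x 0 i0) s 1)).
  apply: isDV_eq (isDV_mkq D0 (Di i1) (Di i2) (Di i3)) _.
  have Eq : q = n s ^+ 2 - s * s * x 0 i0 ^+ 2 by rewrite n2 /p; ring.
  rewrite /meridian poluw // /y !mkqE !exprMn -!mulrDr -/q {1}Eq /k.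
  apply: quatP; rewrite !qE; move: (n s) (n0 s) (x 0 i0) (x 0 _) (eucl x) r0 => w w0 z z' r r0.
  - by field; rewrite !gt_eqF.
  - by field; rewrite !gt_eqF.
  - by field; rewrite !gt_eqF.
  - by field; rewrite !gt_eqF.
have KD s j : isD (fun s => KK (y s) 0 j) s 0.
  have CK : CnV 1 offaxis (fun _ => KK) by exact: CnV_le C_KK.
  have D := isDV_curve open_offaxis CK (Oy s) (yD s).
  by apply: is_derive_eq (D j) _; rewrite dirpdZ dirpd_KK_meridian // scaler0 mxE.
have E : KK (y 1) = KK (y 0) by apply/rowP => j; exact: (derive0_cst (KD ^~ j) 1 0).
have k1 : k 1 = 1.
  have n1 : n 1 = eucl x by rewrite /n /p mul1r mul1r /q /eucl dot4E -!expr2 !addrA.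
  by rewrite /k n1; exact: divff (lt0r_neq0 r0).
have y1 : y 1 = x by rewrite /y k1; apply: quatP; rewrite mkqE !mul1r.
have y0 : y 0 = equator x.
  have p00 : p 0 = q by rewrite /p !mul0r add0r.
  by rewrite /y /equator -/q -p00 -/(n 0) -/(k 0) mul0r mulr0.
by rewrite -y0 -E y1.
Qed.

(** A half great circle of the equator from [axis1 r] at s = 0 to [axis1 (- r)] at s = pi, passing
    through (0, 0, r f2, r f3). *)
Definition eqpath (r f2 f3 s : R) : quat R := mkq 0 (r * cos s) (r * sin s * f2) (r * sin s * f3).

Section Path.
Variables (r f2 f3 e : R).
Hypotheses (r0 : 0 < r) (f1 : f2 ^+ 2 + f3 ^+ 2 = 1) (e0 : 0 <= e) (Fe : curv_le a e r).
Local Notation y := (eqpath r f2 f3).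

Lemma dot_eqpath s : dot (y s) (y s) = r ^+ 2.
Proof.
rewrite dot4E !mkqE.
have -> (c t : R) : 0 * 0 + r * c * (r * c) + r * t * f2 * (r * t * f2) + r * t * f3 * (r * t * f3) =
  r ^+ 2 * (c ^+ 2 + t ^+ 2 * (f2 ^+ 2 + f3 ^+ 2)) by ring.
by rewrite f1 mulr1 cos2Dsin2 mulr1.
Qed.

Lemma eucl_eqpath s : eucl (y s) = r.
Proof. by apply: eucl_eq; [exact: ltW|exact: dot_eqpath]. Qed.

Lemma eqpath_offaxis s : offaxis (y s).
Proof.
have := dot_eqpath s; rewrite dot4E /eqpath !mkqE mul0r add0r -!expr2 => E.
by apply: spatial_mkq; rewrite E exprn_gt0.
Qed.

Definition deqpath (s : R) : quat R := mkq 0 (r * - sin s) (r * cos s * f2) (r * cos s * f3).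

Lemma isDV_eqpath s : isDV (s : R) (1 : R) y (deqpath s).
Proof.
have Dr := isD_cst r s 1.
have Dc := is_deriveMr Dr (is_derive_cos s); have Ds := is_deriveMr Dr (is_derive_sin s).
apply: isDV_eq (isDV_mkq (isD_cst 0 s 1) Dc (is_deriveMr Ds (isD_cst f2 s 1))
  (is_deriveMr Ds (isD_cst f3 s 1))) _.
by rewrite /deqpath !mul0r !add0r !mulr0 !addr0.
Qed.

Lemma KK_path_le s : eucl (dirpd KK (y s) (deqpath s)) <= 2 * e.
Proof.
apply: KK_equator_le => //; rewrite ?eucl_eqpath //; first exact: eqpath_offaxis.
- by rewrite mkqE.
- rewrite dot4E !mkqE.
  have -> (c t : R) : 0 * 0 + r * c * (r * - t) + r * t * f2 * (r * c * f2) + r * t * f3 * (r * c * f3) =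
    r ^+ 2 * c * t * ((f2 ^+ 2 + f3 ^+ 2) - 1) by ring.
  by rewrite f1 subrr mulr0.
apply: eucl_eq; first exact: ltW.
rewrite dot4E !mkqE.
have -> (c t : R) : 0 * 0 + r * - t * (r * - t) + r * c * f2 * (r * c * f2) + r * c * f3 * (r * c * f3) =
  r ^+ 2 * (t ^+ 2 + c ^+ 2 * (f2 ^+ 2 + f3 ^+ 2)) by ring.
by rewrite f1 mulr1 addrC cos2Dsin2 mulr1.
Qed.

Lemma isDV_KK_path s : isDV (s : R) (1 : R) (fun s => KK (y s)) (dirpd KK (y s) (deqpath s)).
Proof.
have CK : CnV 1 offaxis (fun _ => KK) by exact: CnV_le C_KK.
exact: isDV_curve open_offaxis CK (eqpath_offaxis s) (isDV_eqpath s).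
Qed.

Lemma KK_path_dist s t : s <= t -> eucl (KK (y t) - KK (y s)) <= 2 * e * (t - s).
Proof.
move=> st; rewrite mulrBr.
apply: (eucl_mvt st (fun u _ => isDV_KK_path u) (g := fun s => 2 * e * s) (dg := fun=> 2 * e)).
  by move=> u _; exact: is_derive_linear.
by move=> u _; exact: KK_path_le.
Qed.

(** The comparison is made from each end of the half circle, the second time along the reversed
    path. *)
Lemma KK_path_dot b c s : 2 * e < b -> 0 < c -> b * pi + c < pi -> 0 <= s <= pi ->
  cos (b * s + c) + cos (b * (pi - s) + c) <= dot (KK (y s)) (KK (y 0) + KK (y pi)).
Proof.
move=> eb c0 bp sp; have ee : 0 <= 2 * e by rewrite mulr_ge0.
rewrite dotDr; apply: lerD.
  rewrite dotC; apply: ltW.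
  apply: (unit_curve_dot isDV_KK_path _ KK_path_le ee eb c0 bp sp).
  by move=> u; apply: KK_unit; exact: eqpath_offaxis.
have sp' : 0 <= pi - s <= pi by case/andP: sp => s0 s1; apply/andP; split; lra.
have D u : isDV (u : R) (1 : R) (fun u => KK (y (pi - u))) (- dirpd KK (y (pi - u)) (deqpath (pi - u))).
  move=> j; have Dp : isD (fun u => pi - u) u (-1).
    by apply: is_derive_eq (is_deriveDr (isD_cst pi u 1) (is_deriveNr (isD_id u))) (add0r _).
  have D := @is_derive1_comp R (fun u => KK (y u) 0 j) (fun u => pi - u) u _ _ (isDV_KK_path (pi - u) j) Dp.
  by apply: is_derive_eq D _; rewrite mulrN1 [in RHS]mxE.
have := unit_curve_dot D _ _ ee eb c0 bp sp'.
rewrite subr0 opprB addrCA subrr addr0 dotC => H; apply: ltW; apply: H.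
  by move=> u; apply: KK_unit; exact: eqpath_offaxis.
by move=> u; rewrite euclN; exact: KK_path_le.
Qed.
End Path.

Definition axis1 (k : R) : quat R := mkq 0 k 0 0.

Lemma eqpath0 r f2 f3 : eqpath r f2 f3 0 = axis1 r.
Proof. by rewrite /eqpath cos0 sin0 mulr0 !mul0r mulr1. Qed.

Lemma eqpath_pi r f2 f3 : eqpath r f2 f3 pi = axis1 (- r).
Proof. by rewrite /eqpath cospi sinpi mulr0 !mul0r mulrN1. Qed.

(** A point of the equator lies on a half circle between the two ends of the first axis; s is its
    angle from that axis and (f2, f3) the direction of its remaining coordinates. *)
Lemma KK_on_path x : offaxis x -> exists f2 f3 s, [/\ f2 ^+ 2 + f3 ^+ 2 = 1, 0 <= s <= pi &
  KK x = KK (eqpath (eucl x) f2 f3 s)].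
Proof.
move=> Ox; rewrite KK_equator // /equator; have := Ox => /offaxis_spatial.
have r0 : 0 < eucl x by apply: eucl_gt0; case: Ox => /polar_nz.
move: KK (x 0 i1) (x 0 i2) (x 0 i3) (eucl x) r0 => K c1 c2 c3 r r0 q0 {Ox x}.
have := sqr_sqrtr (ltW q0); have : 0 < Num.sqrt (c1 ^+ 2 + c2 ^+ 2 + c3 ^+ 2) by rewrite sqrtr_gt0.
move: (Num.sqrt _) => q qp q2.
have E c : r / q * c = r * (c / q) by rewrite -mulrA [q^-1 * _]mulrC.
rewrite !E; have : (c1 / q) ^+ 2 + (c2 / q) ^+ 2 + (c3 / q) ^+ 2 = 1.
  by rewrite !expr_div_n -!mulrDl -q2 divff // expf_neq0 // gt_eqF.
move: (c1 / q) (c2 / q) (c3 / q) => {E c1 c2 c3 q2 q0 qp q} c1 c2 c3 c1E.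
have c2p : 0 <= c2 ^+ 2 + c3 ^+ 2 by rewrite addr_ge0 ?sqr_ge0.
have cI : -1 <= c1 <= 1.
  by rewrite -ler_norml -ler_sqr ?nnegrE // real_normK ?num_real // expr1n; lra.
have sE : sin (acos c1) ^+ 2 = c2 ^+ 2 + c3 ^+ 2.
  by rewrite sin2cos2 acosK ?in_itv //=; lra.
have sI : 0 <= acos c1 <= pi by rewrite acos_ge0 ?acos_lepi.
case: (eqVneq (sin (acos c1)) 0) => [s0|s0].
  (* The point is one of the two ends, which lie on all half circles; any unit (f2, f3) will do. *)
  exists 1, 0, (acos c1); split=> //; first by rewrite expr0n expr1n addr0.
  rewrite /eqpath acosK ?in_itv // s0 mulr0 !mul0r.
  have := sE; rewrite s0 expr0n /= => /esym/eqP; rewrite paddr_eq0 ?sqr_ge0 // !sqrf_eq0.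
  by move=> /andP[/eqP -> /eqP ->]; rewrite !mulr0.
exists (c2 / sin (acos c1)), (c3 / sin (acos c1)), (acos c1); split=> //.
  by rewrite !expr_div_n -mulrDl -sE divff // expf_neq0.
rewrite /eqpath acosK ?in_itv //; move: (sin _) s0 => t t0.
have E u : r * t * (u / t) = r * u by field.
by rewrite !E.
Qed.

Lemma KK_axis_dist x e : offaxis x -> 0 <= e -> curv_le a e (eucl x) ->
  eucl (KK x - KK (axis1 (eucl x))) <= 8 * e /\ eucl (KK x - KK (axis1 (- eucl x))) <= 8 * e.
Proof.
move=> Ox e0 Fe; have r0 : 0 < eucl x by apply: eucl_gt0; case: Ox => /polar_nz.
have [f2 [f3 [s [f1 /andP[s0 s1] ->]]]] := KK_on_path Ox.
(* The length of the half circle is pi <= 4, hence 8 e = 2 e * 4. *)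
have H u : 0 <= u <= pi -> 2 * e * u <= 8 * e.
  move=> /andP[u0 u1]; have p4 : pi <= 4 :> R by have := (@pihalf_02_cos_pihalf R).1 => /andP[]; lra.
  have -> : 8 * e = 2 * e * 4 by ring.
  by rewrite ler_wpM2l ?mulr_ge0 // (le_trans u1).
split.
  rewrite -(eqpath0 _ f2 f3); apply: le_trans (KK_path_dist r0 f1 e0 Fe s0) _.
  by apply: H; rewrite subr0 s0.
rewrite -(eqpath_pi _ f2 f3) -euclN opprB.
apply: le_trans (KK_path_dist r0 f1 e0 Fe s1) _.
by apply: H; apply/andP; split; lra.
Qed.

Lemma KK_axis_dot x e b : offaxis x -> 0 <= e -> curv_le a e (eucl x) -> 2 * e < b -> b < 1 ->
  2 * cos ((1 + b) * pi / 4) ^+ 2 <= dot (KK x) (KK (axis1 (eucl x)) + KK (axis1 (- eucl x))).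
Proof.
move=> Ox e0 Fe eb b1; have r0 : 0 < eucl x by apply: eucl_gt0; case: Ox => /polar_nz.
have [f2 [f3 [s [f1 sI ->]]]] := KK_on_path Ox.
have pp := @pi_gt0 R.
have b0 : 0 <= b by apply: le_trans (ltW eb); rewrite mulr_ge0.
(* This c satisfies b pi + c < pi and places the two angles b s + c and b (pi - s) + c symmetrically
   about (1 + b) pi / 4, which is less than pi / 2. *)
pose c : R := (1 - b) * pi / 4.
have bp : b * pi < 1 * pi by rewrite ltr_pM2r.
have bp0 : 0 <= b * pi by rewrite mulr_ge0 // ltW.
have c0 : 0 < c by rewrite /c; lra.
have bc : b * pi + c < pi by rewrite /c; lra.
have := KK_path_dot r0 f1 e0 Fe eb c0 bc sI; rewrite eqpath0 eqpath_pi; apply: le_trans.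
have -> : b * s + c = (1 + b) * pi / 4 + b * (s - pi / 2) by rewrite /c; field.
have -> : b * (pi - s) + c = (1 + b) * pi / 4 - b * (s - pi / 2) by rewrite /c; field.
apply: cosD_ge; first by apply/andP; split; lra.
case/andP: sI => s0 s1; rewrite normrM ger0_norm //.
apply: (@le_trans _ _ (b * (pi / 2))); last by lra.
by rewrite ler_wpM2l // ler_norml; apply/andP; split; lra.
Qed.
End Comparing.

(** * A nonvanishing quaternionic gauge *)
#[global] Opaque polT.
Section Powers.
Variable R : realType.
Local Notation isD f x d := (is_derive (x : R) (1 : R) f d).

Lemma is_derive_lineP (V : normedModType R) (f : V -> R) (x v : V) l :
  is_derive x v f l <-> isD (fun t => f (x + t *: v)) 0 l.
Proof.
have E : (fun h : R => h^-1 *: ((f \o shift x) (h *: v) - f x)) =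
    (fun h : R => h^-1 *: (((fun t => f (x + t *: v)) \o shift 0) (h *: 1) - f (x + 0 *: v))).
  apply/funext => h; rewrite /= scale0r !addr0 [h *: 1]mulr1.
  by rewrite [h *: v + x]addrC.
by split=> [[d1 d2]|[d1 d2]]; apply: DeriveDef; move: d1 d2; rewrite /derivable /derive E.
Qed.

Lemma is_derive_comp_dir (V : normedModType R) (k : V -> R) (f : R -> R) (x v : V) dk df :
  is_derive x v k dk -> isD f (k x) df -> is_derive x v (fun y => f (k y)) (df * dk).
Proof.
move=> /is_derive_lineP kD fD; apply/is_derive_lineP.
have E : k x = k (x + 0 *: v) by rewrite scale0r addr0.
rewrite E in fD.
exact: (@is_derive1_comp R f (fun t => k (x + t *: v)) 0 _ _ fD kD).
Qed.

(* [pospow n s] is max(0, s)^(n+1) / (n+1)!. *)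
Fixpoint pospow (n : nat) : R -> R :=
  if n is n'.+1 then prim (pospow n') else Num.max 0.

Lemma pospow_spec n : [/\ continuous (pospow n), (forall s, s <= 0 -> pospow n s = 0),
  (forall s, 0 < s -> 0 < pospow n s) & (forall s t, s <= t -> pospow n s <= pospow n t)].
Proof.
elim: n => [|n [c n0 np nm]] /=.
  have E : (Num.max 0 : R -> R) = (fun s => (s + `|s|) / 2).
    apply/funext => s; case: (lerP 0 s) => h; first by rewrite ger0_norm //; field.
    by rewrite ltr0_norm //; field.
  split=> [|s s0|s s0|s t st].
  - rewrite E => s; apply: cvgM; last exact: cvg_cst.
    by apply: cvgD; [exact: cvg_id|exact: norm_continuous].
  - by apply/max_idPl.
  - by rewrite lt_max s0 orbT.
  - by rewrite ge_max le_max lexx /= le_max st orbT.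
have [P0 PD] := prim_spec c.
have nn s : 0 <= pospow n s.
  by case: (lerP s 0) => [/n0 ->|/np/ltW].
have mono s t : s <= t -> prim (pospow n) s <= prim (pospow n) t.
  move=> st; rewrite -subr_ge0; have [u _ ->] := mvt st (fun s _ => PD s).
  by rewrite mulr_ge0 // subr_ge0.
split=> //.
- by move=> s; exact: is_derive_continuous (PD s).
- move=> s s0; have [u /andP[_ u0]] := mvt s0 (fun s _ => PD s).
  by rewrite n0 // mul0r P0 sub0r => /eqP; rewrite oppr_eq0 => /eqP.
- move=> s s0; apply: (@lt_le_trans _ _ (prim (pospow n) s - prim (pospow n) (s / 2))).
    have h : s / 2 <= s by lra.
    have [u /andP[u0 _] ->] := mvt h (fun s _ => PD s).
    by rewrite mulr_gt0 ?np //; lra.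
  by rewrite lerBlDr lerDl -P0; apply: mono; lra.
Qed.

Lemma is_derive_pospow n s : isD (pospow n.+1) s (pospow n s).
Proof. by have [c _ _ _] := pospow_spec n; have [_ H] := prim_spec c; exact: H. Qed.

Lemma pospow_eq0 n s : s <= 0 -> pospow n s = 0.
Proof. by have [_ H _ _] := pospow_spec n; exact: H. Qed.

Lemma pospow_gt0 n s : 0 < s -> 0 < pospow n s.
Proof. by have [_ _ H _] := pospow_spec n; exact: H. Qed.

Lemma pospow_ge0 n s : 0 <= pospow n s.
Proof. by case: (lerP s 0) => [/(pospow_eq0 n) ->|/(pospow_gt0 n)/ltW]. Qed.

Lemma pospow_le n s t : s <= t -> pospow n s <= pospow n t.
Proof. by have [_ _ _ H] := pospow_spec n; exact: H. Qed.

Lemma Cn_pospow n p (U : set 'rV[R]_p) k : open U -> Cn n U k ->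
  Cn n U (fun s x => pospow n (k s x)).
Proof.
move=> oU; elim: n k => [|n IH] k Ck.
  apply: jcont_Cn => s x Ux.
  apply: (@continuous_comp _ _ _ (fun p : R * 'rV[R]_p => k p.1 p.2)); first exact: Cn_jcont Ck s x Ux.
  by have [c _ _ _] := pospow_spec 0; exact: c.
apply: (@Cn_comp1 R p n U setT (pospow n.+1) (pospow n) k oU) => //.
  by move=> y _; exact: is_derive_pospow.
by apply: IH; exact: Cn_le (leqnSn n) Ck.
Qed.

(** The ramp [pospow 2] is a multiple of the cube of the positive part, hence twice continuously
    differentiable, and so is the step. *)
Definition step (s : R) : R := pospow 2 s / (pospow 2 s + pospow 2 (1 - s)).

Lemma step_den s : 0 < pospow 2 s + pospow 2 (1 - s).
Proof.
case: (lerP s 0) => s0; first by rewrite ltr_wpDl ?pospow_ge0 // pospow_gt0; lra.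
by rewrite ltr_pwDl ?pospow_ge0 // pospow_gt0.
Qed.

Lemma step0 s : s <= 0 -> step s = 0.
Proof. by move=> s0; rewrite /step pospow_eq0 // mul0r. Qed.

Lemma step1 s : 1 <= s -> step s = 1.
Proof.
move=> s1; have := step_den s; rewrite /step (@pospow_eq0 2 (1 - s)) ?subr_le0 // addr0 => h.
by rewrite divff // gt_eqF.
Qed.

Lemma step_ge0 s : 0 <= step s.
Proof. by rewrite divr_ge0 ?pospow_ge0 // ltW // step_den. Qed.

Lemma step_le1 s : step s <= 1.
Proof. by rewrite ler_pdivrMr ?step_den // mul1r lerDl pospow_ge0. Qed.

Definition dstep (s : R) : R :=
  (pospow 1 s * (pospow 2 s + pospow 2 (1 - s)) - pospow 2 s * (pospow 1 s - pospow 1 (1 - s)))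
  / (pospow 2 s + pospow 2 (1 - s)) ^+ 2.

Lemma is_derive_step s : isD step s (dstep s).
Proof.
have D1 := is_derive_pospow 1 s.
have D2 : isD (fun s => pospow 2 (1 - s)) s (- pospow 1 (1 - s)).
  have Dl : isD (fun s => 1 - s) s (-1).
    by apply: is_derive_eq (is_deriveDr (isD_cst 1 s 1) (is_deriveNr (isD_id s))) (add0r _).
  apply: is_derive_eq (@is_derive1_comp R (pospow 2) (fun s => 1 - s) s _ _ (is_derive_pospow 1 _) Dl) _.
  by rewrite mulrN1.
have D3 := is_deriveMr D1 (@is_derive_invr R _ s 1 (fun s => pospow 2 s + pospow 2 (1 - s)) _
  (lt0r_neq0 (step_den s)) (is_deriveDr D1 D2)).
apply: is_derive_eq D3 _; rewrite /dstep; move: (step_den s).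
move: (pospow 2 s) (pospow 2 (1 - s)) (pospow 1 s) (pospow 1 (1 - s)) => a b c d ab.
by field; rewrite gt_eqF.
Qed.

(** The derivative is continuous and vanishes outside [[0, 1]]. It is packed into a row with one
    entry so that [ex_eucl_bound] applies. *)
Lemma dstep_bound : exists2 M, 0 < M & forall s, `|dstep s| <= M.
Proof.
have C : contq (fun s => (\row_(_ < 1) dstep s)).
  have CX : Cn 1 [set: 'rV[R]_1] (fun _ x => x 0 0) by exact: Cn_coord.
  have C1 : Cn 1 [set: 'rV[R]_1] (fun s _ => s) by apply: Cn_time => s; exact: cvg_id.
  have Cs n : Cn 0 [set: 'rV[R]_1] (fun s _ => pospow n s).
    by apply: Cn_time; have [] := pospow_spec n.
  have Ct n : Cn 0 [set: 'rV[R]_1] (fun s _ => pospow n (1 - s)).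
    apply: Cn_time => s; apply: (@continuous_comp _ _ _ (fun s : R => 1 - s) (pospow n)); last by have [c _ _ _] := pospow_spec n; exact: c.
    by apply: cvgB; [exact: cvg_cst|exact: cvg_id].
  have Ci : Cn 0 [set: 'rV[R]_1] (fun s _ => (pospow 2 s + pospow 2 (1 - s))^-1).
    apply: Cn_inv; [exact: openT|by move=> s x _; rewrite gt_eqF // step_den|].
    exact: Cn_add openT (Cs 2) (Ct 2).
  move=> j; have H : Cn 0 [set: 'rV[R]_1] (fun s _ => dstep s).
    apply: (@Cn_eq R 1 0 _ (fun s _ => (pospow 1 s * (pospow 2 s + pospow 2 (1 - s))
      - pospow 2 s * (pospow 1 s - pospow 1 (1 - s))) * ((pospow 2 s + pospow 2 (1 - s))^-1 *
      (pospow 2 s + pospow 2 (1 - s))^-1)) _ openT) => [s x _|].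
      by rewrite /dstep expr2 invfM.
    have S1 := Cs 1%N; have S2 := Cs 2%N; have T1 := Ct 1%N; have T2 := Ct 2%N.
    apply: Cn_mul openT _ (Cn_mul openT Ci Ci).
    apply: Cn_sub2 openT (Cn_mul openT S1 (Cn_add openT S2 T2)) _.
    exact: Cn_mul openT S2 (Cn_sub2 openT S1 T1).
  rewrite (_ : (fun s => _) = dstep); last by apply/funext => s; rewrite mxE.
  exact: (@jcont_time R 1 setT (fun s _ => dstep s) 0 (Cn_jcont H)).
have [M M0 B] := ex_eucl_bound 1 C; exists M => // s.
case: (lerP `|s| 1) => s1.
  apply: le_trans (B s s1); have := eucl_coord (\row_(_ < 1) dstep s) 0.
  by rewrite mxE.
suff -> : dstep s = 0 by rewrite normr0 ltW.
rewrite /dstep; case: (lerP s 0) => s0.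
  by rewrite (@pospow_eq0 2 s) // (@pospow_eq0 1 s) // !mul0r subrr mul0r.
rewrite ger0_norm in s1; last exact: ltW.
rewrite (@pospow_eq0 2 (1 - s)) ?(@pospow_eq0 1 (1 - s)) //; try lra.
Qed.

Lemma Cn_step2 p (U : set 'rV[R]_p) k : open U -> Cn 2 U k -> Cn 2 U (fun s x => step (k s x)).
Proof.
move=> oU Ck; have H1 := Cn_pospow oU Ck.
have H2 := Cn_pospow oU (Cn_sub2 oU (Cn_cst 2 U 1) Ck).
have Ci := Cn_inv oU (fun s x _ => lt0r_neq0 (step_den (k s x))) (Cn_add oU H1 H2).
exact: Cn_mul oU H1 Ci.
Qed.
Lemma CnV_isDV_dir p m (U : set 'rV[R]_p) (f : 'rV[R]_p -> 'rV[R]_m) (x v : 'rV[R]_p) : open U ->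
  CnV 1 U (fun _ => f) -> U x -> isDV x v f (dirpd f x v).
Proof.
move=> oU Cf Ux j; have [d E] := @Cn_differentiable R p 0 U (fun _ y => f y 0 j) 0 x oU (Cf j) Ux.
have D : is_derive x v (fun y => f y 0 j) ('D_v (fun y => f y 0 j) x).
  by apply: DeriveDef => //; exact: diff_derivable.
apply: is_derive_eq D _; rewrite E /dirpd summxE; apply: eq_bigr => i _.
by rewrite [in RHS]mxE pdvE.
Qed.

Lemma dirpd_near p m (U : set 'rV[R]_p) (f g : 'rV[R]_p -> 'rV[R]_m) (x v : 'rV[R]_p) : open U -> U x ->
  (forall y, U y -> f y = g y) -> dirpd f x v = dirpd g x v.
Proof.
move=> oU Ux fg; apply: eq_bigr => i _; congr (_ *: _); apply/rowP => j; rewrite !pdvE.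
by apply: (pd_eq i oU Ux) => y Uy; rewrite fg.
Qed.

End Powers.

(** * Interpolation of the two polar gauges *)

Section Gauge.
Variable R : realType.
Implicit Types x v : quat R.
Variable a : 'I_4 -> quat R -> quat R.
Local Notation U0 := [set x : quat R | x != 0].
Hypothesis Ca : forall i, CnV 2 U0 (fun _ => a i).
Hypothesis a_imag : forall i x, U0 x -> a i x 0 i0 = 0.
Local Notation PN := (PN a).
Local Notation PS := (PS a).
Local Notation KK := (KK a).

(* [psi] is the north gauge for lat x >= 1 and the south gauge times [gm] for
   lat x <= 0; [gm], the midpoint of two opposite equatorial values of [KK], depends
   on |x| only.  In between [psi] is [PS] times a convex combination of [KK] and [gm],
   which have positive scalar product. *)
Definition lat x : R := x 0 i0 / eucl x + 2^-1.
Definition wN x : R := step (lat x).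
Definition gm x : quat R := 2^-1 *: (KK (axis1 (eucl x)) + KK (axis1 (- eucl x))).
Definition psi x : quat R := wN x *: PN x + (1 - wN x) *: qmul (PS x) (gm x).

Let oU0 := @open_nonzero R 4.

Lemma Cn_lat m : Cn m U0 (fun _ x => lat x).
Proof.
have H := Cn_eucl m oU0 (fun _ h => h).
have D := Cn_inv oU0 (fun s x h => lt0r_neq0 (eucl_gt0 h)) H.
exact: Cn_add oU0 (Cn_mul oU0 (Cn_coord _ _ _) D) (Cn_cst _ _ _).
Qed.

Lemma axis1_offaxis (k : R) : k != 0 -> offaxis (axis1 k).
Proof.
move=> k0; apply: spatial_mkq; rewrite expr0n /= !addr0 lt_def sqr_ge0 andbT.
by rewrite sqrf_eq0.
Qed.

Lemma C_gm : CnV 2 U0 (fun _ => gm).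
Proof.
have H := Cn_eucl 2 oU0 (fun _ h => h).
have G sg : sg != 0 -> CnV 2 U0 (fun _ x => KK (axis1 (sg * eucl x))).
  move=> sg0 j; apply: (@Cn_comp R 4 4 U0 (@offaxis R) (fun _ x => axis1 (sg * eucl x)) oU0 (@open_offaxis R)
    _ 2 (fun x => KK x 0 j) (C_KK Ca a_imag j)).
    move=> s x x0; apply: axis1_offaxis; rewrite mulf_neq0 // gt_eqF //; exact: eucl_gt0.
  rewrite /axis1; exact: (CnV_mkq oU0 (Cn_cst _ _ 0) (Cn_mul oU0 (Cn_cst _ _ sg) H) (Cn_cst _ _ 0) (Cn_cst _ _ 0)).
have G1 := G 1 (oner_neq0 _); have G2 : CnV 2 U0 (fun _ x => KK (axis1 (-1 * eucl x))).
  by apply: G; rewrite oppr_eq0 oner_neq0.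
apply: (@CnV_eq R 4 2 4 U0 (fun _ x => 2^-1 *: (KK (axis1 (1 * eucl x)) + KK (axis1 (-1 * eucl x)))) _ oU0).
  by move=> s x _; rewrite /gm mul1r mulN1r.
exact: CnV_scale oU0 (Cn_cst _ _ _) (CnV_D oU0 G1 G2).
Qed.

Definition north : set (quat R) := [set x | x != 0 /\ 1 < lat x].
Definition south : set (quat R) := [set x | x != 0 /\ lat x < 0].

Lemma open_north : open north.
Proof.
rewrite openE => x [x0 lx].
have C := @Cn_continuous R 4 0 _ (fun _ x => lat x) 0 x (Cn_lat 0) x0.
have N : nbhs (lat x) [set y : R | 1 < y] by apply: open_nbhs_nbhs; split; [exact: open_gt|].
have N0 : nbhs x U0 by apply: open_nbhs_nbhs.
by apply: filterS2 N0 (C _ N) => y y0 ly; split.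
Qed.

Lemma open_south : open south.
Proof.
rewrite openE => x [x0 lx].
have C := @Cn_continuous R 4 0 _ (fun _ x => lat x) 0 x (Cn_lat 0) x0.
have N : nbhs (lat x) [set y : R | y < 0] by apply: open_nbhs_nbhs; split; [exact: open_lt|].
have N0 : nbhs x U0 by apply: open_nbhs_nbhs.
by apply: filterS2 N0 (C _ N) => y y0 ly; split.
Qed.

Lemma latE x : x != 0 -> x 0 i0 = (lat x - 2^-1) * eucl x.
Proof. by move=> /eucl_gt0 r0; rewrite /lat addrK divfK // gt_eqF. Qed.

Lemma polar_lat x sg : x != 0 -> 0 < 1 + sg * (lat x - 2^-1) -> polar_set sg x.
Proof.
move=> x0; rewrite /polar_set /= /polw (latE x0) mulrA => h.
by rewrite -[X in 0 < X + _]mul1r -mulrDl mulr_gt0 // eucl_gt0.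
Qed.

Lemma north_polar x : north x -> polar_set 1 x.
Proof. by case=> x0 lx; apply: polar_lat => //; rewrite mul1r; lra. Qed.

Lemma south_polar x : south x -> polar_set (-1) x.
Proof. by case=> x0 lx; apply: polar_lat => //; rewrite mulN1r; lra. Qed.

Lemma middle_offaxis x : x != 0 -> 0 <= lat x <= 1 -> offaxis x.
Proof.
move=> x0 /andP[l0 l1]; split; apply: polar_lat => //; first by rewrite mul1r; lra.
by rewrite mulN1r; lra.
Qed.

Lemma psi_north x : 1 <= lat x -> psi x = PN x.
Proof. by move=> lx; rewrite /psi /wN step1 // subrr scale0r addr0 scale1r. Qed.

Lemma psi_south x : lat x <= 0 -> psi x = qmul (PS x) (gm x).
Proof. by move=> lx; rewrite /psi /wN step0 // subr0 scale0r add0r scale1r. Qed.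

Lemma C_PNoff : CnV 2 (@offaxis R) (fun _ => PN).
Proof. by move=> j; apply: Cn_sub (C_PN Ca a_imag j) => x []. Qed.
Lemma C_PSoff : CnV 2 (@offaxis R) (fun _ => PS).
Proof. by move=> j; apply: Cn_sub (C_PS Ca a_imag j) => x []. Qed.
Lemma C_gmoff : CnV 2 (@offaxis R) (fun _ => gm).
Proof. by move=> j; apply: Cn_sub (C_gm j) => x [/polar_nz]. Qed.
Lemma C_wN : Cn 2 U0 (fun _ x => wN x).
Proof. exact: Cn_step2 oU0 (Cn_lat 2). Qed.

(** Three open sets cover the complement of the origin: off the axis the defining formula is
    regular, and around each half axis only the gauge that is regular there remains. *)
Lemma C_psi : CnV 2 U0 (fun _ => psi).
Proof.
have oO := @open_offaxis R.
have Co : CnV 2 (@offaxis R) (fun _ => psi).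
  have W : Cn 2 (@offaxis R) (fun _ x => wN x) by apply: Cn_sub C_wN => x [/polar_nz].
  have W' := Cn_sub2 oO (Cn_cst 2 _ 1) W.
  exact: CnV_D oO (CnV_scale oO W C_PNoff) (CnV_scale oO W' (CnV_qmul oO C_PSoff C_gmoff)).
have Cn : CnV 2 north (fun _ => psi).
  apply: (@CnV_eq R 4 2 4 north (fun _ => PN) _ open_north).
    by move=> s x [_ lx]; rewrite psi_north // ltW.
  by move=> j; apply: Cn_sub (C_PN Ca a_imag j) => x /north_polar.
have Cs : CnV 2 south (fun _ => psi).
  apply: (@CnV_eq R 4 2 4 south (fun _ x => qmul (PS x) (gm x)) _ open_south).
    by move=> s x [_ lx]; rewrite psi_south // ltW.
  apply: CnV_qmul; first exact: open_south.
    by move=> j; apply: Cn_sub (C_PS Ca a_imag j) => x /south_polar.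
  by move=> j; apply: Cn_sub (C_gm j) => x [].
move=> j; apply: Cn_sub (Cn_setU (Cn_setU (Co j) (Cn j)) (Cs j)) => x x0.
have [l0|l0] := lerP 0 (lat x); last by right.
have [l1|l1] := lerP (lat x) 1; last by left; right.
by left; left; apply: middle_offaxis => //; rewrite l0.
Qed.

Lemma psi_factor x : offaxis x ->
  dot (psi x) (psi x) = dot (wN x *: KK x + (1 - wN x) *: gm x) (wN x *: KK x + (1 - wN x) *: gm x).
Proof.
case=> h1 h2; have -> : psi x = qmul (PS x) (wN x *: KK x + (1 - wN x) *: gm x).
  rewrite /psi qmulDr !qmulZr /KK qmulA (unit_qmulqV (PS_unit Ca a_imag h2)) qmul1q //.
by rewrite dot_qmul PS_unit // mul1r.
Qed.

Section Bounds.
Variable b0 : R.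
Hypotheses (b00 : 0 <= b0) (b01 : b0 < 2^-1) (Fb : forall r, 0 < r -> curv_le a b0 r).

(** The bound of [KK_axis_dot] at b = b0 + 1/2, halfway between 2 b0 and 1, and halved because [gm]
    is half of the sum. *)
Definition gap : R := cos ((1 + (b0 + 2^-1)) * pi / 4) ^+ 2.

Lemma gap_gt0 : 0 < gap.
Proof.
rewrite exprn_gt0 //; have pp := @pi_gt0 R; apply: cos_gt0_pihalf.
have h : b0 * pi < 2^-1 * pi by rewrite ltr_pM2r.
have h' : 0 <= b0 * pi by rewrite mulr_ge0 // ltW.
by apply/andP; split; lra.
Qed.

Lemma KK_gm x : offaxis x -> gap <= dot (KK x) (gm x).
Proof.
move=> Ox; have r0 : 0 < eucl x by apply: eucl_gt0; case: Ox => /polar_nz.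
have h1 : 2 * b0 < b0 + 2^-1 by have -> : 2 * b0 = b0 + b0 by [ring]; rewrite ltrD2l.
have h2 : b0 + 2^-1 < 1 by rewrite [X in _ < X](splitr 1) mul1r ltrD2r.
have := KK_axis_dot Ca a_imag Ox b00 (Fb r0) h1 h2.
by rewrite /gm dotZr -/gap; lra.
Qed.

(** [gm] is the average of two values of K at points of the same radius, and each of them has
    product at least [gap] with [gm] by [KK_gm]. *)
Lemma gm_gm x : x != 0 -> gap <= dot (gm x) (gm x).
Proof.
move=> x0; have r0 := eucl_gt0 x0.
have E k : `|k| = eucl x -> gm (axis1 k) = gm x.
  move=> kE; have : eucl (axis1 k) = eucl x.
    rewrite -kE; apply: eucl_eq => //; rewrite dot4E !mkqE -normrX ger0_norm ?sqr_ge0 //; ring.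
  by rewrite /gm => ->.
have H k : `|k| = eucl x -> gap <= dot (KK (axis1 k)) (gm x).
  move=> kE; rewrite -(E k kE); apply: KK_gm; apply: axis1_offaxis.
  by rewrite -normr_eq0 kE gt_eqF.
have H1 := H (eucl x) (ger0_norm (ltW r0)).
have H2 : gap <= dot (KK (axis1 (- eucl x))) (gm x) by apply: H; rewrite normrN ger0_norm // ltW.
rewrite {1}/gm dotZl dotDl; move: H1 H2; move: (dot _ _) (dot _ _) => u w; lra.
Qed.

Lemma gm_le1 x : x != 0 -> eucl (gm x) <= 1.
Proof.
move=> x0; have r0 := eucl_gt0 x0.
have H k : k != 0 -> eucl (KK (axis1 k)) = 1.
  by move=> k0; apply: unit_eucl; apply: KK_unit => //; exact: axis1_offaxis.
rewrite /gm euclZ ger0_norm ?invr_ge0 //.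
have := eucl_triangle (KK (axis1 (eucl x))) (KK (axis1 (- eucl x))).
rewrite !H ?oppr_eq0 ?gt_eqF //; move: (eucl (_ + _)) => u; lra.
Qed.

(** In the middle zone psi is a unit quaternion times a convex combination of K and [gm]; both have
    product at least [gap] with [gm], and |gm| <= 1. Elsewhere psi has norm 1 or |gm|. *)
Lemma psi_ge x : x != 0 -> gap ^+ 2 <= dot (psi x) (psi x).
Proof.
move=> x0; have g1 := gm_le1 x0; have gg := gm_gm x0; have gp := gap_gt0.
have gap1 : gap <= 1.
  apply: le_trans gg _; rewrite -eucl_sqr expr_le1 //; exact: eucl_ge0.
have gap2 : gap ^+ 2 <= gap by rewrite expr2 ler_piMl // ltW.
have [l0|l0] := lerP 0 (lat x); last first.
  have sx : south x by [].
  rewrite (psi_south (ltW l0)) dot_qmul PS_unit // ?mul1r; first exact: le_trans gg.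
  exact: south_polar.
have [l1|l1] := lerP (lat x) 1; last first.
  have nx : north x by [].
  rewrite (psi_north (ltW l1)) PN_unit //; first exact: le_trans gap1.
  exact: north_polar.
have Ox : offaxis x by apply: middle_offaxis => //; rewrite l0.
rewrite psi_factor //; set q := _ + _.
have : gap <= dot q (gm x).
  rewrite /q dotDl (dotZl (wN x)) (dotZl (1 - wN x)); have Kg := KK_gm Ox.
  have w0 : 0 <= wN x := step_ge0 _; have w1 : wN x <= 1 := step_le1 _.
  have w1' : 0 <= 1 - wN x by rewrite subr_ge0.
  have := lerD (ler_wpM2l w0 Kg) (ler_wpM2l w1' gg).
  by have -> : wN x * gap + (1 - wN x) * gap = gap by ring.
move=> h; rewrite -eucl_sqr ler_pXn2r ?nnegrE ?eucl_ge0 ?(ltW gp) //.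
apply: le_trans h _; apply: le_trans (cauchy_schwarz _ _) _.
by rewrite ler_piMr // eucl_ge0.
Qed.

Section Tangential.
Variables (M e : R).
Hypotheses (M0 : 0 < M) (Mb : forall s, `|dstep s| <= M) (e0 : 0 <= e).

Lemma half_triangle n (p q : 'rV[R]_n) c : eucl p <= c -> eucl q <= c ->
  eucl (2^-1 *: (p + q)) <= c.
Proof.
move=> h1 h2; rewrite euclZ ger0_norm ?invr_ge0 //; have := eucl_triangle p q.
by move: (eucl p) (eucl q) (eucl _) h1 h2 => u1 u2 u3; lra.
Qed.

Lemma covd_near (P Q : quat R -> quat R) (U : set (quat R)) x v : open U -> U x ->
  (forall y, U y -> P y = Q y) -> covd a P x v = covd a Q x v.
Proof. by move=> oU Ux PQ; rewrite /covd (dirpd_near v oU Ux PQ) PQ. Qed.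

Let sgN : (1 : R) * 1 = 1. Proof. by rewrite mulr1. Qed.
Let sgS : (-1 : R) * -1 = 1. Proof. by rewrite mulrNN mulr1. Qed.

(** The last hypothesis says that the cosine of the angle from the pole sg is at least -1/2. There
    [polw] is at least half the radius, which costs the factor 2. *)
Lemma covd_polT_le2 x v sg : sg * sg = 1 -> polar_set sg x -> dot x v = 0 ->
  curv_le a e (eucl x) -> 0 <= 1 + 2 * sg * (lat x - 2^-1) ->
  eucl x * eucl (covd a (polT a sg) x v) <= 2 * e * eucl v.
Proof.
move=> t2 px xv Fe; have x0 := polar_nz px; have r0 := eucl_gt0 x0.
have := covd_polT_le Ca a_imag t2 px xv e0 Fe; have v0 := eucl_ge0 v.
rewrite /polw /polu (latE x0); set l := sg * (lat x - 2^-1).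
have -> : sg * ((lat x - 2^-1) * eucl x) = l * eucl x by rewrite mulrA.
move=> B l0; have l0' : 0 <= 1 + 2 * l by rewrite /l mulrA.
have l1 : l <= 1.
  have := polu_ge0 t2 x; rewrite /polu (latE x0) mulrA -/l -[X in X - _]mul1r -mulrBl.
  by rewrite pmulr_lge0 // subr_ge0.
move: B; have -> : (eucl x + l * eucl x) * (eucl x - l * eucl x) = (1 - l ^+ 2) * eucl x ^+ 2 by ring.
have l2 : 0 <= 1 - l ^+ 2 by have -> : 1 - l ^+ 2 = (1 - l) * (1 + l) by [ring]; rewrite mulr_ge0; lra.
rewrite sqrtrM // sqrtr_sqr (ger0_norm (ltW r0)).
have S1 : Num.sqrt (1 - l ^+ 2) <= 1.
  by rewrite -[X in _ <= X]sqrtr1 ler_sqrt // gerBl sqr_ge0.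
have F (r S u y : R) : 0 < r -> S <= 1 -> 0 <= u -> 0 <= y ->
    (r + l * r) * r * u <= e * (S * r) * y -> r * u <= 2 * e * y.
  move=> r1 s1 u1 y1 B.
  have B1 : (1 + l) * (r * u) <= e * (S * y).
    rewrite -(ler_pM2l r1); apply: le_trans (le_trans B _); rewrite le_eqVlt; apply/orP; left; apply/eqP; ring.
  have B2 : e * (S * y) <= e * y by rewrite ler_wpM2l // ler_piMl.
  have : 0 <= (1 + 2 * l) * (r * u) by rewrite mulr_ge0 // mulr_ge0 // ltW.
  rewrite -[2 * e * y]mulrA; move: (r * u) B1 => z B1 h; move: (e * y) (e * (S * y)) B1 B2 => p q; lra.
apply: F => //; exact: eucl_ge0.
Qed.

(** [gm] depends on x only through |x|, which is stationary in directions orthogonal to x. *)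
Lemma gm_tangential x v : x != 0 -> dot x v = 0 -> isDV x v gm 0.
Proof.
move=> x0 xv; have r0 := eucl_gt0 x0; have oO := @open_offaxis R.
have Dr : is_derive x v (fun y => eucl y) 0.
  by apply: is_derive_eq (is_derive_eucl v x0) _; rewrite xv mul0r.
have CK : CnV 1 (@offaxis R) (fun _ => KK) by exact: CnV_le (C_KK Ca a_imag).
have DK sg : sg != 0 -> isDV x v (fun y => KK (axis1 (sg * eucl y))) 0.
  move=> sg0 j; have Da : isDV (eucl x) 1 (fun s => axis1 (sg * s)) (axis1 sg).
    exact: (isDV_mkq (isD_cst 0 (eucl x) 1) (is_derive_linear sg (eucl x)) (isD_cst 0 (eucl x) 1) (isD_cst 0 (eucl x) 1)).
  have Oa : offaxis (axis1 (sg * eucl x)) by apply: axis1_offaxis; rewrite mulf_neq0 // gt_eqF.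
  have D := @isDV_curve R 4 4 (@offaxis R) KK (fun s => axis1 (sg * s)) (axis1 sg) (eucl x) oO CK Oa Da j.
  by apply: is_derive_eq (is_derive_comp_dir Dr D) _; rewrite mulr0 mxE.
have D1 := DK 1 (oner_neq0 _); have D2 : isDV x v (fun y => KK (axis1 (-1 * eucl y))) 0.
  by apply: DK; rewrite oppr_eq0 oner_neq0.
have -> : gm = (fun y => 2^-1 *: (KK (axis1 (1 * eucl y)) + KK (axis1 (-1 * eucl y)))).
  by apply/funext => y; rewrite /gm mul1r mulN1r.
apply: isDV_eq (isDV_scale (isD_cst 2^-1 x v) (isDV_D D1 D2)) _.
by rewrite addr0 scaler0 scale0r addr0.
Qed.

Lemma covd_middle x v : offaxis x -> dot x v = 0 ->
  covd a psi x v = (dstep (lat x) * (v 0 i0 / eucl x)) *: (PN x - qmul (PS x) (gm x))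
    + wN x *: covd a PN x v + (1 - wN x) *: qmul (covd a PS x v) (gm x).
Proof.
move=> Ox xv; have x0 : x != 0 by case: Ox => /polar_nz.
have r0 := eucl_gt0 x0; have oO := @open_offaxis R.
have Dr : is_derive x v (fun y => eucl y) 0.
  by apply: is_derive_eq (is_derive_eucl v x0) _; rewrite xv mul0r.
have Dl : is_derive x v lat (v 0 i0 / eucl x).
  have D := is_deriveMr (is_derive_coord x v i0) (is_derive_invr (lt0r_neq0 r0) Dr).
  apply: is_derive_eq (is_deriveDr D (isD_cst 2^-1 x v)) _.
  by rewrite oppr0 mul0r mulr0 !addr0.
have Dw : is_derive x v wN (dstep (lat x) * (v 0 i0 / eucl x)).
  exact: is_derive_comp_dir Dl (is_derive_step _).
have Dg := gm_tangential x0 xv.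
have DN := CnV_isDV_dir v oO (CnV_le (isT : (1 <= 2)%N) C_PNoff) Ox.
have DS := CnV_isDV_dir v oO (CnV_le (isT : (1 <= 2)%N) C_PSoff) Ox.
have D := isDV_D (isDV_scale Dw DN) (isDV_scale (is_deriveDr (isD_cst 1 x v) (is_deriveNr Dw)) (isDV_qmul DS Dg)).
rewrite /covd (dirpd_eq oU0 (CnV_le (isT : (1 <= 2)%N) C_psi) x0 D) /psi.
move: (dstep _ * _) (wN x) (form a x v) (PN x) (PS x) (gm x) (dirpd _ x v) (dirpd _ x v) => k w f p q g dp dq.
rewrite (_ : qmul q 0 = 0) ?addr0; last by qring.
rewrite !(qmulDl, qmulDr, qmulZr, scalerDr, scalerBr, scaleNr, add0r) !qmulA.
move: (qmul q g) (qmul f p) (qmul (qmul f q) g) (qmul dq g) => u1 u2 u3 u4.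
by apply: quatP; rewrite !qE; gen_quats; ring.
Qed.

(** The derivative of the weight is of order M / r and not small, but it multiplies PN - PS gm = PS
    (K - gm), which is at most 8 e by [KK_axis_dist]: this is the 8 M. The 4 collects 2 e from each
    of the two gauges. *)
Lemma covd_psi_le x v : x != 0 -> dot x v = 0 -> curv_le a e (eucl x) ->
  eucl x * eucl (covd a psi x v) <= (8 * M + 4) * e * eucl v.
Proof.
move=> x0 xv Fe; have r0 := eucl_gt0 x0; have v0 := eucl_ge0 v.
have g1 := gm_le1 x0.
have weak c : eucl x * c <= 2 * e * eucl v -> eucl x * c <= (8 * M + 4) * e * eucl v.
  move=> h; apply: le_trans h _; rewrite -!mulrA ler_wpM2r ?mulr_ge0 //.
  by have := ltW M0; lra.
have [l0|l0] := lerP 0 (lat x); last first.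
  have sx : south x by [].
  have -> : covd a psi x v = qmul (covd a PS x v) (gm x).
    rewrite (covd_near v open_south sx (Q := fun y => qmul (PS y) (gm y))); last first.
      by move=> y [_ ly]; rewrite psi_south // ltW.
    have CPS : CnV 1 south (fun _ => PS).
      by move=> j; apply: Cn_le (isT : (1 <= 2)%N) _; apply: Cn_sub (C_PS Ca a_imag j) => y /south_polar.
    have Cgm : CnV 1 south (fun _ => gm).
      by move=> j; apply: Cn_le (isT : (1 <= 2)%N) _; apply: Cn_sub (C_gm j) => y [].
    have D := isDV_qmul (CnV_isDV_dir v open_south CPS sx) (gm_tangential x0 xv).
    rewrite /covd (dirpd_eq open_south (CnV_qmul open_south CPS Cgm) sx D).
    move: (dirpd _ _ _) (form _ _ _) (PS x) (gm x) => d f p g.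
    by have -> : qmul p 0 = 0 by [qring]; rewrite addr0 qmulDl qmulA.
  rewrite eucl_qmul; apply: weak.
  have := covd_polT_le2 sgS (south_polar sx) xv Fe.
  have -> : 0 <= 1 + 2 * -1 * (lat x - 2^-1) by lra.
  move=> /(_ isT); apply: le_trans; rewrite ler_pM2l // ler_piMr ?eucl_ge0 //.
have [l1|l1] := lerP (lat x) 1; last first.
  have nx : north x by [].
  rewrite (covd_near v open_north nx (Q := PN)); last first.
    by move=> y [_ ly]; rewrite psi_north // ltW.
  apply: weak; apply: covd_polT_le2 => //; first exact: north_polar.
  by rewrite mulr1; lra.
have Ox : offaxis x by apply: middle_offaxis => //; rewrite l0.
rewrite covd_middle //; have [hN hS] := Ox.
set k := dstep _ * _; set A := covd a PN x v; set B := qmul (covd a PS x v) (gm x).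
have kM : `|k| * eucl x <= M * eucl v.
  rewrite /k normrM [`|v 0 i0 / _|]normrM normfV (ger0_norm (ltW r0)) -!mulrA mulVf ?gt_eqF // mulr1.
  by apply: ler_pM => //; exact: eucl_coord.
have dM : eucl (PN x - qmul (PS x) (gm x)) <= 8 * e.
  have -> : PN x - qmul (PS x) (gm x) = qmul (PS x) (KK x - gm x).
    by rewrite qmulBr /KK qmulA (unit_qmulqV (PS_unit Ca a_imag hS)) qmul1q.
  rewrite eucl_qmul (unit_eucl (PS_unit Ca a_imag hS)) mul1r.
  have [h1 h2] := KK_axis_dist Ca a_imag Ox e0 Fe.
  have -> : KK x - gm x = 2^-1 *: ((KK x - KK (axis1 (eucl x))) + (KK x - KK (axis1 (- eucl x)))).
    rewrite /gm; move: (KK x) (KK _) (KK _) => p q s; apply/rowP => j; rewrite !mxE.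
    by move: (p 0 j) (q 0 j) (s 0 j) => u1 u2 u3; field.
  exact: half_triangle h1 h2.
have AM : eucl x * eucl A <= 2 * e * eucl v.
  by apply: covd_polT_le2 => //; rewrite mulr1; lra.
have BM : eucl x * eucl B <= 2 * e * eucl v.
  rewrite /B eucl_qmul; have := covd_polT_le2 sgS hS xv Fe.
  have -> : 0 <= 1 + 2 * -1 * (lat x - 2^-1) by lra.
  by move=> /(_ isT); apply: le_trans; rewrite ler_pM2l // ler_piMr ?eucl_ge0.
have w0 : 0 <= wN x := step_ge0 _; have w1 : wN x <= 1 := step_le1 _.
have w0' : 0 <= 1 - wN x by rewrite subr_ge0.
have T1 : eucl (k *: (PN x - qmul (PS x) (gm x)) + wN x *: A + (1 - wN x) *: B) <=
    `|k| * (8 * e) + eucl A + eucl B.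
  apply: le_trans (eucl_triangle _ _) _; apply: lerD; last first.
    by rewrite euclZ ger0_norm // ler_piMl ?eucl_ge0 // gerBl.
  apply: le_trans (eucl_triangle _ _) _; apply: lerD; last first.
    by rewrite euclZ ger0_norm // ler_piMl ?eucl_ge0.
  by rewrite euclZ ler_wpM2l.
have T2 := ler_wpM2l (ltW r0) T1; apply: le_trans T2 _.
have e8 : 0 <= 8 * e by rewrite mulr_ge0.
have F (p q y r t : R) : r * p <= 2 * e * y -> r * q <= 2 * e * y -> t * r <= M * y ->
    r * (t * (8 * e) + p + q) <= (8 * M + 4) * e * y.
  by move=> h1 h2 h3; have := ler_wpM2l e8 h3; lra.
exact: F.
Qed.
End Tangential.
End Bounds.

End Gauge.

(** * The Chern-Simons current *)
Ltac zlin := rewrite !mxE; gen_quats; intros; lra.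
Section Brackets.
Variable R : realType.
Lemma bracketNr (a c : quat R) : bracket c (- a) = - bracket c a.
Proof. by qring. Qed.
Lemma bracketNl (a c : quat R) : bracket (- a) c = - bracket a c.
Proof. by qring. Qed.
Lemma bracketxx (a : quat R) : bracket a a = 0.
Proof. by rewrite /bracket subrr. Qed.
Lemma jacobi (a b c : quat R) :
  bracket a (bracket b c) + bracket b (bracket c a) + bracket c (bracket a b) = 0.
Proof.
rewrite /bracket !qmulBr !qmulBl !qmulA.
move: (qmul (qmul a b) c) (qmul (qmul a c) b) (qmul (qmul b c) a) (qmul (qmul b a) c)
  (qmul (qmul c a) b) (qmul (qmul c b) a) => u1 u2 u3 u4 u5 u6.
by apply/rowP => l; zlin.
Qed.
Lemma dot_bracket (a b c : quat R) : dot (bracket a b) c = dot a (bracket b c).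
Proof. by qring. Qed.
Lemma dot_jacobi (a b c d : quat R) : dot (bracket a b) (bracket c d)
  + dot (bracket a c) (bracket d b) + dot (bracket a d) (bracket b c) = 0.
Proof. by rewrite !dot_bracket -!dotDr jacobi dotC dot0l. Qed.

Lemma cs_alg (d1 d2 d3 f1 f2 f3 b1 b2 b3 c1 c2 c3 : quat R) :
  dot d1 c1 + dot b1 f1 + (dot d2 c2 + dot b2 f2) + (dot d3 c3 + dot b3 f3)
    + - (dot d1 (bracket b2 b3) + dot b1 (bracket d2 b3 + bracket b2 d3)) =
  dot d1 (c1 - bracket b2 b3) + dot d2 (c2 - bracket b3 b1) + dot d3 (c3 - bracket b1 b2)
    + (dot b1 f1 + dot b2 f2 + dot b3 f3).
Proof.
rewrite (dotDr b1).
have -> : dot b1 (bracket d2 b3) = dot d2 (bracket b3 b1) by rewrite dotC dot_bracket.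
have -> : dot b1 (bracket b2 d3) = dot d3 (bracket b1 b2) by rewrite -dot_bracket dotC.
move: (bracket _ _) (bracket _ _) (bracket _ _) => r1 r2 r3; rewrite !dotBr.
move: (dot d1 r1) (dot d2 r2) (dot d3 r3) (dot d1 c1) (dot d2 c2) (dot d3 c3) (dot b1 f1) (dot b2 f2) (dot b3 f3) => *.
lra.
Qed.
End Brackets.

Section ChernSimons.
Variable R : realType.
Implicit Types x v : quat R.
Variable a : 'I_4 -> quat R -> quat R.
Local Notation U0 := [set x : quat R | x != 0].
Hypothesis Ca : forall m i, CnV m U0 (fun _ => a i).
Let oU0 := @open_nonzero R 4.

(** The covariant derivative in the adjoint representation, the one acting on curvature and on [bb];
    [covd] is the one for left multiplication, which acts on psi. *)
Definition Dc (i : 'I_4) (X : quat R -> quat R) x : quat R := pdv i X x + bracket (a i x) (X x).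

Lemma pd_dot_Dc i (X Y : quat R -> quat R) x : CnV 1 U0 (fun _ => X) -> CnV 1 U0 (fun _ => Y) -> U0 x ->
  is_derive x (ev R i) (fun y => dot (X y) (Y y)) (dot (Dc i X x) (Y x) + dot (X x) (Dc i Y x)).
Proof.
move=> CX CY Ux.
apply: is_derive_eq (is_derive_dot (CnV_isDV i 0 CX Ux) (CnV_isDV i 0 CY Ux)) _.
rewrite /Dc; move: (pdv i X x) (pdv i Y x) (X x) (Y x) (a i x) => dX dY p q c.
by rewrite dotDl dotDr; have : dot (bracket c p) q + dot p (bracket c q) = 0; [qring|lra].
Qed.

Lemma CnV_curv m i j : CnV m U0 (fun _ => curv a i j).
Proof.
rewrite /curv; apply: CnV_D => //; last exact: CnV_bracket.
by apply: CnV_B => //; apply: CnV_pdv; exact: Ca.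
Qed.

Lemma curvC i j x : curv a i j x = - curv a j i x.
Proof.
rewrite /curv; move: (pdv i _ x) (pdv j _ x) (a i x) (a j x) => p q c d; qring.
Qed.

Lemma isDV_curv l i j x : U0 x -> pdv l (curv a i j) x =
  pdv l (pdv i (a j)) x - pdv l (pdv j (a i)) x
  + (bracket (pdv l (a i) x) (a j x) + bracket (a i x) (pdv l (a j) x)).
Proof.
move=> Ux; apply: isDV_pdv; apply: isDV_D.
  by apply: isDV_B; apply: (CnV_isDV (k := fun _ => pdv _ (a _)) l 0 _ Ux); apply: CnV_pdv; exact: (Ca 2).
by apply: isDV_bracket; exact: (CnV_isDV l 0 (Ca 1 _) Ux).
Qed.

Lemma bianchi i j k x : U0 x ->
  Dc i (curv a j k) x + Dc j (curv a k i) x + Dc k (curv a i j) x = 0.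
Proof.
move=> Ux; rewrite /Dc !isDV_curv // /curv.
have c p q r : pdv p (pdv q (a r)) x = pdv q (pdv p (a r)) x.
  exact: (pdv_comm (k := fun _ => a r) 0 p q oU0 (Ca 2 r) Ux).
rewrite (c j i) (c k i) (c k j).
move: (pdv i (pdv j _) x) (pdv i (pdv k _) x) (pdv j (pdv k _) x) => p1 p2 p3.
move: (pdv i (a j) x) (pdv j (a i) x) (pdv i (a k) x) (pdv k (a i) x) (pdv j (a k) x) (pdv k (a j) x).
move: (a i x) (a j x) (a k x) => q1 q2 q3 d1 d2 d3 d4 d5 d6.
have := jacobi q1 q2 q3.
move: (bracket q2 q3) (bracket q3 q1) (bracket q1 q2) => r1 r2 r3.
rewrite !bracketDr !bracketNr (bracketC d1) (bracketC d5) (bracketC d4).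
move: (bracket q1 r1) (bracket q2 r2) (bracket q3 r3) => e1 e2 e3 E.
move: (bracket q3 d1) (bracket q2 d3) (bracket q1 d5) (bracket q1 d6) => b1 b2 b3 b4.
move: (bracket q3 d2) (bracket q2 d4) => b5 b6.
apply/rowP => l; move: E => /rowP/(_ l); zlin.
Qed.

Lemma DcC l i j x : U0 x -> Dc l (curv a i j) x = - Dc l (curv a j i) x.
Proof.
move=> Ux; rewrite /Dc (curvC i j).
have -> : pdv l (curv a i j) x = - pdv l (curv a j i) x.
  have E : curv a i j = (fun y => - curv a j i y) by apply/funext => y; exact: curvC.
  by rewrite E; apply: isDV_pdv; apply: isDV_N; exact: (CnV_isDV l 0 (CnV_curv 1 j i) Ux).
by move: (curv a j i x) (pdv _ _ x) => f d; rewrite bracketNr -opprD.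
Qed.

Variables (psi : quat R -> quat R).
Hypothesis C_psi : CnV 2 U0 (fun _ => psi).
Hypothesis psi_gt0 : forall x, U0 x -> 0 < dot (psi x) (psi x).

(* [bb] is the right logarithmic covariant derivative of psi. *)
Definition ipsi x : quat R := (dot (psi x) (psi x))^-1 *: qconj (psi x).
Definition bb i x : quat R := qmul (covd a psi x (ev R i)) (ipsi x).

Lemma C_ipsi : CnV 2 U0 (fun _ => ipsi).
Proof.
apply: CnV_scale oU0 _ (CnV_qconj oU0 C_psi); apply: Cn_inv oU0 _ (Cn_dot oU0 C_psi C_psi).
by move=> s x /psi_gt0/lt0r_neq0.
Qed.

Lemma psiV x : U0 x -> qmul (psi x) (ipsi x) = qone R.
Proof. by move=> /psi_gt0 h; rewrite /ipsi qmulZr qmulqV scalerA mulVf ?scale1r // gt_eqF. Qed.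

Lemma Vpsi x : U0 x -> qmul (ipsi x) (psi x) = qone R.
Proof. by move=> /psi_gt0 h; rewrite /ipsi qmulZl qmulVq scalerA mulVf ?scale1r // gt_eqF. Qed.

Lemma dirpd_ev m (f : quat R -> 'rV[R]_m) i x : dirpd f x (ev R i) = pdv i f x.
Proof.
rewrite /dirpd (bigD1 i) //= big1 ?addr0 => [|j ji]; first by rewrite evE eqxx scale1r.
by rewrite evE eq_sym (negbTE ji) scale0r.
Qed.

Lemma form_ev i x : form a x (ev R i) = a i x.
Proof.
rewrite /form (bigD1 i) //= big1 ?addr0 => [|j ji]; first by rewrite evE eqxx scale1r.
by rewrite evE eq_sym (negbTE ji) scale0r.
Qed.

Lemma bbE i x : U0 x -> bb i x = qmul (pdv i psi x) (ipsi x) + a i x.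
Proof.
by move=> Ux; rewrite /bb /covd dirpd_ev form_ev qmulDl -qmulA psiV // qmulq1.
Qed.

Lemma C_bb i : CnV 1 U0 (fun _ => bb i).
Proof.
apply: (@CnV_eq R 4 1 4 U0 (fun _ x => qmul (pdv i psi x) (ipsi x) + a i x) _ oU0).
  by move=> s x Ux; rewrite bbE.
apply: CnV_D oU0 (CnV_qmul oU0 (CnV_pdv i C_psi) _) (Ca 1 i).
exact: CnV_le C_ipsi.
Qed.

Lemma pdv_ipsi i x : U0 x -> pdv i ipsi x = - qmul (qmul (ipsi x) (pdv i psi x)) (ipsi x).
Proof.
move=> Ux.
have D := isDV_qmul (CnV_isDV i 0 C_psi Ux) (CnV_isDV i 0 C_ipsi Ux).
have : pdv i (fun y => qmul (psi y) (ipsi y)) x = 0.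
  apply/rowP => j; rewrite pdvE mxE (@pd_eq R 4 U0 _ (fun=> qone R 0 j) i x oU0 Ux) => [|y Uy].
    exact: is_derive_pd (isD_cst _ _ _).
  by rewrite psiV.
rewrite (isDV_pdv D) => /eqP; rewrite addr_eq0 => /eqP E.
have := congr1 (qmul (ipsi x)) E; rewrite qmulNr qmulA qmulA Vpsi // qmul1q => /eqP.
by rewrite -eqr_oppLR => /eqP <-.
Qed.

(** The covariant derivatives of psi commute up to left multiplication by the curvature, and
    differentiating psi^-1 produces the bracket. *)
Lemma Dbb i j x : U0 x -> Dc i (bb j) x - Dc j (bb i) x = curv a i j x + bracket (bb i x) (bb j x).
Proof.
move=> Ux.
have P i' j' : pdv i' (bb j') x = qmul (pdv i' (pdv j' psi) x) (ipsi x)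
    - qmul (qmul (pdv j' psi x) (ipsi x)) (qmul (pdv i' psi x) (ipsi x)) + pdv i' (a j') x.
  have -> : pdv i' (bb j') x = pdv i' (fun y => qmul (pdv j' psi y) (ipsi y) + a j' y) x.
    apply/rowP => l; rewrite !pdvE; apply: (pd_eq i' oU0 Ux) => y Uy; by rewrite bbE.
  have D := isDV_D (isDV_qmul (CnV_isDV i' 0 (CnV_pdv j' C_psi) Ux) (CnV_isDV i' 0 C_ipsi Ux))
    (CnV_isDV i' 0 (Ca 1 j') Ux).
  by rewrite (isDV_pdv D) pdv_ipsi // qmulNr !qmulA.
rewrite /Dc !P !bbE // /curv (pdv_comm (k := fun _ => psi) 0 i j oU0 C_psi Ux).
move: (qmul (pdv j (pdv i _) x) _) (qmul (pdv i psi x) _) (qmul (pdv j psi x) _) => t p q.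
move: (pdv i (a j) x) (pdv j (a i) x) (a i x) (a j x) => d1 d2 c1 c2.
rewrite !bracketDr !bracketDl.
have -> : bracket p q = qmul p q - qmul q p by [].
rewrite (bracketC c2 p) (bracketC c2 c1).
move: (qmul p q) (qmul q p) (bracket c1 q) (bracket p c2) (bracket c1 c2) => u1 u2 u3 u4 u5.
by apply/rowP => l; zlin.
Qed.

(* Component of the 3-form <b /\ F> - <b, [b, b]>, whose exterior derivative is a
   multiple of <F /\ F> because d_A b = F + b /\ b. *)
Definition cs3 i j k x : R := dot (bb i x) (curv a j k x) + dot (bb j x) (curv a k i x)
  + dot (bb k x) (curv a i j x) - dot (bb i x) (bracket (bb j x) (bb k x)).

Lemma pd_cs3 l i j k x : U0 x -> is_derive x (ev R l) (cs3 i j k)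
  (dot (Dc l (bb i) x) (curv a j k x - bracket (bb j x) (bb k x))
   + dot (Dc l (bb j) x) (curv a k i x - bracket (bb k x) (bb i x))
   + dot (Dc l (bb k) x) (curv a i j x - bracket (bb i x) (bb j x))
   + (dot (bb i x) (Dc l (curv a j k) x) + dot (bb j x) (Dc l (curv a k i) x)
   + dot (bb k x) (Dc l (curv a i j) x))).
Proof.
move=> Ux; have CB := C_bb; have CF := CnV_curv 1.
have CBB j' k' : CnV 1 U0 (fun _ x => bracket (bb j' x) (bb k' x)) by exact: CnV_bracket.
have D := is_deriveDr (is_deriveDr (is_deriveDr (pd_dot_Dc l (CB i) (CF j k) Ux)
  (pd_dot_Dc l (CB j) (CF k i) Ux)) (pd_dot_Dc l (CB k) (CF i j) Ux))
  (is_deriveNr (pd_dot_Dc l (CB i) (CBB j k) Ux)).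
have E : Dc l (fun x => bracket (bb j x) (bb k x)) x =
    bracket (Dc l (bb j) x) (bb k x) + bracket (bb j x) (Dc l (bb k) x).
  rewrite /Dc (isDV_pdv (isDV_bracket (CnV_isDV l 0 (CB j) Ux) (CnV_isDV l 0 (CB k) Ux))).
  move: (pdv l _ x) (pdv l _ x) (a l x) (bb j x) (bb k x) => d1 d2 q1 q2 q3.
  have := jacobi q1 q2 q3; rewrite (bracketC q3 q1) (bracketC q3 (bracket q1 q2)).
  move: (bracket q2 q3) (bracket q1 q3) (bracket q1 q2) => r1 r2 r3.
  rewrite bracketDl bracketDr bracketNr.
  move: (bracket q1 r1) (bracket q2 r2) (bracket r3 q3) (bracket d1 q3) (bracket q2 d2) => e1 e2 e3 u1 u2 E.
  by apply/rowP => q; move: E => /rowP/(_ q); zlin.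
apply: is_derive_eq D _; rewrite E.
exact: cs_alg.
Qed.
End ChernSimons.

#[global] Opaque bracket curv Dc.
(** All inner products become independent unknowns. The Bianchi identities remove the terms with
    derivatives of F; the others assemble to products (f + c)(f - c) in which the mixed terms
    cancel, and the first hypothesis, a Jacobi identity, removes those quartic in b. *)
Lemma div_alg (R : realType) (b0 b1 b2 b3 f01 f02 f03 f12 f23 f31 c01 c02 c03 c12 c23 c31 : quat R)
  (d01 d02 d03 d10 d12 d13 d20 d21 d23 d30 d31 d32 : quat R)
  (h012 h023 h031 h102 h123 h103 h201 h231 h203 h301 h312 h302 : quat R) :
  dot c01 c23 + dot c02 c31 + dot c03 c12 = 0 ->
  h012 + - h102 + h201 = 0 -> h123 + h231 + h312 = 0 ->
  h023 + - h203 + h302 = 0 -> h031 + - h301 + h103 = 0 ->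
  d01 - d10 = f01 + c01 -> d02 - d20 = f02 + c02 -> d03 - d30 = f03 + c03 ->
  d12 - d21 = f12 + c12 -> d31 - d13 = f31 + c31 -> d23 - d32 = f23 + c23 ->
  dot d01 (f23 - c23) + dot d02 (f31 - c31) + dot d03 (f12 - c12) + (dot b1 h023 + dot b2 h031 + dot b3 h012)
  - (dot d10 (f23 - c23) + dot d12 (- f03 - - c03) + dot d13 (f02 - c02)
     + (dot b0 h123 + dot b2 (- h103) + dot b3 h102))
  + (dot d20 (- f31 - - c31) + dot d21 (- f03 - - c03) + dot d23 (f01 - c01)
     + (dot b0 (- h231) + dot b1 (- h203) + dot b3 h201))
  - (dot d30 (f12 - c12) + dot d31 (- f02 - - c02) + dot d32 (f01 - c01)
     + (dot b0 h312 + dot b1 (- h302) + dot b2 h301))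
  = 2 * (dot f01 f23 + dot f02 f31 + dot f03 f12).
Proof.
have S (u w s t : quat R) : u - w = s + t -> u = w + s + t.
  by move=> /eqP; rewrite subr_eq => /eqP ->; rewrite addrC addrA.
move=> J B0 B1 B2 B3 /S-> /S-> /S-> /S-> /S-> /S->.
have K0 := congr1 (dot b3) B0; have K1 := congr1 (dot b0) B1.
have K2 := congr1 (dot b1) B2; have K3 := congr1 (dot b2) B3.
move: K0 K1 K2 K3; rewrite !dotDr !dotNr ?(dotC _ (0 : quat R)) ?dot0l.
rewrite !(dotDl, dotDr, dotNr).
rewrite (dotC c23 f01) (dotC c31 f02) (dotC c12 f03) (dotC f23 f01) (dotC f31 f02) (dotC f12 f03).
rewrite (dotC f23 c01) (dotC f31 c02) (dotC f12 c03) (dotC c23 c01) (dotC c31 c02) (dotC c12 c03).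
move: J.
repeat match goal with |- context [dot ?u ?w] => move: (dot u w) => ? end.
move=> *.
lra.
Qed.

(** * Divergence and radial part of the current *)

Section Current.
Variable R : realType.
Implicit Types x v : quat R.

Lemma eucl_bracket (p q : quat R) : eucl (bracket p q) <= 2 * (eucl p * eucl q).
Proof.
apply: le_trans (eucl_triangleB _ _) _; rewrite !eucl_qmul (mulrC (eucl q)).
by move: (_ * _) => u; lra.
Qed.

Lemma triple_shift (c b1 b2 b3 : quat R) (x1 x2 x3 : R) :
  dot (b1 + x1 *: c) (bracket (b2 + x2 *: c) (b3 + x3 *: c)) = dot b1 (bracket b2 b3)
    + x1 * dot c (bracket b2 b3) + x2 * dot c (bracket b3 b1) + x3 * dot c (bracket b1 b2).
Proof.
have E1 : dot b1 (bracket c b3) = dot c (bracket b3 b1) by rewrite dotC dot_bracket.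
have E2 : dot b1 (bracket b2 c) = dot c (bracket b1 b2) by rewrite -dot_bracket dotC.
have Z2 : dot c (bracket b2 c) = 0 by rewrite dotC dot_bracket bracketxx dotC dot0l.
have Z3 : dot c (bracket c b3) = 0 by rewrite -dot_bracket bracketxx dot0l.
rewrite !(bracketDl, bracketDr, bracketZl, bracketZr) bracketxx !scaler0 addr0.
move: (bracket c b3) (bracket b2 c) (bracket b2 b3) (bracket b3 b1) (bracket b1 b2) E1 E2 Z2 Z3.
move=> r1 r2 r3 r4 r5 E1 E2 Z2 Z3.
rewrite !dotDl !dotDr !dotZl !dotZr E1 E2 Z2 Z3.
by move: (dot b1 r3) (dot c r5) (dot c r4) (dot c r3) => t1 t2 t3 t4; ring.
Qed.

Variable a : 'I_4 -> quat R -> quat R.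
Local Notation U0 := [set x : quat R | x != 0].
Hypothesis Ca : forall m i, CnV m U0 (fun _ => a i).
Variables (psi : quat R -> quat R).
Hypothesis C_psi : CnV 2 U0 (fun _ => psi).
Variable q : R.
Hypothesis q0 : 0 < q.
Hypothesis psi_ge : forall x, U0 x -> q ^+ 2 <= dot (psi x) (psi x).
Local Notation F := (curv a).
Local Notation bb := (bb a psi).
Local Notation cs3 := (cs3 a psi).
Let oU0 := @open_nonzero R 4.

Let psi_gt0 x : U0 x -> 0 < dot (psi x) (psi x).
Proof. by move=> /psi_ge; apply: lt_le_trans; rewrite exprn_gt0. Qed.

(** For anti-self-dual F this is half of the sum of |F_ij|^2 over i < j. *)
Definition energy x : R := dot (F i0 i1 x) (F i0 i1 x) + dot (F i0 i2 x) (F i0 i2 x)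
  + dot (F i0 i3 x) (F i0 i3 x).

(** The Hodge dual of the 3-form with components [cs3], so that its divergence is the exterior
    derivative of that form. *)
Definition current x : quat R :=
  mkq (cs3 i1 i2 i3 x) (- cs3 i0 i2 i3 x) (cs3 i0 i1 i3 x) (- cs3 i0 i1 i2 x).

Lemma Cn_cs3 i j k : Cn 1 U0 (fun _ => cs3 i j k).
Proof.
have CB := C_bb Ca C_psi psi_gt0; have CF := CnV_curv Ca 1.
apply: Cn_sub2 oU0 _ (Cn_dot oU0 (CB i) (CnV_bracket oU0 (CB j) (CB k))).
apply: Cn_add oU0 (Cn_add oU0 _ _) _; exact: Cn_dot.
Qed.

Lemma C_current : CnV 1 U0 (fun _ => current).
Proof.
apply: CnV_mkq oU0 (Cn_cs3 _ _ _) _ (Cn_cs3 _ _ _) _; exact: (Cn_opp oU0 (Cn_cs3 _ _ _)).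
Qed.

Lemma div_current x : U0 x -> \sum_i pd i (fun y => current y 0 i) x =
  2 * (dot (F i0 i1 x) (F i2 i3 x) + dot (F i0 i2 x) (F i3 i1 x) + dot (F i0 i3 x) (F i1 i2 x)).
Proof.
move=> Ux; rewrite sum4.
have -> : pd i0 (fun y => current y 0 i0) x = pd i0 (cs3 i1 i2 i3) x.
  by apply: (pd_eq i0 oU0 Ux) => y _; rewrite mkqE.
have -> : pd i2 (fun y => current y 0 i2) x = pd i2 (cs3 i0 i1 i3) x.
  by apply: (pd_eq i2 oU0 Ux) => y _; rewrite mkqE.
have P l i j k := pd_cs3 Ca C_psi psi_gt0 l i j k Ux.
have -> : pd i1 (fun y => current y 0 i1) x = - pd i1 (cs3 i0 i2 i3) x.
  rewrite (@pd_eq R 4 U0 _ (fun y => - cs3 i0 i2 i3 y) i1 x oU0 Ux) => [|y _]; last by rewrite mkqE.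
  by rewrite (is_derive_pd (P i1 i0 i2 i3)); apply: is_derive_pd; apply: is_deriveNr; exact: P.
have -> : pd i3 (fun y => current y 0 i3) x = - pd i3 (cs3 i0 i1 i2) x.
  rewrite (@pd_eq R 4 U0 _ (fun y => - cs3 i0 i1 i2 y) i3 x oU0 Ux) => [|y _]; last by rewrite mkqE.
  by rewrite (is_derive_pd (P i3 i0 i1 i2)); apply: is_derive_pd; apply: is_deriveNr; exact: P.
rewrite !(is_derive_pd (P _ _ _ _)).
rewrite (curvC a i3 i0) (curvC a i1 i3) (curvC a i2 i0).
rewrite (DcC Ca i1 i3 i0 Ux) (DcC Ca i2 i1 i3 Ux) (DcC Ca i2 i3 i0 Ux) (DcC Ca i3 i2 i0 Ux).
have B1 := bianchi Ca i1 i2 i3 Ux; have B0 := bianchi Ca i0 i1 i2 Ux.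
have B2 := bianchi Ca i0 i2 i3 Ux; have B3 := bianchi Ca i0 i3 i1 Ux.
rewrite (DcC Ca i1 i2 i0 Ux) in B0; rewrite (DcC Ca i2 i3 i0 Ux) in B2; rewrite (DcC Ca i3 i1 i0 Ux) in B3.
have H i j := Dbb Ca C_psi psi_gt0 i j Ux.
have H01 := H i0 i1; have H02 := H i0 i2; have H03 := H i0 i3.
have H12 := H i1 i2; have H31 := H i3 i1; have H23 := H i2 i3.
move: B0 B1 B2 B3 H01 H02 H03 H12 H31 H23 {P H}.
move: (Dc a i0 (F i1 i2) x) (Dc a i0 (F i2 i3) x) (Dc a i0 (F i3 i1) x) => h012 h023 h031.
move: (Dc a i1 (F i0 i2) x) (Dc a i1 (F i2 i3) x) (Dc a i1 (F i0 i3) x) => h102 h123 h103.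
move: (Dc a i2 (F i0 i1) x) (Dc a i2 (F i3 i1) x) (Dc a i2 (F i0 i3) x) => h201 h231 h203.
move: (Dc a i3 (F i0 i1) x) (Dc a i3 (F i1 i2) x) (Dc a i3 (F i0 i2) x) => h301 h312 h302.
move: (Dc a i0 (bb i1) x) (Dc a i0 (bb i2) x) (Dc a i0 (bb i3) x) => d01 d02 d03.
move: (Dc a i1 (bb i0) x) (Dc a i1 (bb i2) x) (Dc a i1 (bb i3) x) => d10 d12 d13.
move: (Dc a i2 (bb i0) x) (Dc a i2 (bb i1) x) (Dc a i2 (bb i3) x) => d20 d21 d23.
move: (Dc a i3 (bb i0) x) (Dc a i3 (bb i1) x) (Dc a i3 (bb i2) x) => d30 d31 d32.
move: (F i0 i1 x) (F i0 i2 x) (F i0 i3 x) (F i1 i2 x) (F i3 i1 x) (F i2 i3 x) => f01 f02 f03 f12 f31 f23.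
move: (bb i0 x) (bb i1 x) (bb i2 x) (bb i3 x) => b0 b1 b2 b3.
have := dot_jacobi b0 b1 b2 b3.
rewrite (bracketC b3 b0) (bracketC b1 b3) (bracketC b2 b0).
move: (bracket b0 b1) (bracket b0 b2) (bracket b0 b3) (bracket b1 b2) (bracket b3 b1) (bracket b2 b3) => c01 c02 c03 c12 c31 c23.
exact: div_alg.
Qed.

Definition S3 (b1 b2 b3 f23 f31 f12 : quat R) : R :=
  dot b1 f23 + dot b2 f31 + dot b3 f12 - dot b1 (bracket b2 b3).

(** Pairing the current with x is the wedge product of r dr with the 3-form. Adding x_i c to b_i
    adds a multiple of r dr to b, which this wedge product annihilates. *)
Lemma S3_shift (c b0 b1 b2 b3 f01 f02 f03 f12 f31 f23 : quat R) (x0 x1 x2 x3 : R) :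
  x0 * S3 (b1 + x1 *: c) (b2 + x2 *: c) (b3 + x3 *: c) f23 f31 f12
  - x1 * S3 (b0 + x0 *: c) (b2 + x2 *: c) (b3 + x3 *: c) f23 (- f03) f02
  + x2 * S3 (b0 + x0 *: c) (b1 + x1 *: c) (b3 + x3 *: c) (- f31) (- f03) f01
  - x3 * S3 (b0 + x0 *: c) (b1 + x1 *: c) (b2 + x2 *: c) f12 (- f02) f01 =
  x0 * S3 b1 b2 b3 f23 f31 f12 - x1 * S3 b0 b2 b3 f23 (- f03) f02
  + x2 * S3 b0 b1 b3 (- f31) (- f03) f01 - x3 * S3 b0 b1 b2 f12 (- f02) f01.
Proof.
rewrite /S3 !triple_shift (bracketC b3 b0) (bracketC b3 b1) (bracketC b2 b0).
move: (bracket b0 b1) (bracket b0 b2) (bracket b0 b3) (bracket b1 b2) (bracket b1 b3) (bracket b2 b3) => c01 c02 c03 c12 c13 c23.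
rewrite !dotDl !dotNr !dotZl.
repeat match goal with |- context [dot ?u ?w] => move: (dot u w) => ? end.
by ring.
Qed.

Lemma S3_bound (b1 b2 b3 f23 f31 f12 : quat R) (u w : R) : 0 <= u -> 0 <= w ->
  eucl b1 <= u -> eucl b2 <= u -> eucl b3 <= u ->
  eucl f23 <= w -> eucl f31 <= w -> eucl f12 <= w ->
  `|S3 b1 b2 b3 f23 f31 f12| <= 3 * (u * w) + 2 * u ^+ 3.
Proof.
move=> u0 w0 h1 h2 h3 g1 g2 g3.
have D (b f : quat R) : eucl b <= u -> eucl f <= w -> `|dot b f| <= u * w.
  move=> hb hf; apply: le_trans (cauchy_schwarz_norm _ _) _; apply: ler_pM => //; exact: eucl_ge0.
have T : `|dot b1 (bracket b2 b3)| <= 2 * u ^+ 3.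
  apply: le_trans (cauchy_schwarz_norm _ _) _.
  apply: (@le_trans _ _ (u * (2 * (u * u)))); last by rewrite le_eqVlt; apply/orP; left; apply/eqP; ring.
  apply: ler_pM => //; try exact: eucl_ge0.
  apply: le_trans (eucl_bracket _ _) _; rewrite ler_wpM2l //.
  by apply: ler_pM => //; exact: eucl_ge0.
rewrite /S3; have := D _ _ h1 g1; have := D _ _ h2 g2; have := D _ _ h3 g3; move: T.
move: (dot b1 f23) (dot b2 f31) (dot b3 f12) (dot _ _) => t1 t2 t3 t4 T B3 B2 B1.
apply: le_trans (ler_normB _ _) _.
have := ler_normD (t1 + t2) t3; have := ler_normD t1 t2.
by move: `|t1 + t2 + t3| `|t1 + t2| `|t1| `|t2| `|t3| `|t4| T B1 B2 B3 => *; lra.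
Qed.

Variable Cp : R.
Hypothesis Cp0 : 0 <= Cp.
Hypothesis covd_psi : forall x v e, U0 x -> dot x v = 0 -> 0 <= e -> curv_le a e (eucl x) ->
  eucl x * eucl (covd a psi x v) <= Cp * e * eucl v.

(* The current is paired with x only, so radial components of [bb] do not matter. *)
Definition tangv (i : 'I_4) x : quat R := ev R i + (- (x 0 i / eucl x ^+ 2)) *: x.

Lemma dot_ev x i : dot x (ev R i) = x 0 i.
Proof.
rewrite /dot (bigD1 i) //= big1 ?addr0 => [|j ji]; first by rewrite evE eqxx mulr1.
by rewrite evE eq_sym (negbTE ji) mulr0.
Qed.

Lemma dot_tangv i x : U0 x -> dot x (tangv i x) = 0.
Proof.
move=> Ux; rewrite dotDr dotZr dot_ev -eucl_sqr mulNr divfK ?subrr //.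
by rewrite expf_neq0 // gt_eqF // eucl_gt0.
Qed.

Lemma tangv_le1 i x : U0 x -> eucl (tangv i x) <= 1.
Proof.
move=> Ux; rewrite -sqrtr1 /eucl ler_sqrt // {1}/tangv dotDl dotZl dot_tangv // mulr0 addr0.
rewrite (dotC (ev R i)) /tangv dotDl dotZl !dot_ev evE eqxx mulr1n gerDl mulNr oppr_le0.
by rewrite mulrAC -expr2 divr_ge0 // sqr_ge0.
Qed.

Lemma covdD P x u v : covd a P x (u + v) = covd a P x u + covd a P x v.
Proof.
rewrite /covd /dirpd /form.
have E m (f : 'I_4 -> 'rV[R]_m) : \sum_i (u + v) 0 i *: f i = \sum_i u 0 i *: f i + \sum_i v 0 i *: f i.
  by rewrite -big_split; apply: eq_bigr => i _; rewrite mxE scalerDl.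
rewrite !E qmulDl; move: (\sum_i _) (\sum_i _) (qmul _ _) (qmul _ _) => p1 p2 p3 p4.
by rewrite addrACA.
Qed.

Definition bt i x : quat R := qmul (covd a psi x (tangv i x)) (ipsi psi x).

Lemma bb_split x : U0 x -> exists c, forall i, bb i x = bt i x + x 0 i *: c.
Proof.
move=> Ux; exists ((eucl x ^+ 2)^-1 *: qmul (covd a psi x x) (ipsi psi x)) => i.
rewrite /bt /tangv covdD covdZ qmulDl qmulZl /Defs.bracket scalerA -addrA -scalerDl.
by rewrite addNr scale0r addr0.
Qed.

Lemma bt_le i x e : U0 x -> 0 <= e -> curv_le a e (eucl x) -> eucl (bt i x) <= Cp / q * e / eucl x.
Proof.
move=> Ux e0 Fe; have r0 := eucl_gt0 Ux; rewrite /bt eucl_qmul.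
have B := covd_psi Ux (dot_tangv i Ux) e0 Fe.
have t1 := tangv_le1 i Ux.
have : eucl x * eucl (covd a psi x (tangv i x)) <= Cp * e.
  by apply: le_trans B _; rewrite ler_piMr // mulr_ge0.
rewrite -ler_pdivlMl // => B1.
have p0 := psi_gt0 Ux.
have P : eucl (ipsi psi x) <= q^-1.
  have qp : q <= eucl (psi x).
    rewrite -(@ler_pXn2r _ 2) ?nnegrE ?eucl_ge0 ?(ltW q0) // eucl_sqr; exact: psi_ge.
  have ep : 0 < eucl (psi x) by exact: lt_le_trans qp.
  rewrite /ipsi euclZ eucl_qconj ger0_norm ?invr_ge0 ?(ltW p0) // -eucl_sqr expr2 invfM.
  by rewrite -mulrA mulVf ?gt_eqF // mulr1 lef_pV2.
apply: le_trans (ler_pM (eucl_ge0 _) (eucl_ge0 _) B1 P) _.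
by rewrite le_eqVlt; apply/orP; left; apply/eqP; field; rewrite !gt_eqF.
Qed.

Lemma curv2_ev j k x : curv2 a x (ev R j) (ev R k) = F j k x.
Proof.
rewrite /curv2 (bigD1 j) //= [X in _ + X]big1 ?addr0 => [|i ij]; last first.
  by rewrite big1 // => l _; rewrite evE eq_sym (negbTE ij) mul0r scale0r.
rewrite (bigD1 k) //= big1 ?addr0 => [|l lk]; first by rewrite !evE !eqxx mulr1 scale1r.
by rewrite [ev R k 0 l]evE eq_sym (negbTE lk) mulr0 scale0r.
Qed.

Lemma curv_le_entry j k x e : U0 x -> 0 <= e -> curv_le a e (eucl x) ->
  eucl (F j k x) <= e / eucl x ^+ 2.
Proof.
move=> Ux e0 Fe; have r0 := eucl_gt0 Ux; rewrite ler_pdivlMr ?exprn_gt0 // mulrC.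
rewrite -curv2_ev; apply: le_trans (Fe x _ _ erefl) _.
rewrite ler_piMr //; apply: le_trans (wedge_le _ _) _.
have E i : eucl (ev R i : quat R) = 1.
  by apply: eucl_eq => //; rewrite dot_ev evE eqxx expr1n.
by rewrite !E mulr1.
Qed.

(** By [bb_split] and [S3_shift] only the tangential part of b enters, with |b| <= Cp e / (q r) and
    |F| <= e / r^2. The four components contribute terms in b F and b^3, of order e^2 / r^3 and e^3
    / r^3; e <= 1 merges them. *)
Lemma dot_current_le x e : U0 x -> 0 <= e -> e <= 1 -> curv_le a e (eucl x) ->
  `|dot x (current x)| <= 4 * (3 * (Cp / q) + 2 * (Cp / q) ^+ 3) * e ^+ 2 / eucl x ^+ 2.
Proof.
move=> Ux e0 e1 Fe; have r0 := eucl_gt0 Ux.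
have [c Ec] := bb_split Ux.
have Bt i := bt_le i Ux e0 Fe.
have Bf j k := curv_le_entry j k Ux e0 Fe.
rewrite dot4E !mkqE /cs3 -!/(S3 _ _ _ _ _ _) !mulrN.
rewrite (curvC a i3 i0) (curvC a i1 i3) (curvC a i2 i0) !Ec S3_shift.
have NF j k : eucl (- F j k x) <= e / eucl x ^+ 2 by rewrite euclN.
set u := Cp / q * e / eucl x in Bt; set w := e / eucl x ^+ 2 in Bf NF.
have u0 : 0 <= u by rewrite /u !mulr_ge0 ?invr_ge0 // ltW.
have w0 : 0 <= w by rewrite /w !mulr_ge0 ?invr_ge0 ?sqr_ge0 // ltW.
have X i : `|x 0 i| <= eucl x := eucl_coord x i.
have G (b1 b2 b3 f1 f2 f3 : quat R) i : eucl b1 <= u -> eucl b2 <= u -> eucl b3 <= u ->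
    eucl f1 <= w -> eucl f2 <= w -> eucl f3 <= w ->
    `|x 0 i * S3 b1 b2 b3 f1 f2 f3| <= eucl x * (3 * (u * w) + 2 * u ^+ 3).
  by move=> *; rewrite normrM; apply: ler_pM => //; exact: S3_bound.
have T : eucl x * (3 * (u * w) + 2 * u ^+ 3) <=
   (3 * (Cp / q) + 2 * (Cp / q) ^+ 3) * e ^+ 2 / eucl x ^+ 2.
  have -> : eucl x * (3 * (u * w) + 2 * u ^+ 3) =
    (3 * (Cp / q) + 2 * (Cp / q) ^+ 3 * e) * e ^+ 2 / eucl x ^+ 2.
    by rewrite /u /w; field; rewrite !gt_eqF.
  rewrite ler_wpM2r ?invr_ge0 ?sqr_ge0 // ler_wpM2r ?sqr_ge0 // lerD2l ler_piMr //.
  by rewrite mulr_ge0 // exprn_ge0 // divr_ge0 // ltW.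
have G1 := G _ _ _ _ _ _ i0 (Bt i1) (Bt i2) (Bt i3) (Bf i2 i3) (Bf i3 i1) (Bf i1 i2).
have G2 := G _ _ _ _ _ _ i1 (Bt i0) (Bt i2) (Bt i3) (Bf i2 i3) (NF i0 i3) (Bf i0 i2).
have G3 := G _ _ _ _ _ _ i2 (Bt i0) (Bt i1) (Bt i3) (NF i3 i1) (NF i0 i3) (Bf i0 i1).
have G4 := G _ _ _ _ _ _ i3 (Bt i0) (Bt i1) (Bt i2) (Bf i1 i2) (NF i0 i2) (Bf i0 i1).
move: G1 G2 G3 G4 T.
move: (_ * S3 _ _ _ _ _ _) (_ * S3 _ _ _ _ _ _) (_ * S3 _ _ _ _ _ _) (_ * S3 _ _ _ _ _ _) => t1 t2 t3 t4.
move: (eucl x * _) => k G1 G2 G3 G4 T.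
have -> : 4 * (3 * (Cp / q) + 2 * (Cp / q) ^+ 3) * e ^+ 2 / eucl x ^+ 2 =
  4 * ((3 * (Cp / q) + 2 * (Cp / q) ^+ 3) * e ^+ 2 / eucl x ^+ 2) by rewrite !mulrA.
move: T; move: (_ / _) => K T.
by rewrite ler_norml; move: G1 G2 G3 G4; rewrite !ler_norml => /andP[? ?] /andP[? ?] /andP[? ?] /andP[? ?]; apply/andP; split; lra.
Qed.
End Current.

(** * Cutoff estimate of the energy *)
Section BoxMore.
Variables (R : realType) (n : nat).
Implicit Types (f g : 'rV[R]_n -> R) (r : seq 'I_n).
Local Notation oT := (@openT 'rV[R]_n).

Lemma boxID r L f g x : Cn 0 setT (fun _ => f) -> Cn 0 setT (fun _ => g) ->
  boxI r L (fun y => f y + g y) x = boxI r L f x + boxI r L g x.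
Proof.
move=> Cf Cg; have Cg' : Cn 0 setT (fun _ y => -1 * g y) by exact: (Cn_mul oT (Cn_cst _ _ _) Cg).
have E : (fun y => f y + g y) = (fun y => f y - -1 * g y) by apply/funext => y; ring.
rewrite E (boxIB oT L (@stablesT R n r) Cf Cg') // (boxIZ oT L (-1) (@stablesT R n r) Cg) //.
by move: (boxI _ _ _ _) (boxI _ _ _ _) => u w; ring.
Qed.

Lemma boxI_agree r L f (x y : 'rV[R]_n) : (forall j, j \notin r -> x 0 j = y 0 j) -> boxI r L f x = boxI r L f y.
Proof.
elim: r x y => [|i r IH] x y xy /=; first by congr f; apply/rowP => j; exact: xy.
rewrite /BI (_ : (fun s => boxI r L f (upd i x s)) = (fun s => boxI r L f (upd i y s))) //.
apply/funext => s; apply: IH => j jr; rewrite !updE.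
by case: (eqVneq i j) => // ij; apply: xy; rewrite inE negb_or eq_sym ij.
Qed.
End BoxMore.

Section Cutoff.
Variable R : realType.
Local Notation isD f x d := (is_derive (x : R) (1 : R) f d).
Implicit Types x : quat R.
Local Notation oT := (@openT (quat R)).
Local Notation U0 := [set x : quat R | x != 0].
Let oU0 := @open_nonzero R 4.

Definition ix4 : seq 'I_4 := [:: i0; i1; i2; i3].

Lemma mem_ix4 j : j \in ix4. Proof. by move: j; apply: ord4P. Qed.

Lemma coord_le_dot n (y : 'rV[R]_n) j : y 0 j ^+ 2 <= dot y y.
Proof.
rewrite -eucl_sqr -real_normK ?num_real //.
by rewrite ler_pXn2r ?nnegrE ?eucl_ge0 // eucl_coord.
Qed.

Lemma norm_prod4_le (k u w z K U Z : R) : 0 <= w -> w <= 1 -> `|k| <= K -> `|u| <= U -> `|z| <= Z ->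
  `|k * u * w * z| <= K * U * 1 * Z.
Proof.
move=> w0 w1 h1 h2 h3; rewrite !normrM (ger0_norm w0).
by apply: ler_pM; rewrite ?mulr_ge0 //; apply: ler_pM; rewrite ?mulr_ge0 //; apply: ler_pM.
Qed.

Lemma dstep0 (s : R) : s <= 0 -> dstep s = 0.
Proof. by move=> s0; rewrite /dstep !(pospow_eq0 _ s0) !mul0r subrr mul0r. Qed.

Lemma dstep1 (s : R) : 1 <= s -> dstep s = 0.
Proof.
move=> s1; have h : 1 - s <= 0 by rewrite subr_le0.
by rewrite /dstep !(pospow_eq0 _ h) subr0 addr0 [X in X - _]mulrC subrr mul0r.
Qed.

Lemma open_dot_lt c : open [set x : quat R | dot x x < c].
Proof.
rewrite openE => x xc.
have C := @Cn_continuous R 4 0 _ (fun _ x => dot x x) 0 x (Cn_dotxx 0 oT) I.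
have N : nbhs (dot x x) [set y : R | y < c] by apply: open_nbhs_nbhs; split; [exact: open_lt|].
exact: (C _ N).
Qed.

Lemma Cn_cut m (f : quat R -> R) c : 0 < c -> Cn m U0 (fun _ => f) ->
  (forall x, dot x x < c -> f x = 0) -> Cn m setT (fun _ => f).
Proof.
move=> c0 Cf f0; have Cz : Cn m [set x : quat R | dot x x < c] (fun _ => f).
  by apply: (Cn_eq (@open_dot_lt c) _ (Cn_cst m _ 0)) => s x xc; rewrite f0.
apply: Cn_sub (Cn_setU Cf Cz) => x _ /=.
by case: (eqVneq x 0) => [->|]; [right; rewrite /= dot0l|left].
Qed.

(** [chi_out] is 1 for |x| <= T and 0 for |x| >= sqrt 2 T; [chi_in] is 0 for |x| <= 1 / T and 1 for
    |x| >= sqrt 2 / T. *)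
Definition chi_out (T : R) x : R := step (2 - dot x x / T ^+ 2).
Definition chi_in (T : R) x : R := step (T ^+ 2 * dot x x - 1).

Lemma C_chi_out T : Cn 2 setT (fun _ => chi_out T).
Proof.
apply: (Cn_step2 oT (Cn_sub2 oT (Cn_cst 2 _ 2) _)).
exact: (Cn_mul oT (Cn_dotxx 2 oT) (Cn_cst 2 _ _)).
Qed.

Lemma C_chi_in T : Cn 2 setT (fun _ => chi_in T).
Proof.
apply: (Cn_step2 oT (Cn_sub2 oT _ (Cn_cst 2 _ 1))).
exact: (Cn_mul oT (Cn_cst 2 _ _) (Cn_dotxx 2 oT)).
Qed.

Lemma is_derive_dotxx n (y : 'rV[R]_n) i : is_derive y (ev R i) (fun z : 'rV[R]_n => dot z z) (2 * y 0 i).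
Proof.
have iV : isDV y (ev R i) (fun z : 'rV[R]_n => z) (ev R i) by move=> j; exact: is_derive_coord.
apply: is_derive_eq (is_derive_dot iV iV) _; rewrite (dotC (ev R i)).
have -> : dot y (ev R i) = y 0 i; last by ring.
rewrite /dot (bigD1 i) //= big1 ?addr0 => [|j ji]; first by rewrite evE eqxx mulr1.
by rewrite evE eq_sym (negbTE ji) mulr0.
Qed.

Lemma pd_chi_out T i x : pd i (chi_out T) x = - (2 / T ^+ 2) * dstep (2 - dot x x / T ^+ 2) * x 0 i.
Proof.
have D : is_derive x (ev R i) (fun z => 2 - dot z z / T ^+ 2) (- (2 * x 0 i / T ^+ 2)).
  have D := is_deriveDr (isD_cst 2 x (ev R i)) (is_deriveNr (is_deriveMr (is_derive_dotxx x i) (isD_cst (T ^- 2) x (ev R i)))).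
  by apply: is_derive_eq D _; rewrite mulr0 addr0 add0r.
rewrite (is_derive_pd (is_derive_comp_dir D (is_derive_step _))).
by move: (dstep (2 - dot x x / T ^+ 2)) (x 0 i) (T ^- 2) => d y t; ring.
Qed.

Lemma pd_chi_in T i x : pd i (chi_in T) x = 2 * T ^+ 2 * dstep (T ^+ 2 * dot x x - 1) * x 0 i.
Proof.
have D : is_derive x (ev R i) (fun z => T ^+ 2 * dot z z - 1) (T ^+ 2 * (2 * x 0 i)).
  have D := is_deriveDr (is_deriveMr (isD_cst (T ^+ 2) x (ev R i)) (is_derive_dotxx x i)) (isD_cst (-1) x (ev R i)).
  by apply: is_derive_eq D _; rewrite mul0r add0r addr0.
rewrite (is_derive_pd (is_derive_comp_dir D (is_derive_step _))).
by move: (dstep (T ^+ 2 * dot x x - 1)) (x 0 i) => d y; ring.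
Qed.

(** Abstract form of the situation: J is the current, e the energy density, and [good d r] stands
    for the curvature bound [curv_le a d r]. *)
Variables (e : quat R -> R) (J : quat R -> quat R) (good : R -> R -> Prop) (CJ M : R).
Hypothesis Ce : Cn 2 U0 (fun _ => e).
Hypothesis CJ1 : CnV 1 U0 (fun _ => J).
Hypothesis divJ : forall x, U0 x -> \sum_i pd i (fun y => J y 0 i) x = - (2 * e x).
Hypothesis CJ0 : 0 <= CJ.
Hypothesis J_le : forall x d, U0 x -> 0 <= d -> d <= 1 -> good d (eucl x) ->
  `|dot x (J x)| <= CJ * d ^+ 2 / eucl x ^+ 2.
Hypotheses (M0 : 0 < M) (Mb : forall s : R, `|dstep s| <= M).

Section Scale.
Variable T : R.
Hypothesis T0 : 0 < T.

Definition chie x : R := chi_out T x * chi_in T x * e x.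

Lemma chi_in0 x : dot x x < T ^- 2 -> chi_in T x = 0.
Proof.
move=> h; apply: step0; have T2 : 0 < T ^+ 2 by rewrite exprn_gt0.
by rewrite subr_le0 -(mulfV (lt0r_neq0 T2)) ler_wpM2l // ltW.
Qed.

Let Tm2 : 0 < T ^- 2. Proof. by rewrite invr_gt0 exprn_gt0. Qed.

Lemma C_chie : Cn 2 setT (fun _ => chie).
Proof.
apply: (Cn_cut Tm2); last by move=> x /chi_in0 h; rewrite /chie h mulr0 mul0r.
have S (k : quat R -> R) : Cn 2 setT (fun _ => k) -> Cn 2 U0 (fun _ => k) by apply: Cn_sub.
exact: Cn_mul oU0 (Cn_mul oU0 (S _ (C_chi_out T)) (S _ (C_chi_in T))) Ce.
Qed.

Let CchiJ i : Cn 1 setT (fun _ x => chi_in T x * J x 0 i).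
Proof.
apply: (Cn_cut Tm2); last by move=> x /chi_in0 ->; rewrite mul0r.
have S (k : quat R -> R) : Cn 2 setT (fun _ => k) -> Cn 1 U0 (fun _ => k).
  by move=> h; apply: Cn_le (isT : (1 <= 2)%N) _; apply: Cn_sub h.
exact: Cn_mul oU0 (S _ (C_chi_in T)) (CJ1 i).
Qed.

(** The terms in which a cutoff is differentiated. They are carried by the shells T^2 <= |x|^2 <= 2
    T^2 and 1 / T^2 <= |x|^2 <= 2 / T^2, and contain J only through its product with x because the
    cutoffs are radial. *)
Let t1 x := \sum_i pd i (chi_out T) x * (chi_in T x * J x 0 i).
Let t2 x := chi_out T x * \sum_i (pd i (chi_in T) x * J x 0 i).

Let Ct1 : Cn 0 setT (fun _ => t1).
Proof.
apply: Cn_sum oT _ => i; apply: Cn_mul oT _ (Cn_le (leq0n 1) (CchiJ i)).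
exact: Cn_le (leq0n 1) (Cn_pd i (C_chi_out T)).
Qed.

Let Ct2 : Cn 0 setT (fun _ => t2).
Proof.
apply: Cn_mul oT (Cn_le (leq0n 2) (C_chi_out T)) _; apply: Cn_sum oT _ => i.
apply: (Cn_cut Tm2).
  apply: Cn_mul oU0 _ (Cn_le (leq0n 1) (CJ1 i)); apply: Cn_sub (Cn_le (leq0n 1) (Cn_pd i (C_chi_in T))) => //.
move=> x h; rewrite pd_chi_in dstep0 ?mulr0 ?mul0r //.
rewrite subr_le0 -(mulfV (lt0r_neq0 (exprn_gt0 2 T0))) ler_wpM2l ?exprn_ge0 ?(ltW T0) //; exact: ltW.
Qed.

Let CV i : Cn 1 setT (fun _ x => chi_out T x * (chi_in T x * J x 0 i)).
Proof. exact: Cn_mul oT (Cn_le (isT : (1 <= 2)%N) (C_chi_out T)) (CchiJ i). Qed.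

Let divE x : \sum_i pd i (fun x => chi_out T x * (chi_in T x * J x 0 i)) x = t1 x + t2 x - 2 * chie x.
Proof.
have Co i := @Cn_derivable R 4 1 setT (fun _ => chi_out T) i 0 x (C_chi_out T) I.
have CcJ i := @Cn_derivable R 4 0 setT (fun _ x => chi_in T x * J x 0 i) i 0 x (CchiJ i) I.
under eq_bigr => i _ do rewrite (pdM (Co i) (CcJ i)).
rewrite big_split /= -addrA; congr (_ + _); rewrite -mulr_sumr /t2 /chie.
case: (eqVneq x 0) => [->|x0].
  have Z i : pd i (fun x => chi_in T x * J x 0 i) 0 = 0.
    rewrite (@pd_eq R 4 [set x : quat R | dot x x < T ^- 2] _ (fun=> 0) i 0 (@open_dot_lt _)) /= ?dot0l //.
      exact: is_derive_pd (isD_cst 0 0 (ev R i)).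
    by move=> y /chi_in0 ->; rewrite mul0r.
  rewrite big1 => [|i _]; last exact: Z.
  rewrite big1 => [|i _]; last by rewrite pd_chi_in mxE mulr0 mul0r.
  by rewrite chi_in0 ?dot0l // !(mulr0, mul0r) subrr.
rewrite (eq_bigr (fun i => pd i (chi_in T) x * J x 0 i + chi_in T x * pd i (fun y => J y 0 i) x)); last first.
  move=> i _; apply: pdM; first exact: (@Cn_derivable R 4 1 setT (fun _ => chi_in T) i 0 x (C_chi_in T) I).
  exact: (@Cn_derivable R 4 0 U0 (fun _ y => J y 0 i) i 0 x (CJ1 i) x0).
rewrite big_split /= -[X in _ * (_ + X)]mulr_sumr divJ //.
by move: (\sum_i _) (chi_out T x) (chi_in T x) (e x) => s u w k; ring.
Qed.

Variable d : R.
Hypotheses (d0 : 0 <= d) (d1 : d <= 1).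
Hypothesis good_out : forall r, 0 < r -> T ^+ 2 <= r ^+ 2 -> good d r.
Hypothesis good_in : forall r, 0 < r -> r ^+ 2 <= 2 / T ^+ 2 -> good d r.

Let t1_le x : t1 x <= 2 * M * CJ * d ^+ 2 / T ^+ 4.
Proof.
have T2 : 0 < T ^+ 2 by rewrite exprn_gt0.
have pos : 0 <= 2 * M * CJ * d ^+ 2 / T ^+ 4.
  by rewrite !mulr_ge0 ?invr_ge0 ?sqr_ge0 ?exprn_ge0 // ltW.
have -> : t1 x = - (2 / T ^+ 2) * dstep (2 - dot x x / T ^+ 2) * chi_in T x * dot x (J x).
  rewrite /t1 /dot mulr_sumr; apply: eq_bigr => i _; rewrite pd_chi_out.
  by move: (dstep (2 - dot x x / T ^+ 2)) (chi_in T x) (x 0 i) (J x 0 i) => u w y z; ring.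
have [h|h] := lerP 1 (2 - dot x x / T ^+ 2); first by rewrite dstep1 // !(mulr0, mul0r).
have q1 : T ^+ 2 < dot x x by rewrite -[X in X < _]mul1r -ltr_pdivlMr //; lra.
have x0 : U0 x by apply: contraTneq q1 => ->; rewrite dot0l -leNgt ltW.
have r0 := eucl_gt0 x0.
have B : `|dot x (J x)| <= CJ * d ^+ 2 / T ^+ 2.
  have g : good d (eucl x) by apply: good_out => //; rewrite eucl_sqr ltW.
  apply: le_trans (J_le x0 d0 d1 g) _; rewrite eucl_sqr.
  by rewrite ler_wpM2l ?mulr_ge0 ?sqr_ge0 // lef_pV2 ?posrE ?dot_gt0 // ltW.
apply: le_trans (ler_norm _) _.
have -> : 2 * M * CJ * d ^+ 2 / T ^+ 4 = 2 / T ^+ 2 * M * 1 * (CJ * d ^+ 2 / T ^+ 2).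
  by field; rewrite gt_eqF.
apply: norm_prod4_le => //; [exact: step_ge0|exact: step_le1|].
by rewrite normrN ger0_norm // divr_ge0 // ltW.
Qed.

Let t2E x : t2 x = 2 * T ^+ 2 * dstep (T ^+ 2 * dot x x - 1) * chi_out T x * dot x (J x).
Proof.
have D : dot x (J x) = \sum_i x 0 i * J x 0 i by [].
rewrite /t2 D [RHS]mulr_sumr [LHS]mulr_sumr; apply: eq_bigr => i _; rewrite pd_chi_in.
by move: (dstep (T ^+ 2 * dot x x - 1)) (chi_out T x) (x 0 i) (J x 0 i) => u w y z; ring.
Qed.

Let t2_le x : t2 x <= 2 * M * CJ * d ^+ 2 * T ^+ 4.
Proof.
have T2 : 0 < T ^+ 2 by rewrite exprn_gt0.
have pos : 0 <= 2 * M * CJ * d ^+ 2 * T ^+ 4.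
  by rewrite !mulr_ge0 ?sqr_ge0 ?exprn_ge0 // ltW.
rewrite t2E.
have [h|h] := lerP (T ^+ 2 * dot x x - 1) 0; first by rewrite dstep0 // !(mulr0, mul0r).
have [h'|h'] := lerP 1 (T ^+ 2 * dot x x - 1); first by rewrite dstep1 // !(mulr0, mul0r).
have q1 : T ^- 2 < dot x x by rewrite -[X in X < _]mul1r ltr_pdivrMr // mulrC; lra.
have q2 : dot x x <= 2 / T ^+ 2 by rewrite ler_pdivlMr // mulrC; lra.
have x0 : U0 x by apply: contraTneq q1 => ->; rewrite dot0l -leNgt ltW.
have r0 := eucl_gt0 x0.
have B : `|dot x (J x)| <= CJ * d ^+ 2 * T ^+ 2.
  have g : good d (eucl x) by apply: good_in => //; rewrite eucl_sqr.
  apply: le_trans (J_le x0 d0 d1 g) _; rewrite eucl_sqr.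
  rewrite ler_wpM2l ?mulr_ge0 ?sqr_ge0 // -[X in _ <= X]invrK lef_pV2 ?posrE ?dot_gt0 //.
  exact: ltW.
apply: le_trans (ler_norm _) _.
have -> : 2 * M * CJ * d ^+ 2 * T ^+ 4 = 2 * T ^+ 2 * M * 1 * (CJ * d ^+ 2 * T ^+ 2) by ring.
apply: norm_prod4_le => //; [exact: step_ge0|exact: step_le1|].
by rewrite ger0_norm // mulr_ge0 // ltW.
Qed.

(** The divergence of the cut-off current integrates to 0, so twice the energy is the integral of
    [t1] and [t2]. The cubes of half side 2 T and 2 / T have volumes 256 T^4 and 256 / T^4, which
    compensate the powers of T in the bounds; each term is at most 512 M CJ d^2. *)
Lemma chie_energy : 1 <= T -> boxI ix4 (2 * T) chie 0 <= 512 * M * CJ * d ^+ 2.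
Proof.
move=> T1; have st := @stablesT R 4 ix4.
have T2 : 0 < T ^+ 2 by rewrite exprn_gt0.
have L0 : 0 <= 2 * T by rewrite mulr_ge0 // ltW.
have l0 : 0 <= 2 / T by rewrite divr_ge0 // ltW.
have lL : 2 / T <= 2 * T by rewrite ler_pdivrMr // -mulrA -expr2 ler_peMr // exprn_ege1.
have V0 (y : quat R) i : `|y 0 i| = `|2 * T| -> chi_out T y = 0.
  move=> yi; apply: step0; have := coord_le_dot y i.
  rewrite -real_normK ?num_real // yi ger0_norm // => h.
  rewrite subr_le0 ler_pdivlMr //; move: h; rewrite exprMn; move: (T ^+ 2) T2 (dot y y) => t t0 q.
  by rewrite expr2; lra.
have I0 : boxI ix4 (2 * T) (fun x => \sum_i pd i (fun x => chi_out T x * (chi_in T x * J x 0 i)) x) 0 = 0.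
  have P i : boxI ix4 (2 * T) (pd i (fun x => chi_out T x * (chi_in T x * J x 0 i))) 0 = 0.
    apply: (boxI_pd oT st _ _ (CV i)) => //; first exact: mem_ix4.
    by move=> y _ /V0 ->; rewrite mul0r.
  have CP i : Cn 0 setT (fun _ => pd i (fun x => chi_out T x * (chi_in T x * J x 0 i))).
    exact: Cn_pd i (CV i).
  rewrite (_ : (fun x => _) = (fun x => pd i0 (fun x => chi_out T x * (chi_in T x * J x 0 i0)) x
    + pd i1 (fun x => chi_out T x * (chi_in T x * J x 0 i1)) x
    + pd i2 (fun x => chi_out T x * (chi_in T x * J x 0 i2)) x
    + pd i3 (fun x => chi_out T x * (chi_in T x * J x 0 i3)) x)); last first.
    by apply/funext => x; rewrite sum4.
  have A1 := Cn_add oT (CP i0) (CP i1); have A2 := Cn_add oT A1 (CP i2).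
  by rewrite (boxID _ _ _ A2 (CP i3)) (boxID _ _ _ A1 (CP i2)) (boxID _ _ _ (CP i0) (CP i1)) !P !addr0.
have Cc := Cn_le (leq0n 2) C_chie.
have C2c : Cn 0 setT (fun _ x => 2 * chie x) by exact: Cn_mul oT (Cn_cst _ _ _) Cc.
have E : boxI ix4 (2 * T) t1 0 + boxI ix4 (2 * T) t2 0 = 2 * boxI ix4 (2 * T) chie 0.
  move: I0; rewrite (_ : (fun x => _) = (fun x => (t1 x + t2 x) - 2 * chie x)); last first.
    by apply/funext => x; exact: divE.
  rewrite (boxIB oT _ st (Cn_add oT Ct1 Ct2) C2c I) (boxID _ _ _ Ct1 Ct2) (boxIZ oT _ _ st Cc I).
  by move/eqP; rewrite subr_eq0 => /eqP.
have B1 := boxI_le_cst oT st L0 Ct1 (I : setT (0 : quat R)) (fun y _ => t1_le y).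
have Z (y : quat R) (j : 'I_4) : setT y -> 2 / T <= `|y 0 j| -> t2 y = 0.
  move=> _ h; rewrite t2E dstep1 ?mulr0 ?mul0r //.
  have h2 : (2 / T) ^+ 2 <= dot y y.
    apply: le_trans (coord_le_dot y j); rewrite -[y 0 j ^+ 2]real_normK ?num_real //.
    by rewrite ler_pXn2r ?nnegrE.
  move: (dot y y) h2 => q; rewrite expr_div_n ler_pdivrMr // (mulrC q).
  by move=> h3; rewrite lerBrDr; apply: le_trans h3; rewrite -natrX -[1 + 1]/(2%:R) ler_nat.
have S2 := boxI_shrink oT st l0 lL Ct2 (I : setT (0 : quat R)) Z isT.
have B2 := boxI_le_cst oT st l0 Ct2 (I : setT (0 : quat R)) (fun y _ => t2_le y).
rewrite S2 in E; move: B1 B2 E.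
have -> : (2 * (2 * T)) ^+ size ix4 * (2 * M * CJ * d ^+ 2 / T ^+ 4) = 512 * M * CJ * d ^+ 2.
  by rewrite /=; field; rewrite gt_eqF.
have -> : (2 * (2 / T)) ^+ size ix4 * (2 * M * CJ * d ^+ 2 * T ^+ 4) = 512 * M * CJ * d ^+ 2.
  by rewrite /=; field; rewrite gt_eqF.
move: (boxI _ _ _ _) (boxI _ _ _ _) (boxI _ _ _ _) (512 * M * CJ * d ^+ 2) => u1 u2 u3 u4; lra.
Qed.
End Scale.
End Cutoff.

(** * The Laplacian of the energy density *)
#[global] Transparent Dc curv.
Section Weitzenboeck.
Variable R : realType.
Implicit Types x v : quat R.
Variable a : 'I_4 -> quat R -> quat R.
Local Notation U0 := [set x : quat R | x != 0].
Hypothesis Ca : forall m i, CnV m U0 (fun _ => a i).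
Let oU0 := @open_nonzero R 4.
Local Notation Da := (Dc a).
Local Notation F := (curv a).

Lemma CnV_Dc m i X : CnV m.+1 U0 (fun _ => X) -> CnV m U0 (fun _ => Da i X).
Proof.
move=> CX; apply: CnV_D oU0 (CnV_pdv i CX) (CnV_bracket oU0 (Ca m i) _).
exact: CnV_le (leqnSn m) CX.
Qed.

Lemma pdv_near i (X Y : quat R -> quat R) x : U0 x -> (forall y, U0 y -> X y = Y y) ->
  pdv i X x = pdv i Y x.
Proof.
move=> Ux XY; apply/rowP => l; rewrite !pdvE; apply: (pd_eq i oU0 Ux) => y Uy.
by rewrite XY.
Qed.

Lemma Dc_near i (X Y : quat R -> quat R) x : U0 x -> (forall y, U0 y -> X y = Y y) ->
  Da i X x = Da i Y x.
Proof. by move=> Ux XY; rewrite /Dc (pdv_near i Ux XY) XY. Qed.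

Lemma DcB i X Y x : U0 x -> CnV 1 U0 (fun _ => X) -> CnV 1 U0 (fun _ => Y) ->
  Da i (fun y => X y - Y y) x = Da i X x - Da i Y x.
Proof.
move=> Ux CX CY; rewrite /Dc.
rewrite (isDV_pdv (isDV_B (CnV_isDV i 0 CX Ux) (CnV_isDV i 0 CY Ux))).
move: (pdv i X x) (pdv i Y x) (X x) (Y x) (a i x) => p q u w c.
rewrite bracketDr bracketNr; move: (bracket c u) (bracket c w) => r s.
by apply/rowP => l; zlin.
Qed.

Lemma Dc_comm i j X x : U0 x -> CnV 2 U0 (fun _ => X) ->
  Da i (Da j X) x - Da j (Da i X) x = bracket (F i j x) (X x).
Proof.
move=> Ux CX; have CX1 := CnV_le (isT : (1 <= 2)%N) CX.
have E p q : pdv p (Da q X) x = pdv p (pdv q X) x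
    + (bracket (pdv p (a q) x) (X x) + bracket (a q x) (pdv p X x)).
  apply: isDV_pdv; apply: isDV_D; first exact: (CnV_isDV p 0 (CnV_pdv q CX) Ux).
  by apply: isDV_bracket; [exact: (CnV_isDV p 0 (Ca 1 q) Ux)|exact: (CnV_isDV p 0 CX1 Ux)].
rewrite {1 3}/Dc !E /Dc /curv (pdv_comm (k := fun _ => X) 0 i j oU0 CX Ux).
move: (pdv j (pdv i X) x) (pdv i X x) (pdv j X x) (pdv i (a j) x) (pdv j (a i) x) (a i x) (a j x) (X x).
move=> d di dj p q u w y.
have := jacobi u w y; rewrite (bracketC y u) bracketNr (bracketC y (bracket u w)).
move: (bracket w y) (bracket u y) (bracket u w) => r1 r2 r3.
rewrite !(bracketDr _ _ u) !(bracketDr _ _ w) !(bracketDl _ _ y) bracketNl.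
move: (bracket u r1) (bracket w r2) (bracket r3 y) => e1 e2 e3.
move: (bracket p y) (bracket w di) (bracket u dj) (bracket q y) => b1 b2 b3 b4 E0.
by apply/rowP => l; move: E0 => /rowP/(_ l); zlin.
Qed.

Hypothesis asd1 : forall x, U0 x -> F i2 i3 x = - F i0 i1 x.
Hypothesis asd2 : forall x, U0 x -> F i3 i1 x = - F i0 i2 x.
Hypothesis asd3 : forall x, U0 x -> F i1 i2 x = - F i0 i3 x.

Local Notation B1 := (F i0 i1).
Local Notation B2 := (F i0 i2).
Local Notation B3 := (F i0 i3).

Let CB i j m : CnV m U0 (fun _ => F i j). Proof. exact: CnV_curv. Qed.

Let DN l (X Y : quat R -> quat R) x : (forall y, U0 y -> X y = - Y y) -> CnV 1 U0 (fun _ => Y) ->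
  U0 x -> Da l X x = - Da l Y x.
Proof.
move=> XY CY Ux; rewrite (Dc_near l Ux XY) /Dc (isDV_pdv (isDV_N (CnV_isDV l 0 CY Ux))).
by move: (pdv l Y x) (Y x) => p q; rewrite bracketNr -opprD.
Qed.

(** With B_i = F_0i, anti-self-duality turns the Bianchi identities into equations of Maxwell type,
    D_0 B = - curl B and div B = 0. *)
Lemma monopole x : U0 x ->
  [/\ Da i0 B1 x = Da i3 B2 x - Da i2 B3 x, Da i0 B2 x = Da i1 B3 x - Da i3 B1 x,
     Da i0 B3 x = Da i2 B1 x - Da i1 B2 x & Da i1 B1 x + Da i2 B2 x + Da i3 B3 x = 0].
Proof.
move=> Ux; have N1 l := DN l asd1 (CB i0 i1 1) Ux; have N2 l := DN l asd2 (CB i0 i2 1) Ux.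
have N3 l := DN l asd3 (CB i0 i3 1) Ux.
have H1 := bianchi Ca i0 i2 i3 Ux; have H2 := bianchi Ca i0 i3 i1 Ux.
have H3 := bianchi Ca i0 i1 i2 Ux; have H4 := bianchi Ca i1 i2 i3 Ux.
rewrite N1 (DcC Ca i2 i3 i0 Ux) in H1; rewrite N2 (DcC Ca i3 i1 i0 Ux) in H2.
rewrite N3 (DcC Ca i1 i2 i0 Ux) in H3; rewrite N1 N2 N3 in H4.
move: H1 H2 H3 H4.
move: (Da i0 B1 x) (Da i0 B2 x) (Da i0 B3 x) (Da i1 B1 x) (Da i1 B2 x) (Da i1 B3 x).
move: (Da i2 B1 x) (Da i2 B2 x) (Da i2 B3 x) (Da i3 B1 x) (Da i3 B2 x) (Da i3 B3 x).
move=> u1 u2 u3 u4 u5 u6 u7 u8 u9 u10 u11 u12 h1 h2 h3 h4.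
by split; apply/rowP => l; [move: h1|move: h2|move: h3|move: h4] => /rowP/(_ l); zlin.
Qed.

Definition rough_lap (X : quat R -> quat R) x : quat R := \sum_k Da k (Da k X) x.

(** The equation for D_0 B_i is differentiated once more and second derivatives are reordered until
    they cancel. Four commutators arise, each contributing - [B_j, B_k]. *)
Lemma rough_lapB (i j k : 'I_4) x : U0 x ->
  (forall y, U0 y -> Da i0 (F i0 i) y = Da k (F i0 j) y - Da j (F i0 k) y) ->
  (forall y, U0 y -> Da i0 (F i0 j) y = Da i (F i0 k) y - Da k (F i0 i) y) ->
  (forall y, U0 y -> Da i0 (F i0 k) y = Da j (F i0 i) y - Da i (F i0 j) y) ->
  (forall y, U0 y -> Da i (F i0 i) y + Da j (F i0 j) y + Da k (F i0 k) y = 0) ->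
  F k i x = - F i0 j x -> F j i x = F i0 k x ->
  Da i0 (Da i0 (F i0 i)) x + Da i (Da i (F i0 i)) x + Da j (Da j (F i0 i)) x
    + Da k (Da k (F i0 i)) x = - 4 *: bracket (F i0 j x) (F i0 k x).
Proof.
move=> Ux h1 h2 h3 h4 a1 a2.
have C2 p q := CB p q 2; have C1 l p q : CnV 1 U0 (fun _ => Da l (F p q)) by apply: CnV_Dc; exact: C2.
have E1 : Da i0 (Da i0 (F i0 i)) x = Da i0 (Da k (F i0 j)) x - Da i0 (Da j (F i0 k)) x.
  by rewrite (Dc_near i0 Ux h1) DcB.
have K1 := Dc_comm i0 k Ux (C2 i0 j); have K2 := Dc_comm i0 j Ux (C2 i0 k).
rewrite (Dc_near k Ux h2) (DcB _ Ux (C1 _ _ _) (C1 _ _ _)) in K1.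
rewrite (Dc_near j Ux h3) (DcB _ Ux (C1 _ _ _) (C1 _ _ _)) in K2.
have h4' y : U0 y -> Da i (F i0 i) y = (- Da j (F i0 j) y) - Da k (F i0 k) y.
  move=> /h4 /eqP; rewrite -addrA addr_eq0 => /eqP ->.
  by move: (Da _ _ _) (Da _ _ _) => u w; rewrite opprD.
have E2 : Da i (Da i (F i0 i)) x = - Da i (Da j (F i0 j)) x - Da i (Da k (F i0 k)) x.
  have CN : CnV 1 U0 (fun _ y => - Da j (F i0 j) y) by exact: (CnV_N oU0 (C1 j i0 j)).
  rewrite (Dc_near i Ux h4') (DcB _ Ux CN (C1 _ _ _)); congr (_ - _).
  exact: (DN i (X := fun y => - Da j (F i0 j) y) (fun y _ => erefl) (C1 j i0 j) Ux).
have K3 := Dc_comm k i Ux (C2 i0 k); have K4 := Dc_comm j i Ux (C2 i0 j).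
rewrite a1 in K3; rewrite a2 in K4; rewrite E1 E2.
move: K1 K2 K3 K4 {E1 E2 h4'}.
move: (Da i0 (Da k (F i0 j)) x) (Da i0 (Da j (F i0 k)) x) (Da k (Da i (F i0 k)) x) (Da k (Da k (F i0 i)) x).
move: (Da j (Da j (F i0 i)) x) (Da j (Da i (F i0 j)) x) (Da i (Da k (F i0 k)) x) (Da i (Da j (F i0 j)) x).
move: (F i0 j x) (F i0 k x) => p q t1 t2 t3 t4 t5 t6 t7 t8; rewrite (bracketC q p) bracketNl.
move: (bracket p q) => w K1 K2 K3 K4.
by apply/rowP => l; move: K1 K2 K3 K4 => /rowP/(_ l) + /rowP/(_ l) + /rowP/(_ l) + /rowP/(_ l); zlin.
Qed.

Definition lap (f : quat R -> R) x : R := \sum_k pd k (pd k f) x.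

(** The Laplacian of |X|^2 is twice the left product plus 2 |D X|^2, which is dropped. *)
Lemma lap_dot (X : quat R -> quat R) x : U0 x -> CnV 2 U0 (fun _ => X) ->
  2 * dot (rough_lap X x) (X x) <= lap (fun y => dot (X y) (X y)) x.
Proof.
move=> Ux CX; have CX1 := CnV_le (isT : (1 <= 2)%N) CX.
have E k y : U0 y -> pd k (fun y => dot (X y) (X y)) y = 2 * dot (Da k X y) (X y).
  move=> Uy; rewrite (is_derive_pd (pd_dot_Dc a k CX1 CX1 Uy)) (dotC (X y)).
  by move: (dot _ _) => u; ring.
have E2 k : pd k (pd k (fun y => dot (X y) (X y))) x =
    2 * (dot (Da k (Da k X) x) (X x) + dot (Da k X x) (Da k X x)).
  rewrite (pd_eq k oU0 Ux (E k)); apply: is_derive_pd.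
  have D := is_deriveMr (isD_cst 2 x (ev R k)) (pd_dot_Dc a k (CnV_Dc k CX) CX1 Ux).
  by apply: is_derive_eq D _; rewrite mul0r add0r.
rewrite /lap /rough_lap (eq_bigr _ (fun k _ => E2 k)).
have -> : dot (\sum_k Da k (Da k X) x) (X x) = \sum_k dot (Da k (Da k X) x) (X x).
  rewrite !sum4 !dotDl //.
rewrite mulr_sumr; apply: ler_sum => k _; rewrite ler_pM2l // lerDl; exact: dot_ge0.
Qed.

Lemma Cn_energy m : Cn m U0 (fun _ => energy a).
Proof.
apply: Cn_add oU0 (Cn_add oU0 _ _) _; exact: Cn_dot oU0 (CB _ _ m) (CB _ _ m).
Qed.

Lemma lapD (f g : quat R -> R) x : U0 x -> Cn 2 U0 (fun _ => f) -> Cn 2 U0 (fun _ => g) ->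
  lap (fun y => f y + g y) x = lap f x + lap g x.
Proof.
move=> Ux Cf Cg; rewrite /lap -big_split; apply: eq_bigr => k _ /=.
have E y : U0 y -> pd k (fun y => f y + g y) y = pd k f y + pd k g y.
  move=> Uy; apply: pdD; [exact: (@Cn_derivable R 4 1 U0 (fun _ => f) k 0 y Cf Uy)|].
  exact: (@Cn_derivable R 4 1 U0 (fun _ => g) k 0 y Cg Uy).
rewrite (pd_eq k oU0 Ux E); apply: pdD.
  exact: (@Cn_derivable R 4 0 U0 (fun _ => pd k f) k 0 x (Cn_pd k Cf) Ux).
exact: (@Cn_derivable R 4 0 U0 (fun _ => pd k g) k 0 x (Cn_pd k Cg) Ux).
Qed.

(** The cyclic symmetry of the triple product makes the three components contribute equally, and 24
    = 3 * 2 * 4. *)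
Lemma lap_energy x : U0 x ->
  - (24 * dot (B1 x) (bracket (B2 x) (B3 x))) <= lap (energy a) x.
Proof.
move=> Ux; have M y : U0 y -> _ := @monopole y.
have m1 y : U0 y -> Da i0 B1 y = Da i3 B2 y - Da i2 B3 y by move=> /M[].
have m2 y : U0 y -> Da i0 B2 y = Da i1 B3 y - Da i3 B1 y by move=> /M[].
have m3 y : U0 y -> Da i0 B3 y = Da i2 B1 y - Da i1 B2 y by move=> /M[].
have m4 y : U0 y -> Da i1 B1 y + Da i2 B2 y + Da i3 B3 y = 0 by move=> /M[].
have m5 y : U0 y -> Da i2 B2 y + Da i3 B3 y + Da i1 B1 y = 0.
  by move=> /m4 <-; rewrite -[RHS]addrA [RHS]addrC.
have m6 y : U0 y -> Da i3 B3 y + Da i1 B1 y + Da i2 B2 y = 0.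
  by move=> /m5 <-; rewrite -[RHS]addrA [RHS]addrC.
have a32 := asd2 Ux; have a21 : F i2 i1 x = B3 x by rewrite curvC asd3 // opprK.
have a13 : F i3 i2 x = B1 x by rewrite curvC asd1 // opprK.
have a12 := asd3 Ux; have a23 := asd1 Ux; have a31 : F i1 i3 x = B2 x by rewrite curvC asd2 // opprK.
have R1 := rough_lapB Ux m1 m2 m3 m4 a32 a21.
have R2 := rough_lapB Ux m2 m3 m1 m5 a12 a13.
have R3 := rough_lapB Ux m3 m1 m2 m6 a23 a31.
have L1 := lap_dot Ux (CB i0 i1 2); have L2 := lap_dot Ux (CB i0 i2 2).
have L3 := lap_dot Ux (CB i0 i3 2).
have d i := Cn_dot oU0 (CB i0 i 2) (CB i0 i 2).
have -> : lap (energy a) x = lap (fun y => dot (B1 y) (B1 y)) x + lap (fun y => dot (B2 y) (B2 y)) x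
   + lap (fun y => dot (B3 y) (B3 y)) x.
  rewrite -(lapD Ux (d i1) (d i2)).
  exact: (lapD Ux (Cn_add oU0 (d i1) (d i2)) (d i3)).
have S X : rough_lap X x = Da i0 (Da i0 X) x + Da i1 (Da i1 X) x + Da i2 (Da i2 X) x + Da i3 (Da i3 X) x.
  exact: sum4.
have P (u w s t : quat R) : u + w + s + t = u + s + t + w.
  by rewrite -!addrA; congr (_ + _); rewrite addrC -addrA.
have P' (u w s t : quat R) : u + w + s + t = u + t + w + s.
  by rewrite -!addrA; congr (_ + _); rewrite addrA addrC.
have S1 := etrans (S B1) R1; have S2 := etrans (etrans (S B2) (P _ _ _ _)) R2.
have S3 := etrans (etrans (S B3) (P' _ _ _ _)) R3.
rewrite S1 dotZl in L1; rewrite S2 dotZl in L2; rewrite S3 dotZl in L3; move: L1 L2 L3.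
have -> : dot (bracket (B2 x) (B3 x)) (B1 x) = dot (B1 x) (bracket (B2 x) (B3 x)) by rewrite dotC.
have -> : dot (bracket (B3 x) (B1 x)) (B2 x) = dot (B1 x) (bracket (B2 x) (B3 x)).
  by rewrite dotC -dot_bracket dotC.
have -> : dot (bracket (B1 x) (B2 x)) (B3 x) = dot (B1 x) (bracket (B2 x) (B3 x)).
  by rewrite dot_bracket.
move: (dot _ _) (lap _ x) (lap _ x) (lap _ x) => t l1 l2 l3; lra.
Qed.
End Weitzenboeck.

(** * Ball averages *)
Lemma boxI_ext (R : realType) n (r : seq 'I_n) L (f g : 'rV[R]_n -> R) x : f =1 g ->
  boxI r L f x = boxI r L g x.
Proof. by move=> /funext ->. Qed.

Section MeanValue.
Variable R : realType.
Local Notation isD f x d := (is_derive (x : R) (1 : R) f d).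
Local Notation oT4 := (@openT 'rV[R]_4).
Local Notation oT5 := (@openT 'rV[R]_5).
Implicit Types (y : 'rV[R]_4) (z : 'rV[R]_5) (i k : 'I_4).

(* The radius of the ball is carried as a fifth coordinate, so that the ball average
   can be differentiated under the integral over R^4. *)
Definition wid (i : 'I_4) : 'I_5 := widen_ord (leqnSn 4) i.
Definition pr z : 'rV[R]_4 := \row_i z 0 (wid i).
Definition emb y (s : R) : 'rV[R]_5 := \row_(j < 5) if unlift ord_max j is Some i then y 0 i else s.

Lemma widE i : wid i = lift ord_max i.
Proof. by apply: val_inj; rewrite /= /bump leqNgt ltn_ord. Qed.

Lemma emb_wid y s i : emb y s 0 (wid i) = y 0 i.
Proof. by rewrite mxE widE liftK. Qed.

Lemma emb_last y s : emb y s 0 ord_max = s.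
Proof. by rewrite mxE unlift_none. Qed.

Lemma prE z i : pr z 0 i = z 0 (wid i).
Proof. by rewrite mxE. Qed.

Lemma pr_emb y s : pr (emb y s) = y.
Proof. by apply/rowP => i; rewrite prE emb_wid. Qed.

Lemma wid_last i : (wid i == ord_max) = false.
Proof. by rewrite widE eq_sym; apply/negbTE; exact: neq_lift. Qed.

Lemma wid_inj : injective wid.
Proof. by move=> i j /(congr1 val) /= h; exact: val_inj. Qed.

Lemma ord5P (P : 'I_5 -> Prop) : (forall i, P (wid i)) -> P ord_max -> forall j, P j.
Proof.
move=> h1 h2 j; case: (unliftP ord_max j) => [i ->|-> //]; by rewrite -widE.
Qed.

Lemma pr_upd i z s : pr (upd (wid i) z s) = upd i (pr z) s.
Proof.
apply/rowP => j; rewrite prE !updE prE.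
by rewrite (inj_eq wid_inj).
Qed.

Lemma boxI_wid r L (G : 'rV[R]_5 -> R) z :
  boxI (map wid r) L G z = boxI r L (fun y => G (emb y (z 0 ord_max))) (pr z).
Proof.
elim: r z => [|i r IH] z /=.
  congr G; apply/rowP; apply: ord5P => [i|]; first by rewrite emb_wid prE.
  by rewrite emb_last.
rewrite /BI; congr (prim _ _ - prim _ _); apply/funext => s;
  by rewrite IH pr_upd updE wid_last.
Qed.

#[global] Opaque boxI.

(* grad zeta (y) = - eta(y) y, whence d/ds of the average of f(p + s y) against eta is
   s times the average of the Laplacian against zeta. *)
Definition eta y : R := pospow 3 (1 - dot y y).
Definition zeta y : R := pospow 4 (1 - dot y y) / 2.

Variables (f : 'rV[R]_4 -> R) (p : 'rV[R]_4).
Hypothesis Cf : Cn 2 setT (fun _ => f).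
Local Notation aff z := (p + z 0 ord_max *: pr z).

Let Cpr m j : Cn m setT (fun _ z => pr z 0 j).
Proof. by apply: (Cn_eq oT5 _ (Cn_coord m _ (wid j))) => s z _; rewrite prE. Qed.

Let Caff m (g : 'rV[R]_4 -> R) : Cn m setT (fun _ => g) -> Cn m setT (fun _ z => g (aff z)).
Proof.
move=> Cg; apply: (@Cn_comp R 5 4 setT setT (fun _ z => aff z) oT5 oT4 _ m g Cg) => [//|j].
apply: (Cn_eq oT5 _ (Cn_add oT5 (Cn_cst m _ (p 0 j)) (Cn_mul oT5 (Cn_coord m _ ord_max) (Cpr m j)))).
by move=> s z _; rewrite [RHS]mxE [X in _ = _ + X]mxE.
Qed.

Let Cdot m : Cn m setT (fun _ z => dot (pr z) (pr z)).
Proof. by apply: (Cn_dot oT5) => j; exact: Cpr. Qed.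

Let Ceta m : (m <= 3)%N -> Cn m setT (fun _ z => eta (pr z)).
Proof.
move=> m3; apply: Cn_le m3 _.
exact: (Cn_pospow oT5 (Cn_sub2 oT5 (Cn_cst _ _ 1) (Cdot _))).
Qed.

Let Czeta m : (m <= 4)%N -> Cn m setT (fun _ z => zeta (pr z)).
Proof.
move=> m3; apply: Cn_le m3 _.
exact: (Cn_mul oT5 (Cn_pospow oT5 (Cn_sub2 oT5 (Cn_cst _ _ 1) (Cdot _))) (Cn_cst _ _ _)).
Qed.

Definition mean_kernel z : R := eta (pr z) * f (aff z).
Definition mean_flux k z : R := zeta (pr z) * pd k f (aff z).

Let Cpdf k : Cn 1 setT (fun _ => pd k f). Proof. exact: Cn_pd k Cf. Qed.

Let CG : Cn 2 setT (fun _ => mean_kernel).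
Proof. exact: (Cn_mul oT5 (Ceta (isT : (2 <= 3)%N)) (Caff Cf)). Qed.

Let CH k : Cn 1 setT (fun _ => mean_flux k).
Proof. exact: (Cn_mul oT5 (Czeta (isT : (1 <= 4)%N)) (Caff (Cpdf k))). Qed.

Lemma is_derive_dotpr z v : is_derive z v (fun z => dot (pr z) (pr z)) (2 * dot (pr v) (pr z)).
Proof.
have D : isDV z v pr (pr v).
  move=> j; have -> : (fun y : 'rV[R]_5 => pr y 0 j) = (fun y : 'rV[R]_5 => y 0 (wid j)).
    by apply/funext => y; rewrite prE.
  by rewrite prE; exact: is_derive_coord.
apply: is_derive_eq (is_derive_dot D D) _; rewrite (dotC (pr z)).
by move: (dot _ _) => u; ring.
Qed.

Lemma pr_ev_wid k : pr (ev R (wid k)) = ev R k.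
Proof. by apply/rowP => j; rewrite prE !evE (inj_eq wid_inj). Qed.

Lemma pr_ev_last : pr (ev R ord_max) = 0.
Proof. by apply/rowP => j; rewrite prE evE eq_sym wid_last mxE. Qed.

Lemma is_derive_aff z j (g : 'rV[R]_4 -> R) : Cn 1 setT (fun _ => g) ->
  is_derive z (ev R j) (fun z => g (aff z))
    (\sum_i ((ev R j 0 ord_max * pr z 0 i + z 0 ord_max * pr (ev R j) 0 i) * pd i g (aff z))).
Proof.
move=> Cg.
have Dc i : is_derive z (ev R j) (fun x : 'rV[R]_5 => (p + x 0 ord_max *: pr x) 0 i)
    (ev R j 0 ord_max * pr z 0 i + z 0 ord_max * pr (ev R j) 0 i).
  have -> : (fun x : 'rV[R]_5 => (p + x 0 ord_max *: pr x) 0 i) =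
      (fun x : 'rV[R]_5 => p 0 i + x 0 ord_max * x 0 (wid i)).
    by apply/funext => x; rewrite mxE [X in _ + X]mxE prE.
  rewrite !prE.
  have D := is_deriveDr (isD_cst (p 0 i) z (ev R j))
    (is_deriveMr (is_derive_coord z (ev R j) ord_max) (is_derive_coord z (ev R j) (wid i))).
  by apply: is_derive_eq D _; rewrite add0r.
have dc i : derivable (fun x : 'rV[R]_5 => (p + x 0 ord_max *: pr x) 0 i) z (ev R j) by case: (Dc i).
have P := @pd_comp R 5 4 setT setT (fun _ (x : 'rV[R]_5) => p + x 0 ord_max *: pr x) oT4 (fun _ _ _ => I) 0 g j 0 z Cg dc I.
apply: is_derive_eq P _; apply: eq_bigr => i _; congr (_ * _).
exact: is_derive_pd (Dc i).
Qed.

(** The derivative in the radius s is eta y . (grad f)(p + s y), which equals - grad zeta . (grad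
    f)(p + s y), and this is s zeta (Laplacian of f) minus a divergence in y; the divergence
    disappears on integration. *)
Lemma pd_last_mean_kernel z : pd ord_max mean_kernel z = z 0 ord_max * (zeta (pr z) * lap f (aff z))
  - \sum_k pd (wid k) (mean_flux k) z.
Proof.
have -> : pd ord_max mean_kernel z = \sum_k eta (pr z) * (pr z 0 k * pd k f (aff z)).
  apply: is_derive_pd.
  have De : is_derive z (ev R ord_max) (fun z => eta (pr z)) 0.
    have D := is_derive_comp_dir (is_deriveDr (isD_cst 1 z (ev R ord_max)) (is_deriveNr (is_derive_dotpr z (ev R ord_max))))
      (is_derive_pospow 2 (1 - dot (pr z) (pr z))).
    by apply: is_derive_eq D _; rewrite pr_ev_last dot0l mulr0 oppr0 addr0 mulr0.
  apply: is_derive_eq (is_deriveMr De (is_derive_aff z ord_max (Cn_le (isT : (1 <= 2)%N) Cf))) _.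
  rewrite mul0r add0r mulr_sumr; apply: eq_bigr => k _.
  by rewrite evE eqxx mul1r pr_ev_last [X in _ + _ * X]mxE mulr0 addr0.
rewrite /lap !mulr_sumr -sumrB; apply: eq_bigr => k _.
have -> : pd (wid k) (mean_flux k) z = - (pr z 0 k * eta (pr z)) * pd k f (aff z)
    + zeta (pr z) * (z 0 ord_max * pd k (pd k f) (aff z)).
  apply: is_derive_pd.
  have Dz : is_derive z (ev R (wid k)) (fun z => zeta (pr z)) (- (pr z 0 k * eta (pr z))).
    have D := is_deriveMr (is_derive_comp_dir (is_deriveDr (isD_cst 1 z (ev R (wid k)))
      (is_deriveNr (is_derive_dotpr z (ev R (wid k)))))
      (is_derive_pospow 3 (1 - dot (pr z) (pr z)))) (isD_cst 2^-1 z (ev R (wid k))).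
    apply: is_derive_eq D _; rewrite pr_ev_wid dotC dot_ev -/(eta _).
    by move: (eta _) (pr z 0 k) (pospow _ _) => u w t; field.
  have := is_derive_aff z (wid k) (Cpdf k).
  rewrite (bigD1 k) //= big1 ?addr0 => [|i ik].
    rewrite evE wid_last mul0r add0r pr_ev_wid evE eqxx mulr1 => D.
    exact: is_deriveMr Dz D.
  by rewrite evE wid_last mul0r add0r pr_ev_wid evE eq_sym (negbTE ik) mulr0 mul0r.
by move: (z 0 ord_max) (eta _) (zeta _) (pr z 0 k) (pd k f _) (pd k (pd k f) _) => s u w t q r; ring.
Qed.

Definition ball_mean (s : R) : R := boxI ix4 1 (fun y => eta y * f (p + s *: y)) 0.

Let r5 := map wid ix4.
Let ur5 : uniq r5. Proof. by rewrite map_inj_uniq //; exact: wid_inj. Qed.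

Lemma ball_meanE s : ball_mean s = boxI r5 1 mean_kernel (0 + s *: ev R ord_max).
Proof.
rewrite boxI_wid /ball_mean.
have -> : (0 + s *: ev R ord_max : 'rV[R]_5) 0 ord_max = s.
  by rewrite add0r mxE evE eqxx mulr1.
rewrite [RHS](@boxI_agree R 4 ix4 1 _ _ 0) => [|j]; last by rewrite mem_ix4.
apply: boxI_ext => y.
by rewrite /mean_kernel emb_last pr_emb.
Qed.

Lemma ball_mean0 : ball_mean 0 = f p * boxI ix4 1 eta 0.
Proof.
rewrite /ball_mean; have Ce : Cn 0 setT (fun _ => eta).
  apply: Cn_le (leq0n 3) _.
  exact: (Cn_pospow oT4 (Cn_sub2 oT4 (Cn_cst _ _ 1) (Cn_dotxx _ oT4))).
rewrite -(boxIZ oT4 1 (f p) (@stablesT R 4 ix4) Ce I); apply: boxI_ext => y.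
by rewrite scale0r addr0 mulrC.
Qed.

Lemma is_derive_ball_mean s : isD ball_mean s (s * boxI ix4 1 (fun y => zeta y * lap f (p + s *: y)) 0).
Proof.
have st := @stablesT R 5 r5.
have lr : ord_max \notin r5.
  by apply/mapP => -[i _ /esym/eqP]; rewrite wid_last.
have CB := Cn_boxI oT5 1 st CG.
have -> : ball_mean = (fun s => boxI r5 1 mean_kernel (0 + s *: ev R ord_max)) by apply/funext => t; exact: ball_meanE.
have D := @is_derive_line R _ _ (boxI r5 1 mean_kernel) 0 (ev R ord_max) s
  (@Cn_derivable R 5 1 setT (fun _ => boxI r5 1 mean_kernel) ord_max 0 _ CB I).
apply: is_derive_eq D _.
rewrite -[LHS]/(pd ord_max (boxI r5 1 mean_kernel) (0 + s *: ev R ord_max)).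
rewrite (pd_boxI oT5 1 st lr (Cn_le (isT : (1 <= 2)%N) CG) I).
have P k : boxI r5 1 (pd (wid k) (mean_flux k)) (0 + s *: ev R ord_max) = 0.
  apply: (boxI_pd oT5 st ur5 _ (CH k) I); first by rewrite mem_map ?mem_ix4 //; exact: wid_inj.
  move=> y _; rewrite normr1 => yk; rewrite /mean_flux /zeta pospow_eq0 ?mul0r //.
  have := coord_le_dot (pr y) k; rewrite prE -real_normK ?num_real // yk expr1n.
  by rewrite subr_le0.
have CHk k : Cn 0 setT (fun _ => pd (wid k) (mean_flux k)) by exact: Cn_pd (wid k) (CH k).
have Clap : Cn 0 setT (fun _ => lap f).
  by apply: Cn_sum oT4 _ => k; exact: Cn_pd k (Cpdf k).
have CK : Cn 0 setT (fun _ z => z 0 ord_max * (zeta (pr z) * lap f (aff z))).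
  exact: (Cn_mul oT5 (Cn_coord _ _ _) (Cn_mul oT5 (Czeta (leq0n 4)) (Caff Clap))).
have -> : pd ord_max mean_kernel = (fun z => z 0 ord_max * (zeta (pr z) * lap f (aff z))
    - (pd (wid i0) (mean_flux i0) z + pd (wid i1) (mean_flux i1) z + pd (wid i2) (mean_flux i2) z + pd (wid i3) (mean_flux i3) z)).
  by apply/funext => z; rewrite pd_last_mean_kernel sum4.
have A1 := Cn_add oT5 (CHk i0) (CHk i1); have A2 := Cn_add oT5 A1 (CHk i2).
have A3 := Cn_add oT5 A2 (CHk i3).
rewrite (boxIB oT5 1 st CK A3 I) (boxID _ _ _ A2 (CHk i3)) (boxID _ _ _ A1 (CHk i2)) (boxID _ _ _ (CHk i0) (CHk i1)).
transitivity (boxI r5 1 (fun z => z 0 ord_max * (zeta (pr z) * lap f (aff z))) (0 + s *: ev R ord_max)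
    - (0 + 0 + 0 + 0)).
  by congr (_ - (_ + _ + _ + _)); [exact: (P i0)|exact: (P i1)|exact: (P i2)|exact: (P i3)].
rewrite (addr0 0) (addr0 0) (addr0 0) (subr0 (boxI _ _ _ _)) (boxI_wid ix4).
have -> : (0 + s *: ev R ord_max : 'rV[R]_5) 0 ord_max = s.
  by rewrite add0r mxE evE eqxx mulr1.
rewrite (@boxI_agree R 4 ix4 1 _ _ 0) => [|j]; last by rewrite mem_ix4.
have CZ : Cn 0 setT (fun _ y => zeta y * lap f (p + s *: y)).
  have Cz : Cn 0 setT (fun _ => zeta).
    apply: Cn_le (leq0n 4) _.
    exact: (Cn_mul oT4 (Cn_pospow oT4 (Cn_sub2 oT4 (Cn_cst _ _ 1) (Cn_dotxx _ oT4))) (Cn_cst _ _ _)).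
  apply: (Cn_mul oT4 Cz).
  apply: (@Cn_comp R 4 4 setT setT (fun _ y => p + s *: y) oT4 oT4 _ 0 (lap f) Clap) => [//|j].
  apply: (Cn_eq oT4 _ (Cn_add oT4 (Cn_cst 0 _ (p 0 j)) (Cn_mul oT4 (Cn_cst 0 _ s) (Cn_coord 0 _ j)))).
  by move=> t y _; rewrite [RHS]mxE [X in _ = _ + X]mxE.
rewrite -(boxIZ oT4 1 s (@stablesT R 4 ix4) CZ I); apply: boxI_ext => y.
by rewrite emb_last pr_emb.
Qed.

(** Mean value inequality for a function that is subharmonic up to an error K: the derivative of the
    average at radius s is at least -8 Z K s, and integration from 0 to c gives 4 Z K c^2. *)
Lemma mean_value (c K : R) : 0 <= c -> 0 <= K ->
  (forall y s, 0 <= s <= c -> dot y y < 1 -> - K <= lap f (p + s *: y)) ->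
  f p * boxI ix4 1 eta 0 <= ball_mean c + 4 * pospow 4 1 * K * c ^+ 2.
Proof.
move=> c0 K0 HK; rewrite -ball_mean0; set Z := pospow 4 1.
have Z0 : 0 <= Z by exact: pospow_ge0.
have Clap : Cn 0 setT (fun _ => lap f).
  by apply: Cn_sum oT4 _ => k; exact: Cn_pd k (Cpdf k).
(* The 8 is the volume 2^4 of the cube times the factor 1/2 in zeta <= Z / 2. *)
have B s : 0 <= s <= c -> - (8 * Z * K * s) <= s * boxI ix4 1 (fun y => zeta y * lap f (p + s *: y)) 0.
  move=> sc; have CZ : Cn 0 setT (fun _ y => zeta y * lap f (p + s *: y)).
    have Cz : Cn 0 setT (fun _ => zeta).
      apply: Cn_le (leq0n 4) _.
      exact: (Cn_mul oT4 (Cn_pospow oT4 (Cn_sub2 oT4 (Cn_cst _ _ 1) (Cn_dotxx _ oT4))) (Cn_cst _ _ _)).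
    apply: (Cn_mul oT4 Cz).
    apply: (@Cn_comp R 4 4 setT setT (fun _ y => p + s *: y) oT4 oT4 _ 0 (lap f) Clap) => [//|j].
    apply: (Cn_eq oT4 _ (Cn_add oT4 (Cn_cst 0 _ (p 0 j)) (Cn_mul oT4 (Cn_cst 0 _ s) (Cn_coord 0 _ j)))).
    by move=> t y _; rewrite [RHS]mxE [X in _ = _ + X]mxE.
  have PW y : setT y -> - (Z / 2 * K) <= zeta y * lap f (p + s *: y).
    move=> _; have [h|h] := lerP 1 (dot y y).
      rewrite /zeta pospow_eq0 ?subr_le0 // !mul0r oppr_le0; apply: mulr_ge0 => //.
      by apply: divr_ge0.
    have z0 : 0 <= zeta y by apply: divr_ge0 => //; exact: pospow_ge0.
    have zZ : zeta y <= Z / 2.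
      by rewrite ler_pM2r ?invr_gt0 //; apply: pospow_le; rewrite gerBl; exact: dot_ge0.
    apply: (@le_trans _ _ (zeta y * - K)); last by apply: ler_wpM2l (HK y s sc h).
    by rewrite mulrN lerN2; exact: ler_wpM2r.
  have st := @stablesT R 4 ix4.
  have := boxI_le oT4 st ler01 (Cn_cst 0 _ (- (Z / 2 * K))) CZ (I : setT (0 : 'rV[R]_4)) PW.
  rewrite boxI_cst; case/andP: sc => s0 _ /(ler_wpM2l s0); apply: le_trans.
  by rewrite le_eqVlt; apply/orP; left; apply/eqP; rewrite /=; field.
have gD s : isD (fun s => - (4 * Z * K * (s * s))) s (- (8 * Z * K * s)).
  have D := is_deriveNr (is_deriveMr (isD_cst (4 * Z * K) s 1) (is_deriveMr (isD_id s) (isD_id s))).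
  by apply: is_derive_eq D _; ring.
have := ler_derive c0 (fun s _ => gD s) (fun s _ => is_derive_ball_mean s) B.
rewrite !mulr0 oppr0 subr0 -expr2; move: (ball_mean c) (ball_mean 0) (4 * Z * K * c ^+ 2) => u w t; lra.
Qed.
End MeanValue.

(** * Vanishing of the curvature *)
Section Vanishing.
Variable R : realType.
Implicit Types x u v : quat R.
Local Notation oT := (@openT (quat R)).
Local Notation st4 := (@stablesT R 4 ix4).

(** The three squared terms are, up to normalisation, the anti-self-dual components of u /\ v. The
    cross terms are twice the Plucker relation p01 p23 - p02 p13 + p03 p12 = 0, which leaves the sum
    of all squares p_ij^2. *)
Lemma wedge_plucker u v :
  (u 0 i0 * v 0 i1 - u 0 i1 * v 0 i0 - (u 0 i2 * v 0 i3 - u 0 i3 * v 0 i2)) ^+ 2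
  + (u 0 i0 * v 0 i2 - u 0 i2 * v 0 i0 - (u 0 i3 * v 0 i1 - u 0 i1 * v 0 i3)) ^+ 2
  + (u 0 i0 * v 0 i3 - u 0 i3 * v 0 i0 - (u 0 i1 * v 0 i2 - u 0 i2 * v 0 i1)) ^+ 2
  = dot u u * dot v v - dot u v ^+ 2.
Proof. by rewrite !dot4E; gen_quats; ring. Qed.

(** Cauchy-Schwarz with the defect written as a sum of squares (Lagrange's identity). *)
Lemma eucl_comb3 (k1 k2 k3 : R) (p1 p2 p3 : quat R) :
  eucl (k1 *: p1 + k2 *: p2 + k3 *: p3) <=
  Num.sqrt (k1 ^+ 2 + k2 ^+ 2 + k3 ^+ 2) * Num.sqrt (dot p1 p1 + dot p2 p2 + dot p3 p3).
Proof.
set S := k1 ^+ 2 + k2 ^+ 2 + k3 ^+ 2; have S0 : 0 <= S by rewrite !addr_ge0 ?sqr_ge0.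
rewrite -sqrtrM // /eucl ler_sqrt; last by rewrite mulr_ge0 // !addr_ge0 ?dot_ge0.
rewrite -subr_ge0.
have -> : S * (dot p1 p1 + dot p2 p2 + dot p3 p3) - dot (k1 *: p1 + k2 *: p2 + k3 *: p3) (k1 *: p1 + k2 *: p2 + k3 *: p3) =
  dot (k1 *: p2 - k2 *: p1) (k1 *: p2 - k2 *: p1) + dot (k1 *: p3 - k3 *: p1) (k1 *: p3 - k3 *: p1)
  + dot (k2 *: p3 - k3 *: p2) (k2 *: p3 - k3 *: p2).
  rewrite /S !(dotDl, dotDr, dotNl, dotNr, dotZl, dotZr) (dotC p2 p1) (dotC p3 p1) (dotC p3 p2).
  by move: (dot p1 p1) (dot p2 p2) (dot p3 p3) (dot p1 p2) (dot p1 p3) (dot p2 p3) => *; ring.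
by rewrite !addr_ge0 ?dot_ge0.
Qed.

Variable a : 'I_4 -> quat R -> quat R.
Local Notation U0 := [set x : quat R | x != 0].
Hypothesis Ca : forall m i, CnV m U0 (fun _ => a i).
Hypothesis a_imag : forall i x, U0 x -> a i x 0 i0 = 0.
Local Notation F := (curv a).
Hypothesis asd1 : forall x, U0 x -> F i2 i3 x = - F i0 i1 x.
Hypothesis asd2 : forall x, U0 x -> F i3 i1 x = - F i0 i2 x.
Hypothesis asd3 : forall x, U0 x -> F i1 i2 x = - F i0 i3 x.
Let oU0 := @open_nonzero R 4.
Local Notation e := (energy a).

Lemma energy_ge0 x : 0 <= e x.
Proof. by rewrite !addr_ge0 ?dot_ge0. Qed.

Lemma curv_diag i x : F i i x = 0.
Proof.
have := curvC a i i x; move: (F i i x) => f E; apply/rowP => l.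
by move: E => /rowP/(_ l); zlin.
Qed.

Lemma curv2_asd x u v : U0 x -> curv2 a x u v =
  (u 0 i0 * v 0 i1 - u 0 i1 * v 0 i0 - (u 0 i2 * v 0 i3 - u 0 i3 * v 0 i2)) *: F i0 i1 x
  + (u 0 i0 * v 0 i2 - u 0 i2 * v 0 i0 - (u 0 i3 * v 0 i1 - u 0 i1 * v 0 i3)) *: F i0 i2 x
  + (u 0 i0 * v 0 i3 - u 0 i3 * v 0 i0 - (u 0 i1 * v 0 i2 - u 0 i2 * v 0 i1)) *: F i0 i3 x.
Proof.
move=> Ux; rewrite /curv2 !sum4 !curv_diag (curvC a i1 i0) (curvC a i2 i0) (curvC a i3 i0).
rewrite (curvC a i3 i2) (curvC a i2 i1) (curvC a i1 i3) (asd1 Ux) (asd2 Ux) (asd3 Ux).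
move: (F i0 i1 x) (F i0 i2 x) (F i0 i3 x) => f1 f2 f3.
by apply/rowP => l; rewrite !mxE; gen_quats; ring.
Qed.

Lemma curv2_energy x u v : U0 x -> eucl (curv2 a x u v) <= wedge u v * Num.sqrt (e x).
Proof.
by move=> Ux; rewrite curv2_asd // /wedge -wedge_plucker; exact: eucl_comb3.
Qed.

Lemma curv_le_energy d r : 0 < r -> 0 <= d -> (forall x, eucl x = r -> r ^+ 4 * e x <= d ^+ 2) ->
  curv_le a d r.
Proof.
move=> r0 d0 H x u v xr; have Ux : U0 x.
  by apply: contraTneq r0 => x0; rewrite -xr x0 eucl0 ltxx.
have S : r ^+ 2 * Num.sqrt (e x) <= d.
  have h : 0 <= r ^+ 2 * Num.sqrt (e x) by apply: mulr_ge0; [exact: sqr_ge0|exact: sqrtr_ge0].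
  rewrite -(@ler_pXn2r _ 2) ?nnegrE //.
  by rewrite exprMn sqr_sqrtr ?energy_ge0 // -exprM; exact: H.
apply: (@le_trans _ _ (r ^+ 2 * (wedge u v * Num.sqrt (e x)))).
  by apply: ler_wpM2l; [exact: sqr_ge0|exact: curv2_energy].
by rewrite mulrCA mulrC; apply: ler_wpM2r S; exact: sqrtr_ge0.
Qed.

Variable b0 : R.
Hypotheses (b00 : 0 <= b0) (b01 : b0 < 2^-1) (Fb : forall r, 0 < r -> curv_le a b0 r).

Lemma energy_bound : exists2 K, 0 < K & forall T d, 1 <= T -> 0 <= d -> d <= 1 ->
  (forall r, 0 < r -> T ^+ 2 <= r ^+ 2 -> curv_le a d r) ->
  (forall r, 0 < r -> r ^+ 2 <= 2 / T ^+ 2 -> curv_le a d r) ->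
  boxI ix4 (2 * T) (chie e T) 0 <= K * d ^+ 2.
Proof.
have [M M0 Mb] := dstep_bound R.
have Ca2 i := Ca 2 i.
have Cpsi := C_psi Ca2 a_imag.
pose q := gap b0; have q0 : 0 < q := gap_gt0 b00 b01.
pose Cp := 8 * M + 4; have Cp0 : 0 < Cp by rewrite addr_gt0 // mulr_gt0.
have psig x : U0 x -> q ^+ 2 <= dot (psi a x) (psi a x) by exact: psi_ge.
have cov x v d : U0 x -> dot x v = 0 -> 0 <= d -> curv_le a d (eucl x) ->
    eucl x * eucl (covd a (psi a) x v) <= Cp * d * eucl v.
  by move=> *; apply: covd_psi_le.
pose CJ := 4 * (3 * (Cp / q) + 2 * (Cp / q) ^+ 3).
have CJ0 : 0 < CJ by rewrite mulr_gt0 // addr_gt0 // mulr_gt0 // ?exprn_gt0 // divr_gt0.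
have CJJ := C_current Ca Cpsi q0 psig.
have dv x : U0 x -> \sum_i pd i (fun y => current a (psi a) y 0 i) x = - (2 * e x).
  move=> Ux; rewrite (div_current Ca Cpsi q0 psig) // asd1 // asd2 // asd3 // !dotNr /energy.
  by move: (dot _ _) (dot _ _) (dot _ _) => u1 u2 u3; ring.
have Jle x d : U0 x -> 0 <= d -> d <= 1 -> curv_le a d (eucl x) ->
    `|dot x (current a (psi a) x)| <= CJ * d ^+ 2 / eucl x ^+ 2.
  move=> Ux d0 d1 Fd; have B := (dot_current_le q0 psig (ltW Cp0) cov Ux d0 d1 Fd).
  exact: B.
clearbody CJ; exists (512 * M * CJ); first exact: (mulr_gt0 (mulr_gt0 (ltr0n _ 512) M0) CJ0).
move=> T d T1 d0 d1 go gi; have T0 : 0 < T by apply: lt_le_trans T1.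
exact: (@chie_energy R e (current a (psi a)) (curv_le a) CJ M (Cn_energy Ca 2) CJJ dv (ltW CJ0)
  Jle M0 Mb T T0 d d0 d1 go gi T1).
Qed.
End Vanishing.

(** * Decay of the energy density and its vanishing *)

Section Decay.
Variable R : realType.
Implicit Types x p y : quat R.
Local Notation oT := (@openT (quat R)).
Local Notation st4 := (@stablesT R 4 ix4).
Local Notation U0 := [set x : quat R | x != 0].

Variable e : quat R -> R.
Hypothesis e0 : forall x, 0 <= e x.
Hypothesis Ce : Cn 2 U0 (fun _ => e).
Hypothesis lap_e : forall x, U0 x -> - (48 / dot x x ^+ 3) <= lap e x.

Definition cut_energy T : R := boxI ix4 (2 * T) (chie e T) 0.
Local Notation E := cut_energy.

Lemma chie_ge0 T x : 0 <= chie e T x.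
Proof. by apply: mulr_ge0 (e0 x); apply: mulr_ge0; exact: step_ge0. Qed.

Lemma chie_eq T x : 0 < T -> 2 / T ^+ 2 <= dot x x -> dot x x <= T ^+ 2 -> chie e T x = e x.
Proof.
move=> T0 h1 h2; have T2 : 0 < T ^+ 2 := exprn_gt0 2 T0.
have -> : chie e T x = chi_out T x * chi_in T x * e x by [].
rewrite [chi_out T x]step1 ?[chi_in T x]step1 ?mul1r //.
  move: h1; rewrite ler_pdivrMr // mulrC; move: (_ * dot x x) => q; lra.
have : dot x x / T ^+ 2 <= 1 by rewrite ler_pdivrMr // mul1r.
by move: (_ / _) => q; lra.
Qed.

Lemma chie_eq0_out T x : 0 < T -> 2 * T ^+ 2 <= dot x x -> chie e T x = 0.
Proof.
move=> T0 h; rewrite /chie [chi_out T x]step0 ?mul0r //.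
by rewrite subr_le0 ler_pdivlMr // exprn_gt0.
Qed.

Lemma chie_eq0_in T x : 0 < T -> T ^+ 2 * dot x x <= 1 -> chie e T x = 0.
Proof. by move=> T0 h; rewrite /chie [chi_in T x]step0 ?mulr0 ?mul0r // subr_le0. Qed.

(** Doubling T makes the larger cutoff identically 1 on the support of the smaller one. *)
Lemma chie_le T T' x : 1 <= T -> 2 * T <= T' -> chie e T x <= chie e T' x.
Proof.
move=> T1 TT; have T0 : 0 < T by apply: lt_le_trans T1.
have T'0 : 0 < T' by apply: lt_le_trans TT; rewrite mulr_gt0.
have q : 4 * T ^+ 2 <= T' ^+ 2.
  have -> : 4 * T ^+ 2 = (2 * T) ^+ 2 by ring.
  by rewrite ler_pXn2r ?nnegrE ?(ltW T'0) // ltW // mulr_gt0.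
have [h|h] := lerP (2 * T ^+ 2) (dot x x); first by rewrite chie_eq0_out // chie_ge0.
have [k|k] := lerP (T ^+ 2 * dot x x) 1; first by rewrite chie_eq0_in // chie_ge0.
have T2 : 0 < T ^+ 2 := exprn_gt0 2 T0.
rewrite (@chie_eq T') //.
- rewrite -[X in _ <= X]mul1r; apply: ler_wpM2r => //.
  have h1 : chi_out T x <= 1 by exact: step_le1.
  have h2 : chi_in T x <= 1 by exact: step_le1.
  have h3 : 0 <= chi_in T x by exact: step_ge0.
  have h4 : 0 <= chi_out T x by exact: step_ge0.
  by rewrite -[X in _ <= X]mulr1; exact: ler_pM.
- rewrite ler_pdivrMr ?exprn_gt0 // mulrC.
  apply: (@le_trans _ _ (4 * T ^+ 2 * dot x x)); last by apply: ler_wpM2r => //; exact: dot_ge0.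
  by rewrite -mulrA; move: (_ * dot x x) k => w; lra.
- by apply: le_trans (ltW h) _; move: (T ^+ 2) (T' ^+ 2) T2 q => u w; lra.
Qed.

#[local] Opaque chie.

Lemma Cchie T : 0 < T -> Cn 0 setT (fun _ => chie e T).
Proof. by move=> T0; exact: Cn_le (leq0n 2) (C_chie Ce T0). Qed.

Lemma box_chie T L : 0 < T -> 2 * T <= L -> boxI ix4 L (chie e T) 0 = E T.
Proof.
move=> T0 TL; have T20 : 0 <= 2 * T by rewrite mulr_ge0 // ltW.
apply: (boxI_shrink oT st4 T20 TL (Cchie T0) I) => // y j _ h.
apply: chie_eq0_out => //; apply: le_trans (coord_le_dot y j).
rewrite -[y 0 j ^+ 2]real_normK ?num_real //.
apply: (@le_trans _ _ ((2 * T) ^+ 2)); last by rewrite ler_pXn2r ?nnegrE.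
by rewrite exprMn; have := exprn_gt0 2 T0; move: (T ^+ 2) => w; lra.
Qed.

#[local] Opaque cut_energy.

Lemma E_mono T T' : 1 <= T -> 2 * T <= T' -> E T <= E T'.
Proof.
move=> T1 TT; have T0 : 0 < T by apply: lt_le_trans T1.
have T'0 : 0 < T' by apply: lt_le_trans TT; rewrite mulr_gt0.
have TT2 : 2 * T <= 2 * T' by move: T0 TT; lra.
have T'20 : 0 <= 2 * T' by move: T0 TT; lra.
rewrite -(box_chie T0 TT2) -(box_chie T'0 (lexx _)).
by apply: (boxI_le oT st4 T'20 (Cchie T0) (Cchie T'0) I) => y _; exact: chie_le.
Qed.

Variable B : R.
Hypothesis EB : forall T, 1 <= T -> E T <= B.

Lemma E_almost_max d : 0 < d -> exists2 T1, 1 <= T1 & forall T, 1 <= T -> E T <= E T1 + d.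
Proof.
move=> d0; pose S := [set E T | T in [set T : R | 1 <= T]].
have hS : has_sup S.
  split; first by exists (E 1), 1 => //=.
  by exists B => _ [T T1 <-]; exact: EB.
have [_ [T1 T11 <-] h] := sup_adherent d0 hS.
exists T1 => // T T1'; rewrite -lerBlDr; apply: le_trans (ltW h).
by rewrite lerD2r; apply: sup_upper_bound => //; exists T.
Qed.

Lemma dot_shell p y (s r k : R) : eucl p = r -> 0 < r -> 0 <= s -> s <= r / 2 -> dot y y < 1 ->
  r ^+ 2 < 4 * dot (p + s *: y) (p + s *: y) /\ 4 * dot (p + s *: y) (p + s *: y) < 9 * r ^+ 2.
Proof.
move=> pr r0 s0 sr y1.
have ey : eucl y < 1.
  by rewrite -(@ltr_pXn2r _ 2) ?nnegrE ?eucl_ge0 // eucl_sqr expr1n.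
have es : eucl (s *: y) < r / 2.
  rewrite euclZ ger0_norm //.
  have [->|s0'] := eqVneq s 0; first by rewrite mul0r divr_gt0.
  apply: lt_le_trans sr; rewrite -[X in _ < X]mulr1 ltr_pM2l //.
  by rewrite lt_neqAle eq_sym s0'.
have h1 : eucl (p + s *: y) < 3 / 2 * r.
  by apply: le_lt_trans (eucl_triangle _ _) _; rewrite pr; move: (eucl _) es => w; lra.
have h2 : r / 2 < eucl (p + s *: y).
  have := eucl_triangleB (p + s *: y) (s *: y); rewrite addrK pr.
  by move: (eucl _) (eucl _) es => w z; lra.
rewrite -eucl_sqr; have h0 := eucl_ge0 (p + s *: y).
by move: (eucl (p + s *: y)) h0 h1 h2 => w *; split; nra.
Qed.

Lemma lap_chie T x : 0 < T -> 2 / T ^+ 2 < dot x x -> dot x x < T ^+ 2 ->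
  lap (chie e T) x = lap e x.
Proof.
move=> T0 h1 h2; pose O := [set y : quat R | 2 / T ^+ 2 < dot y y] `&` [set y : quat R | dot y y < T ^+ 2].
have oO : open O.
  apply: openI; last exact: open_dot_lt.
  rewrite openE => y yc.
  have C := @Cn_continuous R 4 0 _ (fun _ x => dot x x) 0 y (Cn_dotxx 0 oT) I.
  have N : nbhs (dot y y) [set z : R | 2 / T ^+ 2 < z] by apply: open_nbhs_nbhs; split; [exact: open_gt|].
  exact: (C _ N).
have fe y : O y -> chie e T y = e y by case=> /= k1 k2; apply: chie_eq => //; exact: ltW.
rewrite /lap; apply: eq_bigr => i _; apply: (pd_eq i oO) => [|y Oy]; first by split.
exact: (pd_eq i oO Oy).
Qed.

Lemma eta_int_gt0 : 0 < boxI ix4 1 (@eta R) 0.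
Proof.
have C : Cn 0 setT (fun _ => @eta R).
  apply: Cn_le (leq0n 3) _.
  exact: (Cn_pospow oT (Cn_sub2 oT (Cn_cst _ _ 1) (Cn_dotxx _ oT))).
rewrite ltNge; apply/negP => h.
have := @boxI_eq0 R 4 setT oT ix4 1 (@eta R) 0 st4 ler01 C I (fun y _ => pospow_ge0 3 _) _ h.
rewrite /eta dot0l subr0 => h0.
have := pospow_gt0 3 (@ltr01 R); rewrite h0 ?ltxx // => i _.
by rewrite mxE normr0.
Qed.

(** The mean value inequality on the ball of radius k r around p. The ball lies in the shell between
    r / 2 and 3 r / 2, outside the support of the cutoff T1, so its energy is at most E T - E T1 <=
    d; the error term comes from the lower bound for the Laplacian. *)
Lemma energy_mean (T1 d k : R) p r : 1 <= T1 -> (forall T, 1 <= T -> E T <= E T1 + d) ->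
  0 < k -> k <= 2^-1 -> eucl p = r -> 0 < r -> 4 * T1 <= r \/ 4 * T1 * r <= 1 -> 0 <= d ->
  r ^+ 4 * e p * boxI ix4 1 (@eta R) 0 <= k ^- 4 * (pospow 3 1 * d) + 4 * 64 * 48 * pospow 4 1 * k ^+ 2.
Proof.
move=> T11 ET k0 k2 pr r0 rT d0.
(* The three summands make T at least 2 T1, as monotonicity requires, and large enough for the
   cutoff T to be 1 on the whole shell. *)
pose T := 2 * T1 + 2 * r + 4 / r.
have r4 : 0 < 4 / r by rewrite divr_gt0.
have T10 : 0 < T1 by apply: lt_le_trans T11.
have TT1 : 2 * T1 <= T by rewrite /T; move: (4 / r) r4 r0 => *; lra.
have Tr : 2 * r <= T by rewrite /T; move: (4 / r) r4 T10 => *; lra.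
have T4 : 4 / r <= T by rewrite /T; move: (4 / r) r0 T10 => *; lra.
have TT : 1 <= T by move: TT1 T11; lra.
have TT2 : 2 * T1 <= 2 * T by move: TT1 T10; lra.
have T0 : 0 < T by apply: lt_le_trans TT.
clearbody T.
have c0 : 0 < k * r by rewrite mulr_gt0.
have cr : k * r <= r / 2 by rewrite [X in _ <= X]mulrC ler_wpM2r // ltW.
have shell x : r ^+ 2 < 4 * dot x x -> 4 * dot x x < 9 * r ^+ 2 ->
    [/\ 2 / T ^+ 2 < dot x x, dot x x < T ^+ 2 & chie e T1 x = 0].
  move=> h1 h2; split.
  - rewrite ltr_pdivrMr ?exprn_gt0 //.
    have h : 4 <= T * r by rewrite -ler_pdivrMr.
    have h' : 16 <= T ^+ 2 * r ^+ 2 by rewrite -exprMn; move: (T * r) h => w; nra.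
    have : T ^+ 2 * r ^+ 2 < T ^+ 2 * (4 * dot x x) by rewrite ltr_pM2l // exprn_gt0.
    rewrite (mulrCA (T ^+ 2) 4) (mulrC (dot x x)); move: (T ^+ 2 * dot x x) (T ^+ 2 * r ^+ 2) h' => u w; lra.
  - have h : 4 * r ^+ 2 <= T ^+ 2.
      have -> : 4 * r ^+ 2 = (2 * r) ^+ 2 by ring.
      by rewrite ler_pXn2r ?nnegrE ?(ltW T0) ?mulr_ge0 // ltW.
    have := exprn_gt0 2 r0.
    by move: (dot x x) (T ^+ 2) (r ^+ 2) h h2 => u w z; lra.
  - case: rT => h.
      apply: chie_eq0_out => //.
      have : (4 * T1) ^+ 2 <= r ^+ 2 by rewrite ler_pXn2r ?nnegrE ?mulr_ge0 // ltW.
      rewrite exprMn; have := exprn_gt0 2 T10.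
      by move: (T1 ^+ 2) (r ^+ 2) (dot x x) h1 => *; lra.
    apply: chie_eq0_in => //.
    have h' : 16 * (T1 ^+ 2 * r ^+ 2) <= 1.
      have : (4 * T1 * r) ^+ 2 <= 1 by rewrite expr_le1 // !mulr_ge0 // ltW.
      by rewrite !exprMn -mulrA; move: (_ * r ^+ 2) => w; lra.
    have : T1 ^+ 2 * (4 * dot x x) < T1 ^+ 2 * (9 * r ^+ 2) by rewrite ltr_pM2l // exprn_gt0.
    rewrite (mulrCA _ 4) (mulrCA _ 9).
    by move: (T1 ^+ 2 * dot x x) (T1 ^+ 2 * r ^+ 2) h' => u w; lra.
pose f := chie e T.
have Cf : Cn 2 setT (fun _ => f) := C_chie Ce T0.
have fp : f p = e p.
  have pp : dot p p = r ^+ 2 by rewrite -eucl_sqr pr.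
  have := exprn_gt0 2 r0 => r20.
  have [||h1 h2 _] := shell p; rewrite ?pp; try by move: (r ^+ 2) r20 => w; lra.
  by apply: chie_eq => //; exact: ltW.
(* On the shell |x| >= r / 2, so 48 / |x|^6 is at most 64 * 48 / r^6. *)
have K0 : 0 <= 64 * 48 / r ^+ 6 by apply: divr_ge0; [rewrite mulr_ge0 ?ler0n|exact: exprn_ge0 (ltW r0)].
have lapf y s : 0 <= s <= k * r -> dot y y < 1 -> - (64 * 48 / r ^+ 6) <= lap f (p + s *: y).
  move=> /andP[s0 sc] y1.
  have [h1 h2] := dot_shell 0 pr r0 s0 (le_trans sc cr) y1.
  have [k1 k3 _] := shell _ h1 h2.
  rewrite lap_chie //; move: (p + s *: y) h1 h2 k1 k3 => x h1 h2 k1 k3.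
  have x0 : U0 x.
    by apply: contraTneq h1 => ->; rewrite dot0l mulr0 -leNgt sqr_ge0.
  apply: le_trans (lap_e x0); rewrite lerN2.
  have q0 : 0 < dot x x by exact: dot_gt0.
  rewrite ler_pdivrMr ?exprn_gt0 //.
  rewrite mulrAC ler_pdivlMr ?exprn_gt0 //.
  have -> : r ^+ 6 = (r ^+ 2) ^+ 3 by rewrite -exprM.
  have : (r ^+ 2) ^+ 3 <= (4 * dot x x) ^+ 3 by rewrite ler_pXn2r ?nnegrE ?sqr_ge0 ?mulr_ge0 // ltW.
  rewrite (exprMn 3 4 (dot x x)) (_ : 4 ^+ 3 = 64 :> R); last by ring.
  by move: (dot x x ^+ 3) ((r ^+ 2) ^+ 3) => u w; lra.
have MV := mean_value (p := p) Cf (ltW c0) K0 lapf.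
have Vle : ball_mean f p (k * r) <= (k * r) ^- 4 * (pospow 3 1 * d).
  (* The averaging kernel expressed in the original variable, so that the average becomes an
     integral over the large cube by the substitution of [boxI_affine]. *)
  pose g x := eta ((k * r)^-1 *: (x - p)) * f x.
  have Cg : Cn 0 setT (fun _ => g).
    apply: Cn_mul oT _ (Cn_le (leq0n 2) Cf); apply: Cn_le (leq0n 3) _.
    apply: (Cn_pospow oT (Cn_sub2 oT (Cn_cst _ _ 1) _)).
    apply: (Cn_dot oT) => j;
      apply: (Cn_eq oT _ (Cn_mul oT (Cn_cst _ _ (k * r)^-1) (Cn_sub2 oT (Cn_coord _ _ j) (Cn_cst _ _ (p 0 j)))));
      by move=> s z _; rewrite !mxE.
  have g0 x : 0 <= g x by apply: mulr_ge0; [exact: pospow_ge0|exact: chie_ge0].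
  have -> : ball_mean f p (k * r) = boxI ix4 1 (fun z => g (p + (k * r) *: z)) 0.
    apply: boxI_ext => y; rewrite /g [X in X - p]addrC addrK scalerA mulVf ?scale1r //.
    by rewrite gt_eqF.
  have L0 : 0 <= 2 * T by rewrite mulr_ge0 // ltW.
  have pL i : i \in ix4 -> `|p 0 i| + k * r <= 2 * T.
    move=> _; have := eucl_coord p i; rewrite pr.
    by move: `|_| => w h; move: cr Tr r0 h; lra.
  apply: le_trans (boxI_affine 0 c0 L0 pL Cg g0) _.
  rewrite ler_wpM2l ?invr_ge0 ?exprn_ge0 ?(ltW c0) //.
  rewrite (@boxI_agree R 4 ix4 _ _ _ 0) => [|j]; last by rewrite mem_ix4.
  have P0 : 0 < pospow 3 (1 : R) by exact: pospow_gt0.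
  have CD : Cn 0 setT (fun _ x => chie e T x - chie e T1 x).
    exact: Cn_sub2 oT (Cchie T0) (Cchie T10).
  apply: (@le_trans _ _ (boxI ix4 (2 * T) (fun x => pospow 3 1 * (chie e T x - chie e T1 x)) 0)).
    apply: (boxI_le oT st4 L0 Cg (Cn_mul oT (Cn_cst _ _ _) CD) I) => y _; rewrite /g.
    have [h|h] := lerP 1 (dot ((k * r)^-1 *: (y - p)) ((k * r)^-1 *: (y - p))).
      rewrite /eta pospow_eq0 ?subr_le0 // mul0r; apply: mulr_ge0 (ltW P0) _.
      by rewrite subr_ge0; exact: chie_le.
    have yE : y = p + (k * r) *: ((k * r)^-1 *: (y - p)).
      by rewrite scalerA mulfV ?scale1r ?gt_eqF // addrC subrK.
    have [h1 h2] := dot_shell 0 pr r0 (ltW c0) cr h; rewrite -yE in h1 h2.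
    have [_ _ ->] := shell _ h1 h2; rewrite subr0; apply: ler_wpM2r; first exact: chie_ge0.
    by apply: pospow_le; rewrite lerBlDr lerDl; exact: dot_ge0.
  rewrite (boxIZ oT _ _ st4 CD I) (boxIB oT _ st4 (Cchie T0) (Cchie T10) I) (box_chie T10 TT2) (box_chie T0 (lexx _)).
  by rewrite ler_pM2l // lerBlDl; exact: ET.
rewrite fp in MV; have r40 : 0 < r ^+ 4 by rewrite exprn_gt0.
rewrite -mulrA; apply: le_trans (_ : r ^+ 4 * ((k * r) ^- 4 * (pospow 3 1 * d) + 4 * pospow 4 1 * (64 * 48 / r ^+ 6) * (k * r) ^+ 2) <= _).
  rewrite ler_pM2l //; apply: le_trans MV _; by rewrite lerD2r.
move: (pospow 3 1 * d) (pospow 4 1) => u w; rewrite le_eqVlt; apply/orP; left; apply/eqP; field.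
by rewrite !gt_eqF.
Qed.

(* [E T] is bounded and nondecreasing up to a factor in T, hence almost constant
   beyond some T1, which leaves little energy near 0 and infinity. *)
Lemma energy_decay eps : 0 < eps -> exists2 T0, 1 <= T0 &
  forall p, U0 p -> T0 <= eucl p \/ T0 * eucl p <= 1 -> eucl p ^+ 4 * e p <= eps.
Proof.
move=> eps0; have I0 := eta_int_gt0; move: (boxI ix4 1 _ 0) I0 energy_mean => I I0 EM.
have P3 : 0 < pospow 3 (1 : R) by exact: pospow_gt0.
have P4 : 0 < pospow 4 (1 : R) by exact: pospow_gt0.
pose b := eps * I / 2; have b0 : 0 < b by rewrite divr_gt0 // mulr_gt0.
pose A := 4 * 64 * 48 * pospow 4 (1 : R); have A0 : 0 < A by apply: mulr_gt0 P4; rewrite !mulr_gt0 ?ltr0n.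
(* The radius ratio k is fixed first, to make the Laplacian term at most b = eps I / 2; the energy
   allowance d is then chosen in terms of k, to make the other term equal to b. *)
have [k [k0 k2 kA]] : exists k, [/\ 0 < k, k <= 2^-1 & A * k ^+ 2 <= b].
  have A1 : 0 < A + 1 by rewrite addr_gt0.
  pose k := Num.min 2^-1 (b / (A + 1)).
  have k0 : 0 < k by rewrite lt_min invr_gt0 ltr0n divr_gt0.
  have k2 : k <= 2^-1 by rewrite ge_min lexx.
  have kb : k <= b / (A + 1) by rewrite ge_min lexx orbT.
  exists k; split => //; clearbody k.
  have : (A + 1) * k <= b by rewrite mulrC -ler_pdivlMr.
  by clearbody A b; nra.
have d0 : 0 < b * k ^+ 4 / pospow 3 1 by rewrite divr_gt0 // mulr_gt0 // exprn_gt0.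
have [T1 T11 ET] := E_almost_max d0.
exists (4 * T1); first by move: T11; lra.
move=> p p0 pT; have r0 := eucl_gt0 p0.
have := EM T1 _ k p (eucl p) T11 ET k0 k2 erefl r0 pT (ltW d0).
have -> : k ^- 4 * (pospow 3 1 * (b * k ^+ 4 / pospow 3 1)) = b.
  by field; rewrite !gt_eqF.
rewrite -/A => h; rewrite -(ler_pM2r I0); apply: le_trans h _.
have -> : eps * I = b + b by rewrite /b; field.
by rewrite lerD2l.
Qed.

Variable K : R.
Hypothesis K0 : 0 < K.
Hypothesis EK : forall T d, 1 <= T -> 0 <= d -> d <= 1 ->
  (forall r, 0 < r -> T ^+ 2 <= r ^+ 2 -> forall x, eucl x = r -> r ^+ 4 * e x <= d ^+ 2) ->
  (forall r, 0 < r -> r ^+ 2 <= 2 / T ^+ 2 -> forall x, eucl x = r -> r ^+ 4 * e x <= d ^+ 2) ->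
  E T <= K * d ^+ 2.

(** Decay makes the bound d at both ends as small as desired for a wide enough cutoff, so the energy
    is at most K d^2 <= K d <= eps; a nonnegative continuous density with zero integral vanishes. *)
Lemma energy_eq0 p : U0 p -> e p = 0.
Proof.
move=> p0; have r0 := eucl_gt0 p0; pose r := eucl p; rewrite -/r in r0.
pose T := 1 + r + 2 / r.
have r2 : 0 < 2 / r by rewrite divr_gt0.
have T1 : 1 <= T by rewrite /T; move: (2 / r) r2 r0 => *; lra.
have Tr : r <= T by rewrite /T; move: (2 / r) r2 r0 => *; lra.
have T2 : 2 / r <= T by rewrite /T; move: (2 / r) r0 => *; lra.
have T0 : 0 < T by apply: lt_le_trans T1.
clearbody T.
have ET0 : E T <= 0.
  apply/ler_addgt0Pr => eps eps0; rewrite add0r.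
  pose d := Num.min 1 (eps / K).
  have d0 : 0 < d by rewrite lt_min ltr01 divr_gt0.
  have d1 : d <= 1 by rewrite ge_min lexx.
  have dK : d <= eps / K by rewrite ge_min lexx orbT.
  clearbody d.
  have [S S1 HS] := energy_decay (exprn_gt0 2 d0).
  have S0 : 0 < S by apply: lt_le_trans S1.
  (* 2 T allows comparison with E T, and 2 S puts both end regions of the cutoff T', |x| >= T' and
     |x|^2 <= 2 / T'^2, where the decay applies. *)
  pose T' := 2 * T + 2 * S.
  have TT : 2 * T <= T' by rewrite lerDl mulr_ge0 // ltW.
  have ST : 2 * S <= T' by rewrite lerDr mulr_ge0 // ltW.
  have T'1 : 1 <= T' by move: TT T1; lra.
  have T'0 : 0 < T' by apply: lt_le_trans T'1.
  clearbody T'.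
  apply: le_trans (E_mono T1 TT) _.
  have dn : forall (q : R), 0 < q -> S <= q \/ S * q <= 1 -> forall x, eucl x = q -> q ^+ 4 * e x <= d ^+ 2.
    move=> q q0 h x xq; rewrite -xq; apply: HS; last by rewrite xq.
    by apply: contraTneq q0 => x0; rewrite -xq x0 eucl0 ltxx.
  have go : forall q, 0 < q -> T' ^+ 2 <= q ^+ 2 -> forall x, eucl x = q -> q ^+ 4 * e x <= d ^+ 2.
    move=> q q0; rewrite ler_pXn2r ?nnegrE ?(ltW q0) ?(ltW T'0) // => h; apply: dn => //.
    by left; move: ST h S0; lra.
  have gi : forall q, 0 < q -> q ^+ 2 <= 2 / T' ^+ 2 -> forall x, eucl x = q -> q ^+ 4 * e x <= d ^+ 2.
    move=> q q0; rewrite ler_pdivlMr ?exprn_gt0 // => h; apply: dn => //.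
    right; rewrite -(@ler_pXn2r _ 2) ?nnegrE ?mulr_ge0 ?(ltW q0) ?(ltW S0) // expr1n exprMn.
    have : (2 * S) ^+ 2 <= T' ^+ 2 by rewrite ler_pXn2r ?nnegrE ?mulr_ge0 ?(ltW S0) ?(ltW T'0).
    rewrite exprMn => h2.
    have := ler_wpM2l (sqr_ge0 q) h2; rewrite mulrCA [X in _ * X]mulrC.
    by move: (_ * q ^+ 2) (_ * T' ^+ 2) h => u w; lra.
  apply: le_trans (EK T'1 (ltW d0) d1 go gi) _.
  have : K * d <= eps by rewrite mulrC -ler_pdivlMr.
  by nra.
have L0 : 0 <= 2 * T by rewrite mulr_ge0 // ltW.
have pp : dot p p = r ^+ 2 by rewrite -eucl_sqr.
rewrite -(@chie_eq T) // ?pp.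
- rewrite -(box_chie T0 (lexx _)) (@boxI_agree R 4 ix4 _ _ _ p) in ET0 => [|j]; last by rewrite mem_ix4.
  apply: (boxI_eq0 oT st4 L0 (Cchie T0) I (fun y _ => chie_ge0 T y) _ ET0) => i _.
  by apply: le_lt_trans (eucl_coord p i) _; rewrite -/r; move: Tr r0; lra.
- rewrite ler_pdivrMr ?exprn_gt0 // -exprMn.
  have : 2 <= T * r by rewrite -ler_pdivrMr.
  by rewrite [r * T]mulrC; move: (T * r) => w; nra.
- by rewrite ler_pXn2r ?nnegrE ?(ltW r0) ?(ltW T0).
Qed.
End Decay.

Section FlatOnPunctured.
Variable R : realType.
Implicit Types x u v : quat R.
Local Notation U0 := [set x : quat R | x != 0].
Variable a : 'I_4 -> quat R -> quat R.
Hypothesis Ca : forall m i, CnV m U0 (fun _ => a i).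
Hypothesis a_imag : forall i x, U0 x -> a i x 0 i0 = 0.
Local Notation F := (curv a).
Hypothesis asd1 : forall x, U0 x -> F i2 i3 x = - F i0 i1 x.
Hypothesis asd2 : forall x, U0 x -> F i3 i1 x = - F i0 i2 x.
Hypothesis asd3 : forall x, U0 x -> F i1 i2 x = - F i0 i3 x.
Variable b0 : R.
Hypotheses (b00 : 0 <= b0) (b01 : b0 < 2^-1) (Fb : forall r, 0 < r -> curv_le a b0 r).

Let b1 : b0 <= 1. Proof. by move: b01; lra. Qed.

(** Each |F_jk| is at most b0 / r^2 <= 1 / r^2, and the norm of a bracket is at most twice the
    product of the norms, whence 48 = 24 * 2. *)
Lemma lap_energy_ge x : U0 x -> - (48 / dot x x ^+ 3) <= lap (energy a) x.
Proof.
move=> Ux; apply: le_trans (lap_energy Ca asd1 asd2 asd3 Ux); rewrite lerN2.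
have r0 := eucl_gt0 Ux; have q0 := dot_gt0 Ux.
have B j k : eucl (F j k x) <= (dot x x)^-1.
  apply: le_trans (curv_le_entry j k Ux b00 (Fb r0)) _.
  by rewrite eucl_sqr ler_pdivrMr // mulVf ?gt_eqF.
have H : dot (F i0 i1 x) (bracket (F i0 i2 x) (F i0 i3 x)) <=
    (dot x x)^-1 * (2 * ((dot x x)^-1 * (dot x x)^-1)).
  apply: le_trans (cauchy_schwarz _ _) _; apply: ler_pM (B _ _) _; try exact: eucl_ge0.
  apply: le_trans (eucl_bracket _ _) _; rewrite ler_pM2l ?ltr0n //.
  by apply: ler_pM (B _ _) (B _ _); exact: eucl_ge0.
rewrite -exprVn; move: (dot _ _) (dot x x)^-1 H => u w H.
apply: (@le_trans _ _ (24 * (w * (2 * (w * w))))); first by rewrite ler_pM2l ?ltr0n.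
by rewrite le_eqVlt; apply/orP; left; apply/eqP; ring.
Qed.

Theorem curv_eq0 i j x : U0 x -> F i j x = 0.
Proof.
move=> Ux; have [K K0 HK] := energy_bound Ca a_imag asd1 asd2 asd3 b00 b01 Fb.
have EB T : 1 <= T -> cut_energy (energy a) T <= K * b0 ^+ 2.
  by move=> T1; apply: HK => // r r0 _; exact: Fb.
have EK T d : 1 <= T -> 0 <= d -> d <= 1 ->
    (forall r, 0 < r -> T ^+ 2 <= r ^+ 2 -> forall x, eucl x = r -> r ^+ 4 * energy a x <= d ^+ 2) ->
    (forall r, 0 < r -> r ^+ 2 <= 2 / T ^+ 2 -> forall x, eucl x = r -> r ^+ 4 * energy a x <= d ^+ 2) ->
    cut_energy (energy a) T <= K * d ^+ 2.
  move=> T1 d0 d1 go gi; apply: HK => // r r0 h;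
    apply: (curv_le_energy asd1 asd2 asd3 r0 d0) => y yr; [exact: (go r)|exact: (gi r)].
have E0 := energy_eq0 (energy_ge0 a) (Cn_energy Ca 2) lap_energy_ge EB K0 EK Ux.
have h1 := dot_ge0 (F i0 i1 x); have h2 := dot_ge0 (F i0 i2 x); have h3 := dot_ge0 (F i0 i3 x).
have [/eqP z1 /eqP z2 /eqP z3] : [/\ dot (F i0 i1 x) (F i0 i1 x) == 0,
    dot (F i0 i2 x) (F i0 i2 x) == 0 & dot (F i0 i3 x) (F i0 i3 x) == 0].
  move: E0; rewrite /energy; move: (dot _ _) (dot _ _) (dot _ _) h1 h2 h3 => d1 d2 d3 *.
  by split; apply/eqP; lra.
have eq0 (f : quat R) : dot f f = 0 -> f = 0.
  by move=> f0; apply/eqP; apply: contraT => /dot_gt0; rewrite f0 ltxx.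
have {}z1 := eq0 _ z1; have {}z2 := eq0 _ z2; have {}z3 := eq0 _ z3.
have w1 : F i2 i3 x = 0 by rewrite asd1 // z1 oppr0.
have w2 : F i3 i1 x = 0 by rewrite asd2 // z2 oppr0.
have w3 : F i1 i2 x = 0 by rewrite asd3 // z3 oppr0.
move: i j; apply: ord4P; apply: ord4P; rewrite ?curv_diag //; by rewrite curvC ?z1 ?z2 ?z3 ?w1 ?w2 ?w3 oppr0.
Qed.
End FlatOnPunctured.

(** * Smoothness in local coordinates *)
Section SmoothCn.
Variables (R : realType) (n : nat) (W : normedModType R) (U : set 'rV[R]_n).
Hypothesis oU : open U.
Implicit Types (f : 'rV[R]_n -> W) (l : W -> R).

Definition functional l := (forall (c : R) u v, l (c *: u + v) = c * l u + l v) /\ continuous l.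

Lemma is_derive_functional l f x v : functional l -> derivable f x v ->
  is_derive x v (fun y => l (f y)) (l ('D_v f x)).
Proof.
move=> [ll lc] df.
have l0 : l 0 = 0 by have := ll (-1) 0 0; rewrite scaler0 addr0; lra.
have lZ c u : l (c *: u) = c * l u by rewrite -[c *: u]addr0 ll l0 addr0.
have H : (fun h : R => h^-1 *: (((fun y => l (f y)) \o shift x) (h *: v) - l (f x))) @ 0^' --> l ('D_v f x).
  have -> : (fun h : R => h^-1 *: (((fun y => l (f y)) \o shift x) (h *: v) - l (f x))) =
      (fun h : R => l (h^-1 *: ((f \o shift x) (h *: v) - f x))).
    apply/funext => h /=; rewrite lZ; congr (_ * _).
    by rewrite addrC -mulN1r -ll scaleN1r addrC.
  apply: (@cvg_comp _ _ _ (fun h : R => h^-1 *: ((f \o shift x) (h *: v) - f x)) l _ _ _ df).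
  exact: lc.
by apply: DeriveDef; [apply/cvg_ex; exists (l ('D_v f x))|apply: cvg_lim H].
Qed.

Lemma smooth_on_derive f v : smooth_on U f -> smooth_on U ('D_v f).
Proof.
by move=> sf vs x Ux; have := sf (rcons vs v) x Ux; rewrite /iter_derive foldr_rcons.
Qed.

Lemma smooth_derivable f x v : smooth_on U f -> U x -> derivable f x v.
Proof. by move=> sf Ux; apply: diff_derivable; exact: (sf [::]). Qed.

Lemma Cn_smooth m l f : functional l -> smooth_on U f -> Cn m U (fun _ x => l (f x)).
Proof.
move=> lf; have [_ lc] := lf; elim: m f => [|m IH] f sf.
  apply: jcont_Cn; apply: jcont_x => x Ux.
  by apply: continuous_comp; [exact: differentiable_continuous (sf [::] x Ux)|exact: lc].
apply: Cn_succ.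
  apply: jcont_x => x Ux.
  by apply: continuous_comp; [exact: differentiable_continuous (sf [::] x Ux)|exact: lc].
have D i x : U x -> is_derive x (ev R i) (fun y => l (f y)) (l ('D_(ev R i) f x)).
  by move=> Ux; apply: is_derive_functional => //; exact: smooth_derivable.
move=> i; split; first by move=> _ x Ux; case: (D i x Ux).
apply: (Cn_eq oU _ (IH _ (smooth_on_derive (ev R i) sf))) => _ x Ux.
by rewrite (is_derive_pd (D i x Ux)).
Qed.

(** Continuous partial derivatives of the coordinates give differentiability, and a directional
    derivative has as coordinates combinations of their partial derivatives, so the argument can be
    repeated for iterated derivatives. *)
Lemma smooth_Cn k (l : 'I_k -> W -> R) (w : 'I_k -> W) f :
  (forall i, functional (l i)) -> (forall z, z = \sum_i l i z *: w i) ->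
  (forall m i, Cn m U (fun _ x => l i (f x))) -> smooth_on U f.
Proof.
move=> lf lw Cf.
have diffG g : (forall i, Cn 1 U (fun _ x => l i (g x))) -> forall x, U x -> differentiable g x.
  move=> Cg x Ux.
  have -> : g = \sum_(i < k) (fun y => l i (g y) *: w i).
    by apply/funext => y; rewrite fct_sumE; exact: lw.
  apply: differentiable_sum => i; apply: differentiableZl.
  by have [] := @Cn_differentiable R n 0 U (fun _ y => l i (g y)) 0 x oU (Cg i) Ux.
suff H vs m i : Cn m U (fun _ x => l i (iter_derive vs f x)).
  by move=> vs; apply: diffG => i; exact: H.
elim: vs m i => [|v vs IH] m i //=.
have Cs : Cn m U (fun _ x => \sum_j v 0 j * pd j (fun y => l i (iter_derive vs f y)) x).
  by apply: Cn_sum oU _ => j; apply: (Cn_mul oU (Cn_cst _ _ _)); exact: (Cn_pd j (IH m.+1 i)).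
apply: (Cn_eq oU _ Cs) => _ x Ux.
have D := diffG _ (IH 1%N) x Ux.
have [_ <-] := @Cn_differentiable R n 0 U (fun _ y => l i (iter_derive vs f y)) 0 x oU (IH 1%N i) Ux.
have Dv : derivable (iter_derive vs f) x v by exact: diff_derivable.
by case: (is_derive_functional (lf i) Dv).
Qed.
End SmoothCn.

Section Ambient.
Variables (R : realType) (n : nat).
Implicit Type U : set 'rV[R]_n.
Local Notation ambient := (R * 'rV[R]_4)%type.

Lemma functional_coord (i : 'I_4) : functional (fun q : quat R => q 0 i).
Proof. by split; [move=> c u v; rewrite !mxE|exact: coord_continuous]. Qed.

Lemma functional_fst : functional (fun p : ambient => p.1).
Proof. by split => // p; exact: cvg_fst. Qed.

Lemma functional_snd (i : 'I_4) : functional (fun p : ambient => p.2 0 i).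
Proof.
split; first by move=> c u v; rewrite !mxE.
move=> p; apply: (@continuous_comp _ _ _ snd (fun q : 'rV[R]_4 => q 0 i)); first exact: cvg_snd.
exact: coord_continuous.
Qed.

Lemma CnV_smooth m U (f : 'rV[R]_n -> quat R) : open U -> smooth_on U f -> CnV m U (fun _ => f).
Proof. by move=> oU sf i; exact: (Cn_smooth oU m (functional_coord i) sf). Qed.

Lemma smooth_CnV U (f : 'rV[R]_n -> quat R) : open U -> (forall m, CnV m U (fun _ => f)) -> smooth_on U f.
Proof.
move=> oU Cf; apply: (smooth_Cn oU functional_coord (w := fun i => ev R i)) => [z|m i]; last exact: Cf.
exact: row_sum_delta.
Qed.

Lemma smooth_pair U (g : 'rV[R]_n -> ambient) : open U ->
  (forall m, Cn m U (fun _ x => (g x).1)) -> (forall m, CnV m U (fun _ x => (g x).2)) -> smooth_on U g.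
Proof.
move=> oU C1 C2.
pose l (j : 'I_5) (p : ambient) : R := if unlift ord0 j is Some i then p.2 0 i else p.1.
pose w (j : 'I_5) : ambient := if unlift ord0 j is Some i then (0, ev R i) else (1, 0).
apply: (smooth_Cn oU (l := l) (w := w)).
- move=> j; rewrite /l; case: (unlift ord0 j) => [i|]; [exact: functional_snd|exact: functional_fst].
- move=> z; rewrite big_ord_recl /l /w unlift_none.
  under eq_bigr => i _ do rewrite liftK.
  case: z => t q /=.
  have -> : \sum_(i < 4) q 0 i *: ((0, ev R i) : ambient) = (0, q).
    rewrite [in RHS](row_sum_delta q); elim/big_ind2 : _ => //.
      by move=> x1 y1 x2 y2 -> ->; congr (_, _); rewrite ?addr0.
    by move=> i _; congr (_, _); rewrite scaler0.
  by rewrite -[RHS]/(t * 1 + 0, t *: 0 + q) mulr1 addr0 scaler0 add0r.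
- move=> m j; rewrite /l; case: (unlift ord0 j) => [i|]; [exact: C2|exact: C1].
Qed.
End Ambient.

(** * Determinants and the Hodge star *)
Section Det4.
Variable R : realType.
Implicit Types a b c d q : quat R.

Definition pl (i j : 'I_4) a b : R := a 0 i * b 0 j - a 0 j * b 0 i.

(** Laplace expansion of the determinant along its first two rows, in Plucker coordinates. *)
Definition det4 a b c d : R :=
  pl i0 i1 a b * pl i2 i3 c d - pl i0 i2 a b * pl i1 i3 c d + pl i0 i3 a b * pl i1 i2 c d
  + pl i1 i2 a b * pl i0 i3 c d - pl i1 i3 a b * pl i0 i2 c d + pl i2 i3 a b * pl i0 i1 c d.

Lemma det4E (M : 'M[R]_4) : \det M = det4 (row i0 M) (row i1 M) (row i2 M) (row i3 M).
Proof.
pose f i j := M (inord i) (inord j).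
have fE i j : M i j = f (val i) (val j) by rewrite /f !inord_val.
rewrite /det4 /pl !mxE (expand_det_row _ ord0) !big_ord_recl big_ord0 /cofactor.
rewrite !(expand_det_row _ ord0) !big_ord_recl !big_ord0 /cofactor.
rewrite !(expand_det_row _ ord0) !big_ord_recl !big_ord0 /cofactor.
rewrite !det_mx11 !mxE !fE /= /bump /=.
by move: f {fE} => f; ring.
Qed.

Lemma det4_21 a b c d : det4 b a c d = - det4 a b c d.
Proof. by rewrite /det4 /pl; ring. Qed.

Lemma det4_11 a c d : det4 a a c d = 0.
Proof. by rewrite /det4 /pl; ring. Qed.

Lemma det4_ev c d :
  [/\ det4 (ev R i0) (ev R i1) c d = pl i2 i3 c d, det4 (ev R i0) (ev R i2) c d = pl i3 i1 c d,
      det4 (ev R i0) (ev R i3) c d = pl i1 i2 c d, det4 (ev R i2) (ev R i3) c d = pl i0 i1 c d &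
      det4 (ev R i3) (ev R i1) c d = pl i0 i2 c d /\ det4 (ev R i1) (ev R i2) c d = pl i0 i3 c d].
Proof. by rewrite /det4 /pl !evE /=; split; [ring|ring|ring|ring|split; ring]. Qed.

Lemma levi_civitaE (i j k l : 'I_4) :
  levi_civita R i j k l = det4 (ev R i) (ev R j) (ev R k) (ev R l).
Proof.
by rewrite /levi_civita det4E !rowK.
Qed.

Variable F : 'I_4 -> 'I_4 -> quat R.
Hypothesis FC : forall i j, F j i = - F i j.

Let plsum (a b : 'I_4) : a != b -> \sum_(k < 4) \sum_(l < 4) pl a b (ev R k) (ev R l) *: F k l = 2 *: F a b.
Proof.
move=> ab; pose t k l : quat R := ((k == a)%:R * (l == b)%:R) *: F k l.
rewrite (eq_bigr (fun k => \sum_l t k l + \sum_l - (((k == b)%:R * (l == a)%:R) *: F k l))); last first.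
  move=> k _; rewrite -big_split; apply: eq_bigr => l _.
  by rewrite /t /pl !evE scalerBl [X in _ - X *: _]mulrC [X in _ - X *: _]mulrC.
rewrite big_split /= (bigD1 a) //= [X in X + _ + _](bigD1 b) //= {1}/t !eqxx mulr1 scale1r.
rewrite big1 => [|l /negbTE lb]; last by rewrite /t lb mulr0 scale0r.
rewrite big1 => [|k /negbTE ka]; last by apply: big1 => l _; rewrite /t ka mul0r scale0r.
rewrite (bigD1 b) //= [X in _ + (X + _)](bigD1 a) //= !eqxx mulr1 scale1r.
rewrite big1 => [|l /negbTE lb]; last by rewrite lb mulr0 scale0r oppr0.
rewrite big1 => [|k /negbTE ka]; last by apply: big1 => l _; rewrite ka mul0r scale0r oppr0.
by rewrite !addr0 (FC a b) opprK -mulr2n -scaler_nat.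
Qed.

Lemma hodgeE : [/\ hodge F i0 i1 = F i2 i3, hodge F i0 i2 = F i3 i1, hodge F i0 i3 = F i1 i2,
  hodge F i2 i3 = F i0 i1 & hodge F i3 i1 = F i0 i2 /\ hodge F i1 i2 = F i0 i3].
Proof.
have H (i j a b : 'I_4) : a != b -> (forall c d, det4 (ev R i) (ev R j) c d = pl a b c d) -> hodge F i j = F a b.
  move=> ab E; rewrite /hodge.
  under eq_bigr => k _ do under eq_bigr => l _ do rewrite levi_civitaE E.
  by rewrite plsum // scalerA mulVf ?scale1r.
by split; last split; apply: H => // c d; case: (det4_ev c d) => ? ? ? ? [].
Qed.

Lemma hodgeC i j : hodge F j i = - hodge F i j.
Proof.
rewrite /hodge -scalerN -sumrN; congr (_ *: _); apply: eq_bigr => k _.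
by rewrite -sumrN; apply: eq_bigr => l _; rewrite !levi_civitaE det4_21 scaleNr.
Qed.

Lemma hodge_diag i : hodge F i i = 0.
Proof.
by rewrite /hodge big1 ?scaler0 // => k _; apply: big1 => l _; rewrite levi_civitaE det4_11 scale0r.
Qed.

Lemma hodge_asd : F i2 i3 = - F i0 i1 -> F i3 i1 = - F i0 i2 -> F i1 i2 = - F i0 i3 ->
  forall i j, hodge F i j = - F i j.
Proof.
move=> h1 h2 h3; have [e1 e2 e3 e4 [e5 e6]] := hodgeE.
have Fd i : F i i = 0.
  have := FC i i; move: (F i i) => f E; apply/rowP => l.
  by move: E => /rowP/(_ l); zlin.
have k1 : hodge F i0 i1 = - F i0 i1 by rewrite e1.
have k2 : hodge F i0 i2 = - F i0 i2 by rewrite e2.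
have k3 : hodge F i0 i3 = - F i0 i3 by rewrite e3.
have k4 : hodge F i2 i3 = - F i2 i3 by rewrite e4 h1 opprK.
have k5 : hodge F i3 i1 = - F i3 i1 by rewrite e5 h2 opprK.
have k6 : hodge F i1 i2 = - F i1 i2 by rewrite e6 h3 opprK.
have S i j : hodge F i j = - F i j -> hodge F j i = - F j i by move=> h; rewrite hodgeC h (FC i j).
by apply: ord4P; apply: ord4P; rewrite ?hodge_diag ?Fd ?oppr0 //; apply: S.
Qed.
End Det4.

Section Volume.
Variable R : realType.
Local Notation ambient := (R * 'rV[R]_4)%type.
Implicit Types (p u v : ambient) (q : quat R).

Lemma tangentE p v : tangent p v = (dot p.2 v.2 = 0).
Proof. by []. Qed.

Lemma cylE p : cyl p = (dot p.2 p.2 = 1).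
Proof. by congr (_ = _); apply: eq_bigr => i _; rewrite expr2. Qed.

Lemma det4_orth q (u : 'I_4 -> quat R) : q != 0 -> (forall i, dot q (u i) = 0) ->
  det4 (u i0) (u i1) (u i2) (u i3) = 0.
Proof.
move=> q0 qu; pose M : 'M[R]_4 := \matrix_i u i.
have -> : det4 (u i0) (u i1) (u i2) (u i3) = \det M^T by rewrite det_tr det4E !rowK.
apply/eqP/det0P; exists q => //; apply/rowP => j; rewrite !mxE -[RHS](qu j).
by apply: eq_bigr => k _; rewrite !mxE.
Qed.

Lemma vol_S3E q (u : 'I_3 -> quat R) :
  vol_S3 q u = det4 q (u ord0) (u (lift ord0 ord0)) (u (lift ord0 (lift ord0 ord0))).
Proof.
have E0 : lshift 3 (ord0 : 'I_1) = i0 :> 'I_(1 + 3) by exact: val_inj.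
have E1 : rshift 1 (ord0 : 'I_3) = i1 :> 'I_(1 + 3) by exact: val_inj.
have E2 : rshift 1 (lift ord0 ord0 : 'I_3) = i2 :> 'I_(1 + 3) by exact: val_inj.
have E3 : rshift 1 (lift ord0 (lift ord0 ord0) : 'I_3) = i3 :> 'I_(1 + 3) by exact: val_inj.
rewrite /vol_S3 det4E; congr det4; apply/rowP => j; rewrite mxE.
- exact: etrans (congr1 (fun k => col_mx q _ k j) (esym E0)) (col_mxEu _ _ _ _).
- by apply: etrans (congr1 (fun k => col_mx q _ k j) (esym E1)) _; rewrite col_mxEd mxE.
- by apply: etrans (congr1 (fun k => col_mx q _ k j) (esym E2)) _; rewrite col_mxEd mxE.
- by apply: etrans (congr1 (fun k => col_mx q _ k j) (esym E3)) _; rewrite col_mxEd mxE.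
Qed.

(** Expanding the determinant of the vectors t_i q + u_i by multilinearity, q can occur only once,
    which gives the terms of [vol_cyl]; the term without q vanishes because the u_i all lie in the
    hyperplane orthogonal to q. *)
Lemma vol_cylE p (v : 'I_4 -> ambient) : cyl p -> (forall i, tangent p (v i)) ->
  let w i := (v i).1 *: p.2 + (v i).2 in vol_cyl p v = det4 (w i0) (w i1) (w i2) (w i3).
Proof.
rewrite cylE => p1 pv w.
have q0 : p.2 != 0 by apply: contra_eq_neq p1 => ->; rewrite dot0l eq_sym oner_neq0.
have D := det4_orth q0 pv.
rewrite -[RHS]subr0 -D /vol_cyl !big_ord_recl big_ord0 !vol_S3E /w.
have E1 : lift ord0 (ord0 : 'I_3) = i1 by exact: val_inj.
have E2 : lift ord0 (lift ord0 ord0 : 'I_3) = i2 by exact: val_inj.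
have E3 : lift ord0 (lift ord0 (lift ord0 ord0) : 'I_3) = i3 by exact: val_inj.
have E4 : lift i1 (ord0 : 'I_3) = i0 by exact: val_inj.
have E5 : lift i1 (lift ord0 ord0 : 'I_3) = i2 by exact: val_inj.
have E6 : lift i1 (lift ord0 (lift ord0 ord0) : 'I_3) = i3 by exact: val_inj.
have E7 : lift i2 (ord0 : 'I_3) = i0 by exact: val_inj.
have E8 : lift i2 (lift ord0 ord0 : 'I_3) = i1 by exact: val_inj.
have E9 : lift i2 (lift ord0 (lift ord0 ord0) : 'I_3) = i3 by exact: val_inj.
have E10 : lift i3 (ord0 : 'I_3) = i0 by exact: val_inj.
have E11 : lift i3 (lift ord0 ord0 : 'I_3) = i1 by exact: val_inj.
have E12 : lift i3 (lift ord0 (lift ord0 ord0) : 'I_3) = i2 by exact: val_inj.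
rewrite !E3 !E2 !E1 E4 E5 E6 E7 E8 E9 E10 E11 E12 (_ : ord0 = i0); last exact: val_inj.
move: (v i0) (v i1) (v i2) (v i3) p.2 => [t0 u0] [t1 u1] [t2 u2] [t3 u3] q /=.
rewrite /det4 /pl !addqE !scaleqE.
gen_quats; ring.
Qed.
End Volume.

(** * The conformal chart of the cylinder *)
Section CylinderCharts.
Variable R : realType.
Local Notation ambient := (R * 'rV[R]_4)%type.
Local Notation U0 := [set x : quat R | x != 0].
Implicit Types (p u v : ambient) (x y w : quat R).
Let oU0 := @open_nonzero R 4.

(* [kap] and [chart 0] are mutually inverse, with differentials [lift_vec] and
   [dchart]; translating the first coordinate by c makes [chart c] orthonormal on the
   unit sphere instead of only at t = 0. *)
Definition kap p : quat R := expR p.1 *: p.2.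
Definition lift_vec p v : quat R := expR p.1 *: (v.1 *: p.2 + v.2).
Definition chart (c : R) x : ambient := (c + ln (eucl x), (eucl x)^-1 *: x).
Definition dchart x w : ambient :=
  (dot x w / eucl x ^+ 2, (eucl x)^-1 *: w - (dot x w / eucl x ^+ 3) *: x).

Lemma ambient_eq p u : p.1 = u.1 -> p.2 = u.2 -> p = u.
Proof. by case: p u => [? ?] [? ?] /= -> ->. Qed.

Lemma eucl_kap p : cyl p -> eucl (kap p) = expR p.1.
Proof.
rewrite cylE => p1; apply: eucl_eq; first exact: expR_ge0.
by rewrite /kap dotZl dotZr p1 mulr1 expr2.
Qed.

Lemma kap_neq0 p : cyl p -> U0 (kap p).
Proof.
move=> p1; apply: contraTneq (expR_gt0 p.1) => h.
by rewrite -(eucl_kap p1) h eucl0 ltxx.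
Qed.

Lemma chart_kap p : cyl p -> chart 0 (kap p) = p.
Proof.
move=> p1; apply: ambient_eq; rewrite /= eucl_kap //; first by rewrite expRK add0r.
by rewrite scalerA mulVf ?scale1r // gt_eqF // expR_gt0.
Qed.

Lemma dot_lift_vec p u v : cyl p -> tangent p u -> tangent p v ->
  dot (lift_vec p u) (lift_vec p v) = expR p.1 ^+ 2 * inner u v.
Proof.
rewrite cylE !tangentE => p1 pu pv; have pu' := pu; rewrite dotC in pu'.
have -> : inner u v = u.1 * v.1 + dot u.2 v.2 by [].
rewrite /lift_vec !(dotZl (expR _)) !(dotZr (expR _)).
rewrite dotDl (dotDr (u.1 *: p.2)) (dotDr u.2) !(dotZl u.1) !(dotZr v.1) p1 pv pu'.
by move: (expR _) (dot _ _) => e d; ring.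
Qed.

Lemma dchart_lift p v : cyl p -> tangent p v -> dchart (kap p) (lift_vec p v) = v.
Proof.
move=> p1 pv; have e0 := expR_gt0 p.1.
have D : dot (kap p) (lift_vec p v) = expR p.1 ^+ 2 * v.1.
  have p1' := p1; rewrite cylE in p1'; rewrite tangentE in pv.
  rewrite /kap /lift_vec dotZl dotZr dotDr dotZr p1' pv.
  by move: (expR _) => e; ring.
apply: ambient_eq; rewrite /= D eucl_kap //.
  by field; rewrite gt_eqF.
rewrite /kap /lift_vec; move: (expR p.1) e0 => e e0; apply/rowP => i; rewrite !mxE.
by field; rewrite gt_eqF.
Qed.

Lemma lift_dchart x w : U0 x -> lift_vec (chart 0 x) (dchart x w) = w.
Proof.
move=> x0; have r0 := eucl_gt0 x0.
rewrite /lift_vec /= add0r lnK ?posrE //; move: (eucl x) (dot x w) r0 => r d r0.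
by apply/rowP => i; rewrite !mxE; field; rewrite gt_eqF.
Qed.

Lemma dchart_sum x w : dchart x w = \sum_k w 0 k *: dchart x (ev R k).
Proof.
have D : dot x w = \sum_k w 0 k * x 0 k by apply: eq_bigr => k _; exact: mulrC.
have E k : dot x (ev R k) = x 0 k by rewrite dot_ev.
apply: ambient_eq.
  rewrite (raddf_sum (fst : {additive ambient -> R})) /= D mulr_suml; apply: eq_bigr => k _.
  by rewrite E -[RHS]/(w 0 k * _) mulrA.
rewrite (raddf_sum (snd : {additive ambient -> 'rV[R]_4})) /=.
apply/rowP => i; rewrite summxE !mxE D.
rewrite [RHS](eq_bigr (fun k => w 0 k * (eucl x)^-1 * (k == i)%:R - w 0 k * x 0 k * ((eucl x) ^- 3 * x 0 i))); last first.
  move=> k _; rewrite -[LHS]/((w 0 k *: ((eucl x)^-1 *: ev R k - (dot x (ev R k) / eucl x ^+ 3) *: x)) 0 i).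
  rewrite scaleqE addqE oppqE !scaleqE E evE.
  by move: (eucl x)^-1 (eucl x ^- 3) (w 0 k) (x 0 k) (x 0 i) (_%:R) => *; ring.
rewrite sumrB [X in _ = _ - X](_ : _ = (\sum_k w 0 k * x 0 k) * (eucl x ^- 3 * x 0 i)); last by rewrite mulr_suml.
rewrite [X in _ = X - _](bigD1 i) //= eqxx [X in _ = _ + X - _]big1 => [|k /negbTE ->]; last by rewrite mulr0.
rewrite (_ : true%:R = 1 :> R) //.
by move: (\sum_(k < 4) _) (eucl x)^-1 (eucl x ^- 3) => d r s; ring.
Qed.

Lemma cyl_chart c x : U0 x -> cyl (chart c x).
Proof.
move=> x0; have r0 := eucl_gt0 x0; rewrite cylE /= dotZl dotZr -eucl_sqr.
by move: (eucl x) r0 => r r0; field; rewrite gt_eqF.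
Qed.

Lemma tangent_dchart c x w : U0 x -> tangent (chart c x) (dchart x w).
Proof.
move=> x0; have r0 := eucl_gt0 x0; rewrite tangentE /= dotZl dotBr !dotZr -eucl_sqr.
by move: (eucl x) r0 (dot x w) => r r0 d; field; rewrite gt_eqF.
Qed.

Lemma derive_pair (g : quat R -> ambient) x w d1 d2 : derivable g x w ->
  is_derive x w (fun y => (g y).1) d1 -> isDV x w (fun y => (g y).2) d2 -> 'D_w g x = (d1, d2).
Proof.
move=> dg [_ D1] D2; apply: ambient_eq => /=.
  by case: (is_derive_functional (functional_fst R) dg) => _ <-.
apply/rowP => i; case: (is_derive_functional (functional_snd R i) dg) => _ <-.
by case: (D2 i).
Qed.

Lemma Cn_ln m U (f : quat R -> R) : open U -> (forall x, U x -> 0 < f x) ->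
  Cn m U (fun _ => f) -> Cn m U (fun _ x => ln (f x)).
Proof.
move=> oU f0 Cf; case: m Cf => [|m] Cf.
  apply: jcont_Cn; apply: jcont_x => x Ux; apply: continuous_comp.
    exact: (@Cn_continuous R 4 0 U (fun _ => f) 0 x Cf Ux).
  by apply: continuous_ln; exact: f0.
have h1 (s : R) x : U x -> [set y : R | 0 < y] (f x) by move=> Ux; exact: f0.
have h2 (y : R) : [set y : R | 0 < y] y -> is_derive y 1 (@ln R) y^-1 by move=> y0; exact: is_derive1_ln.
have h3 : Cn m U (fun _ x => (f x)^-1).
  by apply: Cn_inv oU _ (Cn_le (leqnSn m) Cf) => _ x Ux; rewrite gt_eqF // f0.
exact: (Cn_comp1 (k := fun _ => f) oU h1 h2 Cf h3).
Qed.

Lemma Cn_chart1 c m : Cn m U0 (fun _ x => (chart c x).1).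
Proof.
apply: (Cn_add oU0 (Cn_cst m _ c)); apply: (Cn_ln oU0) => [x|]; first exact: eucl_gt0.
exact: Cn_eucl.
Qed.

Lemma CnV_chart2 c m : CnV m U0 (fun _ x => (chart c x).2).
Proof.
move=> j; have Ce : Cn m U0 (fun _ x => (eucl x)^-1).
  by apply: (Cn_inv oU0 _ (Cn_eucl m oU0 (fun _ h => h))) => _ x /eucl_gt0 h; rewrite gt_eqF.
by apply: (Cn_eq oU0 _ (Cn_mul oU0 Ce (Cn_coord m _ j))) => _ x _; rewrite mxE.
Qed.

Lemma smooth_chart c : smooth_on U0 (chart c).
Proof. by apply: (smooth_pair oU0) => m; [exact: Cn_chart1|exact: CnV_chart2]. Qed.

Lemma derive_chart c x w : U0 x -> 'D_w (chart c) x = dchart x w.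
Proof.
move=> x0; have r0 := eucl_gt0 x0; have rn : eucl x != 0 by rewrite gt_eqF.
have De := is_derive_eucl w x0.
apply: derive_pair; first exact: smooth_derivable (smooth_chart c) x0.
  have D := is_deriveDr (isD_cst c x w) (is_derive_comp_dir De (is_derive1_ln r0)).
  by apply: is_derive_eq D _; move: (eucl x) (dot x w) rn => r d rn; field.
apply: isDV_eq (isDV_scale (is_derive_invr rn De) (isDV_id x w)) _.
by move: (eucl x) (dot x w) rn => r d rn; apply/rowP => i; rewrite !mxE; field.
Qed.

Lemma coord_vec_chart c x i : U0 x -> coord_vec (chart c) x i = dchart x (ev R i).
Proof. exact: derive_chart. Qed.

Lemma local_coords_chart c : local_coords U0 (chart c).
Proof.
split; [exact: oU0|exact: smooth_chart|by move=> x; exact: cyl_chart| |].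
- move=> x y x0 y0 [/addrI h1 h2].
  have r : eucl x = eucl y by apply: ln_inj h1; rewrite posrE; exact: eucl_gt0.
  move: h2; rewrite r => /(congr1 (fun z => eucl y *: z)).
  by rewrite !scalerA mulfV ?scale1r // gt_eqF // eucl_gt0.
- move=> x x0 y w; have d : differentiable (chart c) x := smooth_chart c [::] x0.
  rewrite -!(deriveE _ d) !derive_chart // => h.
  by rewrite -(lift_dchart y x0) h lift_dchart.
Qed.

Lemma inner_dchart x y w : U0 x -> inner (dchart x y) (dchart x w) = dot y w / eucl x ^+ 2.
Proof.
move=> x0; have r0 := eucl_gt0 x0; have rn : eucl x != 0 by rewrite gt_eqF.
have := dot_lift_vec (cyl_chart 0 x0) (tangent_dchart 0 y x0) (tangent_dchart 0 w x0).
rewrite !lift_dchart //= add0r lnK ?posrE // => ->.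
by move: (inner _ _) => d; field.
Qed.

Lemma orthonormal_chart c x : dot x x = 1 -> orthonormal_at (chart c) x.
Proof.
move=> x1; have x0 : U0 x by apply: contra_eq_neq x1 => ->; rewrite dot0l eq_sym oner_neq0.
move=> i j; rewrite !coord_vec_chart // inner_dchart // eucl_sqr x1 divr1 dot_ev.
by rewrite evE.
Qed.

Lemma oriented_chart c x : U0 x -> oriented_at (chart c) x.
Proof.
move=> x0; have r0 := eucl_gt0 x0; rewrite /oriented_at.
have -> : coord_vec (chart c) x = (fun i => dchart x (ev R i)).
  by apply/funext => i; exact: coord_vec_chart.
rewrite (vol_cylE (cyl_chart c x0)); last by move=> i; exact: tangent_dchart.
have E i : (dchart x (ev R i)).1 *: (chart c x).2 + (dchart x (ev R i)).2 = (eucl x)^-1 *: ev R i.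
  by rewrite /=; apply/rowP => j; rewrite !mxE; move: (eucl x) r0 => r r0; field; rewrite gt_eqF.
rewrite !E /det4 /pl !scaleqE !evE /=.
have k0 : 0 < (eucl x)^-1 by rewrite invr_gt0.
move: (eucl x)^-1 k0 => k k0; have := exprn_gt0 4 k0; congr (0 < _); ring.
Qed.
End CylinderCharts.

(** * Pullback of connections *)
#[global] Opaque bracket.
Section Pullback.
Variable R : realType.
Local Notation ambient := (R * 'rV[R]_4)%type.
Local Notation U0 := [set x : quat R | x != 0].
Implicit Types (x y : quat R).
Let oU0 := @open_nonzero R 4.

Section Forms.
Variables (U : set (quat R)) (k : quat R -> quat R) (a : 'I_4 -> quat R -> quat R).
Hypotheses (oU : open U) (Uk : forall y, U y -> U0 (k y)).
Hypothesis Ck : forall m, CnV m U (fun _ => k).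
Hypothesis Ca : forall m i, CnV m U0 (fun _ => a i).

Definition pullback i y : quat R := form a (k y) (pdv i k y).

Lemma CnV_comp_pull m i : CnV m U (fun _ y => a i (k y)).
Proof.
move=> j; exact: (@Cn_comp R 4 4 U U0 (fun _ => k) oU oU0 (fun _ y Uy => Uk Uy) m
  (fun x => a i x 0 j) (Ca m i j) (Ck m)).
Qed.

Lemma CnV_pullback m i : CnV m U (fun _ => pullback i).
Proof.
move=> j.
have C : Cn m U (fun _ y => \sum_l pd i (fun y => k y 0 l) y * a l (k y) 0 j).
  apply: Cn_sum oU _ => l; apply: Cn_mul oU _ (CnV_comp_pull m l j).
  exact: (Cn_pd i (Ck m.+1 l)).
apply: (Cn_eq oU _ C) => _ y _; rewrite /pullback /form summxE.
by apply: eq_bigr => l _; rewrite mxE pdvE.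
Qed.

Lemma pdv_pullback i j y : U y -> pdv i (pullback j) y =
  form a (k y) (pdv i (pdv j k) y)
    + \sum_l \sum_q (pdv i k y 0 q * pdv j k y 0 l) *: pdv q (a l) (k y).
Proof.
move=> Uy; apply: isDV_pdv; rewrite /form -big_split; apply: isDV_sum => l.
have Da : isDV y (ev R i) (fun y => a l (k y)) (\sum_q pdv i k y 0 q *: pdv q (a l) (k y)).
  move=> r; rewrite summxE.
  have dk q : derivable (fun x => k x 0 q) y (ev R i).
    exact: (@Cn_derivable R 4 0 U (fun _ x => k x 0 q) i 0 y (Ck 1 q) Uy).
  have D := @pd_comp R 4 4 U U0 (fun _ => k) oU0 (fun _ y Uy => Uk Uy) 0 (fun x => a l x 0 r) i 0 y (Ca 1 l r) dk Uy.
  by apply: is_derive_eq D _; apply: eq_bigr => q _; rewrite mxE !pdvE.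
have Dp : is_derive y (ev R i) (fun y => pdv j k y 0 l) (pdv i (pdv j k) y 0 l).
  by have := @CnV_isDV _ _ 0 _ U (fun _ => pdv j k) i 0 y (CnV_pdv j (Ck 2)) Uy l.
apply: isDV_eq (isDV_scale Dp Da) _; congr (_ + _).
by rewrite scaler_sumr; apply: eq_bigr => q _; rewrite scalerA mulrC.
Qed.

(** The second derivatives of k enter symmetrically in i and j and cancel; what is left is the
    curvature on the image vectors. *)
Lemma curv_pullback i j y : U y ->
  curv pullback i j y = curv2 a (k y) (pdv i k y) (pdv j k y).
Proof.
move=> Uy; rewrite /curv !pdv_pullback //.
have Ecomm : pdv i (pdv j k) y = pdv j (pdv i k) y by exact: (@pdv_comm _ _ 0 _ U (fun _ => k) 0 y i j oU (Ck 2) Uy).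
rewrite Ecomm; move: (form a (k y) (pdv j (pdv i k) y)) => u0.
have H (u v w z : quat R) : (u + v) - (u + w) + z = v - w + z by rewrite opprD addrACA subrr add0r.
rewrite H {H}.
rewrite [X in X - _ + _]exchange_big /= -sumrB.
have -> : bracket (pullback i y) (pullback j y) =
    \sum_l \sum_q (pdv i k y 0 l * pdv j k y 0 q) *: bracket (a l (k y)) (a q (k y)).
  rewrite /pullback /form bracket_suml; apply: eq_bigr => l _.
  rewrite bracket_sumr; apply: eq_bigr => q _.
  by rewrite bracketZl bracketZr scalerA.
rewrite -big_split; apply: eq_bigr => l _; rewrite -sumrB -big_split; apply: eq_bigr => q _.
have F (u v w : quat R) (c d : R) : (c * d) *: u - (d * c) *: v + (c * d) *: w = (c * d) *: (u - v + w).
  by rewrite [d * c]mulrC -scalerBr -scalerDr.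
exact: F.
Qed.
End Forms.

Lemma derive_smooth (U : set (quat R)) (f : quat R -> quat R) i y : U y -> smooth_on U f ->
  'D_(basis_vec R i) f y = pdv i f y.
Proof.
move=> Uy sf; have D : derivable f y (ev R i) := smooth_derivable sf Uy.
apply/rowP => j; rewrite pdvE.
by case: (is_derive_functional (functional_coord R j) D) => _ <-.
Qed.

Lemma curvature_curv (U : set (quat R)) phi (A : su2_form R) y i j : U y ->
  (forall i, smooth_on U (coord_form A phi i)) -> curvature A phi y i j = curv (coord_form A phi) i j y.
Proof.
move=> Uy sA; rewrite /curvature /curv; congr (_ - _ + _); [exact: derive_smooth (sA j)|exact: derive_smooth (sA i)].
Qed.

Lemma curv_eq (U : set (quat R)) (a b : 'I_4 -> quat R -> quat R) i j y : open U -> U y ->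
  (forall i y, U y -> a i y = b i y) -> curv a i j y = curv b i j y.
Proof.
move=> oU Uy ab; have E l q : pdv l (a q) y = pdv l (b q) y.
  by apply/rowP => r; rewrite !pdvE; apply: (pd_eq l oU Uy) => z Uz; rewrite ab.
by rewrite /curv !E !ab.
Qed.

(** * Arbitrary coordinates compared with the conformal chart *)

Section Coordinates.
Variables (U : set (quat R)) (phi : quat R -> ambient).
Hypothesis lc : local_coords U phi.
Let oU : open U. Proof. by case: lc. Qed.
Let sphi : smooth_on U phi. Proof. by case: lc. Qed.
Let cphi y : U y -> cyl (phi y). Proof. by case: lc => _ _ + _ _; apply. Qed.

Let Ct m : Cn m U (fun _ y => (phi y).1).
Proof. exact: Cn_smooth (functional_fst R) sphi. Qed.

Let Cq m : CnV m U (fun _ y => (phi y).2).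
Proof. by move=> i; exact: Cn_smooth (functional_snd R i) sphi. Qed.

Let coordE i y : U y -> is_derive y (ev R i) (fun y => (phi y).1) (coord_vec phi y i).1 /\
  isDV y (ev R i) (fun y => (phi y).2) (coord_vec phi y i).2.
Proof.
move=> Uy; have D : derivable phi y (ev R i) := smooth_derivable sphi Uy; split.
  exact: is_derive_functional (functional_fst R) D.
by move=> j; exact: is_derive_functional (functional_snd R j) D.
Qed.

Lemma tangent_coord_vec i y : U y -> tangent (phi y) (coord_vec phi y i).
Proof.
move=> Uy; have [_ D] := coordE i Uy; rewrite tangentE.
have D2 := is_derive_dot D D.
have E : pd i (fun y => dot (phi y).2 (phi y).2) y = pd i (fun=> 1) y.
  by apply: (pd_eq i oU Uy) => z Uz; rewrite -cylE; exact: cphi.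
rewrite (is_derive_pd D2) (is_derive_pd (isD_cst 1 y (ev R i))) dotC in E.
by move: E; move: (dot _ _) => d; lra.
Qed.

Local Notation kappa := (fun y => kap (phi y)).

Lemma CnV_kappa m : CnV m U (fun _ => kappa).
Proof.
move=> j; have Ce : Cn m U (fun _ y => expR (phi y).1).
  elim: m => [|m IH].
    apply: jcont_Cn; apply: jcont_x => x Ux; apply: continuous_comp; last exact: continuous_expR.
    exact: (@Cn_continuous R 4 0 U (fun _ y => (phi y).1) 0 x (Ct 0) Ux).
  exact: (Cn_comp1 (O := setT) (f := @expR R) (df := @expR R) (k := fun _ y => (phi y).1) oU (fun _ _ _ => I) (fun (s : R) _ => is_derive_expR s) (Ct m.+1) IH).
by apply: (Cn_eq oU _ (Cn_mul oU Ce (Cq m j))) => _ y _; rewrite mxE.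
Qed.

Lemma pdv_kappa i y : U y -> pdv i kappa y = lift_vec (phi y) (coord_vec phi y i).
Proof.
move=> Uy; have [D1 D2] := coordE i Uy.
apply: isDV_pdv; apply: isDV_eq (isDV_scale (is_derive_comp_dir D1 (is_derive_expR _)) D2) _.
by rewrite /lift_vec scalerDr scalerA.
Qed.

Variable A : su2_form R.
Hypothesis linA : forall p (c : R) u v, cyl p -> tangent p u -> tangent p v ->
  A p (c *: u + v) = c *: A p u + A p v.
Local Notation a := (coord_form A (chart 0)).

Lemma su2_form_sum p (w : 'I_4 -> R) (u : 'I_4 -> ambient) : cyl p -> (forall i, tangent p (u i)) ->
  A p (\sum_i w i *: u i) = \sum_i w i *: A p (u i).
Proof.
move=> cp tu; have t0 : tangent p 0 by rewrite tangentE dotC (dot0l p.2).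
have A0 : A p 0 = 0.
  have := linA 1 cp t0 t0; rewrite scaler0 addr0 scale1r; move: (A p 0) => z.
  by rewrite -{1}[z]addr0 => /addrI <-.
have H r : tangent p (\sum_(i <- r) w i *: u i) /\
    A p (\sum_(i <- r) w i *: u i) = \sum_(i <- r) w i *: A p (u i); last exact: (H _).2.
elim: r => [|i r [t E]]; first by rewrite !big_nil.
rewrite !big_cons; split; last by rewrite linA // E.
rewrite tangentE in t; have := tu i; rewrite !tangentE /= => ti.
by rewrite dotDr dotZr ti mulr0 add0r.
Qed.

(** The form is recovered from its components in the chart: a tangent vector is the image under
    [dchart] of its lift, and A is linear on tangent vectors. This reduces smoothness and curvature
    in all coordinates to one chart. *)
Lemma su2_form_lift p v : cyl p -> tangent p v -> A p v = form a (kap p) (lift_vec p v).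
Proof.
move=> cp tv; have k0 := kap_neq0 cp.
rewrite -{1}(dchart_lift cp tv) dchart_sum su2_form_sum //; last first.
  by move=> i; have := tangent_dchart 0 (ev R i) k0; rewrite chart_kap.
by apply: eq_bigr => i _; rewrite /coord_form coord_vec_chart // chart_kap.
Qed.

Lemma coord_form_pullback i y : U y -> coord_form A phi i y = pullback kappa a i y.
Proof.
move=> Uy; have E := su2_form_lift (cphi Uy) (tangent_coord_vec i Uy).
rewrite [RHS]/pullback (pdv_kappa i Uy); exact: E.
Qed.

Hypothesis Ca : forall m i, CnV m U0 (fun _ => a i).

Lemma smooth_coord_form i : smooth_on U (coord_form A phi i).
Proof.
apply: (smooth_CnV oU) => m j.
apply: (Cn_eq oU _ (CnV_pullback oU (fun y Uy => kap_neq0 (cphi Uy)) CnV_kappa Ca m i j)) => _ y Uy.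
congr ((_ : quat R) 0 j); exact: esym (coord_form_pullback i Uy).
Qed.

Lemma curvature_lift i j y : U y -> curvature A phi y i j =
  curv2 a (kap (phi y)) (lift_vec (phi y) (coord_vec phi y i)) (lift_vec (phi y) (coord_vec phi y j)).
Proof.
move=> Uy; have E1 := curvature_curv i j Uy smooth_coord_form.
have E2 := curv_eq i j oU Uy coord_form_pullback.
have E3 := curv_pullback oU (fun y Uy => kap_neq0 (cphi Uy)) CnV_kappa Ca i j Uy.
apply: etrans E1 _; apply: etrans E2 _; apply: etrans E3 _.
by rewrite (pdv_kappa i Uy) (pdv_kappa j Uy).
Qed.
End Coordinates.
End Pullback.

(** * The lower bound *)
Section OpNorm.
Variable R : realType.

Lemma sum_lt4 (W : nmodType) (G : 'I_4 -> 'I_4 -> W) :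
  \sum_(i < 4) \sum_(j < 4 | (i < j)%N) G i j =
  G i0 i1 + G i0 i2 + G i0 i3 + G i1 i2 + G i1 i3 + G i2 i3.
Proof.
under eq_bigr => i _ do rewrite big_mkcond sum4.
by rewrite sum4 /= !add0r !addr0 !addrA.
Qed.

Definition sym6 (a01 a02 a03 a12 a13 a23 : R) : 'M[R]_4 :=
  \matrix_(i < 4, j < 4) nth 0 (nth [::] [:: [:: 0; a01; a02; a03]; [:: 0; 0; a12; a13]; [:: 0; 0; 0; a23]] i) j.

Lemma sym6E (a01 a02 a03 a12 a13 a23 : R) (F : 'I_4 -> 'I_4 -> quat R) :
  let a := sym6 a01 a02 a03 a12 a13 a23 in
  (\sum_(i < 4) \sum_(j < 4 | (i < j)%N) a i j *: F i j =
    a01 *: F i0 i1 + a02 *: F i0 i2 + a03 *: F i0 i3 + a12 *: F i1 i2 + a13 *: F i1 i3 + a23 *: F i2 i3) *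
  (\sum_(i < 4) \sum_(j < 4 | (i < j)%N) a i j ^+ 2 =
    a01 ^+ 2 + a02 ^+ 2 + a03 ^+ 2 + a12 ^+ 2 + a13 ^+ 2 + a23 ^+ 2).
Proof. by rewrite /sym6 !sum_lt4 !mxE. Qed.

(** The operator norm is tested on an anti-self-dual 2-vector: its two halves contribute equally to
    the value, giving 2, while its norm grows only by sqrt 2. *)
Lemma op_norm_asd (F : 'I_4 -> 'I_4 -> quat R) (s p1 p2 p3 : R) :
  (forall i j, F j i = - F i j) ->
  F i2 i3 = - F i0 i1 -> F i3 i1 = - F i0 i2 -> F i1 i2 = - F i0 i3 ->
  (op_norm F <= s%:E)%E ->
  Num.sqrt 2 * eucl (p1 *: F i0 i1 + p2 *: F i0 i2 + p3 *: F i0 i3) <= s * Num.sqrt (p1 ^+ 2 + p2 ^+ 2 + p3 ^+ 2).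
Proof.
move=> FC h1 h2 h3 Fs; set W := Num.sqrt (p1 ^+ 2 + p2 ^+ 2 + p3 ^+ 2).
have S0 : 0 <= p1 ^+ 2 + p2 ^+ 2 + p3 ^+ 2 by rewrite !addr_ge0 ?sqr_ge0.
have W2 : W ^+ 2 = p1 ^+ 2 + p2 ^+ 2 + p3 ^+ 2 by rewrite sqr_sqrtr.
have W0 : 0 <= W by exact: sqrtr_ge0.
have q2 : Num.sqrt 2 ^+ 2 = 2 :> R by rewrite sqr_sqrtr.
have q0 : 0 < Num.sqrt (2 : R) by rewrite sqrtr_gt0.
have [Wz|Wn] := eqVneq W 0.
  have [-> [-> ->]] : p1 = 0 /\ p2 = 0 /\ p3 = 0.
    by move: W2; rewrite Wz; clear; rewrite expr0n /= => h; split; [|split]; nra.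
  by rewrite !scale0r !addr0 eucl0 Wz !mulr0.
have Wp : 0 < W by rewrite lt_neqAle eq_sym Wn.
move: (Num.sqrt 2) q0 q2 => t t0 t2; clearbody W.
(* Each p_i occurs twice among the six coefficients, so their squares sum to 2 k^2 W^2 = 1. *)
pose k := (t * W)^-1; have k0 : 0 < k by rewrite invr_gt0 mulr_gt0.
have kE : k * (t * W) = 1 by rewrite mulVf // gt_eqF // mulr_gt0.
clearbody k.
have E := sym6E (k * p1) (k * p2) (k * p3) (- (k * p3)) (k * p2) (- (k * p1)) F.
have [E1 E2] := E; clear E.
have F13 : F i1 i3 = F i0 i2 by rewrite (FC i3 i1) h2 opprK.
have V1 : \sum_(i < 4) \sum_(j < 4 | (i < j)%N) (sym6 (k * p1) (k * p2) (k * p3) (- (k * p3)) (k * p2) (- (k * p1))) i j ^+ 2 = 1.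
  rewrite E2; have -> : 1 = (k * (t * W)) ^+ 2 :> R by rewrite kE expr1n.
  rewrite !exprMn t2 W2; ring.
have B : ((enorm (\sum_(i < 4) \sum_(j < 4 | (i < j)%N) (sym6 (k * p1) (k * p2) (k * p3) (- (k * p3)) (k * p2) (- (k * p1))) i j *: F i j))%:E
    <= s%:E)%E.
  by apply: le_trans Fs; apply: ereal_sup_ubound; eexists; [exact: V1|].
move: B; rewrite E1 h1 F13 h3 lee_fin enormE.
have -> : (k * p1) *: F i0 i1 + (k * p2) *: F i0 i2 + (k * p3) *: F i0 i3 + - (k * p3) *: - F i0 i3
    + (k * p2) *: F i0 i2 + - (k * p1) *: - F i0 i1 =
    (2 * k) *: (p1 *: F i0 i1 + p2 *: F i0 i2 + p3 *: F i0 i3).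
  move: (F i0 i1) (F i0 i2) (F i0 i3) => f1 f2 f3.
  by apply/rowP => l; rewrite !mxE; ring.
rewrite euclZ ger0_norm; last by rewrite mulr_ge0 // ltW.
move: (eucl _) => f fs.
have : 2 * k * f * (t * W) <= s * (t * W) by rewrite ler_wpM2r // ltW // mulr_gt0.
have -> : 2 * k * f * (t * W) = t * (t * f).
  by rewrite mulrA -expr2 t2 -[RHS]mulr1 -kE; ring.
by rewrite (mulrCA s) ler_pM2l.
Qed.
End OpNorm.

Section LowerBound.
Variable R : realType.
Local Notation ambient := (R * 'rV[R]_4)%type.
Local Notation U0 := [set x : quat R | x != 0].
Implicit Types (x y : quat R).
Variable A : su2_form R.
Hypotheses (conA : is_connection A) (asdA : asd A).
Local Notation a := (coord_form A (chart 0)).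

Let linA : forall p (c : R) u v, cyl p -> tangent p u -> tangent p v ->
  A p (c *: u + v) = c *: A p u + A p v.
Proof. by case: conA. Qed.

Let Ca m i : CnV m U0 (fun _ => a i).
Proof.
have lc := local_coords_chart (0 : R); case: conA => _ _ /(_ _ _ lc i) sa.
exact: (CnV_smooth m (@open_nonzero R 4) sa).
Qed.

Let a_imag i x : U0 x -> a i x 0 i0 = 0.
Proof.
move=> x0; case: conA => /(_ (chart 0 x) (coord_vec (chart 0) x i)) h _ _.
have -> : i0 = 0 by exact: val_inj.
by apply: h; [exact: cyl_chart|rewrite coord_vec_chart //; exact: tangent_dchart].
Qed.

(** The chart translated by ln |x| is orthonormal at x / |x|, and [kap] sends the corresponding
    point of the cylinder to x; the lift of the i-th coordinate vector is |x| times the i-th basis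
    vector, once for each argument of the 2-form. *)
Lemma curvature_chart x i j : U0 x ->
  curvature A (chart (ln (eucl x))) ((eucl x)^-1 *: x) i j = eucl x ^+ 2 *: curv a i j x.
Proof.
move=> x0; have r0 := eucl_gt0 x0; have [r rE] : exists r, r = eucl x by exists (eucl x).
rewrite -rE in r0 *; have xr := esym rE.
have rx : U0 (r^-1 *: x) by rewrite /= scaler_eq0 invr_eq0 negb_or gt_eqF.
have er : eucl (r^-1 *: x) = 1.
  by rewrite euclZ ger0_norm ?invr_ge0 ?(ltW r0) // xr mulVf // gt_eqF.
have E := curvature_lift (local_coords_chart (ln r)) linA Ca i j rx.
apply: etrans E _; rewrite !coord_vec_chart //.
have L k : lift_vec (chart (ln r) (r^-1 *: x)) (dchart (r^-1 *: x) (ev R k)) = r *: ev R k.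
  rewrite /lift_vec /= er ln1 addr0 lnK ?posrE //; congr (_ *: _).
  by apply/rowP => l; rewrite !mxE expr1n !expr1n invr1 !mulr1; move: (dot _ _) => d; ring.
have K : kap (chart (ln r) (r^-1 *: x)) = x.
  by rewrite /kap /= er ln1 addr0 lnK ?posrE // invr1 scale1r scalerA mulfV ?scale1r // gt_eqF.
rewrite !L K -(curv2_ev a i j x).
rewrite /curv2 scaler_sumr; apply: eq_bigr => k _; rewrite scaler_sumr; apply: eq_bigr => l _.
rewrite scalerA; congr (_ *: _); rewrite !scaleqE.
by move: (ev R i 0 k) (ev R j 0 l) => u v; ring.
Qed.

Lemma curv_asd x : U0 x ->
  [/\ curv a i2 i3 x = - curv a i0 i1 x, curv a i3 i1 x = - curv a i0 i2 x & curv a i1 i2 x = - curv a i0 i3 x].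
Proof.
move=> x0; have r0 := eucl_gt0 x0.
pose y := (eucl x)^-1 *: x; pose c := ln (eucl x).
have y0 : U0 y by rewrite /= /y scaler_eq0 invr_eq0 negb_or gt_eqF.
have yy : dot y y = 1.
  by rewrite -eucl_sqr /y euclZ ger0_norm ?invr_ge0 ?(ltW r0) // mulVf ?expr1n // gt_eqF.
have H := asdA (local_coords_chart c) y0 (orthonormal_chart c yy) (oriented_chart c y0).
have FE i j : curvature A (chart c) y i j = eucl x ^+ 2 *: curv a i j x by exact: curvature_chart.
have FC i j : curvature A (chart c) y j i = - curvature A (chart c) y i j.
  by rewrite !FE curvC scalerN.
have [e1 e2 e3 _ _] := hodgeE FC.
have r2 : eucl x ^+ 2 != 0 by rewrite gt_eqF // exprn_gt0.
have I (u v : quat R) : eucl x ^+ 2 *: u = - (eucl x ^+ 2 *: v) -> u = - v.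
  by rewrite -scalerN; exact: scalerI.
split; apply: I.
- exact: etrans (esym (FE _ _)) (etrans (esym e1) (etrans (H _ _) (congr1 (@GRing.opp _) (FE _ _)))).
- exact: etrans (esym (FE _ _)) (etrans (esym e2) (etrans (H _ _) (congr1 (@GRing.opp _) (FE _ _)))).
- exact: etrans (esym (FE _ _)) (etrans (esym e3) (etrans (H _ _) (congr1 (@GRing.opp _) (FE _ _)))).
Qed.

Lemma curv_le_norm s : (curvature_norm A <= s%:E)%E -> forall r, 0 < r -> curv_le a (s / Num.sqrt 2) r.
Proof.
move=> Ns r r0 x u v xr.
have x0 : U0 x by apply: contraTneq r0 => x0; rewrite -xr x0 eucl0 ltxx.
have asd1 z (z0 : U0 z) := let: And3 h _ _ := curv_asd z0 in h.
have asd2 z (z0 : U0 z) := let: And3 _ h _ := curv_asd z0 in h.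
have asd3 z (z0 : U0 z) := let: And3 _ _ h := curv_asd z0 in h.
rewrite (curv2_asd asd1 asd2 asd3) //.
have WE : wedge u v = Num.sqrt ((u 0 i0 * v 0 i1 - u 0 i1 * v 0 i0 - (u 0 i2 * v 0 i3 - u 0 i3 * v 0 i2)) ^+ 2
  + (u 0 i0 * v 0 i2 - u 0 i2 * v 0 i0 - (u 0 i3 * v 0 i1 - u 0 i1 * v 0 i3)) ^+ 2
  + (u 0 i0 * v 0 i3 - u 0 i3 * v 0 i0 - (u 0 i1 * v 0 i2 - u 0 i2 * v 0 i1)) ^+ 2).
  by rewrite wedge_plucker.
rewrite WE; move: (_ - _ - _) (_ - _ - _) (_ - _ - _) => p3 p2 p1.
pose y := r^-1 *: x; pose c := ln r.
have y0 : U0 y by rewrite /= /y scaler_eq0 invr_eq0 negb_or gt_eqF.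
have yy : dot y y = 1.
  by rewrite -eucl_sqr /y euclZ ger0_norm ?invr_ge0 ?(ltW r0) // xr mulVf ?expr1n // gt_eqF.
have FE i j : curvature A (chart c) y i j = r ^+ 2 *: curv a i j x.
  by rewrite -xr /c /y -xr; exact: curvature_chart.
have FC i j : curvature A (chart c) y j i = - curvature A (chart c) y i j.
  by rewrite !FE curvC scalerN.
have B : (op_norm (curvature A (chart c) y) <= s%:E)%E.
  apply: le_trans Ns; apply: le_trans (_ : (_ <= curvature_norm_at A (chart c y))%E) _; last first.
    by apply: ereal_sup_ubound; exists (chart c y) => //; exact: cyl_chart.
  apply: ereal_sup_ubound; exists U0, (chart c), y; split => //.
  - exact: local_coords_chart.
  - exact: orthonormal_chart.
have [a1 a2 a3] := curv_asd x0.
have h1 : curvature A (chart c) y i2 i3 = - curvature A (chart c) y i0 i1 by rewrite !FE a1 scalerN.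
have h2 : curvature A (chart c) y i3 i1 = - curvature A (chart c) y i0 i2 by rewrite !FE a2 scalerN.
have h3 : curvature A (chart c) y i1 i2 = - curvature A (chart c) y i0 i3 by rewrite !FE a3 scalerN.
have := op_norm_asd p1 p2 p3 FC h1 h2 h3 B; rewrite !FE.
have F (f1 f2 f3 : quat R) : p1 *: (r ^+ 2 *: f1) + p2 *: (r ^+ 2 *: f2) + p3 *: (r ^+ 2 *: f3) =
    r ^+ 2 *: (p1 *: f1 + p2 *: f2 + p3 *: f3).
  by rewrite !scalerDr !scalerA ![r ^+ 2 * _]mulrC.
rewrite F {F}; move: (curv a i0 i1 x) (curv a i0 i2 x) (curv a i0 i3 x) => f1 f2 f3.
rewrite euclZ (ger0_norm (sqr_ge0 r)).
have q0 : 0 < Num.sqrt (2 : R) by rewrite sqrtr_gt0.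
by rewrite [X in _ -> _ <= X]mulrAC ler_pdivlMr // [X in _ -> X <= _]mulrC.
Qed.

Theorem flat_small s : (curvature_norm A <= s%:E)%E -> 0 <= s -> s < 1 / Num.sqrt 2 -> flat A.
Proof.
move=> Ns s0 s1.
have q0 : 0 < Num.sqrt (2 : R) by rewrite sqrtr_gt0.
have b0 : 0 <= s / Num.sqrt 2 by rewrite divr_ge0 // ltW.
have b1 : s / Num.sqrt 2 < 2^-1.
  have q2 : Num.sqrt 2 ^+ 2 = 2 :> R by rewrite sqr_sqrtr.
  rewrite ltr_pdivrMr //; move: s1; rewrite ltr_pdivlMr //.
  by move: (Num.sqrt 2) q0 q2 => t *; nra.
have asd1 z (z0 : U0 z) := let: And3 h _ _ := curv_asd z0 in h.
have asd2 z (z0 : U0 z) := let: And3 _ h _ := curv_asd z0 in h.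
have asd3 z (z0 : U0 z) := let: And3 _ _ h := curv_asd z0 in h.
move=> U phi y lc Uy i j.
have cy : cyl (phi y) by case: lc => _ _ + _ _; apply.
rewrite (curvature_lift lc linA Ca i j Uy) /curv2.
apply: big1 => k _; apply: big1 => l _.
by rewrite (curv_eq0 Ca a_imag asd1 asd2 asd3 b0 b1 (curv_le_norm Ns)) ?scaler0 //; exact: kap_neq0.
Qed.
End LowerBound.

Theorem lower_bound (R : realType) (A : su2_form R) : is_connection A -> asd A -> ~ flat A ->
  ((1 / Num.sqrt 2)%:E <= curvature_norm A)%E.
Proof.
move=> conA asdA nf; rewrite leNgt; apply/negP => lt; apply: nf.
have q0 : 0 < 1 / Num.sqrt (2 : R) by rewrite divr_gt0 // sqrtr_gt0.
(* A supremum of extended reals might formally be negative or -oo; it is bounded by max s 0 or by 0,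
   since [flat_small] takes a nonnegative s. *)
move: lt; case E : (curvature_norm A) => [s| |] // lt.
- apply: (@flat_small R A conA asdA (Num.max s 0)).
  + by rewrite E lee_fin le_max lexx.
  + by rewrite le_max lexx orbT.
  + by rewrite gt_max q0 -lte_fin lt.
- by apply: (@flat_small R A conA asdA 0) => //; rewrite E leNye.
Qed.

(** * The instanton *)
#[global] Transparent bracket.
Section Frames.
Variable R : realType.
Implicit Types (u v w x n : quat R).

Definition conj_im u v : quat R := mkq 0 (qmul (qconj u) v 0 i1) (qmul (qconj u) v 0 i2) (qmul (qconj u) v 0 i3).

Lemma conj_imZl (c : R) u v : conj_im (c *: u) v = c *: conj_im u v.
Proof. by rewrite /conj_im; qring. Qed.

Lemma conj_imZr (c : R) u v : conj_im u (c *: v) = c *: conj_im u v.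
Proof. by rewrite /conj_im; qring. Qed.

Lemma conj_imDl u v w : conj_im (u + v) w = conj_im u w + conj_im v w.
Proof. by rewrite /conj_im; qring. Qed.

Lemma conj_imDr u v w : conj_im u (v + w) = conj_im u v + conj_im u w.
Proof. by rewrite /conj_im; qring. Qed.

Lemma conj_imC u v : conj_im v u = - conj_im u v.
Proof. by rewrite /conj_im; qring. Qed.

Lemma conj_im_im u v : conj_im u v 0 i0 = 0.
Proof. by rewrite /conj_im mkqE. Qed.

Lemma dot_conj_im n u v : n 0 i0 = 0 -> dot n (conj_im u v) = dot (qmul u n) v.
Proof.
by move=> n0; rewrite /conj_im /qconj ?qE n0; gen_quats; ring.
Qed.

Lemma conj_im_bracket x u v :
  bracket (conj_im x u) (conj_im x v) =
  (2 * dot x u) *: conj_im x v - (2 * dot x v) *: conj_im x u - (2 * dot x x) *: conj_im u v.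
Proof. by rewrite /conj_im; qring. Qed.

(** For each imaginary unit the component of conj(dx) /\ dx is a 2-form whose square is a negative
    multiple of the volume form. *)
Lemma det4_conj_im v0 v1 v2 v3 (a : 'I_4) : a != i0 ->
  conj_im v0 v1 0 a * conj_im v2 v3 0 a + conj_im v0 v2 0 a * conj_im v3 v1 0 a
  + conj_im v0 v3 0 a * conj_im v1 v2 0 a = - det4 v0 v1 v2 v3.
Proof.
rewrite /det4 /pl /conj_im /qconj.
by move: a; apply: ord4P => // _; rewrite ?qE; gen_quats; ring.
Qed.

Variable v : 'I_4 -> quat R.
Hypothesis vO : forall i j, dot (v i) (v j) = (i == j)%:R.
Local Notation N i j := (conj_im (v i) (v j)).

Let M : 'M[R]_4 := \matrix_i v i.
Let MM : M *m M^T = 1%:M.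
Proof.
apply/matrixP => i j; rewrite !mxE -vO /dot.
by apply: eq_bigr => k _; rewrite !mxE.
Qed.

Lemma parseval (z : quat R) : \sum_j dot z (v j) ^+ 2 = dot z z.
Proof.
have E : z *m M^T *m (z *m M^T)^T = z *m z^T.
  by rewrite trmx_mul trmxK mulmxA -(mulmxA z) (mulmx1C MM) mulmx1.
have zv j : (z *m M^T) 0 j = dot z (v j).
  by rewrite mxE; apply: eq_bigr => k _; rewrite !mxE.
have := congr1 (fun B : 'M[R]_1 => B 0 0) E; rewrite !mxE => E'.
rewrite -[RHS](_ : \sum_j z 0 j * z^T j 0 = _); last by apply: eq_bigr => k _; rewrite mxE.
rewrite -E'; apply: eq_bigr => j _.
by rewrite [X in _ = _ * X]mxE zv expr2.
Qed.

Lemma det4_orthonormal : 0 < det4 (v i0) (v i1) (v i2) (v i3) -> det4 (v i0) (v i1) (v i2) (v i3) = 1.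
Proof.
have -> : det4 (v i0) (v i1) (v i2) (v i3) = \det M by rewrite det4E !rowK.
have : \det M * \det M = 1 by rewrite -{2}det_tr -det_mulmx MM det1.
by move: (\det M) => d h d0; nra.
Qed.

(** Right multiplication by n stretches lengths by |n|; Parseval for each v_i n gives |n|^2, and in
    the sum 4 |n|^2 over i every pair i < j is counted twice. *)
Lemma sum_conj_im n : n 0 i0 = 0 ->
  dot n (N i0 i1) ^+ 2 + dot n (N i0 i2) ^+ 2 + dot n (N i0 i3) ^+ 2
  + dot n (N i1 i2) ^+ 2 + dot n (N i1 i3) ^+ 2 + dot n (N i2 i3) ^+ 2 <= 2 * dot n n.
Proof.
move=> n0; have P i : \sum_j dot n (N i j) ^+ 2 = dot n n.
  under eq_bigr => j _ do rewrite dot_conj_im //.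
  rewrite parseval; have := vO i i; rewrite eqxx => vi.
  have -> : dot (qmul (v i) n) (qmul (v i) n) = dot (v i) (v i) * dot n n by rewrite ?qE; gen_quats; ring.
  by rewrite vi mul1r.
have C i j : dot n (N j i) ^+ 2 = dot n (N i j) ^+ 2 by rewrite conj_imC dotNr sqrrN.
have := P i0; have := P i1; have := P i2; have := P i3; rewrite !sum4.
rewrite (C i0 i1) (C i0 i2) (C i0 i3) (C i1 i2) (C i1 i3) (C i2 i3).
have := sqr_ge0 (dot n (N i0 i0)); have := sqr_ge0 (dot n (N i1 i1)).
have := sqr_ge0 (dot n (N i2 i2)); have := sqr_ge0 (dot n (N i3 i3)).
move: (dot n (N i0 i0) ^+ 2) (dot n (N i1 i1) ^+ 2) (dot n (N i2 i2) ^+ 2) (dot n (N i3 i3) ^+ 2).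
move: (dot n (N i0 i1) ^+ 2) (dot n (N i0 i2) ^+ 2) (dot n (N i0 i3) ^+ 2) (dot n (N i1 i2) ^+ 2) (dot n (N i1 i3) ^+ 2) (dot n (N i2 i3) ^+ 2) (dot n n).
by move=> *; lra.
Qed.

(** Equality case of an inequality: for each imaginary component the six squares sum to at most 2,
    while by [det4_conj_im] the three products of complementary entries sum to -1. So the squares of
    the sums of complementary entries add up to at most 0. *)
Lemma conj_im_asd : 0 < det4 (v i0) (v i1) (v i2) (v i3) ->
  [/\ N i2 i3 = - N i0 i1, N i3 i1 = - N i0 i2 & N i1 i2 = - N i0 i3].
Proof.
move=> /det4_orthonormal d1.
suff H a : [/\ N i2 i3 0 a = - N i0 i1 0 a, N i3 i1 0 a = - N i0 i2 0 a & N i1 i2 0 a = - N i0 i3 0 a].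
  by split; apply/rowP => a; rewrite oppqE; case: (H a).
case: (eqVneq a i0) => [->|a0]; first by rewrite !conj_im_im oppr0.
have D := det4_conj_im (v i0) (v i1) (v i2) (v i3) a0; rewrite d1 in D.
have n0 : ev R a 0 i0 = 0 by rewrite evE (negbTE a0).
have S := sum_conj_im n0.
have E z : dot (ev R a) z = z 0 a by rewrite dotC dot_ev.
rewrite !E (conj_imC (v i3) (v i1)) oppqE evE eqxx in S.
move: D S; move: (N i0 i1 0 a) (N i0 i2 0 a) (N i0 i3 0 a) (N i1 i2 0 a) (N i3 i1 0 a) (N i2 i3 0 a).
move=> m1 m2 m3 m4 m5 m6 D S.
have Z : (m6 + m1) ^+ 2 + (m5 + m2) ^+ 2 + (m4 + m3) ^+ 2 <= 0 by move: S; rewrite mulr1; nra.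
have z1 := sqr_ge0 (m6 + m1); have z2 := sqr_ge0 (m5 + m2); have z3 := sqr_ge0 (m4 + m3).
have e1 : (m6 + m1) ^+ 2 = 0 by lra.
have e2 : (m5 + m2) ^+ 2 = 0 by lra.
have e3 : (m4 + m3) ^+ 2 = 0 by lra.
by split; apply/eqP; rewrite -addr_eq0 -sqrf_eq0; apply/eqP.
Qed.

Lemma op_norm_conj_im (c : R) : 0 <= c -> (op_norm (fun i j => c *: N i j) <= (c * Num.sqrt 2)%:E)%E.
Proof.
move=> c0; apply: ub_ereal_sup => _ [al al1 <-]; rewrite lee_fin enormE.
rewrite /= !sum_lt4 in al1 *.
move: al1; move: (al i0 i1) (al i0 i2) (al i0 i3) (al i1 i2) (al i1 i3) (al i2 i3) => a1 a2 a3 a4 a5 a6 al1.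
pose n := a1 *: N i0 i1 + a2 *: N i0 i2 + a3 *: N i0 i3 + a4 *: N i1 i2 + a5 *: N i1 i3 + a6 *: N i2 i3.
have -> : a1 *: (c *: N i0 i1) + a2 *: (c *: N i0 i2) + a3 *: (c *: N i0 i3) + a4 *: (c *: N i1 i2)
    + a5 *: (c *: N i1 i3) + a6 *: (c *: N i2 i3) = c *: n.
  by rewrite /n !scalerDr !scalerA ![c * _]mulrC.
rewrite euclZ (ger0_norm c0); apply: (ler_wpM2l c0); rewrite /eucl ler_sqrt //.
have n0 : n 0 i0 = 0 by rewrite /n !addqE !scaleqE !conj_im_im !mulr0 !addr0.
have S := sum_conj_im n0.
have E : dot n n = a1 * dot n (N i0 i1) + a2 * dot n (N i0 i2) + a3 * dot n (N i0 i3)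
    + a4 * dot n (N i1 i2) + a5 * dot n (N i1 i3) + a6 * dot n (N i2 i3).
  by rewrite {2}/n !dotDr !dotZr.
have D0 := dot_ge0 n.
move: E S D0; move: (dot n (N i0 i1)) (dot n (N i0 i2)) (dot n (N i0 i3)) (dot n (N i1 i2)) (dot n (N i1 i3)) (dot n (N i2 i3)).
move: (dot n n) => d s1 s2 s3 s4 s5 s6 E S D0.
(* With n the combination in question and d = |n|^2 = sum of a s, the inequality 2 a s <= 2 a^2 +
   s^2 / 2 is weighted so that sum a^2 = 1 and sum s^2 <= 2 d yield d <= 2. *)
have CS : 2 * d <= 2 + (s1 ^+ 2 + s2 ^+ 2 + s3 ^+ 2 + s4 ^+ 2 + s5 ^+ 2 + s6 ^+ 2) / 2.
  have h (a s : R) : 2 * (a * s) <= 2 * a ^+ 2 + s ^+ 2 / 2.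
    have -> : 2 * a ^+ 2 + s ^+ 2 / 2 = 2 * (a * s) + (2 * a - s) ^+ 2 / 2 by field.
    by rewrite lerDl; apply: divr_ge0 => //; exact: sqr_ge0.
  rewrite E; have := h a1 s1; have := h a2 s2; have := h a3 s3; have := h a4 s4; have := h a5 s5; have := h a6 s6.
  move: al1; clear; move: (a1 * s1) (a2 * s2) (a3 * s3) (a4 * s4) (a5 * s5) (a6 * s6).
  move: (a1 ^+ 2) (a2 ^+ 2) (a3 ^+ 2) (a4 ^+ 2) (a5 ^+ 2) (a6 ^+ 2).
  move: (s1 ^+ 2) (s2 ^+ 2) (s3 ^+ 2) (s4 ^+ 2) (s5 ^+ 2) (s6 ^+ 2) => *; lra.
move: CS S; clear; move: (s1 ^+ 2) (s2 ^+ 2) (s3 ^+ 2) (s4 ^+ 2) (s5 ^+ 2) (s6 ^+ 2) => *; lra.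
Qed.
End Frames.

#[global] Opaque bracket.
Section Instanton.
Variable R : realType.
Local Notation ambient := (R * 'rV[R]_4)%type.
Local Notation U0 := [set x : quat R | x != 0].
Implicit Types (x y : quat R) (p u v : ambient).
Let oU0 := @open_nonzero R 4.
Local Notation oT := (@openT (quat R)).

(** At x = e^t q this is |x|^2 / (1 + |x|^2) times Im(conj(q) dq), which is the form [bpst] of R^4
    read on the cylinder. *)
Definition instanton : su2_form R :=
  fun p v => (1 + expR (- (p.1 + p.1)))^-1 *: conj_im p.2 v.2.

Lemma instanton_linear p (c : R) u v : instanton p (c *: u + v) = c *: instanton p u + instanton p v.
Proof. by rewrite /instanton /= conj_imDr conj_imZr scalerDr !scalerA [c * _]mulrC. Qed.

Definition bpst k x : quat R := (1 + dot x x)^-1 *: conj_im x (ev R k).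

Lemma conj_im_sum (w : quat R) (z : quat R) : conj_im w z = \sum_k w 0 k *: conj_im (ev R k) z.
Proof.
rewrite {1}(row_sum_delta w); apply: (big_ind2 (fun s t : quat R => conj_im s z = t)).
- by have := conj_imZl 0 0 z; rewrite !scale0r.
- by move=> a1 b1 a2 b2 <- <-; exact: conj_imDl.
- by move=> k _; exact: conj_imZl.
Qed.

Lemma coord_form_instanton k x : U0 x -> coord_form instanton (chart 0) k x = bpst k x.
Proof.
move=> x0; have r0 := eucl_gt0 x0; rewrite /coord_form coord_vec_chart // /instanton /= add0r.
have -> : conj_im ((eucl x)^-1 *: x) ((eucl x)^-1 *: ev R k - (dot x (ev R k) / eucl x ^+ 3) *: x) =
    (dot x x)^-1 *: conj_im x (ev R k).
  rewrite conj_imZl conj_imDr -scaleNr !conj_imZr.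
  have -> : conj_im x x = 0.
    by have := conj_imC x x; move: (conj_im x x) => w E; apply/rowP => l; move: E => /rowP/(_ l); zlin.
  by rewrite scaler0 addr0 scalerA -eucl_sqr expr2 invfM.
rewrite scalerA /bpst; congr (_ *: _).
rewrite opprD expRD expRN lnK ?posrE // -eucl_sqr.
by move: (eucl x) r0 => r r0; field; rewrite !gt_eqF // ?addr_gt0 ?exprn_gt0.
Qed.

Lemma isDV_bpst i k x : isDV x (ev R i) (bpst k)
  ((- (2 * x 0 i) / (1 + dot x x) ^+ 2) *: conj_im x (ev R k) + (1 + dot x x)^-1 *: conj_im (ev R i) (ev R k)).
Proof.
have p0 : 1 + dot x x != 0 by rewrite gt_eqF // ltr_wpDr // dot_ge0.
have Dd : is_derive x (ev R i) (fun y => 1 + dot y y) (2 * x 0 i).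
  by apply: is_derive_eq (is_deriveDr (isD_cst 1 x (ev R i)) (is_derive_dotxx x i)) _; rewrite add0r.
have Dc : isDV x (ev R i) (fun y => conj_im y (ev R k)) (conj_im (ev R i) (ev R k)).
  have -> : (fun y => conj_im y (ev R k)) = (fun y : quat R => \sum_l y 0 l *: conj_im (ev R l) (ev R k)).
    by apply/funext => y; rewrite conj_im_sum.
  rewrite [X in isDV _ _ _ X]conj_im_sum; apply: isDV_sum => l.
  apply: isDV_eq (isDV_scale (is_derive_coord x (ev R i) l) (isDV_cst x (ev R i) _)) _.
  by rewrite scaler0 addr0.
have D := isDV_scale (is_derive_invr (f := fun y => 1 + dot y y) p0 Dd) Dc.
exact: isDV_eq D erefl.
Qed.

Lemma CnV_bpst m k : CnV m setT (fun _ => bpst k).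
Proof.
move=> j; have p0 (s : R) x : setT x -> 1 + dot x x != 0.
  by move=> _; rewrite gt_eqF // ltr_wpDr // dot_ge0.
have C1 := Cn_inv oT p0 (Cn_add oT (Cn_cst m _ 1) (Cn_dotxx m oT)).
have C2 : Cn m setT (fun (_ : R) (x : quat R) => \sum_l x 0 l * conj_im (ev R l) (ev R k) 0 j).
  by apply: Cn_sum oT _ => l; exact: Cn_mul oT (Cn_coord _ _ l) (Cn_cst _ _ _).
apply: (Cn_eq oT _ (Cn_mul oT C1 C2)) => _ x _; rewrite /bpst scaleqE conj_im_sum summxE.
by congr (_ * _); apply: eq_bigr => l _; rewrite scaleqE.
Qed.

Lemma curv_bpst i j x : curv bpst i j x = (2 / (1 + dot x x) ^+ 2) *: conj_im (ev R i) (ev R j).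
Proof.
rewrite /curv (isDV_pdv (isDV_bpst i j x)) (isDV_pdv (isDV_bpst j i x)) /bpst.
rewrite bracketZl bracketZr conj_im_bracket (conj_imC (ev R i) (ev R j)) !(dotC x (ev R _)).
have E l : dot (ev R l) x = x 0 l by rewrite dotC dot_ev.
rewrite !E; have p0 : 1 + dot x x != 0 by rewrite gt_eqF // ltr_wpDr // dot_ge0.
move: (conj_im x (ev R i)) (conj_im x (ev R j)) (conj_im (ev R i) (ev R j)) (dot x x) p0 => a b c d p0.
apply/rowP => l; rewrite !(addqE, oppqE, scaleqE).
by move: (a 0 l) (b 0 l) (c 0 l) (x 0 i) (x 0 j) => *; field.
Qed.

Lemma curv2_bpst x (u v : quat R) : curv2 bpst x u v = (2 / (1 + dot x x) ^+ 2) *: conj_im u v.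
Proof.
rewrite /curv2 conj_im_sum scaler_sumr; apply: eq_bigr => k _.
have -> : conj_im (ev R k) v = \sum_l v 0 l *: conj_im (ev R k) (ev R l).
  rewrite conj_imC conj_im_sum -sumrN; apply: eq_bigr => l _.
  by rewrite -scalerN -conj_imC.
rewrite !scaler_sumr; apply: eq_bigr => l _.
by rewrite curv_bpst !scalerA; congr (_ *: _); rewrite mulrC mulrA.
Qed.

Lemma C_instanton m i : CnV m U0 (fun _ => coord_form instanton (chart 0) i).
Proof.
move=> j; have C : Cn m U0 (fun _ x => bpst i x 0 j) by apply: Cn_sub (CnV_bpst m i j).
by apply: (Cn_eq oU0 _ C) => _ x x0; rewrite coord_form_instanton.
Qed.

Let linA p (c : R) u v : cyl p -> tangent p u -> tangent p v ->
  instanton p (c *: u + v) = c *: instanton p u + instanton p v.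
Proof. by move=> _ _ _; exact: instanton_linear. Qed.

Lemma instanton_connection : is_connection instanton.
Proof.
split.
- move=> p v _ _; rewrite /instanton /su2 /= (_ : 0 = i0 :> 'I_4); last exact: val_inj.
  by rewrite scaleqE conj_im_im mulr0.
- exact: linA.
- by move=> U phi lc i; exact: (smooth_coord_form lc linA C_instanton i).
Qed.

(** [lift_vec] without the factor e^t: an isometry of the tangent space at p onto R^4 that sends
    d/dt to the point q of the sphere. *)
Definition frame p v : quat R := v.1 *: p.2 + v.2.

Lemma curvature_instanton U phi y i j : local_coords U phi -> U y ->
  curvature instanton phi y i j =
  (2 * expR (phi y).1 ^+ 2 / (1 + expR (phi y).1 ^+ 2) ^+ 2) *:
    conj_im (frame (phi y) (coord_vec phi y i)) (frame (phi y) (coord_vec phi y j)).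
Proof.
move=> lc Uy; have cy : cyl (phi y) by case: lc => _ _ + _ _; apply.
have k0 := kap_neq0 cy.
apply: etrans (curvature_lift lc linA C_instanton i j Uy) _.
have -> : curv2 (coord_form instanton (chart 0)) (kap (phi y)) = curv2 bpst (kap (phi y)).
  apply/funext => u; apply/funext => v; apply: eq_bigr => k _; apply: eq_bigr => l _; congr (_ *: _).
  exact: (curv_eq k l oU0 k0 coord_form_instanton).
rewrite curv2_bpst -eucl_sqr (eucl_kap cy) conj_imZl conj_imZr !scalerA; congr (_ *: _).
by move: (expR _) => e; move: ((1 + e ^+ 2) ^- 2) => t; ring.
Qed.

Lemma orthonormal_frame U phi y : local_coords U phi -> U y -> orthonormal_at phi y ->
  forall i j, dot (frame (phi y) (coord_vec phi y i)) (frame (phi y) (coord_vec phi y j)) = (i == j)%:R.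
Proof.
move=> lc Uy on i j; have cy : cyl (phi y) by case: lc => _ _ + _ _; apply.
have := dot_lift_vec cy (tangent_coord_vec lc i Uy) (tangent_coord_vec lc j Uy).
rewrite on /lift_vec dotZl dotZr mulrA -expr2; apply: mulfI.
by rewrite gt_eqF // exprn_gt0 // expR_gt0.
Qed.

Lemma instanton_asd : asd instanton.
Proof.
move=> U phi y lc Uy on ori; have cy : cyl (phi y) by case: lc => _ _ + _ _; apply.
have O := orthonormal_frame lc Uy on.
have P : 0 < det4 (frame (phi y) (coord_vec phi y i0)) (frame (phi y) (coord_vec phi y i1))
    (frame (phi y) (coord_vec phi y i2)) (frame (phi y) (coord_vec phi y i3)).
  have T i := tangent_coord_vec lc i Uy.
  by have := ori; rewrite /oriented_at (vol_cylE cy T).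
have [h1 h2 h3] := conj_im_asd O P.
have FE i j := curvature_instanton i j lc Uy.
have G i j k l : conj_im (frame (phi y) (coord_vec phi y i)) (frame (phi y) (coord_vec phi y j)) =
    - conj_im (frame (phi y) (coord_vec phi y k)) (frame (phi y) (coord_vec phi y l)) ->
    curvature instanton phi y i j = - curvature instanton phi y k l.
  move=> E; apply: etrans (FE i j) _; apply: etrans _ (congr1 (@GRing.opp _) (esym (FE k l))).
  exact: etrans (congr1 (fun z => _ *: z) E) (scalerN _ _).
apply: hodge_asd; [|exact: G h1|exact: G h2|exact: G h3].
by move=> i j; apply: G; exact: conj_imC.
Qed.

Lemma instanton_not_flat : ~ flat instanton.
Proof.
have lc := local_coords_chart (0 : R).
have e0 : U0 (ev R i0).
  by apply/negP => /eqP/rowP/(_ i0); rewrite evE mxE eqxx => /eqP; rewrite oner_eq0.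
have N01 : conj_im (ev R i0) (ev R i1) 0 i1 = 1.
  by rewrite /conj_im mkqE qmulE /qconj !mkqE !evE /=; ring.
move=> /(_ _ _ _ lc e0 i0 i1) H; have E1 := curvature_curv i0 i1 e0 (smooth_coord_form lc linA C_instanton).
have E2 := curv_eq i0 i1 oU0 e0 coord_form_instanton.
have := etrans (esym (etrans E1 E2)) H; rewrite curv_bpst => /rowP/(_ i1).
rewrite scaleqE zeroqE N01 mulr1 => /eqP; rewrite gt_eqF //.
by rewrite divr_gt0 // exprn_gt0 // ltr_wpDr // dot_ge0.
Qed.

Lemma instanton_norm_le : (curvature_norm instanton <= (1 / Num.sqrt 2)%:E)%E.
Proof.
apply: ub_ereal_sup => _ [p cp <-]; apply: ub_ereal_sup => _ [U [phi [y [lc Uy _ on ->]]]].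
have FE : curvature instanton phi y = (fun i j => (2 * expR (phi y).1 ^+ 2 / (1 + expR (phi y).1 ^+ 2) ^+ 2) *:
    conj_im (frame (phi y) (coord_vec phi y i)) (frame (phi y) (coord_vec phi y j))).
  by apply/funext => i; apply/funext => j; exact: (curvature_instanton i j lc Uy).
have e0 : 0 < 1 + expR (phi y).1 ^+ 2 by rewrite addr_gt0 // exprn_gt0 // expR_gt0.
rewrite FE; apply: le_trans (op_norm_conj_im (orthonormal_frame lc Uy on) _) _.
  by rewrite divr_ge0 ?mulr_ge0 ?sqr_ge0.
rewrite lee_fin; have q0 : 0 < Num.sqrt (2 : R) by rewrite sqrtr_gt0.
have q2 : Num.sqrt 2 * Num.sqrt 2 = 2 :> R by rewrite -expr2 sqr_sqrtr.
(* With e standing for e^(2t), the claim is 4 e <= (1 + e)^2, an equality at t = 0. *)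
rewrite ler_pdivlMr //; move: (Num.sqrt 2) q2 (expR _ ^+ 2) e0 => t q2 e e0.
have -> : 2 * e / (1 + e) ^+ 2 * t * t = 4 * e / (1 + e) ^+ 2.
  by rewrite -(mulrA _ t) q2; move: ((1 + e) ^- 2) => k; ring.
rewrite ler_pdivrMr ?exprn_gt0 // mul1r -subr_ge0.
have -> : (1 + e) ^+ 2 - 4 * e = (1 - e) ^+ 2 by ring.
exact: sqr_ge0.
Qed.
End Instanton.

Theorem theorem1p1 (R : realType) :
  (exists A : su2_form R,
     [/\ is_connection A, asd A, ~ flat A
       & curvature_norm A = (1 / Num.sqrt 2)%:E]) /\
  (forall A : su2_form R,
     is_connection A -> asd A -> ~ flat A ->
     ((1 / Num.sqrt 2)%:E <= curvature_norm A)%E).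
Proof.
split; last exact: lower_bound.
have C := instanton_connection R; have D := @instanton_asd R; have F := @instanton_not_flat R.
(* Attainment is not read off from the curvature at t = 0: the general lower bound, applied to the
   instanton itself, gives the reverse inequality. *)
exists (@instanton R); split => //; apply/eqP; rewrite eq_le instanton_norm_le.
exact: lower_bound.
Qed.
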